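(* Let $d\ge 1$ and let $u_0:\mathbb{R}^d\to\mathbb{R}$ satisfy: $u_0\in C^{1,1}(\mathbb{R}^d)$, $\lim_{|x|\to\infty} u_0(x)/|x|=+\infty$, and there is $R_0>0$ such that $u_0=u_0^{**}$ outside the closed ball $\overline{B}_{R_0}$. Then there is a unique continuous function $u$ on $[0,+\infty)\times\mathbb{R}^d$ such that $u(0,\cdot)=u_0$, $u$ is a viscosity solution on $(0,+\infty)\times\mathbb{R}^d$ of $$\partial_t u=\min(0,\lambda_1(D^2u)),$$ and $u(t,\cdot)$ agrees with $u_0^{**}$ outside $B_{R_0}$ for every $t\ge 0$. Moreover this function admits the representation $$u(t,x)=\inf_{\sigma\,:\,|\sigma|\le 1}\ \mathbb{E}\Big(u_0\Big(x+\int_0^t\sqrt{2}\,\sigma_s\,dW_s\Big)\Big),\qquad t\ge 0,\ x\in\mathbb{R}^d.$$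
   Context: $B_R$ (resp. $\overline{B}_R$) is the open (resp. closed) Euclidean ball of radius $R$ centered at $0$ in $\mathbb{R}^d$. $C^{1,1}(\mathbb{R}^d)$ is the set of $C^1$ functions with (globally) Lipschitz gradient. $u_0^{**}$ is the convex envelope of $u_0$, i.e. the largest convex function on $\mathbb{R}^d$ that is everywhere $\le u_0$. For a symmetric matrix $S$, $\lambda_1(S)$ denotes its smallest eigenvalue; $D^2$ is the Hessian with respect to $x$. $(W_s)_{s\ge0}$ is a standard $d$-dimensional Brownian motion; the infimum is over all $d\times d$-matrix-valued processes $\sigma=(\sigma_s)_{s\geq 0}$ that are adapted to the Brownian filtration (with the usual measurability making the stochastic integral well defined, i.e. progressively measurable) and satisfy $|\sigma_s|\le 1$ for all $s$, where $|\sigma|:=\sqrt{\mathrm{Tr}(\sigma\sigma^T)}$. Viscosity solutions: let $\Omega\subset\mathbb{R}^d$ be open and $v$ continuous on $(0,+\infty)\times\Omega$. Then $v$ is a viscosity subsolution of $\partial_t v=\min(0,\lambda_1(D^2v))$ on $(0,+\infty)\times\Omega$ if for every $\varphi\in C^2((0,+\infty)\times\Omega)$ and every $(t_0,x_0)\in(0,+\infty)\times\Omega$ with $(v-\varphi)(t_0,x_0)=\max_{(0,+\infty)\times\Omega}(v-\varphi)$ one has $\partial_t\varphi(t_0,x_0)\le\min(0,\lambda_1(D^2\varphi(t_0,x_0)))$. It is a viscosity supersolution if for every such $\varphi$ and every $(t_0,x_0)$ with $(v-\varphi)(t_0,x_0)=\min_{(0,+\infty)\times\Omega}(v-\varphi)$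 one has $\partial_t\varphi(t_0,x_0)\ge\min(0,\lambda_1(D^2\varphi(t_0,x_0)))$. It is a viscosity solution if it is both a viscosity subsolution and a viscosity supersolution. *)

(* Defs.v *)
From HB Require Import structures.
From mathcomp Require Import all_boot all_order all_algebra.
From mathcomp Require Import all_classical all_reals all_analysis.
Set Implicit Arguments.
Unset Strict Implicit.
Unset Printing Implicit Defensive.
Import Order.TTheory GRing.Theory Num.Theory.
Import numFieldNormedType.Exports.
Local Open Scope classical_set_scope.
Local Open Scope ring_scope.

(* R^d is the type of column vectors 'cV[R]_d.  The library norm `|x| on it is
   the sup norm: it only provides the topology and the differential calculus.
   Euclidean norms are taken with frobenius below. *)

(* |A| = sqrt (Tr (A A^T)); on column vectors, the Euclidean norm. *)
Definition frobenius (R : realType) (m n : nat) (A : 'M[R]_(m, n)) : R :=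
  Num.sqrt (\tr (A *m A^T)).

Section Calculus.
Context {R : realType}.

(* Meant for open O. *)
Definition C1_on (V : normedModType R) (O : set V) (f : V -> R) : Prop :=
  (forall p, O p -> differentiable f p) /\
  (forall v, {within O, continuous (fun p => 'D_v f p)}).

Definition C2_on (V : normedModType R) (O : set V) (f : V -> R) : Prop :=
  C1_on O f /\ (forall v, C1_on O (fun p => 'D_v f p)).

Context {d : nat}.

Definition gradient (f : 'cV[R]_d -> R) (x : 'cV[R]_d) : 'cV[R]_d :=
  \col_i 'D_(delta_mx i ord0) f x.

Definition hessian (f : 'cV[R]_d -> R) (x : 'cV[R]_d) : 'M[R]_d :=
  \matrix_(i, j) 'D_(delta_mx i ord0) (fun y => 'D_(delta_mx j ord0) f y) x.

Definition C11 (f : 'cV[R]_d -> R) : Prop :=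
  C1_on setT f /\
  exists L : R, forall x y,
    frobenius (gradient f x - gradient f y) <= L * frobenius (x - y).

Definition superlinear (f : 'cV[R]_d -> R) : Prop :=
  forall M : R, exists r : R, forall x : 'cV[R]_d,
    r < frobenius x -> M <= f x / frobenius x.

(* Pointwise supremum of the convex minorants of f. *)
Definition convex_envelope (f : 'cV[R]_d -> R) (x : 'cV[R]_d) : R :=
  sup [set w x | w in [set w : 'cV[R]_d -> R |
    @convex_function R 'cV[R]_d setT w /\ forall y, w y <= f y]].

(* The spectrum of a symmetric matrix of positive size is finite and nonempty,
   so that this infimum is a minimum. *)
Definition lambda1 (S : 'M[R]_d) : R := inf [set a : R | eigenvalue S a].

End Calculus.

Section Viscosity.
Context {R : realType} {d : nat}.

Definition cylinder (Om : set 'cV[R]_d) : set (R * 'cV[R]_d) :=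
  [set p | 0 < p.1 /\ Om p.2].

Definition dt (phi : R * 'cV[R]_d -> R) (p : R * 'cV[R]_d) : R :=
  derive1 (fun t : R => phi (t, p.2)) p.1.

Definition D2x (phi : R * 'cV[R]_d -> R) (p : R * 'cV[R]_d) : 'M[R]_d :=
  hessian (fun x => phi (p.1, x)) p.2.

(* Viscosity sub- and supersolutions of dt v = min (0, lambda1 (D2x v)) on
   (0, +oo) x Om, for Om open and v continuous there.  Test functions are
   total, but only their values on (0, +oo) x Om matter. *)
Definition viscosity_subsolution (Om : set 'cV[R]_d)
    (v : R * 'cV[R]_d -> R) : Prop :=
  forall phi : R * 'cV[R]_d -> R, C2_on (cylinder Om) phi ->
  forall p, cylinder Om p ->
  (forall q, cylinder Om q -> v q - phi q <= v p - phi p) ->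
  dt phi p <= Num.min 0 (lambda1 (D2x phi p)).

Definition viscosity_supersolution (Om : set 'cV[R]_d)
    (v : R * 'cV[R]_d -> R) : Prop :=
  forall phi : R * 'cV[R]_d -> R, C2_on (cylinder Om) phi ->
  forall p, cylinder Om p ->
  (forall q, cylinder Om q -> v p - phi p <= v q - phi q) ->
  Num.min 0 (lambda1 (D2x phi p)) <= dt phi p.

Definition viscosity_solution (Om : set 'cV[R]_d)
    (v : R * 'cV[R]_d -> R) : Prop :=
  viscosity_subsolution Om v /\ viscosity_supersolution Om v.

End Viscosity.

Section StochasticIntegral.
Context {R : realType} {d : nat} {disp : measure_display}.
Context {T : measurableType disp}.
Implicit Types (P : probability T R) (W : R -> T -> 'cV[R]_d).

Definition past_generators W (s : R) : set (set T) :=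
  [set A | exists r i (B : set R), [/\ 0 <= r <= s, measurable B &
     A = [set w | B (W r w i ord0)]]].

(* The sigma-algebra of the Brownian filtration at time s. *)
Definition past W (s : R) : set (set T) := <<s past_generators W s >>.

(* The increment field says that, for s < t, W t - W s is independent of
   past W s with law N(0, (t - s) I_d).  The second argument of normal_prob is
   the standard deviation. *)
Record brownian_motion P W : Prop := BrownianMotion {
  bm_measurable : forall t i, 0 <= t ->
    measurable_fun [set: T] (fun w => W t w i ord0 : R);
  bm_start : {ae P, forall w, W 0 w = 0};
  bm_increment : forall s t, 0 <= s -> s < t ->
    forall A, past W s A ->
    forall B : 'I_d -> set R, (forall i, measurable (B i)) ->
    P (A `&` [set w | forall i, B i ((W t w - W s w) i ord0)]) =
    (P A * \prod_(i < d) normal_prob 0 (Num.sqrt (t - s)) (B i))%E;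
  bm_continuous : {ae P, forall w,
    {within [set s : R | 0 <= s], continuous (fun s => W s w)}} }.

(* T endowed with past W s in place of its own sigma-algebra. *)
Definition past_space W (s : R) : Type :=
  g_sigma_algebraType (past_generators W s).

HB.instance Definition _ W s := Measurable.on (past_space W s).

Definition progressive W (sigma : R -> T -> 'M[R]_d) : Prop :=
  forall t : R, 0 <= t -> forall i j,
    @measurable_fun _ _ (R * past_space W t)%type R
      (`[0, t]%classic `*` setT) (fun p => sigma p.1 p.2 i j).

(* The simple process sum_(k < n) xi_k 1_(]tau_k, tau_(k+1)]) on [0, t], with
   xi_k bounded and past W (tau_k)-measurable. *)
Record simple_process W (t : R) := SimpleProcess {
  sp_size : nat;
  sp_time : nat -> R;
  sp_val : nat -> T -> 'M[R]_d;
  sp_time_ge0 : 0 <= sp_time 0;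
  sp_time_le : forall k, (k < sp_size)%N -> sp_time k <= sp_time k.+1;
  sp_time_end : sp_time sp_size <= t;
  sp_bounded : exists M : R, forall k w, (k < sp_size)%N ->
    frobenius (sp_val k w) <= M;
  sp_measurable : forall k i j, (k < sp_size)%N ->
    @measurable_fun _ _ (past_space W (sp_time k)) R setT
      (fun w => sp_val k w i j) }.

Definition sp_eval W t (H : simple_process W t) (s : R) (w : T) : 'M[R]_d :=
  \sum_(k < sp_size H)
    \1_(`]sp_time H k, sp_time H k.+1]) s *: sp_val H k w.

Definition sp_integral W t (H : simple_process W t) (w : T) : 'cV[R]_d :=
  \sum_(k < sp_size H)
    sp_val H k w *m (W (sp_time H k.+1) w - W (sp_time H k) w).

(* I is a version of the Ito integral int_0^t sigma_s dW_s: the limit in L^2(P)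
   of the integrals of simple processes converging to sigma in
   L^2([0, t] x T, ds (x) P).  For sigma bounded and progressive, such an I
   exists and is unique up to P-a.s. equality. *)
Definition ito_integral P W (sigma : R -> T -> 'M[R]_d) (t : R)
    (I : T -> 'cV[R]_d) : Prop :=
  (forall i, measurable_fun [set: T] (fun w => I w i ord0 : R)) /\
  exists H : nat -> simple_process W t,
    (\int[P]_w \int[lebesgue_measure]_(s in `[0%R, t]%classic)
       ((frobenius (sp_eval (H n) s w - sigma s w)%R) ^+ 2)%:E)%E
      @[n --> \oo] --> 0%E /\
    'E_P[fun w => ((frobenius (sp_integral (H n) w - I w)) ^+ 2)%R]%E
      @[n --> \oo] --> 0%E.

Definition admissible_control W (sigma : R -> T -> 'M[R]_d) : Prop :=
  progressive W sigma /\ forall s w, 0 <= s -> frobenius (sigma s w) <= 1.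

Definition control_value P W (u0 : 'cV[R]_d -> R) (t : R) (x : 'cV[R]_d)
    : \bar R :=
  ereal_inf [set e | exists sigma I, [/\ admissible_control W sigma,
    ito_integral P W (fun s w => Num.sqrt 2 *: sigma s w) t I &
    e = 'E_P[fun w => u0 (x + I w)%R]%E]].

End StochasticIntegral.

(* Main.v *)
From HB Require Import structures.
Require Import Defs.
From mathcomp Require Import all_boot all_order all_algebra.
From mathcomp Require Import all_classical all_reals all_analysis.
From mathcomp Require Import measurable_realfun ring lra.
Import Order.TTheory GRing.Theory Num.Theory.
Import numFieldNormedType.Exports.
Local Open Scope classical_set_scope.
Local Open Scope ring_scope.

(* The solution u(t, x) is the decreasing limit, over dyadic time steps h, of the
   iterates of f |-> inf over |v|^2 <= 2h of E f(x + Z v), with Z a real standard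
   Gaussian: the controls are rank one and constant on each step.  It satisfies
   u(t + h, x) <= E u(t, x + sqrt (2h) Z e) for |e| <= 1, which makes it a viscosity
   subsolution, and comparison of the iterates with quartic barriers makes it a
   supersolution.  Since convex minorants of u0 stay below the iterates, u = u0**
   where u0 = u0**.

   Uniqueness needs no doubling of variables: the inequality above is linear in
   u, hence is preserved by Steklov averages, which turn u (up to penalizations)
   into a C2 test function from below; so a supersolution lies above u.  Likewise
   the heat flow of v(t0, .) along e, suitably averaged, is a test function for a
   subsolution v, so that v(t0 + h, x) <= E v(t0, x + sqrt (2h) Z e), and v lies
   below all the iterates.

   For the stochastic representation, semiconvexity of u0 makes u Lipschitz in
   time, and integrating out one Gaussian coordinate of the increment at a time
   gives E u(s, X + xi dW) >= u(s + dt |xi|^2 / 2, X) for simple processes.  The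
   converse inequality is obtained with piecewise constant feedback controls,
   nearly optimal for the iterates. *)

Set Implicit Arguments.
Unset Strict Implicit.
Unset Printing Implicit Defensive.

(** * Gaussian expectations *)


(** Gaussian averages are nonlocal while a viscosity test is local, so the tails have to be
    controlled by hand. Every barrier is polynomial in space, of degree at most four: its averages
    are exact combinations of the moments 1, 0, 1, 0 and [m4], and the quartic term absorbs whatever
    happens away from the contact point. Hence the class [quartic] on the line. On R^d the working
    class is [modulus]. A C^{1,1} datum may grow quadratically and need not be uniformly continuous,
    but for every delta its increments are at most delta (1 + |x|^2) + C |z|^2. This one-sided bound
    passes to averages and to infima with the same delta and C, hence to the limit, and no
    derivative of u is ever needed. Time steps are halved because an average along w is the
    composition of two averages along w / sqrt 2: refining a grid only enlarges the set of
    strategies, which makes the limit monotone and lets it be exchanged with averages by dominated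
    convergence. Superlinearity supplies a lower bound m of u0; subtracting m turns most
    expectations into integrals of nonnegative functions. *)

Section gauss1.
Context {R : realType}.
Local Notation mu := (@lebesgue_measure R).
Implicit Types (m s : R).

(** The Radon-Nikodym derivative of the law agrees almost everywhere with [normal_pdf], because both
    have the same integral over every measurable set. *)
Lemma ge0_integral_normal_prob m s (f : R -> \bar R) :
  measurable_fun setT f -> (forall x, 0 <= f x)%E ->
  (\int[normal_prob m s]_x f x = \int[mu]_x (f x * (normal_pdf m s x)%:E))%E.
Proof.
move=> mf f0.
have dom := normal_prob_dominates m s.
rewrite -(Radon_Nikodym_SigmaFinite.change_of_variables dom)//=.
apply: ae_eq_integral => //.
- apply: emeasurable_funM => //.
  exact: measurable_int (Radon_Nikodym_SigmaFinite.f_integrable dom).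
- apply: emeasurable_funM => //.
  by apply/measurable_EFinP; exact: measurable_normal_pdf.
- apply: ae_eqe_mul2l => /=.
  apply: integral_ae_eq => //=.
  + exact: Radon_Nikodym_SigmaFinite.f_integrable.
  + by apply/measurable_EFinP; exact: measurable_normal_pdf.
  + move=> E E01 mE; rewrite -(Radon_Nikodym_SigmaFinite.f_integral dom)//.
Qed.

Lemma normal_pdf1E (z : R) :
  normal_pdf 0 1 z = (Num.sqrt (pi *+ 2))^-1 * expR (- (z ^+ 2 / 2)).
Proof.
rewrite normal_pdfE ?oner_neq0// /normal_peak /normal_fun expr1n mul1r subr0.
by congr (_ * expR _); rewrite mulNr.
Qed.

Lemma normal_pdfsE s (z : R) : 0 < s ->
  normal_pdf 0 s z = s^-1 * (Num.sqrt (pi *+ 2))^-1 * expR (- (z ^+ 2 / (s ^+ 2 *+ 2))).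
Proof.
move=> s0; rewrite normal_pdfE ?gt_eqF// /normal_peak /normal_fun subr0.
congr (_ * expR _); last by rewrite mulNr.
by rewrite -mulrnAr sqrtrM ?sqr_ge0// sqrtr_sqr gtr0_norm// invfM.
Qed.

(** Squaring y <= exp y at y = z^2 / 8 gives the constant 64. *)
Lemma expR_quart (z : R) : z ^+ 4 <= 64 * expR (z ^+ 2 / 4).
Proof.
have -> : z ^+ 2 / 4 = z ^+ 2 / 8 + z ^+ 2 / 8 by field.
rewrite expRD.
have h : z ^+ 2 / 8 <= expR (z ^+ 2 / 8).
  by apply: le_trans (expR_ge1Dx _); rewrite lerDr.
have h0 : 0 <= z ^+ 2 / 8 by rewrite divr_ge0// sqr_ge0.
have : (z ^+ 2 / 8) * (z ^+ 2 / 8) <= expR (z ^+ 2 / 8) * expR (z ^+ 2 / 8).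
  exact: ler_pM.
by move=> h2; rewrite [leLHS](_ : _ = 64 * (z ^+ 2 / 8 * (z ^+ 2 / 8))) ?ler_pM2l//; field.
Qed.

Lemma measurable_exprn_setT n : measurable_fun [set: R] (fun z : R => z ^+ n).
Proof. exact: measurable_funX. Qed.

(** The Gaussian of variance 2 decays only like exp (- z^2 / 4); the spare factor exp (- z^2 / 4) of
    the standard density absorbs z^4. The fourth moment is thereby finite, without being
    computed. *)
Lemma normal_pdf_quart (z : R) :
  z ^+ 4 * normal_pdf 0 1 z <= 64 * Num.sqrt 2 * normal_pdf 0 (Num.sqrt 2) z.
Proof.
have s2 : 0 < Num.sqrt 2 :> R by rewrite sqrtr_gt0.
rewrite normal_pdf1E normal_pdfsE// sqr_sqrtr//.
have -> : 64 * Num.sqrt 2 * ((Num.sqrt 2)^-1 * (Num.sqrt (pi *+ 2))^-1 *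
    expR (- (z ^+ 2 / (2 *+ 2)))) =
   (Num.sqrt (pi *+ 2))^-1 * (64 * expR (- (z ^+ 2 / (2 *+ 2)))) :> R.
  have sp : Num.sqrt (pi *+ 2) != 0 :> R.
    by rewrite gt_eqF// sqrtr_gt0 mulrn_wgt0// pi_gt0.
  by field; rewrite sp gt_eqF.
rewrite mulrCA ler_wpM2l ?invr_ge0//.
have -> : expR (- (z ^+ 2 / 2)) = expR (- (z ^+ 2 / 4)) * expR (- (z ^+ 2 / 4)) :> R.
  by rewrite -expRD; congr expR; field.
have -> : (z ^+ 2 / (2 *+ 2)) = z ^+ 2 / 4 :> R by rewrite -mulr_natr; field.
rewrite mulrA ler_wpM2r ?expR_ge0// expRN ler_pdivrMr ?expR_gt0//.
exact: expR_quart.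
Qed.

Definition std_normal : probability (measurableTypeR R) R := normal_prob (0 : R) 1.

Lemma ge0_integral_std_normal (f : R -> \bar R) :
  measurable_fun setT f -> (forall x, 0 <= f x)%E ->
  (\int[std_normal]_x f x = \int[mu]_x (f x * (normal_pdf 0 1 x)%:E))%E.
Proof. exact: ge0_integral_normal_prob. Qed.

Lemma integral_std_normal_cst (k : \bar R) : (\int[std_normal]_x k = k)%E.
Proof.
rewrite integral_cst// -[RHS]mule1; congr (_ * _)%E; exact: probability_setT.
Qed.

Lemma gauss_quart_lty : (\int[std_normal]_z ((z ^+ 4)%:E : \bar R) < +oo)%E.
Proof.
have z4 (z : R) : 0 <= z ^+ 4 by rewrite exprn_even_ge0.
rewrite ge0_integral_std_normal//; last first.
  by apply/measurable_EFinP; exact: measurable_exprn_setT.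
apply: (@le_lt_trans _ _ (\int[mu]_z ((64 * Num.sqrt 2)%:E * (normal_pdf 0 (Num.sqrt 2) z)%:E))%E).
  apply: ge0_le_integral => //=.
  - by move=> x _; rewrite lee_fin mulr_ge0// normal_pdf_ge0.
  - apply/measurable_EFinP; apply: measurable_funM.
      exact: measurable_exprn_setT.
    exact: measurable_normal_pdf.
  - apply/measurable_EFinP; apply: measurable_funM => //.
    exact: measurable_normal_pdf.
  - move=> x _; rewrite -EFinM lee_fin.
    exact: normal_pdf_quart.
rewrite integralZl//; last exact: integrable_normal_pdf.
by rewrite integral_normal_pdf mule1 ltry.
Qed.

End gauss1.

(** Growth of order four is what the quartic barriers require; together with continuity it makes
    every Gaussian average below a finite integral. *)
Definition quartic {R : realType} (f : R -> R) : Prop :=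
  continuous f /\ exists C, forall z, `|f z| <= C * (1 + z ^+ 4).

Definition gaussE {R : realType} (f : R -> R) : R :=
  (\int[std_normal]_z f z)%R.

Section gaussE.
Context {R : realType}.
Local Notation mu := (@lebesgue_measure R).
Implicit Types f g : R -> R.

Lemma quarticP f : quartic f -> continuous f /\
  exists2 C, 0 <= C & forall z, `|f z| <= C * (1 + z ^+ 4).
Proof.
move=> [cf [C Cf]]; split => //; exists `|C|; first exact: normr_ge0.
move=> z; apply: le_trans (Cf z) _; rewrite ler_wpM2r ?ler_norm//.
by rewrite addr_ge0// exprn_even_ge0.
Qed.

Lemma quartic_integrable f : quartic f ->
  std_normal.-integrable setT (EFin \o f).
Proof.
move=> /quarticP[cf [C C0 Cf]].
have iq : std_normal.-integrable setT
    (EFin \o (fun z : measurableTypeR R => C * (1 + z ^+ 4))).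
  apply/integrableP; split.
      apply/measurable_EFinP; apply: measurable_funM => //.
      by apply: measurable_funD => //; exact: measurable_exprn_setT.
    apply: (@le_lt_trans _ _ (\int[std_normal]_z (C%:E * (1 + (z ^+ 4)%:E)))%E).
      apply: ge0_le_integral => //=.
        apply/measurable_EFinP; apply: measurableT_comp => //.
        apply: measurable_funM => //.
        by apply: measurable_funD => //; exact: measurable_exprn_setT.
      - apply: emeasurable_funM => //; apply: emeasurable_funD => //.
        by apply/measurable_EFinP; exact: measurable_exprn_setT.
      - move=> x _; rewrite ger0_norm// mulr_ge0// addr_ge0// exprn_even_ge0//.
    rewrite ge0_integralZl//; first last.
    - by move=> x _; rewrite adde_ge0// lee_fin exprn_even_ge0.
    - apply: emeasurable_funD => //.
      by apply/measurable_EFinP; exact: measurable_exprn_setT.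
    rewrite lte_mul_pinfty//.
    rewrite ge0_integralD//; first last.
    - by apply/measurable_EFinP; exact: measurable_exprn_setT.
    - by move=> x _; rewrite lee_fin exprn_even_ge0.
    rewrite integral_std_normal_cst lte_add_pinfty ?ltry//.
    exact: gauss_quart_lty.
apply: (le_integrable _ _ _ iq) => //.
- by apply/measurable_EFinP; exact: continuous_measurable_fun.
- move=> x _ /=; rewrite lee_fin [leRHS]ger0_norm; first exact: Cf.
  by rewrite mulr_ge0// addr_ge0// exprn_even_ge0.
Qed.

Lemma gaussE_EFin f : quartic f ->
  (\int[std_normal]_z (f z)%:E)%E = (gaussE f)%:E.
Proof.
move=> qf; rewrite /gaussE /Rintegral fineK//.
by apply: integrable_fin_num => //; exact: quartic_integrable.
Qed.

Lemma quarticD f g : quartic f -> quartic g -> quartic (fun z => f z + g z).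
Proof.
move=> [cf [C Cf]] [cg [D Dg]]; split.
  by move=> z; apply: cvgD; [exact: cf|exact: cg].
exists (C + D) => z; rewrite mulrDl; apply: le_trans (ler_normD _ _) _.
exact: lerD.
Qed.

Lemma quarticZ k f : quartic f -> quartic (fun z => k * f z).
Proof.
move=> [cf [C Cf]]; split.
  by move=> z; apply: cvgM; [exact: cvg_cst|exact: cf].
by exists (`|k| * C) => z; rewrite normrM -mulrA ler_wpM2l.
Qed.

Lemma quarticN f : quartic f -> quartic (fun z => - f z).
Proof.
move=> /(quarticZ (-1)); congr quartic.
by apply/funext => z; rewrite mulN1r.
Qed.

Lemma quarticB f g : quartic f -> quartic g -> quartic (fun z => f z - g z).
Proof. by move=> qf qg; apply: quarticD => //; exact: quarticN. Qed.

Lemma quartic_cst k : quartic (fun=> k : R).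
Proof.
split; first by move=> z; exact: cvg_cst.
exists `|k| => z; rewrite ler_peMr// lerDl exprn_even_ge0//.
Qed.

Lemma quartic_pow n : (n <= 4)%N -> quartic (fun z : R => z ^+ n).
Proof.
move=> n4; split; first exact: exprn_continuous.
exists 1 => z; rewrite mul1r normrX.
have z0 := normr_ge0 z.
have [z1|z1] := leP `|z| 1.
  apply: le_trans (_ : 1 <= _); first by rewrite exprn_ile1.
  by rewrite lerDl exprn_even_ge0.
apply: (@le_trans _ _ (`|z| ^+ 4)); first by rewrite ler_weXn2l// ltW.
by rewrite -normrX ger0_norm ?exprn_even_ge0// lerDr.
Qed.

Lemma quartic_affine f (c b : R) : quartic f -> quartic (fun z => f (c * z + b)).
Proof.
move=> /quarticP[cf [C C0 Cf]].
pose K := 8 * (1 + c ^+ 4 + b ^+ 4).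
split.
  move=> z; apply: (@continuous_comp _ _ _ (fun z => c * z + b) f).
    by apply: cvgD; [apply: cvgM; [exact: cvg_cst|exact: cvg_id]|exact: cvg_cst].
  exact: cf.
exists (C * K) => z; apply: le_trans (Cf _) _.
rewrite -mulrA ler_wpM2l// /K.
have h (x y : R) : (x + y) ^+ 4 <= 8 * (x ^+ 4 + y ^+ 4).
  have h1 : (x + y) ^+ 2 <= 2 * (x ^+ 2 + y ^+ 2).
    rewrite -subr_ge0 (_ : _ - _ = (x - y) ^+ 2) ?sqr_ge0//; ring.
  have h2 : ((x + y) ^+ 2) ^+ 2 <= (2 * (x ^+ 2 + y ^+ 2)) ^+ 2.
    by rewrite ler_sqr// nnegrE ?sqr_ge0// mulr_ge0// addr_ge0// sqr_ge0.
  have h3 : (x ^+ 2 + y ^+ 2) ^+ 2 <= 2 * (x ^+ 4 + y ^+ 4).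
    rewrite -subr_ge0 (_ : _ - _ = (x ^+ 2 - y ^+ 2) ^+ 2) ?sqr_ge0//; ring.
  rewrite -exprM in h2; apply: le_trans h2 _; lra.
apply: le_trans (_ : 1 + 8 * ((c * z) ^+ 4 + b ^+ 4) <= _).
  by rewrite lerD2l.
rewrite exprMn.
have c4 : 0 <= c ^+ 4 by rewrite exprn_even_ge0.
have b4 : 0 <= b ^+ 4 by rewrite exprn_even_ge0.
have z4 : 0 <= z ^+ 4 by rewrite exprn_even_ge0.
nra.
Qed.

Lemma gaussE_ge0 f : (forall z, 0 <= f z) -> 0 <= gaussE f.
Proof. by move=> f0; rewrite /gaussE Rintegral_ge0. Qed.

Lemma gaussED f g : quartic f -> quartic g ->
  gaussE (fun z => f z + g z) = gaussE f + gaussE g.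
Proof. by move=> qf qg; rewrite /gaussE RintegralD//; exact: quartic_integrable. Qed.

Lemma gaussEB f g : quartic f -> quartic g ->
  gaussE (fun z => f z - g z) = gaussE f - gaussE g.
Proof. by move=> qf qg; rewrite /gaussE RintegralB//; exact: quartic_integrable. Qed.

Lemma gaussEZ k f : quartic f -> gaussE (fun z => k * f z) = k * gaussE f.
Proof. by move=> qf; rewrite /gaussE RintegralZl//; exact: quartic_integrable. Qed.

Lemma gaussE_cst k : gaussE (fun=> k) = k :> R.
Proof.
by rewrite /gaussE /Rintegral integral_std_normal_cst.
Qed.

Lemma le_gaussE f g : quartic f -> quartic g -> (forall z, f z <= g z) ->
  gaussE f <= gaussE g.
Proof.
by move=> qf qg fg; rewrite /gaussE le_Rintegral//; exact: quartic_integrable.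
Qed.

End gaussE.


Section gauss2.
Context {R : realType}.
Local Notation mu := (@lebesgue_measure R).

Lemma continuous_ge0_integral_std_normal (f : R -> R) :
  continuous f -> (forall x, 0 <= f x) ->
  (\int[std_normal]_x (f x)%:E = \int[mu]_x (f x * normal_pdf 0 1 x)%:E)%E.
Proof.
move=> cf f0; rewrite ge0_integral_std_normal//.
by apply/measurable_EFinP; exact: continuous_measurable_fun.
Qed.

Lemma ge0_integral_affine (c b : R) (G : R -> R) : 0 < c -> continuous G ->
  (forall x, 0 <= G x) ->
  (\int[mu]_x (G x)%:E = c%:E * \int[mu]_x (G (c * x + b))%:E)%E.
Proof.
move=> c0 cG G0.
pose F (x : R) := c * x + b.
have dF (x : R) : is_derive x 1 F c.
  rewrite /F; apply: is_derive_eq.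
  by rewrite addr0 /GRing.scale/= mulr1.
have F'E : derive1 F = cst c.
  by apply/funext => x; rewrite derive1E; apply: derive_val.
have cF : continuous F.
  move=> x; apply: cvgD; last exact: cvg_cst.
  by apply: cvgM; [exact: cvg_cst|exact: cvg_id].
rewrite (increasing_ge0_integration_by_substitutionT (F := F))//.
- transitivity (\int[mu]_x (c%:E * (G (c * x + b))%:E))%E.
    by apply: eq_integral => x _; rewrite /= F'E /= -EFinM mulrC.
  rewrite ge0_integralZl//.
  + apply/measurable_EFinP; apply: continuous_measurable_fun => x.
    by apply: continuous_comp; [exact: cF|exact: cG].
  + by move=> x _; rewrite lee_fin.
  + by rewrite lee_fin ltW.
- by move=> x y xy; rewrite /F ltrD2r ltr_pM2l.
- by rewrite F'E => x; exact: cvg_cst.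
- by rewrite F'E; exact: is_cvg_cst.
- by rewrite F'E; exact: is_cvg_cst.
- apply/cvgrNyPle => A; exists (c^-1 * (A - b)); split; first exact: num_real.
  by move=> x /ltW; rewrite ler_pdivlMl// lerBrDr.
- apply/cvgryPge => A; exists (c^-1 * (A - b)); split; first exact: num_real.
  by move=> x /ltW; rewrite ler_pdivrMl// lerBlDr.
Qed.

Lemma ge0_integral_opp (G : R -> R) : continuous G -> (forall x, 0 <= G x) ->
  (\int[mu]_x (G (- x))%:E = \int[mu]_x (G x)%:E)%E.
Proof.
have split_ (H : R -> R) : continuous H -> (forall x, 0 <= H x) ->
    (\int[mu]_x (H x)%:E = \int[mu]_(x in `]-oo, 0%R]) (H x)%:E +
       \int[mu]_(x in `[0%R, +oo[) (H x)%:E)%E.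
  move=> cH H0.
  rewrite -(integral_itv_obnd_cbnd _)//; last first.
    apply/measurable_funTS/measurable_EFinP; exact: continuous_measurable_fun.
  rewrite -ge0_integral_setU//=.
  - by rewrite itv_setU_setT.
  - by apply/measurable_funTS/measurable_EFinP; exact: continuous_measurable_fun.
  - by move=> x _; rewrite lee_fin.
  - rewrite disj_set2E; apply/eqP; rewrite -subset0 => x []/= /[!in_itv]/=.
    by rewrite andbT leNgt => /negP.
move=> cG G0.
have cGN : continuous (G \o -%R).
  by move=> x; apply: continuous_comp; [exact: opp_continuous|exact: cG].
have GN0 x : 0 <= (G \o -%R) x by exact: G0.
(* The reflection exchanges the two half lines, and the substitution is made on each of them. *)
rewrite (split_ G)// (split_ (G \o -%R))//.
rewrite addeC; congr (_ + _)%E.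
  rewrite -[X in `]-oo, X]]oppr0 ge0_integration_by_substitutionNy//.
  exact: continuous_subspaceT.
rewrite -[X in `]-oo, X]]oppr0 ge0_integration_by_substitutionNy//.
- by apply: eq_integral => x _ /=; rewrite opprK.
- exact: continuous_subspaceT.
Qed.

Lemma continuous_std_pdf : continuous (normal_pdf (0 : R) 1).
Proof. by apply: continuous_normal_pdf; rewrite oner_neq0. Qed.

Lemma std_pdf_even (z : R) : normal_pdf 0 1 (- z) = normal_pdf 0 1 z.
Proof. by rewrite !normal_pdf1E sqrrN. Qed.

(* Reduces a statement about quartic functions to nonnegative ones. *)
Lemma quartic_shift (f : R -> R) : quartic f -> exists q : R -> R,
  [/\ quartic q, forall z, 0 <= q z, quartic (fun z => f z + q z) &
      forall z, 0 <= f z + q z].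
Proof.
move=> /[dup] qf /quarticP[cf [C C0 Cf]].
have qq : quartic (fun z : R => C * (1 + z ^+ 4)).
  by apply/quarticZ/quarticD; [exact: quartic_cst|exact: quartic_pow].
exists (fun z : R => C * (1 + z ^+ 4)); split => //.
- by move=> z; rewrite mulr_ge0// addr_ge0// exprn_even_ge0.
- exact: quarticD.
- move=> z; have := Cf z; rewrite ler_norml => /andP[+ _].
  by rewrite -subr_ge0 opprK.
Qed.

Lemma ge0_gaussE_opp (f : R -> R) : continuous f -> (forall z, 0 <= f z) ->
  gaussE (fun z => f (- z)) = gaussE f.
Proof.
move=> cf f0; rewrite /gaussE /Rintegral; congr fine.
have cN : continuous (fun z => f (- z)).
  by move=> x; apply: (@continuous_comp _ _ _ -%R f); [exact: opp_continuous|exact: cf].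
rewrite !continuous_ge0_integral_std_normal//.
rewrite -[RHS](ge0_integral_opp (G := fun x => f x * normal_pdf 0 1 x)).
- by apply: eq_integral => x _; rewrite std_pdf_even.
- by move=> x; apply: cvgM; [exact: cf|exact: continuous_std_pdf].
- by move=> x; rewrite mulr_ge0// normal_pdf_ge0.
Qed.

Lemma quartic_opp (f : R -> R) : quartic f -> quartic (fun z => f (- z)).
Proof.
move=> /(quartic_affine (-1) 0); congr quartic.
by apply/funext => z; rewrite mulN1r addr0.
Qed.

Lemma gaussE_opp (f : R -> R) : quartic f ->
  gaussE (fun z => f (- z)) = gaussE f.
Proof.
move=> qf; have [q [qq q0 qfq fq0]] := quartic_shift qf.
have fE (z : R) : f z = (f z + q z) - q z by rewrite addrK.
transitivity (gaussE (fun z => (f (- z) + q (- z)) - q (- z))).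
  by congr gaussE; apply/funext => z; rewrite addrK.
rewrite gaussEB//; [|exact: (quartic_opp qfq)|exact: quartic_opp].
rewrite (ge0_gaussE_opp (f := fun z => f z + q z))//; last by case: qfq.
rewrite (ge0_gaussE_opp (f := q))//; last by case: qq.
by rewrite -gaussEB//; congr gaussE; apply/funext => z; rewrite addrK.
Qed.

Lemma gaussE_id : gaussE (fun z : R => z) = 0.
Proof.
have qi : quartic (fun z : R => z).
  by have := @quartic_pow R 1 isT; congr quartic; apply/funext => z; rewrite expr1.
have := gaussE_opp qi.
have -> : (fun z : R => - z) = (fun z => (-1) * z).
  by apply/funext => z; rewrite mulN1r.
rewrite gaussEZ// mulN1r => h; lra.
Qed.

Lemma gaussE_cube : gaussE (fun z : R => z ^+ 3) = 0.
Proof.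
have qi : quartic (fun z : R => z ^+ 3) by exact: quartic_pow.
have := gaussE_opp qi.
have -> : (fun z : R => (- z) ^+ 3) = (fun z => (-1) * z ^+ 3).
  by apply/funext => z; ring.
rewrite gaussEZ// mulN1r => h; lra.
Qed.

(** The exponential turns the standard density into r times the density of N(0, r^2). The exponent
    takes both signs, according to whether r is below or above 1. *)
Lemma std_normal_exp_sq (r : R) : 0 < r ->
  (\int[std_normal]_z (expR (- ((r ^- 2 - 1) * (z ^+ 2 / 2))))%:E = r%:E)%E.
Proof.
move=> r0; rewrite ge0_integral_std_normal//; last first.
- apply/measurable_EFinP; apply: measurableT_comp => //.
  apply: measurable_funN; apply: measurable_funM => //.
  by apply: measurable_funM => //; exact: measurable_funX.
transitivity (\int[mu]_z (r%:E * (normal_pdf 0 r z)%:E))%E.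
  apply: eq_integral => z _; rewrite -!EFinM; congr EFin.
  rewrite normal_pdf1E normal_pdfsE// mulrCA -expRD !mulrA divff ?gt_eqF// mul1r.
  by congr (_ * expR _); rewrite -mulr_natr; field; rewrite gt_eqF.
rewrite integralZl//; last exact: integrable_normal_pdf.
by rewrite integral_normal_pdf mule1.
Qed.

Lemma std_normal_exp_sq_integrable (r : R) : 0 < r ->
  std_normal.-integrable setT
    (EFin \o fun z : R => (expR (- ((r ^- 2 - 1) * (z ^+ 2 / 2))))).
Proof.
move=> r0; apply/integrableP; split.
  apply/measurable_EFinP; apply: measurableT_comp => //.
  apply: measurable_funN; apply: measurable_funM => //.
  by apply: measurable_funM => //; exact: measurable_funX.
under eq_integral => z _ do rewrite /= ger0_norm ?expR_ge0//.
by rewrite std_normal_exp_sq// ltry.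
Qed.

(* With m the second moment, 1 - t/2 m <= E exp (- t z^2/2) = (1 + t)^(-1/2)
   for t > -1 of both signs, and t -> 0. *)
Lemma gaussE_sqr : gaussE (fun z : R => z ^+ 2) = 1.
Proof.
set m := gaussE _.
have q2 : quartic (fun z : R => z ^+ 2) by exact: quartic_pow.
have m0 : 0 <= m by apply: gaussE_ge0 => z; rewrite sqr_ge0.
have key (r : R) : 0 < r -> 1 - (r ^- 2 - 1) / 2 * m <= r.
  move=> r0.
  have -> : 1 - (r ^- 2 - 1) / 2 * m =
      gaussE (fun z => 1 - (r ^- 2 - 1) / 2 * z ^+ 2).
    rewrite gaussEB; [|exact: quartic_cst|exact: quarticZ].
    by rewrite gaussE_cst gaussEZ.
  have rE : gaussE (fun z : R => (expR (- ((r ^- 2 - 1) * (z ^+ 2 / 2))))) = r.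
    by rewrite /gaussE /Rintegral std_normal_exp_sq.
  rewrite -[leRHS]rE.
  apply: le_Rintegral => //.
  - apply: quartic_integrable; apply: quarticB; first exact: quartic_cst.
    exact: quarticZ.
  - exact: std_normal_exp_sq_integrable.
  - move=> z _ /=; apply: le_trans (expR_ge1Dx _).
    have -> // : (r ^- 2 - 1) / 2 * z ^+ 2 = (r ^- 2 - 1) * (z ^+ 2 / 2).
    by rewrite -mulrA (mulrC 2^-1).
have key2 (r : R) : 0 < r -> 2 * r ^+ 2 * (1 - r) <= m * (1 - r) * (1 + r).
  move=> r0; have := key r r0.
  rewrite lerBlDr -lerBlDl -(@ler_pM2l _ (2 * r ^+ 2)) ?mulr_gt0 ?exprn_gt0//.
  move=> h; apply: le_trans h _; rewrite le_eqVlt; apply/orP; left; apply/eqP.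
  by field; rewrite gt_eqF.
apply/eqP; rewrite eq_le; apply/andP; split; rewrite leNgt; apply/negP => hm.
(* If m > 1, then r = 1 + e contradicts [key2]: it would give m (2 + e) <= 2 (1 + e)^2, while 2 m =
   2 + 10 e m exceeds 2 + 4 e + 2 e^2. *)
- pose e := (m - 1) / (5 * m).
  have mgt0 : 0 < m by lra.
  have e0 : 0 < e by rewrite divr_gt0 ?subr_gt0// mulr_gt0.
  have em : e * 5 * m = m - 1 by rewrite /e; field; rewrite gt_eqF.
  have e1 : e <= 1 / 5 by nra.
  have em2 : 5 * e <= m - 1 by nra.
  have := key2 (1 + e) ltac:(lra).
  have -> : 1 - (1 + e) = - e by ring.
  rewrite !mulrN mulNr lerN2 -subr_ge0.
  have -> : 2 * (1 + e) ^+ 2 * e - m * e * (1 + (1 + e)) =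
    e * (2 * (1 + e) ^+ 2 - m * (2 + e)) by ring.
  rewrite pmulr_rge0// => h; nra.
(* If m < 1, then r = 1 - e contradicts [key2]: with m = 1 - 4 e, the product m (2 - e) is less than
   2 (1 - e)^2. *)
- pose e := (1 - m) / 4.
  have e0 : 0 < e by rewrite divr_gt0 ?subr_gt0.
  have em : e * 4 = 1 - m by rewrite /e; field.
  have := key2 (1 - e) ltac:(lra).
  have -> : 1 - (1 - e) = e by ring.
  rewrite -subr_ge0.
  have -> : m * e * (1 + (1 - e)) - 2 * (1 - e) ^+ 2 * e =
    e * (m * (2 - e) - 2 * (1 - e) ^+ 2) by ring.
  rewrite pmulr_rge0// => h; nra.
Qed.

(* N(0, a^2) * N(0, b^2) = N(0, a^2 + b^2), by completing the square. *)
Lemma std_normal_convolution (a b c : R) (f : R -> R) : 0 < a -> 0 < b -> 0 < c ->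
  a ^+ 2 + b ^+ 2 = c ^+ 2 -> continuous f -> (forall z, 0 <= f z) ->
  (\int[std_normal]_y \int[std_normal]_z (f (a * y + b * z)%R)%:E =
   \int[std_normal]_z (f (c * z)%R)%:E)%E.
Proof.
move=> a0 b0 c0 abc cf f0.
have mf : measurable_fun [set: R] f by exact: continuous_measurable_fun.
have mpdf : measurable_fun [set: R] (normal_pdf (0 : R) 1) by exact: measurable_normal_pdf.
have pdf0 (x : R) : 0 <= normal_pdf 0 1 x by exact: normal_pdf_ge0.
(* [K (y, x)] is f x times the density at x of a y + b Z, with Z standard normal. *)
pose K (p : R * R) := f p.2 * (b^-1 * normal_pdf 0 1 ((p.2 - a * p.1) / b)).
have K0 p : 0 <= K p by rewrite /K !mulr_ge0// invr_ge0 ltW.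
have mK : measurable_fun [set: measurableTypeR R * measurableTypeR R] (EFin \o K).
  apply/measurable_EFinP; apply: measurable_funM.
    by apply: (measurableT_comp mf); exact: measurable_snd.
  apply: measurable_funM => //; apply: (measurableT_comp mpdf).
  apply: measurable_funM => //; apply: measurable_funB; first exact: measurable_snd.
  by apply: measurable_funM => //; exact: measurable_fst.
transitivity (\int[std_normal]_y \int[mu]_x (K (y, x))%:E)%E.
  apply: eq_integral => y _.
  have cfy : continuous (fun z => f (a * y + b * z)).
    move=> z; apply: (@continuous_comp _ _ _ (fun z => a * y + b * z) f); last exact: cf.
    by apply: cvgD; [exact: cvg_cst|apply: cvgM; [exact: cvg_cst|exact: cvg_id]].
  rewrite continuous_ge0_integral_std_normal//.
  rewrite [RHS](@ge0_integral_affine b (a * y))//.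
  - rewrite -ge0_integralZl//.
    + apply: eq_integral => z _; rewrite -EFinM; congr EFin; rewrite /K /=.
      have -> : (b * z + a * y - a * y) / b = z by field; rewrite gt_eqF.
      by rewrite (addrC (b * z)); field; rewrite gt_eqF.
    + apply/measurable_EFinP; apply: measurable_funM.
        by apply: (measurableT_comp mf); apply: measurable_funD.
      apply: measurable_funM => //; apply: (measurableT_comp mpdf).
      apply: measurable_funM => //; apply: measurable_funB => //=.
      by apply: measurable_funD.
    + by move=> x _; rewrite lee_fin K0.
    + by rewrite lee_fin ltW.
  - move=> x; apply: cvgM; first exact: cf.
    apply: cvgM; first exact: cvg_cst.
    apply: (@continuous_comp _ _ _ (fun x => (x - a * y) / b) (normal_pdf 0 1)).
      by apply: cvgM; [apply: cvgB; [exact: cvg_id|exact: cvg_cst]|exact: cvg_cst].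
    exact: continuous_std_pdf.
rewrite (@fubini_tonelli _ _ _ _ _ std_normal mu (EFin \o K))//.
transitivity (\int[mu]_x (f x * (c^-1 * normal_pdf 0 1 (x / c)))%:E)%E.
  apply: eq_integral => x _; rewrite /fubini_G /=.
  rewrite ge0_integral_std_normal//; last 2 first.
  - apply: (measurableT_comp mK); exact: measurable_pair2.
  - by move=> y; rewrite lee_fin.
  (* The joint density factored the other way: the law N(0, c^2) of x times the law of y given x,
     normal with mean a x / c^2 and standard deviation b / c. *)
  transitivity (\int[mu]_y ((f x * (c^-1 * normal_pdf 0 1 (x / c)))%:E *
      (normal_pdf (a * x / c ^+ 2) (b / c) y)%:E))%E.
    apply: eq_integral => y _; rewrite -!EFinM; congr EFin; rewrite /K /=.
    rewrite -[LHS]mulrA -[RHS]mulrA; congr (_ * _).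
    have bc0 : b / c != 0 by rewrite gt_eqF// divr_gt0.
    rewrite !normal_pdf1E (normal_pdfE _ bc0) /normal_peak /normal_fun.
    rewrite -mulrnAr sqrtrM ?sqr_ge0// sqrtr_sqr gtr0_norm ?divr_gt0//.
    have sp : Num.sqrt (pi *+ 2) != 0 :> R.
      by rewrite gt_eqF// sqrtr_gt0 mulrn_wgt0// pi_gt0.
    set s := Num.sqrt _ in sp *.
    transitivity (b^-1 * s^-1 * s^-1 * (expR (- (((x - a * y) / b) ^+ 2 / 2)) *
        expR (- (y ^+ 2 / 2)))); first by ring.
    transitivity (b^-1 * s^-1 * s^-1 * (expR (- ((x / c) ^+ 2 / 2)) *
        expR (- (y - a * x / c ^+ 2) ^+ 2 / ((b / c) ^+ 2 *+ 2)))); last first.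
      by field; rewrite sp !gt_eqF.
    congr (_ * _); rewrite -!expRD; congr expR.
    rewrite -mulr_natr; apply/eqP; rewrite -subr_eq0; apply/eqP.
    transitivity ((a ^+ 2 + b ^+ 2 - c ^+ 2) * (x ^+ 2 / c ^+ 2 - y ^+ 2) / (2 * b ^+ 2)).
      by field; rewrite !gt_eqF.
    by rewrite abc subrr !mul0r.
  rewrite integralZl//; last exact: integrable_normal_pdf.
  by rewrite integral_normal_pdf mule1.
have cfc : continuous (fun z => f (c * z)).
  move=> z; apply: (@continuous_comp _ _ _ (fun z => c * z) f); last exact: cf.
  by apply: cvgM; [exact: cvg_cst|exact: cvg_id].
rewrite (@ge0_integral_affine c 0)//.
- rewrite continuous_ge0_integral_std_normal// -ge0_integralZl//.
  + apply: eq_integral => z _; rewrite -!EFinM; congr EFin.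
    have -> : (c * z + 0) / c = z by field; rewrite gt_eqF.
    by rewrite addr0; field; rewrite gt_eqF.
  + apply/measurable_EFinP; apply: measurable_funM.
      by apply: (measurableT_comp mf); apply: measurable_funD.
    apply: measurable_funM => //; apply: (measurableT_comp mpdf).
    by apply: measurable_funM => //; apply: measurable_funD.
  + by move=> x _; rewrite lee_fin !mulr_ge0// invr_ge0 ltW.
  + by rewrite lee_fin ltW.
- move=> x; apply: cvgM; first exact: cf.
  apply: cvgM; first exact: cvg_cst.
  apply: (@continuous_comp _ _ _ (fun x : R => x / c) (normal_pdf 0 1)).
    by apply: cvgM; [exact: cvg_id|exact: cvg_cst].
  exact: continuous_std_pdf.
- by move=> x; rewrite !mulr_ge0// invr_ge0 ltW.
Qed.

End gauss2.

(** * Euclidean space and heat averages *)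


Lemma continuous_pair {S U V : topologicalType} (f : S -> U) (g : S -> V) :
  continuous f -> continuous g -> continuous (fun x => (f x, g x)).
Proof. by move=> cf cg x; apply: cvg_pair; [exact: cf|exact: cg]. Qed.

Section normed_module_facts.
Context {R : realType} {V : normedModType R}.

Lemma continuous_subr (a : V) : continuous (fun y : V => y - a).
Proof. by move=> y; apply: cvgB; [exact: cvg_id|exact: cvg_cst]. Qed.

Lemma continuous_addr (a : V) : continuous (fun y : V => y + a).
Proof. by move=> y; apply: cvgD; [exact: cvg_id|exact: cvg_cst]. Qed.

Lemma continuous_line (a v : V) : continuous (fun t : R => a + t *: v).
Proof.
move=> t; apply: cvgD; first exact: cvg_cst.
by apply: cvgZ; [exact: cvg_id|exact: cvg_cst].
Qed.

End normed_module_facts.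

Section euclid.
Context {R : realType} {d : nat}.
Implicit Types x y z v : 'cV[R]_d.

Definition n2 x : R := \sum_i x i ord0 ^+ 2.
Definition dot x y : R := \sum_i x i ord0 * y i ord0.

Lemma frobeniusE x : frobenius x = Num.sqrt (n2 x).
Proof.
rewrite /frobenius; congr Num.sqrt; rewrite /mxtrace /n2.
by apply: eq_bigr => i _; rewrite !mxE big_ord1 mxE expr2.
Qed.

Lemma n2_ge0 x : 0 <= n2 x.
Proof. by apply: sumr_ge0 => i _; rewrite sqr_ge0. Qed.

Lemma frobenius_sqr x : frobenius x ^+ 2 = n2 x.
Proof. by rewrite frobeniusE sqr_sqrtr// n2_ge0. Qed.

Lemma n2_0 : n2 0 = 0.
Proof. by rewrite /n2 big1// => i _; rewrite mxE expr0n. Qed.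

Lemma n2Z k x : n2 (k *: x) = k ^+ 2 * n2 x.
Proof. by rewrite /n2 mulr_sumr; apply: eq_bigr => i _; rewrite mxE exprMn. Qed.

Lemma n2N x : n2 (- x) = n2 x.
Proof. by rewrite -scaleN1r n2Z sqrrN expr1n mul1r. Qed.

Lemma dotC x y : dot x y = dot y x.
Proof. by apply: eq_bigr => i _; rewrite mulrC. Qed.

Lemma dotxx x : dot x x = n2 x.
Proof. by apply: eq_bigr => i _; rewrite expr2. Qed.

Lemma dotZr k x y : dot x (k *: y) = k * dot x y.
Proof. by rewrite /dot mulr_sumr; apply: eq_bigr => i _; rewrite mxE mulrCA. Qed.

Lemma dotZl k x y : dot (k *: x) y = k * dot x y.
Proof. by rewrite dotC dotZr dotC. Qed.

Lemma dotDr x y z : dot x (y + z) = dot x y + dot x z.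
Proof. by rewrite /dot -big_split/=; apply: eq_bigr => i _; rewrite mxE mulrDr. Qed.

Lemma dotDl x y z : dot (x + y) z = dot x z + dot y z.
Proof. by rewrite dotC dotDr !(dotC z). Qed.

Lemma n2D x y : n2 (x + y) = n2 x + 2 * dot x y + n2 y.
Proof.
rewrite -!dotxx dotDr !dotDl (dotC y x); ring.
Qed.

Lemma dot_le (c : R) x y : 0 < c -> 2 * dot x y <= c * n2 x + c^-1 * n2 y.
Proof.
move=> c0; have := n2_ge0 (c *: x - y).
rewrite n2D n2N n2Z -scaleN1r dotZr dotZl => h.
rewrite -(@ler_pM2l _ c)//.
have -> : c * (c * n2 x + c^-1 * n2 y) = c ^+ 2 * n2 x + n2 y by field; rewrite gt_eqF.
lra.
Qed.

Lemma n2D_le x y : n2 (x + y) <= 2 * n2 x + 2 * n2 y.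
Proof. by rewrite n2D; have := @dot_le 1 x y ltr01; rewrite invr1; lra. Qed.

Lemma CS x y : dot x y ^+ 2 <= n2 x * n2 y.
Proof.
have [y0|y0] := eqVneq (n2 y) 0.
  have yi i : y i ord0 = 0.
    apply/eqP; move/eqP: y0; rewrite /n2 psumr_eq0; last by move=> j _; rewrite sqr_ge0.
    by move=> /allP/(_ i (mem_index_enum _)); rewrite /= sqrf_eq0.
  rewrite /dot big1 ?expr0n ?mulr_ge0 ?n2_ge0// => i _.
  by rewrite yi mulr0.
have yp : 0 < n2 y by rewrite lt_neqAle eq_sym y0 n2_ge0.
have := n2_ge0 (n2 y *: x - dot x y *: y).
rewrite n2D n2N !n2Z -scaleN1r !dotZr dotZl => h.
have : 0 <= n2 y * (n2 x * n2 y - dot x y ^+ 2) by nra.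
by rewrite pmulr_rge0// subr_ge0.
Qed.

Lemma coord_le_n2 x i : `|x i ord0| ^+ 2 <= n2 x.
Proof.
rewrite real_normK ?num_real// /n2 (bigD1 i)//= lerDl.
by apply: sumr_ge0 => j _; rewrite sqr_ge0.
Qed.

Lemma normr_le_n2 x : `|x| ^+ 2 <= n2 x.
Proof.
have [->|x0] := eqVneq `|x| 0; first by rewrite expr0n n2_ge0.
have : mx_norm x != 0 by [].
move=> /mx_norm_neq0 [[i j] /= xij].
by have -> : `|x| = mx_norm x by []; rewrite xij ord1; exact: coord_le_n2.
Qed.

Lemma n2_le_normr x : n2 x <= d%:R * `|x| ^+ 2.
Proof.
have -> : d%:R * `|x| ^+ 2 = \sum_(i < d) `|x| ^+ 2.
  by rewrite sumr_const card_ord mulr_natl.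
apply: ler_sum => i _; rewrite -real_normK ?num_real// ler_sqr ?nnegrE//.
have -> : `|x| = mx_norm x by [].
rewrite mx_normrE.
exact: (@le_bigmax _ _ _ 0 (fun ij => `|x ij.1 ij.2|) (i, ord0)).
Qed.

Lemma n2_continuous : continuous n2.
Proof.
rewrite /n2; apply: (continuous_big (op := +%R)); first exact: add_continuous.
move=> i _ x; apply: (@continuous_comp _ _ _ (fun x : 'cV[R]_d => x i ord0) (fun t => t ^+ 2)).
  exact: coord_continuous.
exact: exprn_continuous.
Qed.

End euclid.

(** * Functions with a quadratic modulus, and their heat averages *)

Section modulus.
Context {R : realType} {d : nat}.
Implicit Types (x y z v : 'cV[R]_d) (f g : 'cV[R]_d -> R).

(** One-sided bounds are the ones that pass to infima; using them at x + z with increment - z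
    restores the absolute value. The offset c is a parameter because an average along v only adds
    [n2 v] to it, leaving del and C unchanged. *)
Definition modulus_at (c del C : R) f :=
  forall x z, f (x + z) - f x <= del * (c + n2 x) + C * n2 z.

Definition modulus f := forall del, 0 < del -> exists2 C, 0 <= C &
  modulus_at 1 del C f.

Lemma modulus_abs f : modulus f -> forall del, 0 < del -> exists2 C, 0 <= C &
  forall x z, `|f (x + z) - f x| <= del * (1 + n2 x) + C * n2 z.
Proof.
move=> mf del del0; have [C C0 fC] := mf (del / 2) (divr_gt0 del0 (ltr0Sn _ _)).
exists (C + del); first by rewrite addr_ge0// ltW.
move=> x z; have x0 := n2_ge0 x; have z0 := n2_ge0 z.
rewrite ler_norml; apply/andP; split.
  have := fC (x + z) (- z); rewrite addrK n2N.
  have := n2D_le x z; nra.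
have := fC x z; nra.
Qed.

Lemma modulus_continuous f : modulus f -> continuous f.
Proof.
move=> mf x; apply/(@cvgrPdist_le _ _ _ (nbhs x) (nbhs_filter x)) => e e0.
pose del := e / (2 * (1 + n2 x)).
have x0 : 0 < 1 + n2 x by rewrite ltr_wpDr// n2_ge0.
have del0 : 0 < del by rewrite divr_gt0// mulr_gt0.
have [C C0 fC] := modulus_abs mf del0.
have cn : n2 (y - x) @[y --> x] --> (0 : R).
  rewrite -(@n2_0 R d) -(subrr x).
  apply: (@continuous_comp _ _ _ (fun y => y - x) n2); last exact: n2_continuous.
  exact: continuous_subr.
have e1 : 0 < e / (2 * (C + 1)) by rewrite divr_gt0// mulr_gt0// ltr_wpDl.
move/cvgrPdist_le : cn => /(_ _ e1); apply: (@filterS _ _ (nbhs_filter x)) => y.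
rewrite sub0r normrN ger0_norm ?n2_ge0// => hy.
rewrite distrC -[y in f y](subrK x) [_ - x + x]addrC.
apply: le_trans (fC _ _) _.
have -> : del * (1 + n2 x) = e / 2 by rewrite /del; field; rewrite gt_eqF.
have : C * n2 (y - x) <= (C + 1) * (e / (2 * (C + 1))).
  apply: ler_pM => //; [exact: n2_ge0|lra].
have -> : (C + 1) * (e / (2 * (C + 1))) = e / 2 by field; rewrite gt_eqF// ltr_wpDl.
lra.
Qed.

Lemma modulus_growth f : modulus f -> exists2 C, 0 <= C &
  forall x, `|f x| <= C * (1 + n2 x).
Proof.
move=> mf; have [C C0 fC] := modulus_abs mf ltr01.
exists (C + 1 + `|f 0|); first by rewrite !addr_ge0.
move=> x; have := fC 0 x; rewrite add0r n2_0 => h.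
have x0 := n2_ge0 x.
have : `|f x| <= `|f x - f 0| + `|f 0|.
  by rewrite -[X in `|X| <= _](subrK (f 0)) ler_normD.
have := normr_ge0 (f 0); nra.
Qed.

Lemma quartic_line f x v : continuous f ->
  (exists2 C, 0 <= C & forall y, `|f y| <= C * (1 + n2 y ^+ 2)) ->
  quartic (fun z : R => f (x + z *: v)).
Proof.
move=> cf [C C0 fC]; split.
  move=> z; apply: (@continuous_comp _ _ _ (fun z : R => x + z *: v) f).
    exact: (@continuous_line R 'cV[R]_d).
  exact: cf.
exists (C * (1 + 8 * n2 x ^+ 2 + 8 * n2 v ^+ 2)) => z; apply: le_trans (fC _) _.
rewrite -mulrA ler_wpM2l//.
have := n2D_le x (z *: v); rewrite n2Z => h.
have h0 := n2_ge0 (x + z *: v).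
have : n2 (x + z *: v) ^+ 2 <= (2 * n2 x + 2 * (z ^+ 2 * n2 v)) ^+ 2.
  rewrite ler_sqr// nnegrE; exact: le_trans h.
have : 0 <= (n2 x - (z ^+ 2 * n2 v)) ^+ 2 by rewrite sqr_ge0.
have -> : z ^+ 4 = (z ^+ 2) ^+ 2 by rewrite -exprM.
have := n2_ge0 x; have := n2_ge0 v; have := sqr_ge0 z.
move: (n2 (x + z *: v)) h h0 => N h h0; move: (n2 x) (n2 v) (z ^+ 2) h => X V Z h.
move=> *.
have : 0 <= Z ^+ 2 by rewrite sqr_ge0.
have : 0 <= X ^+ 2 by rewrite sqr_ge0.
have : 0 <= V ^+ 2 by rewrite sqr_ge0.
nra.
Qed.

Lemma quartic_modulus f x v : modulus f -> quartic (fun z : R => f (x + z *: v)).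
Proof.
move=> mf; apply: quartic_line; first exact: modulus_continuous.
have [C C0 fC] := modulus_growth mf.
exists (2 * C); first by rewrite mulr_ge0.
move=> y; apply: le_trans (fC y) _; rewrite [2 * C]mulrC -mulrA ler_wpM2l//.
have := sqr_ge0 (n2 y - 1); nra.
Qed.

Lemma modulusD f g : modulus f -> modulus g -> modulus (fun x => f x + g x).
Proof.
move=> mf mg del del0.
have [C C0 fC] := mf (del / 2) (divr_gt0 del0 (ltr0Sn _ _)).
have [D D0 gD] := mg (del / 2) (divr_gt0 del0 (ltr0Sn _ _)).
exists (C + D); first exact: addr_ge0.
by move=> x z; have := fC x z; have := gD x z; lra.
Qed.

Lemma modulus_cst (k : R) : modulus (fun=> k).
Proof.
move=> del del0; exists 0 => // x z; rewrite subrr mul0r addr0 mulr_ge0 ?ltW//.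
by rewrite ltr_wpDr// n2_ge0.
Qed.

Lemma modulusN f : modulus f -> modulus (fun x => - f x).
Proof.
move=> mf del del0; have [C C0 fC] := modulus_abs mf del0.
exists C => // x z; apply: le_trans (fC x z).
by rewrite -opprD -normrN ler_norm.
Qed.

Lemma modulus_n2 : modulus n2.
Proof.
move=> del del0; exists (1 + del^-1); first by rewrite addr_ge0// invr_ge0 ltW.
move=> x z; rewrite n2D; have := dot_le x z del0; lra.
Qed.

(* Average of f(x + Z v) over a standard real Gaussian Z: the time-1/2 heat
   flow in direction v. *)
Definition heat v f x : R := gaussE (fun z : R => f (x + z *: v)).

Lemma heat0 f x : heat 0 f x = f x.
Proof.
rewrite /heat -[RHS](gaussE_cst (f x)); congr gaussE.
by apply/funext => z; rewrite scaler0 addr0.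
Qed.

Lemma le_heat v f g x : modulus f -> modulus g -> (forall y, f y <= g y) ->
  heat v f x <= heat v g x.
Proof. by move=> mf mg fg; apply: le_gaussE => //; exact: quartic_modulus. Qed.

Lemma heatD v f g x : modulus f -> modulus g ->
  heat v (fun y => f y + g y) x = heat v f x + heat v g x.
Proof. by move=> mf mg; apply: gaussED; exact: quartic_modulus. Qed.

Lemma heat_cst v (k : R) x : heat v (fun=> k) x = k.
Proof. exact: gaussE_cst. Qed.

Lemma heatN v f x : modulus f -> heat v (fun y => - f y) x = - heat v f x.
Proof.
move=> mf; rewrite /heat -[RHS]mulN1r -gaussEZ; last exact: quartic_modulus.
by congr gaussE; apply/funext => z; rewrite mulN1r.
Qed.

Lemma heat_n2 v x : heat v n2 x = n2 x + n2 v.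
Proof.
rewrite /heat.
have qi : quartic (fun z : R => z).
  by have := @quartic_pow R 1 isT; congr quartic; apply/funext => z; rewrite expr1.
have q2 : quartic (fun z : R => z ^+ 2) by exact: quartic_pow.
transitivity (gaussE (fun z : R => (n2 x + 2 * dot x v * z) + n2 v * z ^+ 2)).
  congr gaussE; apply/funext => z; rewrite n2D n2Z dotZr; ring.
rewrite gaussED; [|by apply: quarticD; [exact: quartic_cst|exact: quarticZ]|exact: quarticZ].
rewrite gaussED; [|exact: quartic_cst|exact: quarticZ].
by rewrite gaussE_cst !gaussEZ// gaussE_id gaussE_sqr mulr0 addr0 mulr1.
Qed.

(** The bound is averaged pointwise, and the average of [n2] along v is [n2 x + n2 v]. *)
Lemma heat_modulus_at v c del C f : modulus f -> modulus_at c del C f ->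
  modulus_at (c + n2 v) del C (heat v f).
Proof.
move=> mf fC x z.
rewrite lerBlDl.
have -> : heat v f x + (del * (c + n2 v + n2 x) + C * n2 z) =
    gaussE (fun t => f (x + t *: v) + (del * c + C * n2 z + del * n2 (x + t *: v))).
  rewrite gaussED; [|exact: quartic_modulus|]; last first.
    apply: quarticD; first exact: quartic_cst.
    by apply: quarticZ; apply: quartic_modulus; exact: modulus_n2.
  rewrite gaussED; [|exact: quartic_cst|]; last first.
    by apply: quarticZ; apply: quartic_modulus; exact: modulus_n2.
  rewrite gaussE_cst gaussEZ; last by apply: quartic_modulus; exact: modulus_n2.
  by rewrite -/(heat v n2 x) heat_n2 /heat; ring.
apply: le_gaussE.
- exact: quartic_modulus.
- apply: quarticD; first exact: quartic_modulus.
  apply: quarticD; first exact: quartic_cst.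
  by apply: quarticZ; apply: quartic_modulus; exact: modulus_n2.
- move=> t; have := fC (x + t *: v) z.
  rewrite addrAC; lra.
Qed.

Lemma modulus_atP c f : 0 <= c -> (forall del, 0 < del -> exists2 C, 0 <= C &
  modulus_at c del C f) -> modulus f.
Proof.
move=> c0 mf del del0; have c1 : 0 < 1 + c by rewrite ltr_wpDr.
have [C C0 fC] := mf (del / (1 + c)) (divr_gt0 del0 c1).
exists C => // x z; apply: le_trans (fC x z) _; rewrite lerD2r.
rewrite -mulrA ler_pM2l// mulrC ler_pdivrMr//.
have := n2_ge0 x; nra.
Qed.

Lemma modulus_heat v f : modulus f -> modulus (heat v f).
Proof.
move=> mf; apply: (@modulus_atP (1 + n2 v)); first by rewrite addr_ge0// n2_ge0.
move=> del del0; have [C C0 fC] := mf del del0.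
by exists C => //; exact: heat_modulus_at.
Qed.

(** Semigroup property along a line: variances add. The convolution formula is stated for
    nonnegative functions, so f is written as (f + q) - q with q = C (1 + |y|^2) dominating |f|. *)
Lemma heat_heat (a b c : R) v f x : 0 <= a -> 0 <= b -> 0 <= c ->
  a ^+ 2 + b ^+ 2 = c ^+ 2 -> modulus f ->
  heat (a *: v) (heat (b *: v) f) x = heat (c *: v) f x.
Proof.
rewrite le_eqVlt => /predU1P[<- b0 c0|a0].
  rewrite expr0n add0r scale0r heat0 => /eqP.
  by rewrite eqrXn2// => /eqP ->.
rewrite le_eqVlt => /predU1P[<- c0|b0].
  rewrite expr0n addr0 scale0r => /eqP; rewrite eqrXn2// ?ltW// => /eqP -> _.
  by congr (gaussE _); apply/funext => z; rewrite heat0.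
move=> c0 abc mf.
have {}c0 : 0 < c.
  rewrite lt_neqAle c0 andbT eq_sym; apply/eqP => c00.
  by move: abc; rewrite c00 expr0n => /eqP; rewrite gt_eqF// addr_gt0// exprn_gt0.
have qE y (k : R) (g : 'cV[R]_d -> R) : (fun z : R => g (y + z *: (k *: v))) =
    (fun z : R => g (y + (k * z) *: v)).
  by apply/funext => z; rewrite scalerA mulrC.
suff pos (g : 'cV[R]_d -> R) : modulus g -> (forall y, 0 <= g y) ->
    heat (a *: v) (heat (b *: v) g) x = heat (c *: v) g x.
  have [C C0 fC] := modulus_growth mf.
  pose q y := C * (1 + n2 y).
  have mq : modulus q.
    rewrite /q => del del0; have C1 : 0 < C + 1 by rewrite ltr_wpDl.
    have [D D0 nD] := modulus_n2 (divr_gt0 del0 C1).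
    exists (C * D); first exact: mulr_ge0.
    move=> y z; have := nD y z => h.
    have : C * (n2 (y + z) - n2 y) <= C * (del / (C + 1) * (1 + n2 y) + D * n2 z).
      exact: ler_wpM2l.
    have : C * (del / (C + 1)) <= del.
      by rewrite mulrCA ger_pMr// ler_pdivrMr// mul1r lerDl.
    have := n2_ge0 y; nra.
  have fE : f = (fun y => (f y + q y) + - q y) by apply/funext => y; rewrite addrK.
  have mfq := modulusD mf mq.
  have mqN := modulusN mq.
  have hE w y : heat w f y = heat w (fun y => f y + q y) y - heat w q y.
    by rewrite [in LHS]fE heatD// heatN.
  rewrite [RHS]hE -!pos//.
  - have -> : heat (b *: v) f = (fun y => heat (b *: v) (fun y => f y + q y) y +
        - heat (b *: v) q y) by apply/funext.
    rewrite heatD ?heatN//; try exact: modulus_heat.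
    by apply: modulusN; exact: modulus_heat.
  - by move=> y; rewrite /q mulr_ge0// addr_ge0// n2_ge0.
  - by move=> y; have := fC y; rewrite ler_norml => /andP[+ _]; rewrite /q; lra.
move=> mg g0.
have qg y w := quartic_modulus y w mg.
apply: EFin_inj.
have h1 : quartic (fun z : R => heat (b *: v) g (x + z *: (a *: v))).
  by apply: quartic_modulus; exact: modulus_heat.
have -> : heat (c *: v) g x = gaussE (fun z : R => g (x + (c * z) *: v)).
  by congr (gaussE _); exact: qE.
have qc : quartic (fun z : R => g (x + (c * z) *: v)) by rewrite -qE.
rewrite -(gaussE_EFin qc) /heat -(gaussE_EFin h1).
have cg : continuous (fun z : R => g (x + z *: v)) by case: (qg x v).
rewrite -(std_normal_convolution (a := a) (b := b) (f := fun z : R => g (x + z *: v)))//.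
apply: eq_integral => y _; rewrite /heat -gaussE_EFin; last exact: qg.
by apply: eq_integral => z _; rewrite scalerDl !scalerA addrA (mulrC a) (mulrC b).
Qed.

(* Jensen: convexity along lines suffices, with no integrability of w. *)
Lemma heat_convex_minorant (w : 'cV[R]_d -> R) v f x : modulus f ->
  (forall y z, w y <= (w (y + z) + w (y - z)) / 2) -> (forall y, w y <= f y) ->
  w x <= heat v f x.
Proof.
move=> mf cw wf.
have qf := quartic_modulus x v mf.
have qfN := quartic_opp qf.
have -> : heat v f x = gaussE (fun z : R => 2^-1 * (f (x + z *: v) + f (x + (- z) *: v))).
  rewrite gaussEZ; last exact: quarticD.
  rewrite gaussED// (gaussE_opp qf) -/(heat v f x); lra.
rewrite -(gaussE_cst (w x)); apply: le_gaussE.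
- exact: quartic_cst.
- by apply: quarticZ; exact: quarticD.
- move=> z; have := cw x (z *: v); have := wf (x + z *: v).
  have := wf (x + (- z) *: v); rewrite scaleNr; lra.
Qed.

(** Z and - Z have the same law, so the average can be taken of the symmetrized function, to which
    the second-difference inequality applies; E Z^2 = 1 gives the constant. *)
Lemma heat_semiconvex (L : R) v f x : modulus f ->
  (forall y z, 2 * f y - 2 * L * n2 z <= f (y + z) + f (y - z)) ->
  f x - L * n2 v <= heat v f x.
Proof.
move=> mf cf.
have qf := quartic_modulus x v mf.
have qfN := quartic_opp qf.
have q2 : quartic (fun z : R => z ^+ 2) by exact: quartic_pow.
have -> : heat v f x = gaussE (fun z : R => 2^-1 * (f (x + z *: v) + f (x + (- z) *: v))).
  rewrite gaussEZ; last exact: quarticD.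
  rewrite gaussED// (gaussE_opp qf) -/(heat v f x); lra.
have -> : f x - L * n2 v = gaussE (fun z : R => f x - L * n2 v * z ^+ 2).
  rewrite gaussEB; [|exact: quartic_cst|exact: quarticZ].
  by rewrite gaussE_cst gaussEZ// gaussE_sqr mulr1.
apply: le_gaussE.
- by apply: quarticB; [exact: quartic_cst|exact: quarticZ].
- by apply: quarticZ; exact: quarticD.
- by move=> z; have := cf x (z *: v); rewrite scaleNr n2Z; lra.
Qed.

End modulus.

(** * Iterated Bellman operator *)


Section bellman.
Context {R : realType} {d : nat}.
Implicit Types (x y z v : 'cV[R]_d) (f g : 'cV[R]_d -> R) (h m : R).

(* One step of length h: the best choice of a constant control. *)
Definition bellman h f x : R := inf [set heat v f x | v in [set v | n2 v <= 2 * h]].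

Lemma le_heat_cst (m : R) v f x : modulus f -> (forall y, m <= f y) -> m <= heat v f x.
Proof.
move=> mf fm; rewrite -(heat_cst v m x); apply: le_heat => //.
exact: modulus_cst.
Qed.

Lemma heat_sub_cst v f x (c : R) : modulus f -> heat v (fun y => f y - c) x = heat v f x - c.
Proof.
by move=> mf; rewrite heatD//; [rewrite heat_cst|exact: modulus_cst].
Qed.

Lemma modulus_sub_cst f (c : R) : modulus f -> modulus (fun y => f y - c).
Proof. by move=> mf; apply: modulusD => //; exact: modulus_cst. Qed.

Section lower_bounded.
Context (m : R).

Definition admissible_fun f := modulus f /\ forall y, m <= f y.

Lemma bellman_has_lbound h f x : admissible_fun f ->
  has_lbound [set heat v f x | v in [set v | n2 v <= 2 * h]].
Proof. by move=> [mf fm]; exists m => _ [v _ <-]; exact: le_heat_cst. Qed.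

Lemma bellman_nonempty h f x : 0 <= h ->
  [set heat v f x | v in [set v | n2 v <= 2 * h]] !=set0.
Proof.
by move=> h0; exists (heat 0 f x); exists 0 => //=; rewrite n2_0 mulr_ge0.
Qed.

Lemma bellman_le_heat h f x v : admissible_fun f -> n2 v <= 2 * h ->
  bellman h f x <= heat v f x.
Proof.
by move=> af hv; apply: ge_inf; [exact: bellman_has_lbound|exists v].
Qed.

Lemma le_bellman_glb h f x (c : R) : 0 <= h ->
  (forall v, n2 v <= 2 * h -> c <= heat v f x) -> c <= bellman h f x.
Proof.
move=> h0 cv; apply: lb_le_inf; first exact: bellman_nonempty.
by move=> _ [v hv <-]; exact: cv.
Qed.

Lemma bellman_approx h f x (e : R) : admissible_fun f -> 0 <= h -> 0 < e ->
  exists2 v, n2 v <= 2 * h & heat v f x < bellman h f x + e.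
Proof.
move=> af h0 e0.
have [|_ [v hv <-] ve] := @inf_adherent _
    [set heat v f x | v in [set v | n2 v <= 2 * h]] e e0.
  by split; [exact: bellman_nonempty|exact: bellman_has_lbound].
by exists v.
Qed.

Lemma bellman_le h f x : admissible_fun f -> 0 <= h -> bellman h f x <= f x.
Proof.
move=> af h0; rewrite -[leRHS]heat0; apply: bellman_le_heat => //.
by rewrite n2_0 mulr_ge0.
Qed.

Lemma bellman_modulus_at h c del C f : 0 <= h -> 0 <= del -> admissible_fun f ->
  modulus_at c del C f -> modulus_at (c + 2 * h) del C (bellman h f).
Proof.
move=> h0 del0 af fC x z; apply/ler_addgt0Pr => e e0.
have [v hv ve] := bellman_approx x af h0 e0.
have h1 := bellman_le_heat (x + z) af hv.
have h2 := heat_modulus_at v af.1 fC x z.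
have h3 : del * (c + n2 v + n2 x) <= del * (c + 2 * h + n2 x).
  by rewrite ler_wpM2l// lerD2r lerD2l.
lra.
Qed.

Lemma admissible_bellman h f : 0 <= h -> admissible_fun f -> admissible_fun (bellman h f).
Proof.
move=> h0 /[dup] af [mf fm]; split; last first.
  by move=> x; apply: le_bellman_glb => // v _; exact: le_heat_cst.
apply: (@modulus_atP _ _ (1 + 2 * h)); first by rewrite addr_ge0// mulr_ge0.
move=> del del0; have [C C0 fC] := mf del del0.
by exists C => //; apply: bellman_modulus_at => //; exact: ltW.
Qed.

Lemma le_bellman_sub h f g x (c : R) : 0 <= h -> admissible_fun f -> admissible_fun g ->
  (forall y, f y - c <= g y) -> bellman h f x - c <= bellman h g x.
Proof.
move=> h0 af ag fg; apply: le_bellman_glb => // v hv.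
apply: (@le_trans _ _ (heat v (fun y => f y - c) x)).
  by rewrite heat_sub_cst; [rewrite lerB// bellman_le_heat|exact: af.1].
by apply: le_heat fg; [exact: modulus_sub_cst af.1|exact: ag.1].
Qed.

Lemma le_bellman h f g x : 0 <= h -> admissible_fun f -> admissible_fun g ->
  (forall y, f y <= g y) -> bellman h f x <= bellman h g x.
Proof.
move=> h0 af ag fg; rewrite -[leLHS]subr0; apply: le_bellman_sub => // y.
by rewrite subr0.
Qed.

(** A direction w allowed for the long step is replaced by w / sqrt 2, allowed for each short one;
    by the semigroup property the two short averages compose to the long one. *)
Lemma bellman_bellman h f x : 0 <= h -> admissible_fun f ->
  bellman h (bellman h f) x <= bellman (2 * h) f x.
Proof.
move=> h0 af; apply: le_bellman_glb; first by rewrite mulr_ge0.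
move=> w hw; pose v := (Num.sqrt 2)^-1 *: w.
have s2 : 0 < Num.sqrt 2 :> R by rewrite sqrtr_gt0.
have wv : w = Num.sqrt 2 *: v by rewrite /v scalerA divff ?scale1r// gt_eqF.
have hv : n2 v <= 2 * h by rewrite /v n2Z exprVn sqr_sqrtr// ler_pdivrMl.
have <- : heat (1 *: v) (heat (1 *: v) f) x = heat w f x.
  by rewrite wv; apply: heat_heat => //; [rewrite sqr_sqrtr// expr1n|exact: af.1].
rewrite !scale1r.
apply: le_trans (bellman_le_heat _ (admissible_bellman h0 af) hv) _.
apply: le_heat; [exact: (admissible_bellman h0 af).1|exact/modulus_heat/af.1|].
by move=> y; exact: bellman_le_heat.
Qed.

Lemma admissible_iter_bellman h k f : 0 <= h -> admissible_fun f ->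
  admissible_fun (iter k (bellman h) f).
Proof. by move=> h0 af; elim: k => //= k IH; exact: admissible_bellman. Qed.

(** The same direction v is used at every step; by the semigroup property k averages along v are one
    average along sqrt k v. *)
Lemma iter_bellman_le_heat h k f x v : 0 <= h -> admissible_fun f -> n2 v <= 2 * h ->
  iter k (bellman h) f x <= heat (Num.sqrt k%:R *: v) f x.
Proof.
move=> h0 af hv; elim: k x => [|k IH] x.
  by rewrite sqrtr0 scale0r heat0.
rewrite iterS; apply: le_trans (bellman_le_heat _ (admissible_iter_bellman k h0 af) hv) _.
have <- : heat (1 *: v) (heat (Num.sqrt k%:R *: v) f) x = heat (Num.sqrt k.+1%:R *: v) f x.
  apply: heat_heat => //; last exact: af.1.
  by rewrite !sqr_sqrtr// expr1n -natr1 addrC.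
rewrite scale1r; apply: le_heat => //.
- exact: (admissible_iter_bellman k h0 af).1.
- by apply: modulus_heat; exact: af.1.
Qed.

Lemma iter_bellman_modulus_at h k c del C f : 0 <= h -> 0 <= del -> admissible_fun f ->
  modulus_at c del C f -> modulus_at (c + 2 * h * k%:R) del C (iter k (bellman h) f).
Proof.
move=> h0 del0 af fC; elim: k => [|k IH]; first by rewrite mulr0 addr0.
rewrite iterS -[k.+1%:R]natr1 mulrDr mulr1 addrA.
apply: bellman_modulus_at => //; exact: admissible_iter_bellman.
Qed.

Lemma le_iter_bellman_sub h k f g x (c : R) : 0 <= h -> admissible_fun f -> admissible_fun g ->
  (forall y, f y - c <= g y) -> iter k (bellman h) f x - c <= iter k (bellman h) g x.
Proof.
move=> h0 af ag fg; elim: k x => //= k IH x.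
by apply: le_bellman_sub => //; exact: admissible_iter_bellman.
Qed.

(** No semiconvexity of the iterates enters: the induction bounds each of them below by f minus a
    constant, and the one-step estimate is applied to f itself. *)
Lemma iter_bellman_semiconvex (L : R) h k f x : 0 <= h -> 0 <= L -> admissible_fun f ->
  (forall y z, 2 * f y - 2 * L * n2 z <= f (y + z) + f (y - z)) ->
  f x - 2 * L * (h * k%:R) <= iter k (bellman h) f x.
Proof.
move=> h0 L0 af cf; elim: k x => [|k IH] x; first by rewrite !mulr0 subr0.
rewrite iterS; apply: le_bellman_glb => // v hv.
apply: (@le_trans _ _ (heat v (fun y => f y - 2 * L * (h * k%:R)) x)).
  rewrite heat_sub_cst; last exact: af.1.
  have := heat_semiconvex v x af.1 cf.
  have : L * n2 v <= L * (2 * h) by exact: ler_wpM2l.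
  by rewrite -[k.+1%:R]natr1; lra.
apply: le_heat => //; first exact/modulus_sub_cst/af.1.
exact: (admissible_iter_bellman k h0 af).1.
Qed.

Lemma iter_bellman_convex_minorant (w : 'cV[R]_d -> R) h k f x : 0 <= h -> admissible_fun f ->
  (forall y z, w y <= (w (y + z) + w (y - z)) / 2) -> (forall y, w y <= f y) ->
  w x <= iter k (bellman h) f x.
Proof.
move=> h0 af cw wf; elim: k x => //= k IH x.
apply: le_bellman_glb => // v _; apply: heat_convex_minorant => //.
exact: (admissible_iter_bellman k h0 af).1.
Qed.

End lower_bounded.

Definition stmodulus (w : R -> 'cV[R]_d -> R) := forall del, 0 < del ->
  exists2 C, 0 <= C & forall t s x z, 0 <= t -> 0 <= s ->
  `|w (t + s) (x + z) - w t x| <= del * (1 + t + n2 x) + C * (s + n2 z).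

(* Decreasing limit over dyadic time steps of the piecewise constant controls. *)
Definition bellman_grid (u0 : 'cV[R]_d -> R) (n j : nat) : 'cV[R]_d -> R :=
  iter j (bellman (2 ^- n)) u0.

Definition bellman_dyadic u0 n (t : R) : 'cV[R]_d -> R :=
  bellman_grid u0 n (Num.truncn (2 ^+ n * t)).

Definition value u0 (t : R) x : R := inf (range (fun n => bellman_dyadic u0 n t x)).

Section value_theory.
Context (m L : R) (u0 : 'cV[R]_d -> R).
Hypothesis L0 : 0 <= L.
Hypothesis au0 : admissible_fun m u0.
Hypothesis scu0 : forall y z, 2 * u0 y - 2 * L * n2 z <= u0 (y + z) + u0 (y - z).

Let dy n : 0 <= 2 ^- n :> R. Proof. by rewrite invr_ge0 exprn_ge0. Qed.
Local Hint Resolve dy : core.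

Local Notation U := (bellman_grid u0).
Local Notation uu := (bellman_dyadic u0).
Local Notation u := (value u0).

Lemma admissible_grid n j : admissible_fun m (U n j).
Proof. exact: admissible_iter_bellman. Qed.
Local Hint Resolve admissible_grid : core.

Lemma grid_mono n j k x : (j <= k)%N -> U n k x <= U n j x.
Proof.
move=> /subnK <-; elim: (k - j)%N => // i IH; rewrite addSn.
by apply: le_trans IH; apply: bellman_le (admissible_grid n (i + j)) _.
Qed.

Lemma grid_refine n j x : U n.+1 j.*2 x <= U n j x.
Proof.
elim: j x => // j IH x; rewrite doubleS /bellman_grid /=.
apply: (@le_trans _ _ (bellman (2 ^- n.+1) (bellman (2 ^- n.+1) (U n j)) x)).
  apply: (@le_bellman m); [by []| |exact: admissible_bellman|].
    by apply: admissible_bellman => //; exact: (admissible_grid n.+1 j.*2).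
  move=> y; apply: (@le_bellman m) => //; exact: (admissible_grid n.+1 j.*2).
apply: le_trans (bellman_bellman _ (dy n.+1) (admissible_grid n j)) _.
by rewrite [X in bellman X](_ : _ = 2 ^- n)// exprS invfM mulrA divff ?mul1r.
Qed.

Lemma dyadic_dec n t x : uu n.+1 t x <= uu n t x.
Proof.
rewrite /bellman_dyadic; apply: le_trans (grid_refine _ _ _).
apply: grid_mono.
have [t0|t0] := leP 0 t; last first.
  rewrite (_ : Num.truncn (2 ^+ n * t) = 0%N)//.
  by rewrite truncn_floor leNgt pmulr_rlt0 ?exprn_gt0// t0.
have a0 : 0 <= 2 ^+ n * t by rewrite mulr_ge0// exprn_ge0.
rewrite truncn_ge_nat; last by rewrite mulr_ge0// exprn_ge0.
rewrite exprS -mulrA -mul2n natrM ler_pM2l//.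
by rewrite truncn_le.
Qed.

Lemma dyadic_dec_le n k t x : (n <= k)%N -> uu k t x <= uu n t x.
Proof.
move=> /subnK <-; elim: (k - n)%N => // i IH; rewrite addSn.
exact: le_trans (dyadic_dec _ _ _) IH.
Qed.

Lemma dyadic_ge n t x : m <= uu n t x.
Proof. exact: (admissible_grid _ _).2. Qed.

Lemma value_has_inf t x : has_inf (range (fun n => uu n t x)).
Proof.
split; first by exists (uu 0 t x); exists 0%N.
by exists m => _ [n _ <-]; exact: dyadic_ge.
Qed.

Lemma value_le_dyadic n t x : u t x <= uu n t x.
Proof. by apply: ge_inf; [exact: (value_has_inf t x).2|exists n]. Qed.

Lemma le_value (c : R) t x : (forall n, c <= uu n t x) -> c <= u t x.
Proof.
move=> cu; apply: lb_le_inf; first exact: (value_has_inf t x).1.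
by move=> _ [n _ <-]; exact: cu.
Qed.

Lemma value_approx t x (e : R) : 0 < e ->
  exists N, forall n, (N <= n)%N -> uu n t x < u t x + e.
Proof.
move=> e0; have [_ [N _ <-] h] := inf_adherent e0 (value_has_inf t x).
by exists N => n Nn; apply: le_lt_trans h; exact: dyadic_dec_le.
Qed.

Lemma value_ge t x : m <= u t x.
Proof. by apply: le_value => n; exact: dyadic_ge. Qed.

Lemma grid_le_u0 n j x : U n j x <= u0 x.
Proof. exact: (@grid_mono n 0 j). Qed.

Lemma value_le_u0 t x : u t x <= u0 x.
Proof. by apply: le_trans (value_le_dyadic 0 t x) _; exact: grid_le_u0. Qed.

Lemma value_0 x : u 0 x = u0 x.
Proof.
apply/eqP; rewrite eq_le value_le_u0; apply: le_value => n.
by rewrite /bellman_dyadic mulr0 truncn0.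
Qed.

Lemma value_ge_convex (w : 'cV[R]_d -> R) t x :
  (forall y z, w y <= (w (y + z) + w (y - z)) / 2) -> (forall y, w y <= u0 y) ->
  w x <= u t x.
Proof.
move=> cw wu; apply: le_value => n.
exact: (iter_bellman_convex_minorant (m := m)).
Qed.

Lemma dyadic_nat n j x : uu n (j%:R * 2 ^- n) x = U n j x.
Proof. by rewrite /bellman_dyadic mulrCA divff ?expf_neq0// mulr1 natrK. Qed.

Lemma value_modulus_at del C t : 0 <= t -> 0 <= del ->
  modulus_at 1 del C u0 -> modulus_at (1 + 2 * t) del C (u t).
Proof.
move=> t0 del0 uC x z; apply/ler_addgt0Pr => e e0.
have [N /(_ N (leqnn _)) h] := value_approx t x e0.
have h1 := value_le_dyadic N t (x + z).
have := @iter_bellman_modulus_at m (2 ^- N) (Num.truncn (2 ^+ N * t)) 1 del C u0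
  (dy N) del0 au0 uC x z.
rewrite -/(bellman_grid u0 N _) -/(bellman_dyadic u0 N t) => h2.
have a0 : 0 <= 2 ^+ N * t by rewrite mulr_ge0// exprn_ge0.
have h3 : 2 ^- N * (Num.truncn (2 ^+ N * t))%:R <= t.
  by rewrite ler_pdivrMl ?exprn_gt0// truncn_le.
have : del * (1 + 2 * 2 ^- N * (Num.truncn (2 ^+ N * t))%:R + n2 x) <=
       del * (1 + 2 * t + n2 x).
  by rewrite ler_wpM2l// lerD2r lerD2l -mulrA ler_pM2l.
lra.
Qed.

Lemma admissible_value t : 0 <= t -> admissible_fun m (u t).
Proof.
move=> t0; split; last by move=> y; exact: value_ge.
apply: (@modulus_atP _ _ (1 + 2 * t)); first by rewrite addr_ge0// mulr_ge0.
move=> del del0; have [C C0 uC] := au0.1 del del0.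
by exists C => //; apply: value_modulus_at => //; exact: ltW.
Qed.

(** The loss over the first k steps is known for u0; the remaining j steps are monotone and commute
    with the subtraction of constants, so they carry this loss over to every later time. *)
Lemma grid_lip n j k x : U n j x - 2 * L * (2 ^- n * k%:R) <= U n (j + k) x.
Proof.
rewrite {2}/bellman_grid iterD.
apply: (@le_iter_bellman_sub m) => //; first exact: admissible_iter_bellman.
by move=> y; exact: (@iter_bellman_semiconvex m).
Qed.

Lemma value_noninc t s x : t <= s -> u s x <= u t x.
Proof.
move=> ts; apply: le_value => n; apply: le_trans (value_le_dyadic n s x) _.
by apply: grid_mono; apply: le_truncn; rewrite ler_pM2l ?exprn_gt0.
Qed.

Lemma exists_dyadic_lt (e : R) : 0 < e -> exists N, forall n, (N <= n)%N -> 2 ^- n < e.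
Proof.
move=> e0; have ei0 : 0 <= e^-1 by rewrite invr_ge0 ltW.
exists (Num.truncn e^-1).+1 => n Nn.
have /andP[_ h] := truncn_itv ei0.
rewrite -[ltRHS]invrK ltf_pV2 ?posrE ?exprn_gt0 ?invr_gt0//.
apply: lt_le_trans h _; apply: (@le_trans _ _ n%:R); first by rewrite ler_nat.
by rewrite -natrX ler_nat ltnW// ltn_expl.
Qed.

Lemma value_lip t h x : 0 <= t -> 0 <= h -> u t x - 2 * L * h <= u (t + h) x.
Proof.
move=> t0 h0; apply/ler_addgt0Pr => e e0.
have L1 : 0 < 2 * L + 1 by rewrite ltr_wpDl// mulr_ge0.
have [N1 hN1] := exists_dyadic_lt (divr_gt0 (divr_gt0 e0 (ltr0Sn _ 1)) L1).
have [N2 hN2] := value_approx (t + h) x (divr_gt0 e0 (ltr0Sn _ 1)).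
pose n := maxn N1 N2.
have {hN1} := hN1 n (leq_maxl _ _); rewrite ltr_pdivlMr// => h1.
have {hN2} h2 := hN2 n (leq_maxr _ _).
have h3 := value_le_dyadic n t x.
(* The extra step in k makes up for rounding both t and h down: the index of t + h is at most j +
   k. *)
pose j := Num.truncn (2 ^+ n * t); pose k := (Num.truncn (2 ^+ n * h)).+1.
have a0 : 0 <= 2 ^+ n * t by rewrite mulr_ge0// exprn_ge0.
have b0 : 0 <= 2 ^+ n * h by rewrite mulr_ge0// exprn_ge0.
have h4 : U n (j + k) x <= uu n (t + h) x.
  apply: grid_mono; rewrite -ltnS truncn_lt_nat; last by rewrite mulrDr addr_ge0.
  have /andP[_ j1] := truncn_itv a0; have /andP[_ k1] := truncn_itv b0.
  by rewrite mulrDr -addSn natrD; rewrite -/j -/k in j1 k1 *; lra.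
have h5 := grid_lip n j k x.
have h6 : 2 ^- n * k%:R <= h + 2 ^- n.
  have kE : k%:R = (Num.truncn (2 ^+ n * h))%:R + 1 :> R by rewrite natr1.
  rewrite kE mulrDr mulr1.
  by rewrite lerD2r ler_pdivrMl ?exprn_gt0// truncn_le.
have h7 : 2 * L * (2 ^- n * k%:R) <= 2 * L * (h + 2 ^- n) by rewrite ler_wpM2l// mulr_ge0.
have h8 : 0 <= 2 ^- n :> R by [].

have h9 : u t x <= U n j x by exact: h3.
nra.
Qed.

Lemma heat_dyadic_cvg t x v : 0 <= t ->
  heat v (uu n t) x @[n --> \oo] --> heat v (u t) x.
Proof.
move=> t0.
have qu n : quartic (fun z : R => uu n t (x + z *: v)).
  by apply: quartic_modulus; exact: (admissible_grid _ _).1.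
have q0 : quartic (fun z : R => u0 (x + z *: v)) by exact/quartic_modulus/au0.1.
have q1 : quartic (fun z : R => u t (x + z *: v)).
  by apply: quartic_modulus; exact: (admissible_value t0).1.
(* Since the iterates lie between m and u0, their absolute values are at most u0 - m + |m|, the
   dominating function. *)
have qb : quartic (fun z : R => u0 (x + z *: v) - m + `|m|).
  by apply: quarticD; [apply: quarticB => //|]; exact: quartic_cst.
have mq (f : R -> R) : quartic f -> measurable_fun setT (EFin \o f).
  by move=> [cf _]; apply/measurable_EFinP; exact: continuous_measurable_fun.
have h : (\int[std_normal]_z (uu n t (x + z *: v))%:E)%E @[n --> \oo] -->
    (\int[std_normal]_z (u t (x + z *: v))%:E)%E.
  apply: (@dominated_cvg _ (measurableTypeR R) R std_normal setT measurableT
    (fun n (z : R) => (uu n t (x + z *: v))%:E) (fun z : R => (u t (x + z *: v))%:E)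
    (fun z : R => (u0 (x + z *: v) - m + `|m|)%:E)) => //.
  - by move=> n; exact: mq.
  - move=> z _; apply/cvg_EFin; first by apply: nearW => n.
    apply/cvgrPdist_lt => e e0; have [N hN] := value_approx t (x + z *: v) e0.
    exists N => // n /= Nn; have := hN n Nn.
    have := value_le_dyadic n t (x + z *: v).
    by move=> h1 h2; rewrite /= distrC ger0_norm ?subr_ge0// ltrBlDl.
  - exact: quartic_integrable.
  - move=> n z _; rewrite lee_fin.
    have h1 := dyadic_ge n t (x + z *: v).
    have h2 : uu n t (x + z *: v) <= u0 (x + z *: v) by exact: grid_le_u0.
    rewrite ler_norml; have := ler_norm m; have := ler_norm (- m).
    by rewrite normrN; lra.
have h2 : forall n, (\int[std_normal]_z (uu n t (x + z *: v))%:E)%E = (heat v (uu n t) x)%:E.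
  by move=> n; exact: gaussE_EFin.
move: h; rewrite (gaussE_EFin q1); under eq_fun do rewrite h2.
by move/fine_cvg.
Qed.

(** By the Lipschitz bound in time it suffices to treat a dyadic h' slightly above h. At every finer
    level h' is exactly K steps, all taken along v / sqrt K, and the index of t + h' is exactly j +
    K; the level then tends to infinity under the average. *)
Lemma value_le_heat t h x v : 0 <= t -> n2 v <= 2 * h ->
  u (t + h) x <= heat v (u t) x.
Proof.
move=> t0 hv; apply/ler_addgt0Pr => e e0.
have h0 : 0 <= h by have := n2_ge0 v; lra.
have L1 : 0 < 2 * L + 1 by rewrite ltr_wpDl// mulr_ge0.
have [p0 hp] := exists_dyadic_lt (divr_gt0 (divr_gt0 e0 (ltr0Sn _ 1)) L1).
have {hp} := hp p0 (leqnn _); rewrite ltr_pdivlMr// => hp.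
have a0 : 0 <= 2 ^+ p0 * h by rewrite mulr_ge0// exprn_ge0.
pose k := (Num.truncn (2 ^+ p0 * h)).+1; pose h' : R := 2 ^- p0 * k%:R.
have /andP[k1 k2] := truncn_itv a0; rewrite -/k in k2.
have kE : k%:R = (Num.truncn (2 ^+ p0 * h))%:R + 1 :> R by rewrite natr1.
have hh' : h <= h' by rewrite /h' ler_pdivlMl ?exprn_gt0// ltW.
have h'h : h' <= h + 2 ^- p0.
  by rewrite /h' kE mulrDr mulr1 lerD2r ler_pdivrMl ?exprn_gt0.
have hl := @value_lip (t + h) (h' - h) x (addr_ge0 t0 h0) ltac:(by rewrite subr_ge0).
rewrite -addrA [h + _]addrC subrK in hl.
have hd : 2 * L * (h' - h) <= 2 * L * 2 ^- p0.
  by rewrite ler_wpM2l// ?mulr_ge0// lerBlDl.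
suff hk : u (t + h') x <= heat v (u t) x by have := dy p0; nra.
have cv := @heat_dyadic_cvg t x v t0.
apply: (cvgr_to_ge cv).
- exists p0 => // n /= pn.
  apply: le_trans (value_le_dyadic n _ _) _.
  pose j := Num.truncn (2 ^+ n * t).
  pose K := (k * 2 ^ (n - p0))%N.
  have KE : K%:R = 2 ^+ n * h'.
    rewrite /K /h' natrM natrX mulrC mulrA; congr (_ * _).
    by rewrite -{2}(subnK pn) exprD mulfK// expf_neq0.
  have -> : uu n (t + h') x = U n (j + K) x.
    rewrite /bellman_dyadic; congr (bellman_grid _ _ _ _).
    rewrite mulrDr -KE; apply: truncn_def.
    have b0 : 0 <= 2 ^+ n * t by rewrite mulr_ge0// exprn_ge0.
    have /andP[j1 j2] := truncn_itv b0; rewrite -/j in j1 j2.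
    by rewrite -addSn !natrD; apply/andP; split; lra.
  have K0 : 0 < K%:R :> R by rewrite ltr0n /K muln_gt0 expn_gt0.
  have sK : 0 < Num.sqrt K%:R :> R by rewrite sqrtr_gt0.
  pose v' := (Num.sqrt K%:R)^-1 *: v.
  have -> : v = Num.sqrt K%:R *: v' by rewrite /v' scalerA divff ?scale1r// gt_eqF.
  rewrite /bellman_grid addnC iterD.
  apply: (@iter_bellman_le_heat m) => //; first exact: admissible_grid.
  rewrite /v' n2Z exprVn sqr_sqrtr ?ler0n// ler_pdivrMl//.
  rewrite KE [leRHS](_ : _ = 2 * h').
    by apply: le_trans hv _; rewrite ler_pM2l.
  have simp (a b : R) : a != 0 -> a * b * (2 * a^-1) = 2 * b by move=> a1; field.
  by rewrite simp// expf_neq0.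
Qed.

End value_theory.

Lemma value_stmodulus (m L : R) u0 : 0 <= L -> admissible_fun m u0 ->
  (forall y z, 2 * u0 y - 2 * L * n2 z <= u0 (y + z) + u0 (y - z)) ->
  stmodulus (value u0).
Proof.
move=> L0 au0 scu0 del del0.
have [C C0 uC] := au0.1 (del / 4) (divr_gt0 del0 (ltr0Sn _ 3)).
exists (C + del + 2 * L); first by rewrite !addr_ge0 ?mulr_ge0// ltW.
move=> t s x z t0 s0.
have e0 : 0 <= del / 4 by rewrite divr_ge0// ltW.
have h1 := @value_modulus_at m u0 au0 (del / 4) C t t0 e0 uC.
have h2 := h1 x z.
have := h1 (x + z) (- z); rewrite addrK n2N => h3.
have h4 := n2D_le x z.
have h5 := @value_lip m L u0 L0 au0 scu0 t s (x + z) t0 s0.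
have h6 : value u0 (t + s) (x + z) <= value u0 t (x + z).
  by apply: (value_noninc au0); rewrite lerDl.
have x0 := n2_ge0 x; have z0 := n2_ge0 z.
have Ls : 0 <= L * s by exact: mulr_ge0.
have Cs : 0 <= C * s by exact: mulr_ge0.
have ds : 0 <= del * s by rewrite mulr_ge0// ltW.
have Lz : 0 <= L * n2 z by exact: mulr_ge0.
have dz : 0 <= del * n2 z by rewrite mulr_ge0// ltW.
have dx : 0 <= del * n2 x by rewrite mulr_ge0// ltW.
have dt : 0 <= del * t by rewrite mulr_ge0// ltW.
have d4 : del / 4 * n2 (x + z) <= del / 4 * (2 * n2 x + 2 * n2 z) by rewrite ler_wpM2l.
rewrite ler_norml; apply/andP; split; nra.
Qed.

End bellman.

(** * Quadratic forms and Taylor expansions *)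


Section quadratic_form.
Context {R : realType} {d : nat}.
Implicit Types (S B : 'M[R]_d) (x y z : 'cV[R]_d).

Definition quad S x y : R := dot x (S *m y).

Lemma quadE S x y : quad S x y = \sum_i \sum_j x i ord0 * S i j * y j ord0.
Proof.
rewrite /quad /dot; apply: eq_bigr => i _; rewrite mxE mulr_sumr.
by apply: eq_bigr => j _; rewrite mulrA.
Qed.

Lemma quadC S x y : S^T = S -> quad S x y = quad S y x.
Proof.
move=> symS; rewrite !quadE exchange_big/=; apply: eq_bigr => i _; apply: eq_bigr => j _.
by rewrite -[in RHS]symS mxE; ring.
Qed.

Lemma quadDr S x y z : quad S x (y + z) = quad S x y + quad S x z.
Proof. by rewrite /quad mulmxDr dotDr. Qed.

Lemma quadDl S x y z : quad S (x + y) z = quad S x z + quad S y z.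
Proof. by rewrite /quad dotDl. Qed.

Lemma quadZr S k x y : quad S x (k *: y) = k * quad S x y.
Proof. by rewrite /quad -scalemxAr dotZr. Qed.

Lemma quadZl S k x y : quad S (k *: x) y = k * quad S x y.
Proof. by rewrite /quad dotZl. Qed.

Lemma quad_bound S : exists2 C, 0 <= C & forall x, `|quad S x x| <= C * n2 x.
Proof.
exists (\sum_i \sum_j `|S i j|).
  by apply: sumr_ge0 => i _; apply: sumr_ge0.
move=> x; rewrite quadE mulr_suml; apply: le_trans (ler_norm_sum _ _ _) _.
apply: ler_sum => i _; rewrite mulr_suml; apply: le_trans (ler_norm_sum _ _ _) _.
apply: ler_sum => j _; rewrite !normrM mulrAC mulrC ler_wpM2l//.
have := coord_le_n2 x i; have := coord_le_n2 x j.
have := sqr_ge0 (`|x i ord0| - `|x j ord0|); nra.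
Qed.

Lemma quad_sub S B x y : quad (S - B) x y = quad S x y - quad B x y.
Proof. by rewrite /quad mulmxBl dotDr -scaleN1r dotZr mulN1r. Qed.

Lemma quad_CS S x y : S^T = S -> (forall z, 0 <= quad S z z) ->
  quad S x y ^+ 2 <= quad S x x * quad S y y.
Proof.
move=> symS S0.
have key (t : R) : 0 <= quad S x x + 2 * t * quad S x y + t ^+ 2 * quad S y y.
  have := S0 (x + t *: y); rewrite quadDr !quadDl !quadZr !quadZl (quadC y x symS).
  by move=> h; lra.
have [yy0|yy0] := eqVneq (quad S y y) 0.
  have [xy0|xy0] := eqVneq (quad S x y) 0; first by rewrite xy0 yy0 expr0n mulr0.
  have := key (- (quad S x x + 1) / (2 * quad S x y)); rewrite yy0 mulr0 addr0.
  have -> : quad S x x + 2 * (- (quad S x x + 1) / (2 * quad S x y)) * quad S x y = -1.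
    by field.
  by move=> h; exfalso; move: h; rewrite lerNr oppr0 ler10.
have yp : 0 < quad S y y by rewrite lt_neqAle eq_sym yy0 S0.
have := key (- quad S x y / quad S y y).
have -> : quad S x x + 2 * (- quad S x y / quad S y y) * quad S x y +
   (- quad S x y / quad S y y) ^+ 2 * quad S y y =
   (quad S x x * quad S y y - quad S x y ^+ 2) / quad S y y by field.
by rewrite pmulr_lge0 ?invr_gt0// subr_ge0.
Qed.

Lemma eigenvalue_quad S (a : R) : eigenvalue S a ->
  exists2 x, 0 < n2 x & quad S x x = a * n2 x.
Proof.
move=> /eigenvalueP[v vS v0]; exists v^T.
  rewrite lt_neqAle n2_ge0 andbT eq_sym; apply: contra v0 => /eqP h.
  apply/eqP/rowP => i; rewrite mxE; apply/eqP.
  have := coord_le_n2 v^T i; rewrite h mxE => h2.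
  by rewrite -normr_eq0 -sqrf_eq0 eq_le h2 sqr_ge0.
rewrite quadE exchange_big/= /n2 mulr_sumr; apply: eq_bigr => j _.
transitivity ((v *m S) ord0 j * v^T j ord0).
  by rewrite [(v *m S) _ _]mxE mulr_suml; apply: eq_bigr => i _; rewrite !mxE.
by rewrite vS !mxE expr2 mulrA.
Qed.

(* The infimum of the empty set is 0, whence the case a <= 0 needs no eigenvalue. *)
Lemma le_lambda1 S (a : R) : a <= 0 -> (forall x, a * n2 x <= quad S x x) ->
  a <= lambda1 S.
Proof.
move=> a0 aS; rewrite /lambda1; set E := [set _ | _].
have [->|/set0P E0] := eqVneq E set0; first by rewrite inf0.
apply: lb_le_inf => // b /eigenvalue_quad[x x0 xb].
by have := aS x; rewrite xb ler_pM2r.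
Qed.

Lemma exists_unit : (0 < d)%N -> exists x : 'cV[R]_d, n2 x = 1.
Proof.
case: d => // d' _; exists (delta_mx ord0 ord0).
rewrite /n2 (bigD1 ord0)//= big1 ?mxE ?eqxx ?expr1n ?addr0// => i i0.
by rewrite mxE (negbTE i0) expr0n.
Qed.

(* If mu is the infimum of the Rayleigh quotient, S - mu is positive semidefinite,
   and by Cauchy-Schwarz it cannot be invertible. *)
Lemma lambda1_le_quad S x : (0 < d)%N -> S^T = S -> lambda1 S * n2 x <= quad S x x.
Proof.
move=> d0 symS.
have [C C0 SC] := quad_bound S.
have [e e1] := exists_unit d0.
pose Q := [set quad S y y | y in [set y | n2 y = 1]].
have Qlb : has_lbound Q.
  exists (- C) => _ [y y1 <-]; have := SC y; rewrite y1 mulr1 ler_norml.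
  by case/andP.
have Q0 : Q !=set0 by exists (quad S e e); exists e.
pose mu := inf Q.
have muS y : mu * n2 y <= quad S y y.
  have [y0|y0] := eqVneq (n2 y) 0.
    have := SC y; rewrite y0 mulr0 mulr0 normr_le0 => /eqP ->//.
  have yp : 0 < n2 y by rewrite lt_neqAle eq_sym y0 n2_ge0.
  pose k := (Num.sqrt (n2 y))^-1.
  have k2 : k ^+ 2 = (n2 y)^-1 by rewrite exprVn sqr_sqrtr// ltW.
  have : mu <= quad S (k *: y) (k *: y).
    by apply: ge_inf => //; exists (k *: y) => //=; rewrite n2Z k2 mulVf.
  by rewrite quadZl quadZr mulrA -expr2 k2 mulrC ler_pdivlMr.
pose B := S - mu%:M.
have BE y z : quad B y z = quad S y z - mu * dot y z.
  by rewrite quad_sub /quad mul_scalar_mx dotZr.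
have B0 y : 0 <= quad B y y by rewrite BE dotxx subr_ge0.
have symB : B^T = B by rewrite /B linearB/= symS tr_scalar_mx.
have Bsing : B \notin unitmx.
  apply/negP => Bu.
  have [D D0 BD] := quad_bound (invmx B).
  have key y : n2 y = 1 -> 1 <= D * quad B y y.
    move=> y1; have := quad_CS y (invmx B *m y) symB B0.
    have -> : quad B y (invmx B *m y) = 1 by rewrite /quad mulKVmx// dotxx.
    have -> : quad B (invmx B *m y) (invmx B *m y) = quad (invmx B) y y.
      by rewrite /quad mulKVmx// dotC.
    have := BD y; rewrite y1 mulr1 expr1n => h1 h2.
    apply: le_trans h2 _; rewrite mulrC ler_wpM2r//.
    by apply: le_trans h1; exact: ler_norm.
  have Dp : 0 < D.
    rewrite lt_neqAle D0 andbT eq_sym; apply/eqP => D00.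
    by have := key e e1; rewrite D00 mul0r ler10.
  have : mu + D^-1 <= inf Q.
    apply: lb_le_inf => // _ [y y1 <-].
    have := key y y1; rewrite BE dotxx y1 mulr1 -ler_pdivrMl// mulr1.
    by rewrite lerBrDl.
  by rewrite gerDl leNgt invr_gt0 Dp.
have muE : eigenvalue S mu.
  by rewrite /eigenvalue /eigenspace -/B kermx_eq0 row_free_unit.
apply: le_trans (muS x); rewrite ler_wpM2r ?n2_ge0//.
apply: ge_inf => //; exists mu => b /eigenvalue_quad[y y0 yb].
by have := muS y; rewrite yb ler_pM2r.
Qed.

End quadratic_form.

(** * Taylor expansion and symmetry of second derivatives *)

Section line_calculus.
Context {R : realType} {V : normedModType R}.
Implicit Types (f : V -> R) (p v : V).

Lemma line_derive_ext f p v (s : R) :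
  (fun h : R => h^-1 *: (((fun s : R => f (p + s *: v)) \o shift s) (h *: (1 : R)) - f (p + s *: v))) =
  (fun h : R => h^-1 *: ((f \o shift (p + s *: v)) (h *: v) - f (p + s *: v))).
Proof.
apply/funext => h /=; congr (_ *: (f _ - _)).
by rewrite scalerDl [h *: 1]mulr1 addrCA.
Qed.

Lemma is_derive_line f p v (s : R) : derivable f (p + s *: v) v ->
  is_derive s 1 (fun s : R => f (p + s *: v)) ('D_v f (p + s *: v)).
Proof.
move=> df; split; first by rewrite /derivable line_derive_ext.
by rewrite /derive line_derive_ext.
Qed.

Lemma MVT_line (g dg : R -> R) : (forall s : R, is_derive s 1 g (dg s)) ->
  exists2 c, 0 < c < 1 & g 1 - g 0 = dg c.
Proof.
move=> dgE.
have cg : continuous g.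
  move=> s; apply/differentiable_continuous/derivable1_diffP.
  exact: (@ex_derive _ _ _ _ _ _ _ (dgE s)).
have [c cI ->] := @MVT R g dg 0 1 ltr01 (fun x _ => dgE x) (continuous_subspaceT cg).
by exists c; [rewrite in_itv in cI|rewrite subr0 mulr1].
Qed.

Lemma Taylor2_line (g g1 g2 : R -> R) :
  (forall s : R, is_derive s 1 g (g1 s)) -> (forall s : R, is_derive s 1 g1 (g2 s)) ->
  exists2 c, 0 < c < 1 & g 1 - g 0 - g1 0 = g2 c / 2.
Proof.
(* The function k takes equal values at 0 and 1, so its derivative vanishes at some c; the mean
   value theorem for s -> g1 (s c) then identifies K. *)
move=> dg dg1; pose K := g 1 - g 0 - g1 0.
pose k (s : R) := g s - s * g1 0 - s ^+ 2 * K.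
have dk (s : R) : is_derive s 1 k (g1 s - g1 0 - 2 * s * K).
  have := dg s => dgs.
  rewrite /k; apply: is_derive_eq.
  rewrite /GRing.scale/= !(mulr1, mulr0, add0r, addr0, expr1, scaler1).
  by rewrite -mulr_natr; ring.
have [c /andP[c0 c1]] := MVT_line dk.
have -> : k 1 - k 0 = 0 by rewrite /k /K; ring.
move=> kc.
have dl (s : R) : is_derive s 1 (fun s => g1 (s * c)) (c * g2 (s * c)).
  have := dg1 (s * c) => h1.
  have h2 : is_derive s 1 (fun s : R => s * c) c.
    by apply: is_derive_eq; rewrite /GRing.scale/= mulr0 add0r mulr1.
  have := @is_derive1_comp R g1 (fun s => s * c) s _ _ h1 h2.
  by rewrite mulrC.
have [t /andP[t0 t1]] := MVT_line dl; rewrite mul1r mul0r => gt.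
exists (t * c); first by rewrite mulr_gt0//=; nra.
have : c * (g2 (t * c) - 2 * K) = 0 by rewrite mulrBr -gt [RHS]kc; ring.
move/eqP; rewrite mulf_eq0 gt_eqF//= subr_eq0 => /eqP ->.
by rewrite -/K; field.
Qed.

End line_calculus.

Section jets.
Context {R : realType} {d : nat}.
Local Notation V := 'cV[R]_d.
Context (F : V -> R) (F1 : 'I_d -> V -> R) (F2 : 'I_d -> 'I_d -> V -> R) (x0 : V).
Hypothesis dF : forall x y (s : R), is_derive s 1 (fun s : R => F (x + s *: y))
  (\sum_i y i ord0 * F1 i (x + s *: y)).
Hypothesis dF1 : forall j x y (s : R), is_derive s 1 (fun s : R => F1 j (x + s *: y))
  (\sum_i y i ord0 * F2 i j (x + s *: y)).
Hypothesis cF2 : forall i j, {for x0, continuous (F2 i j)}.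

Lemma near_n2 (e : R) : 0 < e -> forall G : V -> R, {for x0, continuous G} ->
  exists2 r, 0 < r & forall y, n2 y < r -> `|G (x0 + y) - G x0| < e.
Proof.
move=> e0 G cG.
have [r r0 rG] : exists2 r : R, 0 < r & ball x0 r `<=` [set x | `|G x - G x0| < e].
  have /(@cvgrPdist_lt _ _ _ (nbhs x0) (nbhs_filter x0))/(_ _ e0) :
    G x @[x --> x0] --> G x0 by exact: cG.
  move=> /nbhs_ballP[r r0 h]; exists r => // x /h.
  by rewrite /= distrC.
exists (r ^+ 2); first by rewrite exprn_gt0.
move=> y yr; apply: rG; rewrite -ball_normE /= opprD addrA subrr sub0r normrN.
by rewrite -(@ltr_pXn2r _ 2)// ?nnegrE// ?(ltW r0)//; apply: le_lt_trans (normr_le_n2 y) yr.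
Qed.

Lemma near_n2_all (e : R) : 0 < e ->
  exists2 r, 0 < r & forall i j y, n2 y < r -> `|F2 i j (x0 + y) - F2 i j x0| < e.
Proof.
move=> e0.
have h (ij : 'I_d * 'I_d) : exists r, 0 < r /\ forall y, n2 y < r ->
    `|F2 ij.1 ij.2 (x0 + y) - F2 ij.1 ij.2 x0| < e.
  by have [r r0 hr] := near_n2 e0 (@cF2 ij.1 ij.2); exists r.
have [r hr] := choice h.
exists (\big[Order.min/1]_ij r ij).
  by apply: lt_bigmin => [|ij _]; [exact: ltr01|case: (hr ij)].
move=> i j y yr; apply: (hr (i, j)).2; apply: lt_le_trans yr _.
exact: bigmin_le.
Qed.

Lemma Taylor2 (e : R) : 0 < e -> exists2 r, 0 < r & forall y, n2 y < r ->
  `|F (x0 + y) - F x0 - \sum_i y i ord0 * F1 i x0 -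
     2^-1 * \sum_i \sum_j y i ord0 * F2 i j x0 * y j ord0| <= e * n2 y.
Proof.
move=> e0.
have d1 : 0 < d%:R + 1 :> R by rewrite ltr_wpDl.
(* The factor d + 1 pays for passing from entries to the quadratic form: the square of the sum of
   the |y_j| is at most d |y|^2. *)
have [r r0 hr] := near_n2_all (divr_gt0 e0 d1).
exists r => // y yr.
pose g s := F (x0 + s *: y).
pose g1 s := \sum_j y j ord0 * F1 j (x0 + s *: y).
pose g2 s := \sum_j y j ord0 * \sum_i y i ord0 * F2 i j (x0 + s *: y).
have dg (s : R) : is_derive s 1 g (g1 s) by exact: dF.
have dg1 (s : R) : is_derive s 1 g1 (g2 s).
  have -> : g1 = \sum_j (fun s => y j ord0 * F1 j (x0 + s *: y)).
    by apply/funext => t; rewrite /g1 fct_sumE.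
  have h j : is_derive s 1 (fun s : R => y j ord0 * F1 j (x0 + s *: y))
      (y j ord0 * \sum_i y i ord0 * F2 i j (x0 + s *: y)).
    have := dF1 j x0 y s => hj.
    exact: (@is_deriveZ _ _ _ (fun s : R => F1 j (x0 + s *: y)) (y j ord0) s 1 _ hj).
  exact: is_derive_sum.
have [c /andP[c0 c1]] := Taylor2_line dg dg1.
rewrite /g /g1 /g2 scale1r scale0r addr0 => ->.
have -> : 2^-1 * (\sum_i \sum_j y i ord0 * F2 i j x0 * y j ord0) =
    (\sum_j y j ord0 * \sum_i y i ord0 * F2 i j x0) / 2.
  rewrite mulrC; congr (_ / _); rewrite exchange_big/=; apply: eq_bigr => j _.
  by rewrite mulr_sumr; apply: eq_bigr => i _; rewrite mulrC.
rewrite -mulrBl -sumrB normrM [X in _ * X]ger0_norm ?invr_ge0//.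
have cy : n2 (c *: y) < r.
  rewrite n2Z; apply: le_lt_trans yr; rewrite ler_piMl ?n2_ge0//.
  by rewrite exprn_ile1// ltW.
pose A := \sum_j \sum_i `|y j ord0| * `|y i ord0| * (e / (d%:R + 1)).
have hA : `|\sum_j (y j ord0 * (\sum_i y i ord0 * F2 i j (x0 + c *: y)) -
     y j ord0 * (\sum_i y i ord0 * F2 i j x0))| <= A.
  apply: le_trans (ler_norm_sum _ _ _) _; apply: ler_sum => j _.
  rewrite -mulrBr -sumrB normrM -mulr_suml -mulr_sumr -mulrA ler_wpM2l// mulr_suml.
  apply: le_trans (ler_norm_sum _ _ _) _; apply: ler_sum => i _.
  by rewrite -mulrBr normrM ler_wpM2l// ltW// hr.
have hA2 : A <= e * n2 y.
  have -> : A = (\sum_j `|y j ord0|) ^+ 2 * (e / (d%:R + 1)).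
    rewrite /A expr2 !mulr_suml; apply: eq_bigr => j _.
    by rewrite mulr_sumr mulr_suml.
  have : (\sum_j `|y j ord0|) ^+ 2 <= d%:R * n2 y.
    pose o : V := \col__ 1; pose a : V := \col_j `|y j ord0|.
    have -> : \sum_j `|y j ord0| = dot o a.
      by apply: eq_bigr => j _; rewrite !mxE mul1r.
    have -> : d%:R = n2 o.
      by rewrite /n2 (eq_bigr (fun=> 1)) ?sumr_const ?card_ord// => j _; rewrite mxE expr1n.
    have -> : n2 y = n2 a by apply: eq_bigr => j _; rewrite mxE real_normK ?num_real.
    exact: CS.
  move=> h; apply: (@le_trans _ _ (d%:R * n2 y * (e / (d%:R + 1)))).
    by rewrite ler_wpM2r// divr_ge0// ltW.
  have -> : e * n2 y = (d%:R + 1) * n2 y * (e / (d%:R + 1)) by field; rewrite gt_eqF.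
  have y0 := n2_ge0 y.
  by rewrite ler_wpM2r ?divr_ge0 ?(ltW e0) ?(ltW d1)//; lra.
have A0 := le_trans (normr_ge0 _) hA.
by apply: le_trans (_ : A / 2 <= _); [rewrite ler_pM2r|lra].
Qed.

(** The second difference of F over the square with sides h e_i and h e_j is symmetric in i and j;
    two mean value theorems write it as h^2 times a mixed derivative at a point near x0, in either
    order. *)
Lemma Schwarz i j : F2 i j x0 = F2 j i x0.
Proof.
apply/eqP; rewrite -subr_eq0 -normr_eq0 eq_le normr_ge0 andbT.
apply/ler_addgt0Pr => e e0; rewrite add0r.
have [r r0 hr] := near_n2_all (divr_gt0 e0 (ltr0Sn _ 1)).
(* The intermediate points satisfy |y|^2 <= 4 h^2, which is 4/9 of min (r, 1), hence less than r. *)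
pose h := Num.sqrt (Num.min r 1) / 3.
have m0 : 0 < Num.min r 1 by rewrite lt_min r0 ltr01.
have h0 : 0 < h by rewrite divr_gt0// sqrtr_gt0.
have hr' : 4 * h ^+ 2 < r.
  rewrite expr_div_n sqr_sqrtr ?(ltW m0)//.
  by apply: lt_le_trans (_ : Num.min r 1 <= _); [lra|rewrite ge_min lexx].
pose e_ k : V := delta_mx k ord0.
have se (a : 'I_d -> R) k : \sum_i (e_ k) i ord0 * a i = a k.
  rewrite (bigD1 k)//= mxE !eqxx mul1r big1 ?addr0// => l lk.
  by rewrite mxE (negbTE lk) mul0r.
have n2e k : n2 (e_ k) = 1 by rewrite -dotxx /dot se mxE !eqxx.
have dd k l : exists2 y, n2 y <= 4 * h ^+ 2 &
    F (x0 + h *: e_ k + h *: e_ l) - F (x0 + h *: e_ l) -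
    F (x0 + h *: e_ k) + F x0 = h ^+ 2 * F2 l k (x0 + y).
  have dk (y : V) (s : R) : is_derive s 1 (fun s : R => F (y + s *: (h *: e_ k)))
      (h * F1 k (y + s *: (h *: e_ k))).
    have := dF y (h *: e_ k) s; congr is_derive.
    rewrite -[RHS](se (fun i => h * F1 i (y + s *: (h *: e_ k)))); apply: eq_bigr => a _.
    by rewrite mxE; ring.
  have dkl (y : V) (s : R) : is_derive s 1 (fun s : R => F1 k (y + s *: (h *: e_ l)))
      (h * F2 l k (y + s *: (h *: e_ l))).
    have := dF1 k y (h *: e_ l) s; congr is_derive.
    rewrite -[RHS](se (fun i => h * F2 i k (y + s *: (h *: e_ l)))); apply: eq_bigr => a _.
    by rewrite mxE; ring.
  pose g s := F (x0 + h *: e_ l + s *: (h *: e_ k)) - F (x0 + s *: (h *: e_ k)).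
  have dg (s : R) : is_derive s 1 g (h * F1 k (x0 + h *: e_ l + s *: (h *: e_ k)) -
      h * F1 k (x0 + s *: (h *: e_ k))).
    exact: (is_deriveB (dk (x0 + h *: e_ l) s) (dk x0 s)).
  have [c /andP[c0 c1]] := MVT_line dg.
  have [b /andP[b0 b1]] := MVT_line (dkl (x0 + c *: (h *: e_ k))).
  rewrite /g !scale1r !scale0r !addr0 => hb hc.
  exists (c *: (h *: e_ k) + b *: (h *: e_ l)).
    apply: le_trans (n2D_le _ _) _; rewrite !n2Z !n2e !mulr1.
    have : c ^+ 2 <= 1 by rewrite exprn_ile1// ltW.
    have : b ^+ 2 <= 1 by rewrite exprn_ile1// ltW.
    have := sqr_ge0 h; nra.
  rewrite addrA expr2 -mulrA -hb mulrBr [x0 + _ + h *: e_ l]addrAC.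
  rewrite [x0 + c *: _ + h *: _]addrAC -hc; ring.
have [y1 y1h E1] := dd i j; have [y2 y2h E2] := dd j i.
have h2 : h ^+ 2 != 0 by rewrite expf_neq0// gt_eqF.
have EE : F2 j i (x0 + y1) = F2 i j (x0 + y2).
  apply: (mulfI h2); rewrite -E1 -E2 [x0 + h *: e_ i + _]addrAC; ring.
have k1 := hr j i y1 (le_lt_trans y1h hr').
have k2 := hr i j y2 (le_lt_trans y2h hr').
have -> : F2 i j x0 - F2 j i x0 = (F2 j i (x0 + y1) - F2 j i x0) - (F2 i j (x0 + y2) - F2 i j x0).
  by rewrite EE; ring.
apply: le_trans (ler_normB _ _) _; lra.
Qed.

End jets.

(** * Test functions and the value function *)


Section directional.
Context {R : realType} {d : nat}.
Local Notation V := 'cV[R]_d.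
Local Notation E := (R * V)%type.
Implicit Types (f phi : E -> R) (p : E).

Local Notation O := (cylinder (setT : set V)).

Definition basis_vec (i : 'I_d) : V := delta_mx i ord0.

Lemma vec_basisE (y : V) : y = \sum_i y i ord0 *: basis_vec i.
Proof.
apply/colP => i; rewrite summxE (bigD1 i)//= !mxE !eqxx mulr1 big1 ?addr0// => j ji.
by rewrite !mxE eq_sym (negbTE ji) mulr0.
Qed.

Lemma open_cylinder : open O.
Proof.
have -> : O = fst @^-1` [set t : R | 0 < t].
  by apply/seteqP; split => p /=; [case|move=> h; split].
apply: open_comp; last exact: open_gt.
by move=> p _; exact: cvg_fst.
Qed.

Lemma within_open_continuous (W : normedModType R) (A : set W) (g : W -> R) (p : W) :
  open A -> A p -> {within A, continuous g} -> {for p, continuous g}.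
Proof.
move=> oA Ap /subspace_continuousP/(_ p Ap).
by rewrite within_interior//; apply: open_nbhs_nbhs.
Qed.

Lemma derive_dirE f p (t : R) (y : V) : differentiable f p ->
  'D_(t, y) f p = t * 'D_(1, 0) f p + \sum_i y i ord0 * 'D_(0, basis_vec i) f p.
Proof.
move=> df; rewrite !deriveE//.
have -> : (t, y) = t *: ((1, 0) : E) + \sum_i y i ord0 *: ((0, basis_vec i) : E).
  have -> : \sum_i y i ord0 *: ((0, basis_vec i) : E) = (0, y).
    rewrite {2}(vec_basisE y).
    elim/big_rec2 : _ => [//|i a b _ ->].
    by congr (_, _); rewrite /= ?scaler0 ?mulr0 ?addr0.
  congr (_, _) => /=; first by rewrite addr0; exact: (esym (mulr1 t)).
  by rewrite scaler0 add0r.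
rewrite linearD linearZ/= linear_sum/=; congr (_ + _).
by apply: eq_bigr => i _; rewrite linearZ/= deriveE.
Qed.

Lemma is_derive_space f (t : R) (x y : V) (s : R) : 0 < t ->
  (forall p, O p -> differentiable f p) ->
  is_derive s 1 (fun s : R => f (t, x + s *: y))
    (\sum_i y i ord0 * 'D_(0, basis_vec i) f (t, x + s *: y)).
Proof.
move=> t0 df.
have fE : (fun s : R => f (t, x + s *: y)) = (fun s : R => f ((t, x) + s *: (0, y))).
  by apply/funext => a; congr (f (_, _)); rewrite /= ?scaler0 ?mulr0 ?addr0.
rewrite fE.
have Op : O ((t, x) + s *: (0, y)) by split => //=; rewrite ?scaler0 ?mulr0 addr0.
have -> : (t, x + s *: y) = (t, x) + s *: ((0, y) : E).
  by congr (_, _); rewrite /= ?scaler0 ?mulr0 ?addr0.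
have := derive_dirE 0 y (df _ Op); rewrite mul0r add0r => <-.
by apply: is_derive_line; apply: diff_derivable; exact: df.
Qed.

Lemma is_derive_time f (t0 a : R) (x : V) (s : R) : 0 < t0 + s * a ->
  (forall p, O p -> differentiable f p) ->
  is_derive s 1 (fun s : R => f (t0 + s * a, x)) (a * 'D_(1, 0) f (t0 + s * a, x)).
Proof.
move=> t0a df.
have fE : (fun s : R => f (t0 + s * a, x)) = (fun s : R => f ((t0, x) + s *: (a, 0))).
  by apply/funext => b; congr (f (_, _)); rewrite /= scaler0 addr0.
rewrite fE.
have -> : (t0 + s * a, x) = (t0, x) + s *: ((a, 0) : E).
  by congr (_, _); rewrite /= scaler0 addr0.
have Op : O ((t0, x) + s *: (a, 0)) by split.
have := derive_dirE a 0 (df _ Op); rewrite big1 ?addr0 => [<-|i _]; last first.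
  by rewrite mxE mul0r.
by apply: is_derive_line; apply: diff_derivable; exact: df.
Qed.

Lemma derive_spaceE f (t : R) (x : V) (v : V) :
  'D_v (fun x => f (t, x)) x = 'D_(0, v) f (t, x).
Proof.
rewrite /derive.
have -> // : (fun h : R => h^-1 *: ((f \o shift (t, x)) (h *: (0, v)) - f (t, x))) =
    (fun h : R => h^-1 *: (((fun x => f (t, x)) \o shift x) (h *: v) - f (t, x))).
apply/funext => h /=.
by congr (_ *: (f (_, _) - _)); rewrite /= ?scaler0 ?mulr0 add0r.
Qed.

Lemma dtE f p : dt f p = 'D_(1, 0) f p.
Proof.
case: p => t x; rewrite /dt derive1E /derive.
have -> // : (fun h : R => h^-1 *: ((f \o shift (t, x)) (h *: (1, 0)) - f (t, x))) =
    (fun h : R => h^-1 *: (((fun t => f (t, x)) \o shift t) (h *: (1 : R)) - f (t, x))).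
apply/funext => h /=.
by congr (_ *: (f (_, _) - _)); rewrite /= ?scaler0 ?add0r.
Qed.

Lemma D2xE f p i j : D2x f p i j = 'D_(0, basis_vec i) ('D_(0, basis_vec j) f) p.
Proof.
case: p => t x; rewrite /D2x /hessian mxE -derive_spaceE /=.
have -> // : (fun y => 'D_(delta_mx j ord0) (fun x => f (t, x)) y) =
  (fun y => 'D_(0, basis_vec j) f (t, y)).
by apply/funext => y; rewrite derive_spaceE.
Qed.

Definition space_gradient f p : V := \col_i 'D_(0, basis_vec i) f p.

Lemma MVT_line01 (g dg : R -> R) :
  (forall s : R, 0 <= s <= 1 -> is_derive s 1 g (dg s)) ->
  exists2 c, 0 < c < 1 & g 1 - g 0 = dg c.
Proof.
move=> dgE.
have cg : {within `[0, 1], continuous g}.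
  apply: derivable_within_continuous => s; rewrite in_itv/= => /dgE h.
  exact: (@ex_derive _ _ _ _ _ _ _ h).
have dgE' (s : R) : s \in `]0, 1[ -> is_derive s 1 g (dg s).
  by rewrite in_itv/= => /andP[s0 s1]; apply: dgE; rewrite !ltW.
have [c cI ->] := @MVT R g dg 0 1 ltr01 dgE' cg.
by exists c; [rewrite in_itv in cI|rewrite subr0 mulr1].
Qed.

Section C2.
Context (phi : E -> R) (p : E).
Hypothesis C2phi : C2_on O phi.
Hypothesis Op : O p.

Let dphi q : O q -> differentiable phi q. Proof. exact: C2phi.1.1. Qed.

Let dphi1 v q : O q -> differentiable ('D_v phi) q.
Proof. exact: (C2phi.2 v).1. Qed.

Let c1 v q : O q -> {for q, continuous ('D_v phi)}.
Proof.
by move=> Oq; apply: within_open_continuous; [exact: open_cylinder|exact: Oq|exact: C2phi.1.2].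
Qed.

Let c2 v w q : O q -> {for q, continuous ('D_w ('D_v phi))}.
Proof.
by move=> Oq; apply: within_open_continuous;
  [exact: open_cylinder|exact: Oq|exact: (C2phi.2 v).2].
Qed.

Lemma space_slice_continuous (f : E -> R) (t : R) (x : V) :
  {for (t, x), continuous f} -> {for x, continuous (fun x => f (t, x))}.
Proof.
move=> cf; apply: (@continuous_comp _ _ _ (fun x => (t, x)) f) => //.
exact: (continuous_pair (fun=> cvg_cst _) (fun=> cvg_id)).
Qed.

Lemma D2x_sym : (D2x phi p)^T = D2x phi p.
Proof.
case: p Op => t x Otx; have t0 : 0 < t := Otx.1; apply/matrixP => i j; rewrite mxE !D2xE.
apply: (@Schwarz _ _ (fun x => phi (t, x)) (fun i x => 'D_(0, basis_vec i) phi (t, x))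
  (fun i j x => 'D_(0, basis_vec i) ('D_(0, basis_vec j) phi) (t, x)) x).
- by move=> y z s; exact: is_derive_space.
- move=> k y z s; apply: is_derive_space => //; exact: dphi1.
- move=> k l; exact: (@space_slice_continuous ('D_(0, basis_vec k) ('D_(0, basis_vec l) phi))
    t x (c2 Otx)).
Qed.

(** The increment is split at (t, x + y): second order Taylor in space at time t, then the mean
    value theorem in time at position x + y, where the time derivative is continuous. *)
Lemma parabolic_Taylor (e : R) : 0 < e -> exists2 r, 0 < r & forall (tau : R) (y : V),
  `|tau| < r -> n2 y < r ->
  `|phi (p.1 + tau, p.2 + y) - phi p - tau * dt phi p - dot (space_gradient phi p) y -
     quad (D2x phi p) y y / 2| <= e * (`|tau| + n2 y).
Proof.
case: p Op => t x Otx e0; have t0 := Otx.1 => /=.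
have [r1 r10 T1] := @Taylor2 _ _ (fun x => phi (t, x))
  (fun i x => 'D_(0, basis_vec i) phi (t, x))
  (fun i j x => 'D_(0, basis_vec i) ('D_(0, basis_vec j) phi) (t, x)) x
  (fun y z s => is_derive_space y z s t0 dphi)
  (fun k y z s => is_derive_space y z s t0 (@dphi1 _))
  (fun k l => space_slice_continuous (c2 Otx)) e e0.
have [r2 r20 T2] : exists2 r : R, 0 < r & forall (tau : R) (y : V), `|tau| < r -> n2 y < r ->
    `|'D_(1, 0) phi (t + tau, x + y) - 'D_(1, 0) phi (t, x)| <= e.
  have /cvgrPdist_le/(_ _ e0) : 'D_(1, 0) phi q @[q --> (t, x)] --> 'D_(1, 0) phi (t, x).
    exact: c1.
  move=> /nbhs_ballP[r /= r0 h]; exists (Num.min r (r ^+ 2)).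
    by rewrite lt_min r0 exprn_gt0.
  move=> tau y; rewrite !lt_min => /andP[tr _] /andP[_ yr]; rewrite distrC; apply: h.
  split; rewrite -ball_normE /= opprD addrA subrr sub0r normrN//.
  rewrite -(@ltr_pXn2r _ 2)// ?nnegrE// ?(ltW r0)//.
  exact: le_lt_trans (normr_le_n2 y) yr.
(* The bound by t keeps t + tau positive, inside the cylinder. *)
pose r := Num.min t (Num.min r1 r2).
exists r; first by rewrite !lt_min t0 r10 r20.
move=> tau y; rewrite !lt_min => /and3P[taut _ taur2] /and3P[_ yr1 yr2].
have [c /andP[c0 c1']] : exists2 c : R, 0 < c < 1 &
    phi (t + 1 * tau, x + y) - phi (t + 0 * tau, x + y) =
    tau * 'D_(1, 0) phi (t + c * tau, x + y).
  apply: (@MVT_line01 (fun s => phi (t + s * tau, x + y))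
    (fun s => tau * 'D_(1, 0) phi (t + s * tau, x + y))) => s /andP[s0 s1].
  apply: is_derive_time => //.
  have : `|s * tau| <= `|tau| by rewrite normrM ger0_norm// ler_piMl.
  have := ler_norm (- (s * tau)); rewrite normrN; lra.
rewrite mul1r mul0r addr0 => hc.
have {T1} := T1 y yr1.
have -> : \sum_i y i ord0 * 'D_(0, basis_vec i) phi (t, x) =
    dot (space_gradient phi (t, x)) y.
  by rewrite dotC; apply: eq_bigr => i _; rewrite mxE.
have -> : 2^-1 * (\sum_i \sum_j y i ord0 *
    'D_(0, basis_vec i) ('D_(0, basis_vec j) phi) (t, x) * y j ord0) =
    quad (D2x phi (t, x)) y y / 2.
  rewrite mulrC quadE; congr (_ / _); apply: eq_bigr => i _; apply: eq_bigr => j _.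
  by rewrite D2xE.
move=> h1.
have h2 : `|'D_(1, 0) phi (t + c * tau, x + y) - dt phi (t, x)| <= e.
  rewrite dtE; apply: T2 => //; apply: le_lt_trans taur2.
  by rewrite normrM ger0_norm ?(ltW c0)// ler_piMl// ltW.
set A := phi (t, x + y) - _ - _ - _ in h1.
have -> : phi (t + tau, x + y) - phi (t, x) - tau * dt phi (t, x) -
    dot (space_gradient phi (t, x)) y - quad (D2x phi (t, x)) y y / 2 =
    tau * ('D_(1, 0) phi (t + c * tau, x + y) - dt phi (t, x)) + A.
  rewrite mulrBr -hc /A; ring.
apply: le_trans (ler_normD _ _) _; rewrite [leRHS]mulrDr normrM.
by apply: lerD => //; rewrite mulrC ler_wpM2r.
Qed.

End C2.
End directional.

(** * From averaged inequalities to inequalities on test functions *)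

Section touching.
Context {R : realType} {d : nat}.
Local Notation V := 'cV[R]_d.
Local Notation E := (R * V)%type.
Local Notation O := (cylinder (setT : set V)).

Definition m4 : R := gaussE (fun z : R => z ^+ 4).

Lemma m4_ge0 : 0 <= m4.
Proof. by apply: gaussE_ge0 => z; rewrite exprn_even_ge0. Qed.

Lemma gaussE_quartic_poly (a0 a1 a2 a3 a4 : R) :
  quartic (fun z => a0 + a1 * z + a2 * z ^+ 2 + a3 * z ^+ 3 + a4 * z ^+ 4) /\
  gaussE (fun z => a0 + a1 * z + a2 * z ^+ 2 + a3 * z ^+ 3 + a4 * z ^+ 4) = a0 + a2 + a4 * m4.
Proof.
have q1 : quartic (fun z : R => z).
  by have := @quartic_pow R 1 isT; congr quartic; apply/funext => z; rewrite expr1.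
have q2 : quartic (fun z : R => z ^+ 2) by exact: quartic_pow.
have q3 : quartic (fun z : R => z ^+ 3) by exact: quartic_pow.
have q4 : quartic (fun z : R => z ^+ 4) by exact: quartic_pow.
have Q1 : quartic (fun z => a0 + a1 * z) by apply: quarticD; [exact: quartic_cst|exact: quarticZ].
have Q2 : quartic (fun z => a0 + a1 * z + a2 * z ^+ 2) by apply: quarticD => //; exact: quarticZ.
have Q3 : quartic (fun z => a0 + a1 * z + a2 * z ^+ 2 + a3 * z ^+ 3).
  by apply: quarticD => //; exact: quarticZ.
split; first by apply: quarticD => //; exact: quarticZ.
rewrite gaussED//; last exact: quarticZ.
rewrite gaussED//; last exact: quarticZ.
rewrite gaussED//; last exact: quarticZ.
rewrite gaussED//; [|exact: quartic_cst|exact: quarticZ].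
by rewrite gaussE_cst !gaussEZ// gaussE_id gaussE_sqr gaussE_cube !mulr0 mulr1 !addr0.
Qed.

(** Past S = r a constant and a linear term are absorbed by a quadratic one. With S = |y|^2 this
    yields the coefficient of the quartic term of the barriers. *)
Lemma square_dominates (r A B S : R) : 0 < r -> 0 <= A -> 0 <= B -> r <= S ->
  A + B * S <= (A / r ^+ 2 + B / r) * S ^+ 2.
Proof.
move=> r0 A0 B0 rS; have S0 : 0 <= S by apply: le_trans rS; exact: ltW.
have h1 : 1 <= S ^+ 2 / r ^+ 2.
  by rewrite ler_pdivlMr ?exprn_gt0// mul1r ler_sqr ?nnegrE// ltW.
have h2 : S <= S ^+ 2 / r by rewrite ler_pdivlMr// expr2 ler_wpM2l.
rewrite mulrDl -!mulrA ![_^-1 * _]mulrC; apply: lerD.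
  by rewrite ler_peMr.
by rewrite ler_wpM2l.
Qed.

(** On the line through the contact point, w at the earlier time t0 - h lies below a polynomial P of
    degree four: by contact and Taylor expansion where |s e|^2 < r, by the growth of w elsewhere.
    The average of P is explicit; dividing by h and making h small leaves the inequality up to
    eps. *)
Lemma touching_above (w phi : E -> R) (p : E) (e : V) (c h0 K : R) :
  O p -> C2_on O phi -> (forall q, O q -> w q - phi q <= w p - phi p) ->
  0 < h0 -> 0 <= K ->
  (forall h x, 0 < h < h0 -> `|w (p.1 - h, x)| <= K * (1 + n2 x)) ->
  (forall h, 0 < h < h0 -> continuous (fun x => w (p.1 - h, x))) ->
  (forall h, 0 < h < h0 ->
    w p <= heat (Num.sqrt (2 * h) *: e) (fun x => w (p.1 - h, x)) p.2 - c * h) ->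
  dt phi p <= quad (D2x phi p) e e - c.
Proof.
case: p => t0 x0 Op C2 wphi h00 K0 wK wc wheat /=; have t00 : 0 < t0 := Op.1.
rewrite /= in wK wc wheat.
set a := dt phi _; set H := D2x phi _; set g := space_gradient phi (t0, x0).
apply/ler_addgt0Pr => eps eps0.
have ne0 := n2_ge0 e.
have den0 : 0 < 2 * (1 + 2 * n2 e) by rewrite mulr_gt0// ltr_wpDr// mulr_ge0.
pose eta := eps / (2 * (1 + 2 * n2 e)).
have eta0 : 0 < eta by rewrite divr_gt0.
have [r r0 hT] := parabolic_Taylor C2 Op eta0.
have [C C0 HC] := quad_bound H.
(* A1 and B1 collect, as constant and linear terms in S = |s e|^2, the growth of w and the most
   negative value of the Taylor polynomial, for h <= 1; K' converts them into a quartic term for S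
   >= r. *)
pose A1 := K * (1 + 2 * n2 x0) + `|a| + n2 g + `|w (t0, x0)|.
pose B1 := 2 * K + 1 + C / 2.
have A10 : 0 <= A1.
  rewrite /A1 !addr_ge0 ?mulr_ge0 ?n2_ge0// addr_ge0// mulr_ge0// n2_ge0//.
have B10 : 0 <= B1 by rewrite /B1 !addr_ge0// ?mulr_ge0.
pose K' := A1 / r ^+ 2 + B1 / r.
have K'0 : 0 <= K' by rewrite addr_ge0// divr_ge0// ?exprn_ge0// ltW.
pose D := 4 * K' * n2 e ^+ 2 * m4.
have D0 : 0 <= D by rewrite /D !mulr_ge0// ?exprn_ge0// m4_ge0.
pose h := Num.min (Num.min (h0 / 2) (t0 / 2)) (Num.min (Num.min (r / 2) 1) (eps / (2 * (D + 1)))).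
have D1 : 0 < 2 * (D + 1) by rewrite mulr_gt0// ltr_wpDl.
have h_0 : 0 < h by rewrite !lt_min ltr01 !divr_gt0.
have hh0 : h <= h0 / 2 by rewrite /h !ge_min lexx.
have ht0 : h <= t0 / 2 by rewrite /h !ge_min lexx !orbT.
have hr : h <= r / 2 by rewrite /h !ge_min lexx !orbT.
have h1 : h <= 1 by rewrite /h !ge_min lexx !orbT.
have hD : h * (2 * (D + 1)) <= eps.
  by rewrite -ler_pdivlMr// /h !ge_min lexx !orbT.
have hint : 0 < h < h0 by rewrite h_0/=; lra.
pose sq := Num.sqrt (2 * h).
have sq2 : sq ^+ 2 = 2 * h by rewrite sqr_sqrtr// mulr_ge0// ltW.
pose P (s : R) := w (t0, x0) - h * a + s * dot g e + s ^+ 2 * quad H e e / 2 +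
  eta * (h + s ^+ 2 * n2 e) + K' * (s ^+ 2 * n2 e) ^+ 2.
have key (s : R) : w (t0 - h, x0 + s *: e) <= P s.
  have nse : n2 (s *: e) = s ^+ 2 * n2 e by rewrite n2Z.
  have S0 : 0 <= s ^+ 2 * n2 e by rewrite -nse n2_ge0.
  have [Sr|Sr] := ltP (s ^+ 2 * n2 e) r.
    have Oq : O (t0 + - h, x0 + s *: e) by split => //=; lra.
    have := wphi _ Oq => h2.
    have := hT (- h) (s *: e); rewrite normrN ger0_norm ?(ltW h_0)// nse.
    move=> /(_ ltac:(lra) Sr) /= /ler_normlW.
    rewrite dotZr quadZl quadZr -/a -/H -/g => h3.
    rewrite /P; have : 0 <= K' * (s ^+ 2 * n2 e) ^+ 2 by rewrite mulr_ge0// exprn_ge0.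
    rewrite expr2 in h3 *; lra.
  have := wK h (x0 + s *: e) hint => /ler_normlW h2.
  have h3 := n2D_le x0 (s *: e); rewrite nse in h3.
  have h4 : K * (1 + n2 (x0 + s *: e)) <= K * (1 + 2 * n2 x0 + 2 * (s ^+ 2 * n2 e)).
    by rewrite ler_wpM2l// -addrA lerD2l.
  have h5 := square_dominates r0 A10 B10 Sr; rewrite -/K' in h5.
  have h6 : - (n2 g + s ^+ 2 * n2 e) <= s * dot g e.
    have := @dot_le _ _ 1 g (- s *: e) ltr01; rewrite invr1 !mul1r n2Z sqrrN dotZr.
    have := n2_ge0 g; lra.
  have h7 : - (C * (s ^+ 2 * n2 e)) <= s ^+ 2 * quad H e e.
    have := HC (s *: e); rewrite nse quadZl quadZr mulrA -expr2 ler_norml.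
    by case/andP.
  have h8 : - `|a| <= - (h * a).
    rewrite lerN2; apply: le_trans (ler_norm _) _; rewrite normrM ger0_norm ?(ltW h_0)//.
    by rewrite ler_piMl.
  have h9 := ler_norm (- w (t0, x0)); rewrite normrN in h9.
  have h10 : 0 <= eta * (h + s ^+ 2 * n2 e) by rewrite mulr_ge0 ?(ltW eta0)// addr_ge0// ltW.
  rewrite /P; rewrite /A1 /B1 in h5; lra.
have [qP EP] := gaussE_quartic_poly (w (t0, x0) - h * a + eta * h) (sq * dot g e)
  (h * quad H e e + eta * (2 * h * n2 e)) 0 (K' * (2 * h * n2 e) ^+ 2).
have := wheat h hint; rewrite -/sq => h2.
have h3 : heat (sq *: e) (fun x => w (t0 - h, x)) x0 <=
    w (t0, x0) - h * a + eta * h + (h * quad H e e + eta * (2 * h * n2 e)) +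
      K' * (2 * h * n2 e) ^+ 2 * m4.
  rewrite -EP; apply: le_gaussE => //.
    apply: (@quartic_line _ _ (fun x => w (t0 - h, x))); first exact: wc.
    exists (2 * K); first by rewrite mulr_ge0.
    move=> y; apply: le_trans (wK h y hint) _; rewrite [2 * K]mulrC -mulrA ler_wpM2l//.
    by have := sqr_ge0 (n2 y - 1); nra.
  move=> z; rewrite scalerA; apply: le_trans (key (z * sq)) _.
  have zs : (z * sq) ^+ 2 = 2 * h * z ^+ 2 by rewrite exprMn sq2 mulrC.
  rewrite le_eqVlt; apply/orP; left; apply/eqP; rewrite /P zs.
  have simp (w0 h' a' s' g' z' q' e' n' k' : R) :
    w0 - h' * a' + z' * s' * g' + 2 * h' * z' ^+ 2 * q' / 2 +
      e' * (h' + 2 * h' * z' ^+ 2 * n') + k' * (2 * h' * z' ^+ 2 * n') ^+ 2 =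
    w0 - h' * a' + e' * h' + s' * g' * z' + (h' * q' + e' * (2 * h' * n')) * z' ^+ 2 +
      0 * z' ^+ 3 + k' * (2 * h' * n') ^+ 2 * z' ^+ 4 by field.
  exact: simp.
have : h * a <= h * (quad H e e - c + eps).
  have e1 : eta * (2 * (1 + 2 * n2 e)) = eps by rewrite /eta mulfVK// gt_eqF.
  have e2 : K' * (2 * h * n2 e) ^+ 2 * m4 = h * (h * D).
    have simp (k x1 y1 z1 : R) :
      k * (2 * x1 * y1) ^+ 2 * z1 = x1 * (x1 * (4 * k * y1 ^+ 2 * z1)) by ring.
    exact: simp.
  have e3 : h * (h * D) <= h * (eps / 2) by rewrite ler_wpM2l ?(ltW h_0)//; nra.
  have e4 : eta * h + eta * (2 * h * n2 e) = h * (eps / 2) by rewrite -e1; field.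
  lra.
by rewrite ler_pM2l.
Qed.

End touching.


(** * Continuity and growth of the value function *)

Section value_continuity.
Context {R : realType} {d : nat}.
Local Notation V := 'cV[R]_d.
Local Notation E := (R * V)%type.
Local Notation O := (cylinder (setT : set V)).
Context (m L : R) (u0 : V -> R).
Hypothesis d0 : (0 < d)%N.
Hypothesis L0 : 0 <= L.
Hypothesis au0 : admissible_fun m u0.
Hypothesis scu0 : forall y z, 2 * u0 y - 2 * L * n2 z <= u0 (y + z) + u0 (y - z).

Local Notation U := (bellman_grid u0).
Local Notation u := (value u0).

(** Freezing negative times at time 0 makes the function continuous on the whole of R x R^d, so no
    relative topology is needed at t = 0. *)
Definition value_fun (p : E) : R := u (Num.max p.1 0) p.2.

Lemma value_funE (t : R) (x : V) : 0 <= t -> value_fun (t, x) = u t x.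
Proof. by move=> t0; rewrite /value_fun/= max_l. Qed.

Lemma stmodulus_slice_continuous (w : R -> V -> R) : stmodulus w ->
  continuous (fun p : E => w (Num.max p.1 0) p.2).
Proof.
move=> mw [t x]; apply/cvgrPdist_le => /= e e0.
pose T := Num.max t 0.
have T0 : 0 <= T by rewrite le_max lexx orbT.
pose X := 2 * n2 x + 2.
have X0 : 0 <= X by rewrite /X addr_ge0// mulr_ge0// n2_ge0.
have D0 : 0 < 2 * (2 + T + X) by lra.
have DX : 2 + T + X != 0 by rewrite gt_eqF//; lra.
have [C C0 hC] := mw (e / (2 * (2 + T + X))) (divr_gt0 e0 D0).
have C1 : 0 < C + 1 by rewrite ltr_wpDl.
have e1 : 0 < e / (4 * (C + 1)) by rewrite divr_gt0// mulr_gt0.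
have n2c : continuous (fun y : V => n2 (y - x)).
  move=> z; apply: (@continuous_comp _ _ _ (fun y : V => y - x) (@n2 R d)); last exact: n2_continuous.
  exact: continuous_subr.
have /(@cvgrPdist_lt _ _ _ (nbhs x) (nbhs_filter x)) hn : n2 (y - x) @[y --> x] --> n2 (x - x) by exact: (n2c x).
pose b := Num.min (e / (4 * (C + 1))) 1.
have b0 : 0 < b by rewrite lt_min e1 ltr01.
have {hn} hn := hn b b0.
exists (ball t b, [set y | `|n2 (x - x) - n2 (y - x)| < b]) => /=.
  by split => //; exact: nbhsx_ballx.
move=> [s y] /= [ts]; rewrite subrr n2_0 sub0r normrN ger0_norm ?n2_ge0// => yb.
have be : b <= e / (4 * (C + 1)) by rewrite /b ge_min lexx.
have b1 : b <= 1 by rewrite /b ge_min lexx orbT.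
pose S := Num.max s 0.
have S0 : 0 <= S by rewrite le_max lexx orbT.
have TS : `|T - S| < b.
  apply: le_lt_trans ts; rewrite /T /S /Num.max.
  by do 2 case: ltP => ?; rewrite ?subrr ?normr0//; rewrite ler_norml; apply/andP;
     split; have := ler_norm (t - s); have := ler_norm (s - t); rewrite (distrC s); lra.
have Cb : C * (b + b) <= e / 2.
  have : (C + 1) * b <= (C + 1) * (e / (4 * (C + 1))) by rewrite ler_pM2l.
  have -> : (C + 1) * (e / (4 * (C + 1))) = e / 4 by field; rewrite gt_eqF.
  nra.
have key (T1 T2 : R) (a c : V) : 0 <= T1 -> T1 <= T2 -> T2 - T1 < b -> n2 (c - a) < b ->
   1 + T1 + n2 a <= 2 + T + X -> `|w T2 c - w T1 a| <= e.
  move=> T10 T12 Tb cb wb.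
  have := hC T1 (T2 - T1) a (c - a) T10 ltac:(by rewrite subr_ge0).
  rewrite [T1 + _]addrC subrK [a + _]addrC subrK => h; apply: le_trans h _.
  have h1 : e / (2 * (2 + T + X)) * (1 + T1 + n2 a) <= e / (2 * (2 + T + X)) * (2 + T + X).
    by rewrite ler_wpM2l// divr_ge0// ltW.
  have h2 : e / (2 * (2 + T + X)) * (2 + T + X) = e / 2.
    by field.
  have h3 : C * (T2 - T1 + n2 (c - a)) <= C * (b + b) by rewrite ler_wpM2l// lerD// ltW.
  lra.
have nyx : n2 (x - y) = n2 (y - x) by rewrite -n2N opprB.
have ny : n2 y <= 2 * n2 x + 2.
  have := n2D_le x (y - x); rewrite [x + _]addrC subrK; lra.
have nx := n2_ge0 x.
have := ler_norm (T - S); have := ler_norm (S - T); rewrite (distrC S) => h1 h2.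
rewrite -/T -/S; have [ST|/ltW ST] := leP S T.
  apply: key => //; [lra|by rewrite nyx|rewrite /X; lra].
by rewrite distrC; apply: key => //; [lra|rewrite /X; lra].
Qed.

Lemma value_fun_continuous : continuous value_fun.
Proof. exact/stmodulus_slice_continuous/(value_stmodulus L0 au0 scu0). Qed.

Lemma value_growth : exists2 K, 0 <= K & forall t x, `|u t x| <= K * (1 + n2 x).
Proof.
have [C C0 hC] := modulus_growth au0.1.
exists (C + `|m|); first exact: addr_ge0.
move=> t x; have h1 := value_ge au0 t x; have h2 := value_le_u0 au0 t x.
have := hC x; rewrite ler_norml => /andP[_ h3].
have x0 := n2_ge0 x.
have h4 : 0 <= `|m| * n2 x by rewrite mulr_ge0.
have h5 : 0 <= C * (1 + n2 x) by rewrite mulr_ge0// addr_ge0.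
have := ler_norm (- m); rewrite normrN => h6.
have -> : (C + `|m|) * (1 + n2 x) = C * (1 + n2 x) + `|m| + `|m| * n2 x by ring.
have m0 := normr_ge0 m.
by rewrite ler_norml; apply/andP; split; lra.
Qed.

End value_continuity.


Section value_viscosity.
Context {R : realType} {d : nat}.
Local Notation V := 'cV[R]_d.
Local Notation E := (R * V)%type.
Local Notation O := (cylinder (setT : set V)).
Context (m L : R) (u0 : V -> R).
Hypothesis d0 : (0 < d)%N.
Hypothesis L0 : 0 <= L.
Hypothesis au0 : admissible_fun m u0.
Hypothesis scu0 : forall y z, 2 * u0 y - 2 * L * n2 z <= u0 (y + z) + u0 (y - z).

Local Notation U := (bellman_grid u0).
Local Notation u := (value u0).
Local Notation value_fun := (value_fun u0).

(* A discrete comparison: the quartic barrier psi, a strict subsolution where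
   n2 y < rho, stays below the Bellman iterates. *)
Lemma touching_below_value (phi : E -> R) (p : E) :
  O p -> C2_on O phi -> (forall q, O q -> value_fun p - phi p <= value_fun q - phi q) ->
  Num.min 0 (lambda1 (D2x phi p)) <= dt phi p.
Proof.
case: p => t0 x0 Op C2 uphi; have t00 : 0 < t0 := Op.1.
have symH := D2x_sym C2 Op.
rewrite leNgt; apply/negP.
set a := dt phi _; set H := D2x phi _; set g := space_gradient phi (t0, x0).
rewrite -/H in symH; set l := Num.min 0 (lambda1 H) => al.
have l0 : l <= 0 by rewrite /l ge_min lexx.
have lH y : l * n2 y <= quad H y y.
  apply: le_trans (lambda1_le_quad y d0 symH).
  by rewrite ler_wpM2r ?n2_ge0// /l ge_min lexx orbT.
(* The gap is spent exactly: in [step], psi has slope a + 2 eta, its quadratic penalty costs 4 eta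
   per unit of time, the cross terms of the quartic cost eta and the fourth moment costs eta. *)
pose eta := (l - a) / 8.
have eta0 : 0 < eta by rewrite divr_gt0 ?subr_gt0.
have etaE : 8 * eta = l - a by rewrite /eta mulrC divfK.
have [r0' r0'0 hT0] := parabolic_Taylor C2 Op eta0.
pose r := Num.min r0' t0.
have r0 : 0 < r by rewrite lt_min r0'0.
have rt0 : r <= t0 by rewrite /r ge_min lexx orbT.
have hT (tau : R) (y : V) : `|tau| < r -> n2 y < r ->
  `|phi (t0 + tau, x0 + y) - phi (t0, x0) - tau * a - dot g y - quad H y y / 2| <=
    eta * (`|tau| + n2 y).
  by rewrite /r !lt_min => /andP[h1 _] /andP[h2 _]; exact: hT0.
have [C C0 HC] := quad_bound H.
pose up := u t0 x0.
have upE : value_fun (t0, x0) = up by rewrite value_funE// ltW.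
have mup : m <= up := value_ge au0 t0 x0.
pose A1 := (up - m) + `|a + 2 * eta| * r + n2 g + eta * r.
pose B1 := 1 + C / 2.
have A10 : 0 <= A1.
  have := n2_ge0 g; have : 0 <= `|a + 2 * eta| * r by rewrite mulr_ge0// ltW.
  have : 0 <= eta * r by rewrite mulr_ge0// ltW.
  by rewrite /A1; lra.
have B10 : 0 <= B1 by rewrite /B1 addr_ge0// mulr_ge0.
pose K := A1 / r ^+ 2 + B1 / r.
have K0 : 0 <= K by rewrite addr_ge0// divr_ge0// ?exprn_ge0// ltW.
(* The Taylor polynomial of phi raised to the value [up], tilted by eta so as to lie strictly below
   u at earlier times and off the contact point, minus a quartic that pushes it below m far away. *)
pose psi (tau : R) (y : V) := up + (a + 2 * eta) * tau + dot g y + quad H y y / 2 -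
  2 * eta * n2 y - K * n2 y ^+ 2.
have a2 : a + 2 * eta < 0 by lra.
have gap1 (tau : R) (y : V) : - r < tau <= 0 -> n2 y < r ->
    psi tau y + eta * (- tau + n2 y) <= u (t0 + tau) (x0 + y).
  move=> /andP[tr tau0] yr.
  have tn : `|tau| = - tau by rewrite ler0_norm.
  have Oq : O (t0 + tau, x0 + y) by split => //=; lra.
  have := uphi _ Oq; rewrite upE value_funE/=; last by have := Oq.1; exact: ltW.
  have := hT tau y; rewrite tn => /(_ ltac:(lra) yr) /ler_normlW.
  have := hT tau y; rewrite tn => /(_ ltac:(lra) yr); rewrite ler_norml => /andP[+ _].
  have : 0 <= K * n2 y ^+ 2 by rewrite mulr_ge0// exprn_ge0// n2_ge0.
  rewrite /psi; lra.
have gap2 (tau : R) (y : V) : - r < tau <= 0 -> r <= n2 y ->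
    psi tau y + eta * r <= u (t0 + tau) (x0 + y).
  move=> /andP[tr tau0] yr; apply: le_trans (value_ge au0 _ _).
  have h5 := square_dominates r0 A10 B10 yr; rewrite -/K in h5.
  have h6 := @dot_le _ _ 1 g y ltr01; rewrite invr1 !mul1r in h6.
  have h7 := HC y; rewrite ler_norml in h7; case/andP : h7 => _ h7.
  have h8 : (a + 2 * eta) * tau <= `|a + 2 * eta| * r.
    apply: le_trans (ler_norm _) _; rewrite normrM ler_wpM2l// ler0_norm//; lra.
  have := n2_ge0 g; have := n2_ge0 y.
  have : 0 <= eta * n2 y by rewrite mulr_ge0 ?n2_ge0// ltW.
  rewrite /psi; rewrite /A1 /B1 in h5; lra.
have K1 : 0 < 12 * (K + 1) by rewrite mulr_gt0// ltr_wpDl.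
pose rho := Num.min r (eta / (12 * (K + 1))).
have rho0 : 0 < rho by rewrite lt_min r0 divr_gt0.
have rhor : rho <= r by rewrite /rho ge_min lexx.
have rhoK : 12 * K * rho <= eta.
  have : rho * (12 * (K + 1)) <= eta by rewrite -ler_pdivlMr// /rho ge_min lexx orbT.
  nra.
(* A margin between psi and u that holds at the starting time, where - tau >= r / 2, and at all
   times where |y|^2 >= rho. *)
pose gap := eta * rho / 2.
have gap0 : 0 < gap by rewrite divr_gt0// mulr_gt0.
have gapr : eta * rho <= eta * r by rewrite ler_pM2l.
have gapr2 : gap <= eta * r.
  have : 0 < eta * rho by exact: mulr_gt0.
  by rewrite /gap; lra.
have M1 : 0 < 4 * (K * m4 + 1) :> R by rewrite mulr_gt0// ltr_wpDl// mulr_ge0// m4_ge0.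
have [N1 hN1] := exists_dyadic_lt (divr_gt0 r0 (ltr0Sn R 1)).
have [N2 hN2] := exists_dyadic_lt (divr_gt0 eta0 M1).
have [N3 hN3] := value_approx au0 t0 x0 gap0.
pose n := maxn N1 (maxn N2 N3).
have {hN1} dr : 2 ^- n < r / 2 by apply: hN1; rewrite leq_max leqnn.
have {hN2} dM : 2 ^- n < eta / (4 * (K * m4 + 1)) by apply: hN2; rewrite !leq_max leqnn orbT.
have {hN3} uun : bellman_dyadic u0 n t0 x0 < up + gap.
  by apply: hN3; rewrite !leq_max leqnn !orbT.
set dl : R := 2 ^- n in dr dM.
have dl0 : 0 < dl by rewrite invr_gt0 exprn_gt0.
have dlM : 4 * K * m4 * dl <= eta.
  move: dM; rewrite ltr_pdivlMr// => dM.
  have := m4_ge0 (R := R); nra.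
have uU j x : u (j%:R * dl) x <= U n j x.
  by rewrite -dyadic_nat; exact: (value_le_dyadic au0).
have step (tau : R) (y v : V) : n2 v <= 2 * dl -> n2 y < rho ->
    quartic (fun z : R => psi (tau - dl) (y + z *: v) + gap) /\
    psi tau y + gap <= gaussE (fun z : R => psi (tau - dl) (y + z *: v) + gap).
  move=> hv yrho.
  have [qP EP] := gaussE_quartic_poly
    (up + (a + 2 * eta) * (tau - dl) + dot g y + quad H y y / 2 - 2 * eta * n2 y -
      K * n2 y ^+ 2 + gap)
    (dot g v + quad H y v - 4 * eta * dot y v - 4 * K * n2 y * dot y v)
    (quad H v v / 2 - 2 * eta * n2 v - K * (2 * n2 y * n2 v + 4 * dot y v ^+ 2))
    (- (4 * K * dot y v * n2 v)) (- (K * n2 v ^+ 2)).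
  have fE : (fun z : R => psi (tau - dl) (y + z *: v) + gap) = (fun z : R =>
      (up + (a + 2 * eta) * (tau - dl) + dot g y + quad H y y / 2 - 2 * eta * n2 y -
      K * n2 y ^+ 2 + gap) +
    (dot g v + quad H y v - 4 * eta * dot y v - 4 * K * n2 y * dot y v) * z +
    (quad H v v / 2 - 2 * eta * n2 v - K * (2 * n2 y * n2 v + 4 * dot y v ^+ 2)) * z ^+ 2 +
    (- (4 * K * dot y v * n2 v)) * z ^+ 3 + (- (K * n2 v ^+ 2)) * z ^+ 4).
    apply/funext => z; rewrite /psi n2D n2Z !dotDr !dotZr quadDr !quadDl !quadZr !quadZl.
    rewrite (quadC v y symH).
    move: (dot g y) (dot g v) (quad H y y) (quad H y v) (quad H v v) (n2 y) (n2 v) (dot y v).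
    move: (K) (up) (gap) (dl) (eta) => *; by field.
  rewrite fE; split => //; rewrite EP.
  have y0 := n2_ge0 y; have v0 := n2_ge0 v.
  have h1 : l * dl <= quad H v v / 2.
    have := lH v; have : l * (2 * dl) <= l * n2 v by rewrite ler_wnM2l. lra.
  have h2 : eta * n2 v <= eta * (2 * dl) by rewrite ler_wpM2l// ltW.
  have h3 : K * (2 * n2 y * n2 v + 4 * dot y v ^+ 2) <= eta * dl.
    apply: (@le_trans _ _ (K * (6 * rho * (2 * dl)))); last first.
      have -> : K * (6 * rho * (2 * dl)) = 12 * K * rho * dl by ring.
      by rewrite ler_pM2r.
    rewrite ler_wpM2l//; have := CS y v; have : n2 y * n2 v <= rho * (2 * dl).
      by apply: ler_pM => //; exact: ltW.
    lra.
  have h4 : K * n2 v ^+ 2 * m4 <= eta * dl.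
    apply: (@le_trans _ _ (K * (2 * dl) ^+ 2 * m4)).
      rewrite ler_wpM2r ?m4_ge0// ler_wpM2l// ler_sqr ?nnegrE//.
      by rewrite mulr_ge0// ltW.
    have -> : K * (2 * dl) ^+ 2 * m4 = 4 * K * m4 * dl * dl by ring.
    by rewrite ler_pM2r.
  have h5 : l * dl = 8 * eta * dl + a * dl by rewrite etaE; ring.
  rewrite /psi; lra.
pose j0 := Num.truncn (2 ^+ n * (t0 - r / 2)).
pose j1 := Num.truncn (2 ^+ n * t0).
have trunc_itv (t : R) : 0 <= t -> t - dl < (Num.truncn (2 ^+ n * t))%:R * dl <= t.
  move=> t_0; have := truncn_itv (mulr_ge0 (exprn_ge0 n (ler0n R 2)) t_0).
  rewrite -[X in X * dl](mulr1) => /andP[h1 h2].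
  have p0 : 0 < 2 ^+ n :> R by rewrite exprn_gt0.
  have dlE : dl * 2 ^+ n = 1 by rewrite mulVf// gt_eqF.
  have tE : t = (2 ^+ n * t) * dl by rewrite mulrAC [_ * dl]mulrC dlE mul1r.
  rewrite mulr1; apply/andP; split; last by rewrite [leRHS]tE ler_pM2r.
  rewrite [X in X - dl < _]tE -[X in _ - X < _]mul1r -mulrBl ltr_pM2r// ltrBlDr.
  by rewrite natr1.
have /andP[j0a j0b] : t0 - r / 2 - dl < j0%:R * dl <= t0 - r / 2.
  by apply: trunc_itv; lra.
have /andP[j1a j1b] : t0 - dl < j1%:R * dl <= t0 by apply: trunc_itv; lra.
have claim k y : (j0 + k <= j1)%N ->
    psi ((j0 + k)%:R * dl - t0) y + gap <= U n (j0 + k) (x0 + y).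
  elim: k y => [|k IH] y.
    rewrite addn0 => _; apply: le_trans (uU _ _).
    have hI : - r < j0%:R * dl - t0 <= 0 by apply/andP; split; lra.
    have E1 : j0%:R * dl = t0 + (j0%:R * dl - t0) by rewrite addrC subrK.
    rewrite [X in u X]E1; have [yr|yr] := ltP (n2 y) r.
      apply: le_trans (gap1 _ _ hI yr); rewrite lerD2l /gap.
      have : eta * (rho / 2) <= eta * (- (j0%:R * dl - t0) + n2 y).
        by rewrite ler_wpM2l ?(ltW eta0)//; have := n2_ge0 y; lra.
      lra.
    by apply: le_trans (gap2 _ _ hI yr); rewrite lerD2l.
  move=> jk; have jk' : (j0 + k <= j1)%N by apply: leq_trans jk; rewrite leq_add2l.
  have tk : (j0 + k.+1)%:R * dl <= t0.
    by apply: le_trans j1b; rewrite ler_pM2r// ler_nat.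
  have tkE : (j0 + k.+1)%:R * dl - t0 = (j0 + k)%:R * dl - t0 + dl.
    by rewrite addnS -natr1; ring.
  have tk0 : t0 - r / 2 - dl < (j0 + k)%:R * dl.
    by apply: lt_le_trans j0a _; rewrite ler_pM2r// ler_nat leq_addr.
  have [yrho|yrho] := ltP (n2 y) rho; last first.
    apply: le_trans (uU _ _).
    have hI : - r < (j0 + k.+1)%:R * dl - t0 <= 0 by apply/andP; split; lra.
    have E1 : (j0 + k.+1)%:R * dl = t0 + ((j0 + k.+1)%:R * dl - t0) by rewrite addrC subrK.
    rewrite [X in u X]E1; have [yr|yr] := ltP (n2 y) r.
      apply: le_trans (gap1 _ _ hI yr); rewrite lerD2l /gap.
      have : eta * (rho / 2) <= eta * (- ((j0 + k.+1)%:R * dl - t0) + n2 y).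
        by rewrite ler_wpM2l ?(ltW eta0)//; lra.
      lra.
    by apply: le_trans (gap2 _ _ hI yr); rewrite lerD2l.
  rewrite addnS /bellman_grid iterS; apply: le_bellman_glb; first exact: ltW.
  move=> v hv; have [qs hs] := step ((j0 + k.+1)%:R * dl - t0) y v hv yrho.
  rewrite -addnS; apply: le_trans hs _; rewrite /heat; apply: le_gaussE => //.
    by apply: quartic_modulus; exact: (admissible_grid au0 n (j0 + k)).1.
  move=> z; have := IH (y + z *: v) jk'; rewrite tkE addrK addrA.
  exact.
have j01 : (j0 <= j1)%N.
  by apply: le_truncn; rewrite ler_pM2l ?exprn_gt0//; lra.
have := claim (j1 - j0)%N 0; rewrite subnKC// addr0 => /(_ (leqnn _)).
have -> : psi (j1%:R * dl - t0) 0 = up + (a + 2 * eta) * (j1%:R * dl - t0).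
  rewrite /psi n2_0 -(scale0r (0 : V)) dotZr quadZl; ring.
(* Both factors are nonpositive. Hence the iterate at (t0, x0) is at least [up + gap], against the
   choice of n. *)
have : 0 <= (a + 2 * eta) * (j1%:R * dl - t0).
  by rewrite mulr_le0// ?(ltW a2)// subr_le0.
have -> : U n j1 x0 = bellman_dyadic u0 n t0 x0 by [].
lra.
Qed.

End value_viscosity.


Section value_viscosity2.
Context {R : realType} {d : nat}.
Local Notation V := 'cV[R]_d.
Local Notation E := (R * V)%type.
Local Notation O := (cylinder (setT : set V)).
Context (m L : R) (u0 : V -> R).
Hypothesis d0 : (0 < d)%N.
Hypothesis L0 : 0 <= L.
Hypothesis au0 : admissible_fun m u0.
Hypothesis scu0 : forall y z, 2 * u0 y - 2 * L * n2 z <= u0 (y + z) + u0 (y - z).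

Local Notation U := (bellman_grid u0).
Local Notation u := (value u0).
Local Notation value_fun := (value_fun u0).

(** [touching_above] with c = 0 in all directions with |e| <= 1: e = 0 gives a nonpositive time
    derivative, and unit vectors bound the Rayleigh quotient of the Hessian from below. *)
Lemma value_subsolution : viscosity_subsolution setT value_fun.
Proof.
move=> phi C2 p Op uphi.
have p0 : 0 < p.1 := Op.1.
have [K K0 hK] := value_growth au0.
have key (e : V) : n2 e <= 1 -> dt phi p <= quad (D2x phi p) e e.
  move=> e1; rewrite -[leRHS]subr0.
  apply: (@touching_above _ _ value_fun phi p e 0 p.1 K) => //.
  - by move=> h x _; exact: hK.
  - move=> h _; have <- : (fun x => value_fun (p.1 - h, x)) = (fun x => value_fun (p.1 - h, x)) by [].
    move=> x; apply: (@continuous_comp _ _ _ (fun x => (p.1 - h, x)) value_fun).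
      exact: (continuous_pair (fun=> cvg_cst _) (fun=> cvg_id)).
    exact: (value_fun_continuous L0 au0 scu0).
  - move=> h /andP[h0 hp]; rewrite mul0r subr0.
    have ph : 0 <= p.1 - h by rewrite subr_ge0 ltW.
    have -> : (fun x => value_fun (p.1 - h, x)) = u (p.1 - h).
      by apply/funext => x; rewrite value_funE.
    have -> : value_fun p = u (p.1 - h + h) p.2.
      by rewrite subrK /value_fun max_l// ltW.
    apply: (value_le_heat L0 au0 scu0) => //.
    by rewrite n2Z sqr_sqrtr ?mulr_ge0 ?(ltW h0)// ler_piMr// mulr_ge0// ltW.
rewrite le_min; have dt0 : dt phi p <= 0.
  by have := key 0; rewrite n2_0 ler01 -(scale0r (0 : V)) quadZl mul0r => /(_ isT).
rewrite dt0 /=; apply: le_lambda1 => // x.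
have [x0|x0] := eqVneq (n2 x) 0.
  have [C C0 hC] := quad_bound (D2x phi p).
  by have := hC x; rewrite x0 !mulr0 normr_le0 => /eqP ->.
have xp : 0 < n2 x by rewrite lt_neqAle eq_sym x0 n2_ge0.
pose k := (Num.sqrt (n2 x))^-1.
have k2 : k ^+ 2 = (n2 x)^-1 by rewrite exprVn sqr_sqrtr// ltW.
have := key (k *: x); rewrite n2Z k2 mulVf// => /(_ (lexx _)).
by rewrite quadZl quadZr mulrA -expr2 k2 mulrC ler_pdivlMr.
Qed.

Lemma value_viscosity : viscosity_solution setT value_fun.
Proof.
split; first exact: value_subsolution.
by move=> phi C2 p Op uphi; exact: (touching_below_value d0 au0).
Qed.

End value_viscosity2.

(** * Measurability, independence and Brownian increments *)


Section measurability.
Context {R : realType}.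

(** The preimage of a set is a countable union of level sets of k, whatever h is. With k the index
    of a grid cell, h may come from a choice function. *)
Lemma measurable_countable_valued (C : countType) {d1 d2} (X : measurableType d1)
    (Y : measurableType d2) (k : X -> C) (h : C -> Y) :
  (forall c, measurable (k @^-1` [set c])) -> measurable_fun setT (h \o k).
Proof.
move=> mk _ B mB; rewrite setTI.
have -> : (h \o k) @^-1` B = \bigcup_n (if unpickle n is Some c then
    (if h c \in B then k @^-1` [set c] else set0) else set0).
  apply/seteqP; split => [x /= Bx|x [n _]].
    by exists (pickle (k x)) => //=; rewrite pickleK; rewrite (mem_set Bx).
  case: (unpickle n) => // c; case: ifPn => // /set_mem hc /= ->.
  exact: hc.
apply: bigcupT_measurable => n; case: (unpickle n) => // c.
by case: ifPn.
Qed.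

Context {d : nat}.

Lemma normr_cV_le (x : 'cV[R]_d) (e : R) : 0 <= e ->
  (forall i, `|x i ord0| <= e) -> `|x| <= e.
Proof.
move=> e0 h; have [->//|x0] := eqVneq `|x| 0.
have : mx_norm x != 0 by [].
move=> /mx_norm_neq0[[i j] xij].
by have -> : `|x| = mx_norm x by []; rewrite xij /= ord1.
Qed.

Definition grid_index {T} (n : nat) (tau : T -> R) (Y : T -> 'cV[R]_d) (w : T) :
    int * {ffun 'I_d -> int} :=
  (Num.floor (2 ^+ n * tau w), [ffun i => Num.floor (2 ^+ n * Y w i ord0)]).

Definition grid_point (n : nat) (k : int * {ffun 'I_d -> int}) : R * 'cV[R]_d :=
  (2 ^- n * k.1%:~R, \col_i (2 ^- n * (k.2 i)%:~R)).

Lemma measurable_floor_eq {d1} (X : measurableType d1) (g : X -> R) (z : int) (c : R) :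
  measurable_fun setT g -> measurable [set w | Num.floor (c * g w) = z].
Proof.
move=> mg; have mcg : measurable_fun setT (fun w => c * g w) by exact: measurable_funM.
have -> : [set w | Num.floor (c * g w) = z] =
    (fun w => c * g w) @^-1` `[z%:~R, (z + 1)%:~R[%classic.
  apply/seteqP; split => w /=; rewrite in_itv/=.
    by move=> <-; exact: floor_itv.
  by move=> /floor_def.
by rewrite -[X in measurable X]setTI; exact: mcg.
Qed.

Lemma measurable_grid_index {d1} (X : measurableType d1) n (tau : X -> R) (Y : X -> 'cV[R]_d) k :
  measurable_fun setT tau -> (forall i, measurable_fun setT (fun w => Y w i ord0)) ->
  measurable (grid_index n tau Y @^-1` [set k]).
Proof.
move=> mt mY; case: k => k1 k2.
have -> : grid_index n tau Y @^-1` [set (k1, k2)] =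
    [set w | Num.floor (2 ^+ n * tau w) = k1] `&`
    \bigcap_(i in [set: 'I_d]) [set w | Num.floor (2 ^+ n * Y w i ord0) = k2 i].
  apply/seteqP; split => w /=.
    by move=> [<- <-]; split => // i _ /=; rewrite ffunE.
  move=> [<-] h; congr (_, _).
  by apply/ffunP => i; rewrite ffunE; exact: h.
apply: measurableI; first exact: measurable_floor_eq.
by apply: fin_bigcap_measurable => // i _; exact: measurable_floor_eq.
Qed.

Lemma grid_point_dist n {T} (tau : T -> R) (Y : T -> 'cV[R]_d) w :
  let p := grid_point n (grid_index n tau Y w) in
  `|tau w - p.1| <= 2 ^- n /\ forall i, `|Y w i ord0 - p.2 i ord0| <= 2 ^- n.
Proof.
have fl (t : R) : `|t - 2 ^- n * (Num.floor (2 ^+ n * t))%:~R| <= 2 ^- n.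

  have /andP[h1 h2] := floor_itv (2 ^+ n * t).
  have -> : t - 2 ^- n * (Num.floor (2 ^+ n * t))%:~R =
      2 ^- n * (2 ^+ n * t - (Num.floor (2 ^+ n * t))%:~R).
    by rewrite mulrBr mulrA mulVf ?mul1r// expf_neq0.
  have p0 : 0 <= 2 ^- n :> R by rewrite invr_ge0 exprn_ge0.
  rewrite normrM ger0_norm// ler_piMr// ger0_norm ?subr_ge0//.
  by move: h2; rewrite intrD; lra.
by split => [|i]; rewrite /= ?mxE ?ffunE; exact: fl.
Qed.

(** The composite is the pointwise limit of the values of f at dyadic grid points, which depend on w
    through a countable index only. Measurability of Y is thus required of its coordinates alone. *)
Lemma measurable_continuous_coord {d1} (X : measurableType d1) (tau : X -> R)
    (Y : X -> 'cV[R]_d) (f : R * 'cV[R]_d -> R) : continuous f ->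
  measurable_fun setT tau -> (forall i, measurable_fun setT (fun w => Y w i ord0)) ->
  measurable_fun setT (fun w => f (tau w, Y w)).
Proof.
move=> cf mt mY.
apply: (@measurable_fun_cvg _ _ _ _ (fun n w => f (grid_point n (grid_index n tau Y w)))).
  move=> n; apply: (@measurable_countable_valued _ _ _ _ _ (grid_index n tau Y)
    (fun k => f (grid_point n k))).
  by move=> k; exact: measurable_grid_index.
move=> w _; apply: (@continuous_cvg _ _ _ _ _ _ f); first exact: cf.
apply/cvgrPdist_le => e e0.
have [N hN] : exists N, forall n, (N <= n)%N -> 2 ^- n <= e :> R.
  exists (Num.truncn e^-1).+1 => n Nn.
  have /andP[_ h] : (Num.truncn e^-1)%:R <= e^-1 < (Num.truncn e^-1).+1%:R.
    by apply: truncn_itv; rewrite invr_ge0 ltW.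
  rewrite -[leRHS]invrK lef_pV2 ?posrE ?exprn_gt0 ?invr_gt0//.
  apply: le_trans (ltW h) _; apply: (@le_trans _ _ n%:R); first by rewrite ler_nat.
  by rewrite -natrX ler_nat ltnW// ltn_expl.
exists N => // n /= Nn; have [h1 h2] := grid_point_dist n tau Y w.
rewrite prod_normE/= ge_max; apply/andP; split; first exact: le_trans h1 (hN n Nn).
apply: normr_cV_le => [|i]; first exact: ltW.
by rewrite 2!mxE; exact: le_trans (h2 i) (hN n Nn).
Qed.

Lemma measurable_continuous_coord2 {d1} (X : measurableType d1)
    (Y : X -> 'cV[R]_d) (f : 'cV[R]_d -> R) : continuous f ->
  (forall i, measurable_fun setT (fun w => Y w i ord0)) ->
  measurable_fun setT (fun w => f (Y w)).
Proof.
move=> cf mY; apply: (measurable_continuous_coord (tau := cst 0) (f := fun p => f p.2)) => //.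
by move=> p; apply: (@continuous_comp _ _ _ snd f); [exact: cvg_snd|exact: cf].
Qed.

End measurability.

(** * Integrating out an independent variable *)

Section independence.
Context {R : realType} {disp : measure_display} {T : measurableType disp}.
Context (P : probability T R) (G : set (set T)) (Z : T -> R)
  (nu : probability (measurableTypeR R) R).
Hypothesis GI : setI_closed G.
Hypothesis GT : G setT.
Hypothesis mG : forall A, G A -> measurable A.
Hypothesis mZ : measurable_fun setT Z.
Hypothesis indep : forall A B, G A -> measurable B ->
  P (A `&` Z @^-1` B) = (P A * nu B)%E.

Local Notation T' := (g_sigma_algebraType G).

Lemma sub_g_sigma_algebra (A : set T) : (<<s G >>) A -> measurable A.
Proof. by apply: smallest_sub; [exact: sigma_algebra_measurable|exact: mG]. Qed.

Lemma measurable_to_sub : @measurable_fun _ _ T T' setT (fun w : T => w).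
Proof. by move=> _ B mB; rewrite setTI; exact: sub_g_sigma_algebra. Qed.

(** For fixed B both sides are finite measures in A, and they agree on the generating class G, which
    contains the whole space and is closed under intersection. *)
Lemma indep_sigma (A B : set _) : (<<s G >>) A -> measurable B ->
  P (A `&` Z @^-1` B) = (P A * nu B)%E.
Proof.
move=> sA mB.
have mZB : measurable (Z @^-1` B) by rewrite -[X in measurable X]setTI; exact: mZ.
have nuB : (nu B \is a fin_num) by exact: fin_num_measure.
pose k : {nonneg R} := NngNum (fine_ge0 (measure_ge0 nu B)).
have kE : (k%:num)%:E = nu B by rewrite /= fineK.
pose m1 : {measure set T -> \bar R} := mrestr P mZB.
pose m2 : {measure set T -> \bar R} := mscale k P.
have : m1 A = m2 A.
  apply: (g_sigma_algebra_measure_unique G mG (fun=> setT)) => //.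
  - by rewrite bigcup_const//; exists 0%N.
  - move=> C GC; transitivity (P (C `&` Z @^-1` B)) => //.
    by rewrite indep// muleC -kE.
  - move=> _; apply: (@le_lt_trans _ _ 1%E); last exact: ltry.
    exact: (probability_le1 P (measurableI _ _ measurableT mZB)).
by move=> m12; transitivity (m1 A) => //; rewrite m12 muleC -kE.
Qed.

(** Independence says that the joint law of the identity, valued in T with the generated
    sigma-algebra, and of Z is a product; Tonelli's theorem then integrates z with w frozen. *)
Lemma freezing (F : T' * measurableTypeR R -> \bar R) :
  measurable_fun setT F -> (forall p, 0 <= F p)%E ->
  (\int[P]_w F (w, Z w) = \int[P]_w \int[nu]_z F (w, z))%E.
Proof.
move=> mF F0.
have mpair : @measurable_fun _ _ T (T' * measurableTypeR R)%type setT (fun w => (w, Z w)).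
  by apply: measurable_fun_pair => //; exact: measurable_to_sub.
pose idT : {mfun T >-> T'} := HB.pack (fun w : T => (w : T'))
  (isMeasurableFun.Build _ _ T T' (fun w : T => w) measurable_to_sub).
pose pairT : {mfun T >-> (T' * measurableTypeR R)%type} := HB.pack
  (fun w : T => (w, Z w) : (T' * measurableTypeR R)%type)
  (isMeasurableFun.Build _ _ T (T' * measurableTypeR R)%type _ mpair).
have E (X : set (T' * measurableTypeR R)) : measurable X ->
    (distribution P idT \x nu)%E X = distribution P pairT X.
  apply: product_measure_unique => A B mA mB.
  exact: indep_sigma.
transitivity (\int[distribution P pairT]_p F p)%E.
  by rewrite /distribution ge0_integral_pushforward.
transitivity (\int[distribution P idT \x nu]_p F p)%E.
  by apply: eq_measure_integral => A mA _; exact: (esym (E A mA)).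
rewrite fubini_tonelli1// /distribution ge0_integral_pushforward//.
- exact: measurable_fun_fubini_tonelli_F.
- by move=> x _; apply: integral_ge0 => y _; exact: F0.
Qed.

End independence.


Section normal_scaling.
Context {R : realType}.
Local Notation mu := (@lebesgue_measure R).

Lemma ge0_integral_normal_prob_scale (s : R) (f : R -> R) : 0 < s -> continuous f ->
  (forall x, 0 <= f x) ->
  (\int[normal_prob 0 s]_x (f x)%:E = \int[std_normal]_z (f (s * z))%:E)%E.
Proof.
move=> s0 cf f0.
have cfs : continuous (fun z => f (s * z)).
  move=> z; apply: (@continuous_comp _ _ _ (fun z => s * z) f); last exact: cf.
  by apply: cvgM; [exact: cvg_cst|exact: cvg_id].
have mf : measurable_fun setT (fun x : measurableTypeR R => (f x)%:E).
  by apply/measurable_EFinP; exact: continuous_measurable_fun.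
rewrite ge0_integral_normal_prob//.
rewrite continuous_ge0_integral_std_normal//.
have cp : continuous (normal_pdf (0 : R) s) by apply: continuous_normal_pdf; rewrite gt_eqF.
transitivity (\int[mu]_x (f x * normal_pdf 0 s x)%:E)%E; first by [].
rewrite (@ge0_integral_affine _ s 0)//; last 2 first.
- by move=> x; apply: cvgM; [exact: cf|exact: cp].
- by move=> x; rewrite mulr_ge0// normal_pdf_ge0.
rewrite -ge0_integralZl//.
- apply: eq_integral => z _; rewrite -EFinM addr0; congr EFin.
  rewrite normal_pdfsE// normal_pdf1E exprMn -mulr_natr.
  have -> : s ^+ 2 * z ^+ 2 / (s ^+ 2 * 2) = z ^+ 2 / 2 by field; rewrite gt_eqF.
  have s1 : s != 0 by rewrite gt_eqF.
  have simp (a b c : R) : s * (a * (s^-1 * b * c)) = a * (b * c) by field.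
  exact: simp.
- apply/measurable_EFinP; apply: measurable_funM.
    by apply: measurableT_comp; [exact: continuous_measurable_fun|apply: measurable_funD].
  by apply: measurableT_comp; [exact: measurable_normal_pdf|apply: measurable_funD].
- by move=> x _; rewrite lee_fin mulr_ge0// normal_pdf_ge0.
- by rewrite lee_fin ltW.
Qed.

End normal_scaling.

(** * Brownian increments, one coordinate at a time *)

Section brownian.
Context {R : realType} {d : nat} {disp : measure_display} {T : measurableType disp}.
Context (P : probability T R) (W : R -> T -> 'cV[R]_d).
Hypothesis bm : brownian_motion P W.
Local Notation V := 'cV[R]_d.

Lemma past_measurable s A : past W s A -> measurable A.
Proof.
apply: smallest_sub; first exact: sigma_algebra_measurable.
move=> _ [r [i [B [/andP[r0 rs] mB ->]]]].
by rewrite -[X in measurable X]setTI; exact: (bm_measurable bm i r0).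
Qed.

Lemma past_mono s t A : s <= t -> past W s A -> past W t A.
Proof.
move=> st; apply: smallest_sub; first exact: smallest_sigma_algebra.
move=> _ [r [i [B [/andP[r0 rs] mB ->]]]]; apply: sub_sigma_algebra.
by exists r, i, B; split => //; rewrite r0 (le_trans rs st).
Qed.

Lemma measurable_past s (f : T -> R) :
  @measurable_fun _ _ (past_space W s) R setT f -> measurable_fun setT f.
Proof. by move=> mf _ B mB; have := mf measurableT B mB; rewrite !setTI; exact: past_measurable. Qed.

Lemma measurable_past_mono s t (f : T -> R) : s <= t ->
  @measurable_fun _ _ (past_space W s) R setT f ->
  @measurable_fun _ _ (past_space W t) R setT f.
Proof.
move=> st mf _ B mB; have := mf measurableT B mB; rewrite !setTI.
exact: past_mono.
Qed.

Lemma measurable_past_W r s i : 0 <= r <= s ->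
  @measurable_fun _ _ (past_space W s) R setT (fun w => W r w i ord0).
Proof.
move=> rs _ B mB; rewrite setTI; apply: sub_sigma_algebra.
by exists r, i, B; split.
Qed.

Definition increment s t (w : T) : V := W t w - W s w.

(* Generators of the past up to s together with the first i coordinates of the
   increment: each coordinate is integrated out separately. *)
Definition past_coord s t (i : nat) : set (set T) :=
  [set A | exists (A0 : set T) (B : 'I_d -> set R), [/\ past W s A0,
     forall j, measurable (B j), forall j : 'I_d, (i <= j)%N -> B j = setT &
     A = A0 `&` [set w | forall j, B j (increment s t w j ord0)]]].

Lemma past_coord_past s t i A : past W s A -> past_coord s t i A.
Proof.
move=> pA; exists A, (fun=> setT); split => //.
by apply/seteqP; split => w // [].
Qed.

Lemma pastT s : past W s setT.
Proof. exact: (@measurableT _ (past_space W s)). Qed.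

Lemma pastI s A B : past W s A -> past W s B -> past W s (A `&` B).
Proof. exact: (@measurableI _ (past_space W s)). Qed.

Lemma measurable_increment s t i : 0 <= s -> 0 <= t ->
  measurable_fun setT (fun w => increment s t w i ord0).
Proof.
move=> s0 t0.
have -> : (fun w => increment s t w i ord0) = (fun w => W t w i ord0 - W s w i ord0).
  by apply/funext => w; rewrite /increment !mxE.
by apply: measurable_funB; exact: (bm_measurable bm).
Qed.

Section one_coordinate.
Context (s t : R) (i : 'I_d).
Hypothesis s0 : 0 <= s.
Hypothesis st : s < t.
Local Notation G := (past_coord s t i).
Local Notation T' := (g_sigma_algebraType G).

Let t0 : 0 <= t. Proof. by apply: le_trans s0 (ltW st). Qed.

Let GI : setI_closed G.
Proof.
move=> _ _ [A0 [B [pA mB Bi ->]]] [A1 [B' [pA' mB' Bi' ->]]].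
exists (A0 `&` A1), (fun j => B j `&` B' j); split.
- exact: pastI.
- by move=> j; exact: measurableI.
- by move=> j ij; rewrite Bi// Bi'// setTI.
- apply/seteqP; split => w /=; first by move=> [[? h] [? h']]; do 2 split => //.
  by move=> [[? ?] h]; split; split => // j; case: (h j).
Qed.

Let mG A : G A -> measurable A.
Proof.
move=> [A0 [B [pA mB Bi ->]]]; apply: measurableI; first exact: past_measurable pA.
have -> : [set w | forall j, B j (increment s t w j ord0)] =
    \bigcap_(j in [set: 'I_d]) [set w | B j (increment s t w j ord0)].
  by apply/seteqP; split => w /= h j //=; exact: h.
apply: fin_bigcap_measurable => // j _.
by rewrite -[X in measurable X]setTI; exact: (measurable_increment j s0 t0).
Qed.

Let indep A (B : set R) : G A -> measurable B ->
  P (A `&` (fun w => increment s t w i ord0) @^-1` B) =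
  (P A * normal_prob 0 (Num.sqrt (t - s)) B)%E.
Proof.
move=> [A0 [B0 [pA mB0 Bi ->]]] mB.
have H (C : 'I_d -> set R) : (forall j, measurable (C j)) ->
    P (A0 `&` [set w | forall j, C j (increment s t w j ord0)]) =
    (P A0 * \prod_(j < d) normal_prob 0 (Num.sqrt (t - s)) (C j))%E.
  by move=> mC; exact: (bm_increment bm s0 st).
(* The event A leaves coordinate i unconstrained, so B takes its place in the product formula. *)
pose C j := if j == i then B else B0 j.
have mC j : measurable (C j) by rewrite /C; case: ifP.
have -> : A0 `&` [set w | forall j, B0 j (increment s t w j ord0)] `&`
    (fun w => increment s t w i ord0) @^-1` B =
    A0 `&` [set w | forall j, C j (increment s t w j ord0)].
  apply/seteqP; split => w /=.
    move=> [[? h] hB]; split => // j; rewrite /C; case: eqP => [->//|_].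
    exact: h.
  move=> [? h]; split; last by have := h i; rewrite /C eqxx.
  split => // j; have := h j; rewrite /C; case: eqP => [->|//] _.
  by rewrite Bi.
rewrite !H// -muleA; congr (_ * _)%E.
rewrite (bigD1 i)//= [in RHS](bigD1 i)//= /C eqxx Bi//.
have -> : normal_prob 0 (Num.sqrt (t - s)) [set: R] = 1%E :> \bar R.
  exact: integral_normal_pdf.
rewrite mul1e muleC; congr (_ * _)%E.
by apply: eq_bigr => j ji; rewrite (negbTE ji).
Qed.

(** [freezing] applied to coordinate i, with the normal law of variance t - s rescaled to the
    standard one. The data tau, Y and e may depend on the past and on the coordinates of the
    increment before i. *)
Lemma increment_freezing (tau : T -> R) (Y e : T -> V) (Phi : R * V -> R) :
  continuous Phi -> (forall p, 0 <= Phi p) ->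
  @measurable_fun _ _ T' R setT tau ->
  (forall j, @measurable_fun _ _ T' R setT (fun w => Y w j ord0)) ->
  (forall j, @measurable_fun _ _ T' R setT (fun w => e w j ord0)) ->
  (\int[P]_w (Phi (tau w, (Y w + increment s t w i ord0 *: e w)%R))%:E =
   \int[P]_w \int[std_normal]_z
     (Phi (tau w, (Y w + z *: (Num.sqrt (t - s) *: e w))%R))%:E)%E.
Proof.
move=> cPhi Phi0 mtau mY me.
have sts : 0 < Num.sqrt (t - s) by rewrite sqrtr_gt0 subr_gt0.
pose nu : probability (measurableTypeR R) R := normal_prob 0 (Num.sqrt (t - s)).
pose F (p : T' * measurableTypeR R) : \bar R := (Phi (tau p.1, Y p.1 + p.2 *: e p.1))%:E.
have mF : measurable_fun setT F.
  apply/measurable_EFinP; apply: (measurable_continuous_coord (X := (T' * measurableTypeR R)%type)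
    (tau := fun p => tau p.1) (Y := fun p => Y p.1 + p.2 *: e p.1)) => //.
    exact: (measurableT_comp mtau).
  move=> j.
  have -> : (fun w : T' * measurableTypeR R => (Y w.1 + w.2 *: e w.1) j ord0) =
      (fun w => Y w.1 j ord0 + w.2 * e w.1 j ord0).
    by apply/funext => w; rewrite !mxE.
  apply: measurable_funD; first exact: (measurableT_comp (mY j)).
  by apply: measurable_funM => //; exact: (measurableT_comp (me j)).
have F0 p : (0 <= F p)%E by rewrite lee_fin.
rewrite (@freezing _ _ _ P G (fun w => increment s t w i ord0) nu GI
  (past_coord_past t i (@pastT s)) mG (measurable_increment i s0 t0) indep F mF F0).
apply: eq_integral => w _.
rewrite (@ge0_integral_normal_prob_scale R (Num.sqrt (t - s))
  (fun z : R => Phi (tau w, Y w + z *: e w)))//.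
- by apply: eq_integral => z _; rewrite scalerA mulrC.
- move=> z; apply: (@continuous_comp _ _ _ (fun z : R => (tau w, Y w + z *: e w)) Phi).
    exact: (continuous_pair (fun=> cvg_cst _) (@continuous_line R V _ _)).
  exact: cPhi.
Qed.

End one_coordinate.
End brownian.

(** * Controls do not beat the value function *)


Section nonneg_integral.
Local Open Scope ereal_scope.
Context {d} {T : measurableType d} {R : realType} (mu : {measure set T -> \bar R}).

(* Monotonicity with no measurability assumption: the integral of a nonnegative
   function is a supremum over simple minorants. *)
Lemma le_integral_nonneg (D : set T) (f g : T -> \bar R) :
  (forall x, D x -> 0 <= f x) -> (forall x, D x -> f x <= g x) ->
  \int[mu]_(x in D) f x <= \int[mu]_(x in D) g x.
Proof.
move=> f0 fg.
have g0 x : D x -> 0 <= g x by move=> Dx; exact: le_trans (f0 x Dx) (fg x Dx).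
rewrite !ge0_integralE//; apply: le_ereal_sup => _ [h hf <-]; exists h => //= x.
apply: le_trans (hf x) _; rewrite !patchE; case: ifPn => // /set_mem Dx.
exact: fg.
Qed.

End nonneg_integral.

Section frobenius_facts.
Context {R : realType} {d : nat}.
Implicit Types (A B : 'M[R]_d).

Definition f2 A : R := \sum_i \sum_j A i j ^+ 2.

Lemma frobenius_sqr_mx A : frobenius A ^+ 2 = f2 A.
Proof.
have E : \tr (A *m A^T) = f2 A.
  rewrite /mxtrace /f2; apply: eq_bigr => i _; rewrite mxE.
  by apply: eq_bigr => j _; rewrite mxE expr2.
rewrite /frobenius E sqr_sqrtr// /f2.
by apply: sumr_ge0 => i _; apply: sumr_ge0 => j _; rewrite sqr_ge0.
Qed.

Lemma f2_ge0 A : 0 <= f2 A.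
Proof. by rewrite -frobenius_sqr_mx sqr_ge0. Qed.

Lemma f2_col A : f2 A = \sum_j n2 (col j A).
Proof.
rewrite /f2 exchange_big/=; apply: eq_bigr => j _; apply: eq_bigr => i _.
by rewrite mxE.
Qed.

Lemma mulmx_col A (y : 'cV[R]_d) : A *m y = \sum_j y j ord0 *: col j A.
Proof.
apply/colP => i; rewrite mxE summxE; apply: eq_bigr => j _.
by rewrite !mxE mulrC.
Qed.

Lemma n2_mulmx A (y : 'cV[R]_d) : n2 (A *m y) <= f2 A * n2 y.
Proof.
rewrite /f2 mulr_suml; apply: ler_sum => i _.
have := CS (row i A)^T y.
have -> : dot (row i A)^T y = (A *m y) i ord0.
  by rewrite /dot mxE; apply: eq_bigr => j _; rewrite !mxE.
have -> // : n2 (row i A)^T = \sum_j A i j ^+ 2.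
by apply: eq_bigr => j _; rewrite !mxE.
Qed.

Lemma f2_young (k : R) A B : 0 < k -> f2 A <= (1 + k) * f2 B + (1 + k^-1) * f2 (A - B).
Proof.
move=> k0; rewrite /f2 !mulr_sumr -big_split/=; apply: ler_sum => i _.
rewrite !mulr_sumr -big_split/=; apply: ler_sum => j _; rewrite !mxE.
set a := A i j; set b := B i j.
have : 0 <= k^-1 * (k * b - (a - b)) ^+ 2 by rewrite mulr_ge0 ?sqr_ge0// invr_ge0 ltW.
have -> : k^-1 * (k * b - (a - b)) ^+ 2 = k * b ^+ 2 - 2 * b * (a - b) + k^-1 * (a - b) ^+ 2.
  by field; rewrite gt_eqF.
nra.
Qed.

Lemma f2Z (c : R) A : f2 (c *: A) = c ^+ 2 * f2 A.
Proof.
rewrite /f2 mulr_sumr; apply: eq_bigr => i _; rewrite mulr_sumr.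
by apply: eq_bigr => j _; rewrite mxE exprMn.
Qed.

End frobenius_facts.

Section lower_bound.
Context {R : realType} {d : nat} {disp : measure_display} {T : measurableType disp}.
Context (P : probability T R) (W : R -> T -> 'cV[R]_d).
Hypothesis bm : brownian_motion P W.
Local Notation V := 'cV[R]_d.

Lemma measurable_past_coord s t i (f : T -> R) :
  @measurable_fun _ _ (past_space W s) R setT f ->
  @measurable_fun _ _ (g_sigma_algebraType (past_coord W s t i)) R setT f.
Proof.
move=> mf _ B mB; have := mf measurableT B mB; rewrite !setTI => h.
by apply: sub_sigma_algebra; exact: past_coord_past.
Qed.

Lemma measurable_past_coord_increment s t i (j : 'I_d) : (j < i)%N ->
  @measurable_fun _ _ (g_sigma_algebraType (past_coord W s t i)) R setT
    (fun w => increment W s t w j ord0).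
Proof.
move=> ji _ B mB; rewrite setTI; apply: sub_sigma_algebra.
exists setT, (fun k => if k == j then B else setT); split.
- exact: pastT.
- by move=> k; case: ifP.
- by move=> k ik; case: eqP => // kj; move: ik; rewrite kj leqNgt ji.
- apply/seteqP; split => w /=; last by move=> [_ /(_ j)]; rewrite eqxx.
  by move=> Bw; split => // k; case: eqP => // ->.
Qed.

Lemma measurable_past_increment s t r (i : 'I_d) : 0 <= s <= r -> 0 <= t <= r ->
  @measurable_fun _ _ (past_space W r) R setT (fun w => increment W s t w i ord0).
Proof.
move=> sr tr.
have -> : (fun w => increment W s t w i ord0) = (fun w => W t w i ord0 - W s w i ord0).
  by apply/funext => w; rewrite /increment !mxE.
by apply: measurable_funB; exact: measurable_past_W.
Qed.

Section value_step.
Context (m L : R) (u0 : V -> R).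
Hypothesis L0 : 0 <= L.
Hypothesis au0 : admissible_fun m u0.
Hypothesis scu0 : forall y z, 2 * u0 y - 2 * L * n2 z <= u0 (y + z) + u0 (y - z).
Local Notation u := (value_fun u0).

Let Phi (p : R * V) : R := u p - m.

Let cPhi : continuous Phi.
Proof.
move=> p; apply: (@continuous_comp _ _ _ u (fun y => y - m)).
  exact: (value_fun_continuous L0 au0 scu0).
exact: continuous_subr.
Qed.

Let Phi0 p : 0 <= Phi p.
Proof. by rewrite subr_ge0; exact: (value_ge au0). Qed.

(** Interpolation over the columns of xi: those with index below i already act as displacements in
    [Y i], the others still count as time in [tau i]. Integrating out coordinate i trades the time
    (t - s) |col i|^2 / 2 for a Gaussian displacement, which [value_le_heat] allows. *)
Lemma brownian_step (a s t : R) (X : T -> V) (xi : T -> 'M[R]_d) :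
  0 <= a -> 0 <= s -> s <= t ->
  (forall i, @measurable_fun _ _ (past_space W s) R setT (fun w => X w i ord0)) ->
  (forall i j, @measurable_fun _ _ (past_space W s) R setT (fun w => xi w i j)) ->
  (\int[P]_w (Phi (a + (t - s) * f2 (xi w) / 2, X w))%:E <=
   \int[P]_w (Phi (a, (X w + xi w *m increment W s t w)%R))%:E)%E.
Proof.
move=> a0 s0; rewrite le_eqVlt => /predU1P[<- mX mxi|st mX mxi].
  rewrite le_eqVlt; apply/orP; left; apply/eqP; apply: eq_integral => w _.
  by rewrite /increment !subrr mul0r mul0r addr0 mulmx0 addr0.
pose tau (i : nat) w : R := a + (t - s) / 2 * \sum_(j < d | (i <= j)%N) n2 (col j (xi w)).
pose Y (i : nat) w : V := X w + \sum_(j < d | (j < i)%N)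
  increment W s t w j ord0 *: col j (xi w).
pose I i := (\int[P]_w (Phi (tau i w, Y i w))%:E)%E.
have ts0 : 0 <= t - s by rewrite subr_ge0 ltW.
have tau0 i w : 0 <= tau i w.
  rewrite /tau addr_ge0// mulr_ge0 ?divr_ge0//.
  by apply: sumr_ge0 => j _; exact: n2_ge0.
have I0E : (\int[P]_w (Phi (a + (t - s) * f2 (xi w) / 2, X w))%:E)%E = I 0%N.
  apply: eq_integral => w _; rewrite /tau /Y.
  have -> : \sum_(j < d | (j < 0)%N) increment W s t w j ord0 *: col j (xi w) = 0.
    by rewrite big_pred0.
  by rewrite addr0; congr (Phi (_ + _, _))%:E; rewrite f2_col mulrAC.
have IdE : (\int[P]_w (Phi (a, (X w + xi w *m increment W s t w)%R))%:E)%E = I d.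
  apply: eq_integral => w _; congr (Phi (_, _))%:E.
    rewrite /tau big_pred0 ?mulr0 ?addr0// => j.
    by rewrite leqNgt ltn_ord.
  rewrite /Y mulmx_col; congr (_ + _); apply: eq_bigl => j.
  by rewrite ltn_ord.
rewrite I0E IdE.
have step (i : 'I_d) : (I i <= I i.+1)%E.
  have YS w : Y i.+1 w = Y i w + increment W s t w i ord0 *: col i (xi w).
    rewrite /Y -addrA; congr (_ + _); rewrite (bigD1 i)//= addrC; congr (_ + _).
    by apply: eq_bigl => j; rewrite ltnS ltn_neqAle andbC.
  have tauS w : tau i w = tau i.+1 w + (t - s) / 2 * n2 (col i (xi w)).
    rewrite /tau -addrA; congr (_ + _); rewrite -mulrDr; congr (_ * _).
    rewrite (bigD1 i)//= addrC; congr (_ + _); apply: eq_bigl => j.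
    by rewrite ltn_neqAle andbC eq_sym.
  have mcol j k : @measurable_fun _ _ (past_space W s) R setT (fun w => col j (xi w) k ord0).
    have -> : (fun w => col j (xi w) k ord0) = (fun w => xi w k j).
      by apply/funext => w; rewrite mxE.
    exact: mxi.
  have mn2 j : @measurable_fun _ _ (past_space W s) R setT (fun w => n2 (col j (xi w))).
    exact: (measurable_continuous_coord2 n2_continuous (mcol j)).
  have mtau : @measurable_fun _ _ (past_space W s) R setT (tau i.+1).
    apply: measurable_funD => //; apply: measurable_funM => //.
    have -> : (fun w => \sum_(j < d | (i < j)%N) n2 (col j (xi w))) =
        (fun w => \sum_(j < d) (if (i < j)%N then n2 (col j (xi w)) else 0)).
      by apply/funext => w; rewrite big_mkcond.
    apply: (@measurable_sum _ (past_space W s) R setT 'I_d _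
      (fun j w => if (i < j)%N then n2 (col j (xi w)) else 0)) => j.
    by have [_|_] := boolP (i < j)%N; [exact: mn2|exact: measurable_cst].
  have mY j : @measurable_fun _ _ (g_sigma_algebraType (past_coord W s t i)) R setT
      (fun w => Y i w j ord0).
    have -> : (fun w => Y i w j ord0) = (fun w => X w j ord0 + \sum_(k < d)
        (if (k < i)%N then increment W s t w k ord0 * col k (xi w) j ord0 else 0)).
      apply/funext => w; rewrite /Y mxE summxE big_mkcond/=; congr (_ + _).
      by apply: eq_bigr => k _; case: ifP => // _; rewrite mxE.
    apply: measurable_funD; first exact: measurable_past_coord.
    apply: (@measurable_sum _ (g_sigma_algebraType (past_coord W s t i)) R setT 'I_d _
      (fun k w => if (k < i)%N
      then increment W s t w k ord0 * col k (xi w) j ord0 else 0)) => k.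
    have [ki|_] := boolP (k < i)%N; last exact: measurable_cst.
    apply: measurable_funM; first exact: measurable_past_coord_increment.
    by apply: measurable_past_coord; exact: mcol.
  have -> : I i.+1 = (\int[P]_w (Phi (tau i.+1 w,
      (Y i w + increment W s t w i ord0 *: col i (xi w))%R))%:E)%E.
    by apply: eq_integral => w _; rewrite YS.
  rewrite (increment_freezing (i := i) bm s0 st (tau := tau i.+1) (Y := Y i)
     (e := fun w => col i (xi w)) cPhi Phi0 (measurable_past_coord mtau) mY
     (fun j => measurable_past_coord (mcol i j))).
  apply: le_integral_nonneg => w _; first by rewrite lee_fin Phi0.
  have qh : quartic (fun z : R => Phi (tau i.+1 w, Y i w + z *: (Num.sqrt (t - s) *: col i (xi w)))).
    have -> : (fun z : R => Phi (tau i.+1 w, Y i w + z *: (Num.sqrt (t - s) *: col i (xi w)))) =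
        (fun z : R => value u0 (tau i.+1 w) (Y i w + z *: (Num.sqrt (t - s) *: col i (xi w))) - m).
      by apply/funext => z; rewrite /Phi value_funE.
    apply: quarticB; last exact: quartic_cst.
    by apply: quartic_modulus; exact: (admissible_value au0 (tau0 _ _)).1.
  rewrite gaussE_EFin// lee_fin tauS.
  apply: (@le_trans _ _ (heat (Num.sqrt (t - s) *: col i (xi w))
     (value u0 (tau i.+1 w)) (Y i w) - m)).
    rewrite /Phi lerB// value_funE; last by rewrite -tauS.
    apply: (value_le_heat L0 au0 scu0) => //.
    rewrite n2Z sqr_sqrtr// mulrA mulrCA mulfV ?pnatr_eq0// mulr1//.
  rewrite -heat_sub_cst; last exact: (admissible_value au0 (tau0 _ _)).1.
  rewrite le_eqVlt; apply/orP; left; apply/eqP; rewrite /heat; congr gaussE.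
  by apply/funext => z; rewrite /Phi value_funE.
have : forall k, (k <= d)%N -> (I 0%N <= I k)%E.
  elim => [//|k IH] kd; apply: le_trans (IH (ltnW kd)) _.
  exact: (step (Ordinal kd)).
by move/(_ d (leqnn _)).
Qed.

End value_step.
End lower_bound.


Section nonneg_real_integral.
Local Open Scope ereal_scope.
Context {d} {T : measurableType d} {R : realType} (mu : {measure set T -> \bar R}).
Implicit Types f g : T -> R.

Lemma integral_EFinD f g : measurable_fun setT f -> measurable_fun setT g ->
  (forall w, 0 <= f w)%R -> (forall w, 0 <= g w)%R ->
  \int[mu]_w (f w + g w)%:E = \int[mu]_w (f w)%:E + \int[mu]_w (g w)%:E.
Proof.
move=> mf mg f0 g0; rewrite -ge0_integralD//.
- by move=> w _; rewrite lee_fin.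
- exact/measurable_EFinP.
- by move=> w _; rewrite lee_fin.
- exact/measurable_EFinP.
Qed.

Lemma integral_EFinZ (c : R) f : measurable_fun setT f ->
  (forall w, 0 <= f w)%R -> (0 <= c)%R ->
  \int[mu]_w (c * f w)%:E = c%:E * \int[mu]_w (f w)%:E.
Proof.
move=> mf f0 c0; rewrite -ge0_integralZl_EFin//.
- by move=> w _; rewrite lee_fin.
- exact/measurable_EFinP.
Qed.

End nonneg_real_integral.

Lemma integral_prob_cst {d} {T : measurableType d} {R : realType} (P : probability T R) (c : R) :
  (\int[P]_w (c%:E) = c%:E)%E.
Proof.
rewrite -[LHS]/(\int[P]_w cst c%:E w)%E integral_cst// -[RHS]mule1; congr (_ * _)%E.
exact: probability_setT.
Qed.

Lemma measurable_f2 {d1} {X : measurableType d1} {R : realType} {d : nat} (A : X -> 'M[R]_d) :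
  (forall i j, measurable_fun setT (fun w => A w i j)) ->
  measurable_fun setT (fun w => f2 (A w)).
Proof.
move=> mA; apply: measurable_sum => i; apply: measurable_sum => j.
exact: measurable_funX.
Qed.

(** * Lower bound along simple processes *)

Section simple_integrals.
Context {R : realType} {d : nat} {disp : measure_display} {T : measurableType disp}.
Context (P : probability T R) (W : R -> T -> 'cV[R]_d).
Hypothesis bm : brownian_motion P W.
Local Notation V := 'cV[R]_d.

Section simple_path.
Context (t : R) (x : V) (H : simple_process W t).
Local Notation N := (sp_size H).
Local Notation tau := (sp_time H).
Local Notation xi := (sp_val H).

Definition simple_path k w : V :=
  x + \sum_(l < k) xi l w *m increment W (tau l) (tau l.+1) w.
Local Notation X := simple_path.

Lemma simple_pathE w : x + sp_integral H w = X N w.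
Proof. by []. Qed.

Lemma simple_pathS k w : X k.+1 w = X k w + xi k w *m increment W (tau k) (tau k.+1) w.
Proof. by rewrite /X big_ord_recr/= addrA. Qed.

Lemma sp_time_mono j k : (j <= k)%N -> (k <= N)%N -> tau j <= tau k.
Proof.
move=> /subnK <-; elim: (k - j)%N => // i IH; rewrite addSn => iN.
by apply: le_trans (IH (ltnW iN)) _; exact: sp_time_le.
Qed.

Lemma sp_time_nonneg k : (k <= N)%N -> 0 <= tau k.
Proof. by move=> kN; apply: le_trans (sp_time_ge0 H) _; exact: sp_time_mono. Qed.

Lemma sp_time_le_end k : (k <= N)%N -> tau k <= t.
Proof. by move=> kN; apply: le_trans (sp_time_end H); exact: sp_time_mono. Qed.

Lemma measurable_simple_path k i : (k <= N)%N ->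
  @measurable_fun _ _ (past_space W (tau k)) R setT (fun w => X k w i ord0).
Proof.
elim: k i => [|k IH] i kN.
  have -> : (fun w => X 0%N w i ord0) = (fun=> x i ord0).
    by apply/funext => w; rewrite /X big_ord0 addr0.
  exact: measurable_cst.
have -> : (fun w => X k.+1 w i ord0) = (fun w => X k w i ord0 +
    \sum_j xi k w i j * increment W (tau k) (tau k.+1) w j ord0).
  by apply/funext => w; rewrite simple_pathS !mxE.
have tk : tau k <= tau k.+1 by exact: sp_time_le.
have tk0 : 0 <= tau k by exact/sp_time_nonneg/ltnW.
apply: measurable_funD; first by apply: measurable_past_mono tk _; exact: IH (ltnW kN).
apply: (@measurable_sum _ (past_space W (tau k.+1)) R setT 'I_d _
  (fun j w => xi k w i j * increment W (tau k) (tau k.+1) w j ord0)) => j.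
apply: measurable_funM.
  by apply: measurable_past_mono tk _; exact: sp_measurable.
by apply: measurable_past_increment; [rewrite tk0 tk|rewrite (le_trans tk0 tk) lexx].
Qed.

Lemma increment_second_moment s r i : 0 <= s -> s <= r ->
  (\int[P]_w (increment W s r w i ord0 ^+ 2)%:E = (r - s)%:E)%E.
Proof.
move=> s0; rewrite le_eqVlt => /predU1P[<-|sr].
  rewrite subrr -[RHS](integral_prob_cst P 0); apply: eq_integral => w _.
  by rewrite /increment subrr mxE expr0n.
pose e : V := delta_mx i ord0.
have ne : n2 e = 1.
  rewrite /n2 (bigD1 i)//= big1 ?addr0 ?mxE ?eqxx ?expr1n// => j ji.
  by rewrite mxE (negbTE ji) expr0n.
have := increment_freezing (i := i) bm s0 sr (tau := fun=> 0) (Y := fun=> 0) (e := fun=> e)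
  (Phi := fun p => n2 p.2).
have -> : (\int[P]_w (n2 ((0 : R), (0 + increment W s r w i ord0 *: e)%R).2)%:E =
    \int[P]_w (increment W s r w i ord0 ^+ 2)%:E)%E.
  by apply: eq_integral => w _; rewrite /= add0r n2Z ne mulr1.
move=> ->.
- rewrite -[RHS](integral_prob_cst P); apply: eq_integral => w _.
  have sr0 : 0 <= r - s by rewrite subr_ge0 ltW.
  under eq_integral do rewrite /= add0r 2!n2Z ne mulr1 (sqr_sqrtr sr0) mulrC.
  have q2 : quartic (fun z : R => z ^+ 2) by exact: quartic_pow.
  by rewrite gaussE_EFin ?gaussEZ ?gaussE_sqr ?mulr1//; exact: quarticZ.
- by move=> p; apply: (@continuous_comp _ _ _ snd (@n2 R d)); [exact: cvg_snd|exact: n2_continuous].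
- by move=> p; exact: n2_ge0.
- exact: measurable_cst.
- by move=> j; exact: measurable_cst.
- by move=> j; exact: measurable_cst.
Qed.

Lemma increment_n2_moment s r : 0 <= s -> s <= r ->
  (\int[P]_w (n2 (increment W s r w))%:E < +oo)%E.
Proof.
move=> s0 sr; have r0 := le_trans s0 sr.
under eq_integral do rewrite /n2 -sumEFin.
rewrite ge0_integral_sum//.
- apply: lte_sum_pinfty => i _; rewrite increment_second_moment//; exact: ltry.
- move=> i; apply/measurable_EFinP/measurable_funX; exact: (measurable_increment bm).
- by move=> i w _; rewrite lee_fin sqr_ge0.
Qed.

Lemma simple_path_moment k : (k <= N)%N -> (\int[P]_w (n2 (X k w))%:E < +oo)%E.
Proof.
have mX j : (j <= N)%N -> measurable_fun setT (fun w => n2 (X j w)).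
  move=> jN; apply: (measurable_continuous_coord2 n2_continuous) => i.
  by apply: (measurable_past bm (s := tau j)); exact: measurable_simple_path.
elim: k => [|k IH] kN.
  rewrite (_ : (\int[P]_w _)%E = (n2 x)%:E) ?ltry// -[RHS](integral_prob_cst P).
  by apply: eq_integral => w _; rewrite /X big_ord0 addr0.
have [M hM] := sp_bounded H.
have M0 w : f2 (xi k w) <= M ^+ 2.
  rewrite -frobenius_sqr_mx lerXn2r ?nnegrE ?sqrtr_ge0//; last exact: hM.
  by apply: le_trans (hM k w kN); exact: sqrtr_ge0.
have tk : tau k <= tau k.+1 by exact: sp_time_le.
have tk0 : 0 <= tau k by exact/sp_time_nonneg/ltnW.
pose D w := n2 (increment W (tau k) (tau k.+1) w).
have mD : measurable_fun setT D.
  apply: (measurable_continuous_coord2 n2_continuous) => i.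
  by apply: (measurable_increment bm) => //; exact: le_trans tk0 tk.
have D0 w : 0 <= D w by exact: n2_ge0.
have M1 : 0 <= 2 * M ^+ 2 by rewrite mulr_ge0// sqr_ge0.
apply: (@le_lt_trans _ _ (\int[P]_w (2 * n2 (X k w) + (2 * M ^+ 2) * D w)%:E)%E).
  apply: le_integral_nonneg => w _; rewrite lee_fin ?n2_ge0// simple_pathS.
  apply: le_trans (n2D_le _ _) _; rewrite lerD2l -mulrA ler_pM2l//.
  by apply: le_trans (n2_mulmx _ _) _; rewrite ler_wpM2r// n2_ge0.
have mXk : measurable_fun setT (fun w => 2 * n2 (X k w)).
  by apply: measurable_funM => //; exact/mX/ltnW.
rewrite integral_EFinD//; last 3 first.
- exact: measurable_funM.
- by move=> w; rewrite mulr_ge0// n2_ge0.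
- by move=> w; rewrite mulr_ge0.
rewrite integral_EFinZ//; last 2 first.
- exact/mX/ltnW.
- by move=> w; exact: n2_ge0.
rewrite integral_EFinZ//.
apply: lte_add_pinfty; apply: lte_mul_pinfty; rewrite ?lee_fin//.
- exact/IH/ltnW.
- exact: increment_n2_moment.
Qed.

(** Half of [f2 A] is the rate at which the volatility A consumes time in [brownian_step].
    Admissible controls scaled by sqrt 2 have rate at most 1, but the simple processes that
    approximate them in L^2 may exceed it. *)
Definition excess (kap : R) (A : 'M[R]_d) : R := Num.max 0 (f2 A / 2 - 1 - kap).

Lemma excess_ge0 kap A : 0 <= excess kap A.
Proof. by rewrite le_max lexx. Qed.

(** Young's inequality bounds f2 A by (1 + kap) f2 B + (1 + 1 / kap) f2 (A - B); the tolerance kap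
    in [excess] cancels the first term exactly, since f2 B <= 2. *)
Lemma excess_le kap A B : 0 < kap -> f2 B <= 2 ->
  excess kap A <= (1 + kap^-1) / 2 * f2 (A - B).
Proof.
move=> k0 B2; have k1 : 0 < kap^-1 by rewrite invr_gt0.
rewrite /excess ge_max; apply/andP; split.
  by rewrite mulr_ge0 ?f2_ge0// divr_ge0// addr_ge0// ltW.
have := f2_young A B k0; nra.
Qed.

(* At most one summand of sp_eval is nonzero. *)
Lemma sum_excess_le (kap : R) (sigma : R -> T -> 'M[R]_d) w : 0 < kap ->
  (forall s, 0 <= s -> f2 (sigma s w) <= 2) ->
  ((\sum_(k < N) (tau k.+1 - tau k) * (((1 + kap^-1) / 2)^-1 * excess kap (xi k w)))%:E <=
   \int[lebesgue_measure]_(s in `[0%R, t]%classic)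
     (f2 (sp_eval H s w - sigma s w)%R)%:E)%E.
Proof.
move=> k0 s2; set c := (1 + kap^-1) / 2.
have c0 : 0 < c by rewrite divr_gt0// addr_gt0// invr_gt0.
pose a k := c^-1 * excess kap (xi k w).
have a0 k : 0 <= a k by rewrite mulr_ge0 ?excess_ge0// invr_ge0 ltW.
have mI k : measurable (`]tau k, tau k.+1]%classic : set R) by exact: measurable_itv.
have -> : ((\sum_(k < N) (tau k.+1 - tau k) * a k)%:E =
    \int[lebesgue_measure]_(s in `[0%R, t]%classic)
      \sum_(k < N) (a k * \1_(`]tau k, tau k.+1]%classic) s)%:E)%E.
  rewrite ge0_integral_sum//; last 2 first.
  - by move=> k; apply/measurable_EFinP/measurable_funM => //; exact: measurable_indic.
  - by move=> k s _; rewrite lee_fin mulr_ge0.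
  rewrite -sumEFin; apply: eq_bigr => -[k kN] _ /=.
  under eq_integral do rewrite EFinM.
  rewrite ge0_integralZl_EFin; last first.
  all: try first [exact: measurable_itv|exact/measurable_EFinP/measurable_indic|
    exact: a0|by move=> s _; rewrite lee_fin].
  rewrite integral_indic// mulrC EFinM; congr (_ * _)%E.
  have -> : `]tau k, tau k.+1]%classic `&` `[0, t]%classic = `]tau k, tau k.+1]%classic.
    apply/setIidl => s /=; rewrite !in_itv/= => /andP[ks sk].
    rewrite (le_trans _ (ltW ks)) ?sp_time_nonneg 1?ltnW//=.
    by apply: le_trans sk _; exact: sp_time_le_end.
  have tk : tau k <= tau k.+1 by exact: sp_time_le.
  rewrite [RHS](lebesgue_measure_itv `]tau k, tau k.+1])/= lte_fin.
  by case: ltgtP tk => // -> _; rewrite subrr.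
apply: le_integral_nonneg => s /=; rewrite in_itv/= => /andP[s0 _].
  by rewrite sumEFin lee_fin sumr_ge0// => k _; rewrite mulr_ge0.
rewrite sumEFin lee_fin.
have [[k ks]|nk] := pselect (exists k : 'I_N, tau k < s <= tau k.+1); last first.
  rewrite big1 ?f2_ge0// => k _; rewrite indicE; case: (boolP (s \in _)); rewrite ?mulr0//.
  by move=> /set_mem /=; rewrite in_itv/= => ks; case: nk; exists k.
have uniq_k (j : 'I_N) : j != k -> \1_(`]tau j, tau j.+1]%classic) s = 0 :> R.
  move=> jk; rewrite indicE; case: (boolP (s \in _)) => // /set_mem /=.
  rewrite in_itv/= => /andP[js sj]; case/andP: ks => ks sk.
  have [lt_jk|lt_kj|/val_inj e] := ltngtP j k; last by rewrite e eqxx in jk.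
    have := sp_time_mono lt_jk (ltnW (ltn_ord k)); lra.
  have := sp_time_mono lt_kj (ltnW (ltn_ord j)); lra.
have in_k : \1_(`]tau k, tau k.+1]%classic) s = 1 :> R by rewrite indicE mem_set//= in_itv.
rewrite (bigD1 k)//= in_k mulr1 big1 ?addr0; last by move=> j jk; rewrite uniq_k// mulr0.
have -> : sp_eval H s w = xi k w.
  rewrite /sp_eval (bigD1 k)//= in_k scale1r big1 ?addr0// => j jk.
  by rewrite uniq_k// scale0r.
rewrite /a mulrC ler_pdivrMr// mulrC; apply: excess_le => //; exact: s2.
Qed.

End simple_path.

Section lower_bound.
Context (m L : R) (u0 : V -> R).
Hypothesis L0 : 0 <= L.
Hypothesis au0 : admissible_fun m u0.
Hypothesis scu0 : forall y z, 2 * u0 y - 2 * L * n2 z <= u0 (y + z) + u0 (y - z).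
Local Notation u := (value_fun u0).

(** [J k] is the expected value after k steps, with time t - tau k left. Each step loses at most 2 L
    times its overrun of the allotted time, and the last value is at most u0. Subtracting m keeps
    all integrands nonnegative. *)
Lemma simple_lower_bound (t : R) (x : V) (H : simple_process W t) (kap : R) : 0 < kap ->
  ((value u0 t x - m)%:E <= \int[P]_w (u0 (x + sp_integral H w)%R - m)%:E +
    (2 * L)%:E * (\int[P]_w (\sum_(k < sp_size H) (sp_time H k.+1 - sp_time H k) *
       (kap + excess kap (sp_val H k w)))%:E))%E.
Proof.
move=> k0; set N := sp_size H; set tau := sp_time H; set xi := sp_val H.
have t0 : 0 <= t by apply: le_trans (sp_time_end H); exact: sp_time_nonneg.
have uc : continuous u by exact: (value_fun_continuous L0 au0 scu0).
have uc' : continuous (fun p => u p - m).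
  move=> p; apply: (@continuous_comp _ _ _ u (fun y => y - m)); [exact: uc|exact: continuous_subr].
have um p : 0 <= u p - m by rewrite subr_ge0; exact: (value_ge au0).
pose X := simple_path x H.
have mX k i : (k <= N)%N -> @measurable_fun _ _ (past_space W (tau k)) R setT (fun w => X k w i ord0).
  exact: measurable_simple_path.
have mX' k i : (k <= N)%N -> measurable_fun setT (fun w => X k w i ord0).
  by move=> kN; apply: (measurable_past bm (s := tau k)); exact: mX.
have mxi k i j : (k < N)%N -> @measurable_fun _ _ (past_space W (tau k)) R setT (fun w => xi k w i j).
  exact: sp_measurable.
have mf2 k : (k < N)%N -> measurable_fun setT (fun w => f2 (xi k w)).
  move=> kN; apply: measurable_f2 => i j.
  by apply: (measurable_past bm (s := tau k)); exact: mxi.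
have mex k : (k < N)%N -> measurable_fun setT (fun w => excess kap (xi k w)).
  move=> kN; apply: measurable_maxr => //; apply: measurable_funB => //.
  by apply: measurable_funB => //; apply: measurable_funM => //; exact: mf2.
pose h k := tau k.+1 - tau k.
have h0 k : (k < N)%N -> 0 <= h k by move=> kN; rewrite subr_ge0; exact: sp_time_le.
pose J k := (\int[P]_w (u (t - tau k, X k w) - m)%:E)%E.
pose c k w := h k * (kap + excess kap (xi k w)).
have c0 k w : (k < N)%N -> 0 <= c k w.
  by move=> kN; rewrite mulr_ge0 ?h0// addr_ge0 ?excess_ge0// ltW.
have mc k : (k < N)%N -> measurable_fun setT (c k).
  by move=> kN; apply: measurable_funM => //; apply: measurable_funD => //; exact: mex.
have L2 : 0 <= 2 * L by rewrite mulr_ge0.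
have step k : (k < N)%N -> (J k <= J k.+1 + (2 * L)%:E * \int[P]_w (c k w)%:E)%E.
  move=> kN; have a0 : 0 <= t - tau k.+1 by rewrite subr_ge0; exact: sp_time_le_end.
  have hk := h0 k kN.
  rewrite -integral_EFinZ//; [|exact: mc|by move=> w; exact: c0].
  have -> : J k.+1 = (\int[P]_w (u (t - tau k.+1, X k w + xi k w *m increment W (tau k) (tau k.+1) w)%R - m)%:E)%E.
    by apply: eq_integral => w _; rewrite /X simple_pathS.
  apply: le_trans (leeD (brownian_step bm L0 au0 scu0 (a := t - tau k.+1) a0
     (sp_time_nonneg (ltnW kN)) (sp_time_le kN) (X := X k) (xi := xi k)
     (fun i => mX k i (ltnW kN)) (fun i j => mxi k i j kN)) (lexx _)).
  have tf w : 0 <= (tau k.+1 - tau k) * f2 (xi k w) / 2.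
    by rewrite mulr_ge0// mulr_ge0 ?f2_ge0//; exact: hk.
  rewrite -integral_EFinD//; last 3 first.
  - apply: (measurable_continuous_coord uc').
      apply: measurable_funD => //; apply: measurable_funM => //.
      by apply: measurable_funM => //; exact: mf2.
    by move=> i; exact: mX' (ltnW kN).
  - by apply: measurable_funM => //; exact: mc.
  - by move=> w; rewrite mulr_ge0// c0.
  apply: le_integral_nonneg => w _; rewrite lee_fin ?um// addrAC lerD2r.
  rewrite !value_funE; [|exact: addr_ge0|by rewrite subr_ge0; exact/sp_time_le_end/ltnW].
  have -> : t - tau k = t - tau k.+1 + h k by rewrite /h; ring.
  have Mf := excess_ge0 kap (xi k w).
  have Me : f2 (xi k w) / 2 - 1 - kap <= excess kap (xi k w) by rewrite le_max lexx orbT.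
  (* The step uses the time h k f2 / 2 instead of h k. A smaller time argument only raises the
     value; an overrun lowers it by at most 2 L times the surplus, which [c k] covers. *)
  have [f1|f1] := leP (f2 (xi k w) / 2) 1.
    apply: (@le_trans _ _ (value u0 (t - tau k.+1 + (tau k.+1 - tau k) * f2 (xi k w) / 2) (X k w))).
      apply: (value_noninc au0); rewrite lerD2l /h -mulrA -[leRHS]mulr1.
      by rewrite ler_wpM2l.
    by rewrite lerDl mulr_ge0// c0.
  have l0 : 0 <= h k * (f2 (xi k w) / 2 - 1) by rewrite mulr_ge0// subr_ge0 ltW.
  have := value_lip L0 au0 scu0 (X k w) (addr_ge0 a0 hk) l0.
  have -> : t - tau k.+1 + h k + h k * (f2 (xi k w) / 2 - 1) =
    t - tau k.+1 + (tau k.+1 - tau k) * f2 (xi k w) / 2 by rewrite /h; ring.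
  have : 2 * L * (h k * (f2 (xi k w) / 2 - 1)) <= 2 * L * c k w.
    by rewrite ler_wpM2l// /c ler_wpM2l//; lra.
  lra.
have acc k : (k <= N)%N -> (J 0%N <= J k + (2 * L)%:E * \int[P]_w (\sum_(j < k) c j w)%:E)%E.
  elim: k => [|k IH] kN.
    under eq_integral do rewrite big_ord0.
    by rewrite integral0 mule0 adde0.
  apply: le_trans (IH (ltnW kN)) _; apply: le_trans (leeD (step k kN) (lexx _)) _.
  rewrite -addeA leeD2l// -ge0_muleDr ?integral_ge0//; last 2 first.
  - by move=> w _; rewrite lee_fin c0.
  - by move=> w _; rewrite lee_fin sumr_ge0// => j _; rewrite c0// (ltn_trans _ kN).
  under [in leRHS]eq_integral do rewrite big_ord_recr/=.
  rewrite addeC integral_EFinD//.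
  - apply: measurable_sum => j; apply: mc; exact: ltn_trans kN.
  - exact: mc.
  - by move=> w; rewrite sumr_ge0// => j _; rewrite c0// (ltn_trans _ kN).
  - by move=> w; exact: c0.
have JN : (J N <= \int[P]_w (u0 (x + sp_integral H w)%R - m)%:E)%E.
  apply: le_integral_nonneg => w _; rewrite lee_fin ?um// lerD2r.
  exact: (value_le_u0 au0).
apply: le_trans (leeD JN (lexx _)); apply: le_trans (acc N (leqnn _)).
rewrite -(integral_prob_cst P); apply: le_integral_nonneg => w _; rewrite lee_fin.
  by rewrite subr_ge0; exact: (value_ge au0).
rewrite lerD2r /X /simple_path big_ord0 addr0 value_funE.
  by apply: (value_noninc au0); rewrite gerBl; exact: sp_time_nonneg.
by rewrite subr_ge0; exact: sp_time_le_end.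
Qed.

End lower_bound.
End simple_integrals.


Section expectation_datum.
Context {R : realType} {d : nat} {disp : measure_display} {T : measurableType disp}.
Context (P : probability T R).
Local Notation V := 'cV[R]_d.
Context (m : R) (u0 : V -> R).
Hypothesis au0 : admissible_fun m u0.
Context (Y : T -> V).
Hypothesis mY : forall i, measurable_fun setT (fun w => Y w i ord0).
Hypothesis Y2 : (\int[P]_w (n2 (Y w))%:E < +oo)%E.

Lemma measurable_n2 : measurable_fun setT (fun w => n2 (Y w)).
Proof. exact: (measurable_continuous_coord2 n2_continuous). Qed.

Lemma measurable_datum : measurable_fun setT (fun w => u0 (Y w)).
Proof. exact: (measurable_continuous_coord2 (modulus_continuous au0.1)). Qed.

Lemma n2_moment_fin : exists2 a, 0 <= a & (\int[P]_w (n2 (Y w))%:E = a%:E)%E.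
Proof.
have : (0 <= \int[P]_w (n2 (Y w))%:E)%E by apply: integral_ge0 => w _; rewrite lee_fin n2_ge0.
case: (\int[P]_w (n2 (Y w))%:E)%E Y2 => // a _; rewrite lee_fin => a0; by exists a.
Qed.

(** Quadratic growth of u0 and the finite second moment make u0 (Y) integrable, so the signed
    expectation can be replaced by the integral of a nonnegative function. *)
Lemma expectation_datum :
  ('E_P[fun w => u0 (Y w)] = \int[P]_w (u0 (Y w) - m)%:E + m%:E)%E /\
  (\int[P]_w (u0 (Y w) - m)%:E < +oo)%E.
Proof.
have [K K0 hK] := modulus_growth au0.1.
have mD : measurable_fun setT (fun w => u0 (Y w) - m).
  by apply: measurable_funB => //; exact: measurable_datum.
have D0 w : 0 <= u0 (Y w) - m by rewrite subr_ge0 au0.2.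
have fin : (\int[P]_w (u0 (Y w) - m)%:E < +oo)%E.
  have [a a0 ha] := n2_moment_fin.
  apply: (@le_lt_trans _ _ (\int[P]_w ((K + `|m|) + K * n2 (Y w))%:E)%E).
    apply: le_integral_nonneg => w _; rewrite lee_fin//.
    have := hK (Y w); rewrite ler_norml => /andP[_ h].
    have := ler_norm (- m); rewrite normrN; lra.
  rewrite integral_EFinD//.
  - rewrite integral_prob_cst integral_EFinZ//; last by move=> w; exact: n2_ge0.
      by rewrite ha -EFinM -EFinD ltry.
    exact: measurable_n2.
  - by apply: measurable_funM => //; exact: measurable_n2.
  - by move=> _; rewrite addr_ge0.
  - by move=> w; rewrite mulr_ge0// n2_ge0.
split => //.
have iD : P.-integrable setT (EFin \o (fun w => u0 (Y w) - m)).
  apply/integrableP; split; first exact/measurable_EFinP.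
  by under eq_integral do rewrite /= ger0_norm//.
have -> : ('E_P[fun w => u0 (Y w)] = \int[P]_w (u0 (Y w))%:E)%E by rewrite unlock.
have -> : (\int[P]_w (u0 (Y w))%:E =
    \int[P]_w ((EFin \o (fun w => u0 (Y w) - m)%R) w + (EFin \o cst m) w))%E.
  by apply: eq_integral => w _; rewrite /= -EFinD subrK.
rewrite integralD//; last exact: finite_measure_integrable_cst.
by congr (_ + _)%E; exact: integral_prob_cst.
Qed.

End expectation_datum.

(** * Lower bound for all admissible controls *)

Section control_lower_bound.
Context {R : realType} {d : nat} {disp : measure_display} {T : measurableType disp}.
Context (P : probability T R) (W : R -> T -> 'cV[R]_d).
Hypothesis bm : brownian_motion P W.
Local Notation V := 'cV[R]_d.
Context (m L : R) (u0 : V -> R).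
Hypothesis L0 : 0 <= L.
Hypothesis au0 : admissible_fun m u0.
Hypothesis scu0 : forall y z, 2 * u0 y - 2 * L * n2 z <= u0 (y + z) + u0 (y - z).

Lemma near_ereal0_lt (f : nat -> \bar R) (e : R) : f n @[n --> \oo] --> 0%E -> 0 < e ->
  \forall n \near \oo, (f n < e%:E)%E.
Proof.
move=> f0 e0; have := f0 [set y | (y < e%:E)%E]; apply.
exact: (@nbhs_open_ereal_lt R 0 (fun=> e)).
Qed.

Lemma measurable_sp_integral t (H : simple_process W t) i :
  measurable_fun setT (fun w => sp_integral H w i ord0).
Proof.
have := measurable_simple_path 0 i (leqnn (sp_size H)) => /(measurable_past bm).
have -> // : (fun w => simple_path 0 H (sp_size H) w i ord0) = (fun w => sp_integral H w i ord0).
by apply/funext => w; rewrite -simple_pathE add0r.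
Qed.

Lemma control_lower_bound t x sigma I : 0 <= t -> admissible_control W sigma ->
  ito_integral P W (fun s w => Num.sqrt 2 *: sigma s w) t I ->
  ((value u0 t x)%:E <= 'E_P[fun w => u0 (x + I w)%R])%E.
Proof.
move=> t0 [_ s1] [mI [H [Hs HI]]].
pose sg s w := Num.sqrt 2 *: sigma s w.
have sg2 s w : 0 <= s -> f2 (sg s w) <= 2.
  move=> s0; rewrite f2Z sqr_sqrtr// -frobenius_sqr_mx ger_pMr//.
  by rewrite exprn_ile1 ?sqrtr_ge0//; exact: s1.
have mxI i : measurable_fun setT (fun w => (x + I w) i ord0).
  have -> : (fun w => (x + I w) i ord0) = (fun w => x i ord0 + I w i ord0).
    by apply/funext => w; rewrite mxE.
  exact: measurable_funD.
pose S n := sp_integral (H n).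
pose D n w := n2 (S n w - I w).
have D0 n w : 0 <= D n w by exact: n2_ge0.
have mD n : measurable_fun setT (D n).
  apply: (measurable_continuous_coord2 n2_continuous) => i.
  have -> : (fun w => (S n w - I w) i ord0) = (fun w => S n w i ord0 - I w i ord0).
    by apply/funext => w; rewrite !mxE.
  by apply: measurable_funB => //; exact: measurable_sp_integral.
pose eD n := (\int[P]_w (D n w)%:E)%E.
have eD0 : eD n @[n --> \oo] --> 0%E.
  move: HI; rewrite (_ : (fun n => _) = eD)//; apply/funext => n; rewrite unlock.
  by apply: eq_integral => w _; rewrite frobenius_sqr.
pose eS n := (\int[P]_w \int[lebesgue_measure]_(s in `[0%R, t]%classic)
     (f2 (sp_eval (H n) s w - sg s w)%R)%:E)%E.
have eS0 : eS n @[n --> \oo] --> 0%E.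
  move: Hs; rewrite (_ : (fun n => _) = eS)//; apply/funext => n.
  apply: eq_integral => w _; apply: eq_integral => s _.
  by rewrite frobenius_sqr_mx.
have Y2 : (\int[P]_w (n2 (x + I w)%R)%:E < +oo)%E.
  have [n _ hn] := near_ereal0_lt eD0 ltr01; have {}hn := hn n (leqnn n).
  have mXn : measurable_fun setT (fun w => n2 (x + S n w)).
    apply: (measurable_continuous_coord2 n2_continuous) => i.
    have -> : (fun w => (x + S n w) i ord0) = (fun w => x i ord0 + S n w i ord0).
      by apply/funext => w; rewrite mxE.
    by apply: measurable_funD => //; exact: measurable_sp_integral.
  apply: (@le_lt_trans _ _ (\int[P]_w (2 * n2 (x + S n w) + 2 * D n w)%:E)%E).
    apply: le_integral_nonneg => w _; rewrite lee_fin ?n2_ge0//.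
    have -> : x + I w = (x + S n w) + (- (S n w - I w)) by rewrite opprB addrACA subrr addr0.
    by rewrite -[D n w]n2N; exact: n2D_le.
  rewrite integral_EFinD//.
  - rewrite !integral_EFinZ//; last by move=> w; exact: n2_ge0.
    apply: lte_add_pinfty; apply: lte_mul_pinfty => //.
      exact: (simple_path_moment bm x (leqnn (sp_size (H n)))).
    by apply: lt_trans hn _; exact: ltry.
  - exact: measurable_funM.
  - exact: measurable_funM.
  - by move=> w; rewrite mulr_ge0// n2_ge0.
  - by move=> w; rewrite mulr_ge0.
have [a a0 ha] := n2_moment_fin Y2.
have [-> bfin] := expectation_datum au0 mxI Y2.
set b := (\int[P]_w _)%E in bfin *.
suff : ((value u0 t x - m)%:E <= b)%E.
  have : (0 <= b)%E.
    by apply: integral_ge0 => w _; rewrite lee_fin subr_ge0 au0.2.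
  by case: b bfin => // b _ _; rewrite -EFinD !lee_fin lerBlDr.
apply/lee_addgt0Pr => e e0.
(* Four errors of at most e / 4: del (1 + a), C times the squared L^2 distance of the stochastic
   integrals, 2 L kap t, and 2 L c times the squared L^2 distance of the integrands. The index n
   comes last, as c depends on kap. *)
pose del := e / (4 * (1 + a)).
have a1 : 0 < 1 + a by rewrite ltr_wpDr.
have del0 : 0 < del by rewrite divr_gt0// mulr_gt0.
have [C C0 hC] := au0.1 del del0.
pose kap := e / (8 * (L * t + 1)).
have Lt1 : 0 < L * t + 1 by rewrite ltr_wpDl// mulr_ge0.
have k0 : 0 < kap by rewrite divr_gt0// mulr_gt0.
pose c := (1 + kap^-1) / 2.
have c0 : 0 < c by rewrite divr_gt0// addr_gt0// invr_gt0.
have e1 : 0 < e / (8 * (L * c + 1)).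
  by rewrite divr_gt0// mulr_gt0// ltr_wpDl// mulr_ge0// ltW.
have e2 : 0 < e / (4 * (C + 1)) by rewrite divr_gt0// mulr_gt0// ltr_wpDl.
have [n1 _ h1] := near_ereal0_lt eS0 e1; have [n2' _ h2] := near_ereal0_lt eD0 e2.
pose n := maxn n1 n2'.
have {}h1 : (eS n < (e / (8 * (L * c + 1)))%:E)%E by apply: h1; rewrite /= leq_maxl.
have {}h2 : (eD n < (e / (4 * (C + 1)))%:E)%E by apply: h2; rewrite /= leq_maxr.
have := simple_lower_bound bm L0 au0 scu0 x (H n) k0.
set c1 := (\int[P]_w _)%E; set c2 := (\int[P]_w _)%E => main.
have mn : measurable_fun setT (fun w => n2 (x + I w)) by exact: measurable_n2.
have mu : measurable_fun setT (fun w => u0 (x + I w) - m).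
  by apply: measurable_funB => //; exact: (measurable_datum au0).
have u00 w : 0 <= u0 (x + I w) - m by rewrite subr_ge0 au0.2.
have md : measurable_fun setT (fun w => del * (1 + n2 (x + I w))).
  by apply: measurable_funM => //; exact: measurable_funD.
have d0 w : 0 <= del * (1 + n2 (x + I w)).
  by rewrite mulr_ge0 ?(ltW del0)// addr_ge0// n2_ge0.
have c1b : (c1 <= b + (e / 2)%:E)%E.
  apply: (@le_trans _ _ (\int[P]_w (u0 (x + I w) - m + (del * (1 + n2 (x + I w)) + C * D n w))%:E)%E).
    apply: le_integral_nonneg => w _; rewrite lee_fin ?subr_ge0 ?au0.2// -/(S n).
    have -> : x + S n w = (x + I w) + (S n w - I w) by rewrite addrACA subrr addr0.
    have := hC (x + I w) (S n w - I w); rewrite -/(D n w); lra.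
  have mCD : measurable_fun setT (fun w => C * D n w) by exact: measurable_funM.
  have CD0 w : 0 <= C * D n w by rewrite mulr_ge0.
  rewrite integral_EFinD//; last 2 first.
  - exact: measurable_funD.
  - by move=> w; rewrite addr_ge0.
  rewrite leeD2l// integral_EFinD// (integral_EFinZ P (f := fun w => 1 + n2 (x + I w))).
  all: try first [exact: measurable_funD|exact: ltW|by move=> w; rewrite addr_ge0// n2_ge0].
  rewrite integral_EFinD//; last by move=> w; exact: n2_ge0.
  rewrite integral_prob_cst ha integral_EFinZ// -/(eD n).
  have -> : (e / 2 = del * (1 + a) + e / 4)%R by rewrite /del; field; rewrite gt_eqF.
  rewrite EFinD; apply: leeD; first by rewrite -EFinD -EFinM.
  apply: (@le_trans _ _ (C%:E * (e / (4 * (C + 1)))%:E)%E).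
    by apply: lee_wpmul2l; rewrite ?lee_fin// ltW.
  rewrite -EFinM lee_fin.
  have -> : C * (e / (4 * (C + 1))) = e / 4 * (C / (C + 1)) by field; rewrite gt_eqF// ltr_wpDl.
  by rewrite ger_pMr ?divr_gt0// ler_pdivrMr ?ltr_wpDl// mul1r lerDl.
have c2b : ((2 * L)%:E * c2 <= (e / 2)%:E)%E.
  pose h k := sp_time (H n) k.+1 - sp_time (H n) k.
  pose N := sp_size (H n).
  have h0 (k : 'I_N) : 0 <= h k by rewrite subr_ge0; exact: sp_time_le.
  pose G w := \sum_(k < N) h k * (c^-1 * excess kap (sp_val (H n) k w)).
  have G0 w : 0 <= G w.
    apply: sumr_ge0 => k _; rewrite mulr_ge0 ?h0// mulr_ge0 ?excess_ge0//.
    by rewrite invr_ge0 ltW.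
  have mG : measurable_fun setT G.
    apply: measurable_sum => k; do 2 apply: measurable_funM => //.
    apply: measurable_maxr => //; do 2 apply: measurable_funB => //.
    apply: measurable_funM => //; apply: measurable_f2 => i j.
    by apply: (measurable_past bm (s := sp_time (H n) k)); exact: sp_measurable.
  have GS : (\int[P]_w (G w)%:E <= eS n)%E.
    apply: le_integral_nonneg => w _; first by rewrite lee_fin.
    by apply: sum_excess_le => // s s0; exact: sg2.
  have c2G : (c2 <= (kap * t)%:E + c%:E * \int[P]_w (G w)%:E)%E.
    rewrite -integral_EFinZ//; last exact: ltW.
    rewrite -(integral_prob_cst P) -integral_EFinD//; last 3 first.
    - exact: measurable_funM.
    - by move=> _; rewrite mulr_ge0// ltW.
    - by move=> w; rewrite mulr_ge0// ltW.
    apply: le_integral_nonneg => w _; rewrite lee_fin.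
      by apply: sumr_ge0 => k _; rewrite mulr_ge0 ?h0// addr_ge0 ?excess_ge0// ltW.
    rewrite /G mulr_sumr.
    have -> : \sum_(k < N) c * (h k * (c^-1 * excess kap (sp_val (H n) k w))) =
       \sum_(k < N) h k * excess kap (sp_val (H n) k w).
      by apply: eq_bigr => k _; field; rewrite gt_eqF.
    have -> : \sum_(k < N) h k * (kap + excess kap (sp_val (H n) k w)) =
       (\sum_(k < N) h k) * kap + \sum_(k < N) h k * excess kap (sp_val (H n) k w).
      by rewrite mulr_suml -big_split; apply: eq_bigr => k _; rewrite /= mulrDr.
    rewrite lerD2r mulrC ler_pM2l//.
    rewrite -(big_mkord xpredT h) /h telescope_sumr//.
    have := sp_time_end (H n); have := sp_time_ge0 (H n); lra.
  apply: (@le_trans _ _ ((2 * L)%:E * ((kap * t)%:E + c%:E * (e / (8 * (L * c + 1)))%:E))%E).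
    apply: lee_wpmul2l => //; rewrite ?lee_fin ?mulr_ge0//.
    apply: le_trans c2G _; rewrite leeD2l//; apply: lee_wpmul2l; rewrite ?lee_fin ?(ltW c0)//.
    by apply: le_trans GS (ltW h1).
  rewrite -[leLHS]/((2 * L * (kap * t + c * (e / (8 * (L * c + 1)))))%:E) lee_fin.
  have Lc : 0 < L * c + 1 by rewrite ltr_wpDl// mulr_ge0// ltW.
  have -> : 2 * L * (kap * t + c * (e / (8 * (L * c + 1)))) =
    e / 4 * ((L * t) / (L * t + 1) + (L * c) / (L * c + 1)).
    by rewrite /kap; field; rewrite !gt_eqF.
  have f1 : L * t / (L * t + 1) <= 1 by rewrite ler_pdivrMr// mul1r lerDl.
  have f2' : L * c / (L * c + 1) <= 1 by rewrite ler_pdivrMr// mul1r lerDl.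
  nra.
apply: le_trans main _; apply: le_trans (leeD c1b c2b) _.
by rewrite -addeA -EFinD; have -> : e / 2 + e / 2 = e by field.
Qed.

Lemma control_value_ge t x : 0 <= t -> ((value u0 t x)%:E <= control_value P W u0 t x)%E.
Proof.
move=> t0; apply: le_ereal_inf_tmp => _ [sigma [I [ac ito ->]]].
exact: control_lower_bound ito.
Qed.

End control_lower_bound.

(** * The datum and its convex envelope *)


Section datum.
Context {R : realType} {d : nat} (u0 : 'cV[R]_d -> R).
Local Notation V := 'cV[R]_d.
Implicit Types x y z : V.

Section C11_datum.
Hypothesis u0C : C11 u0.

Lemma derive_gradient x z : 'D_z u0 x = dot (gradient u0 x) z.
Proof.
have du := u0C.1.1 x I.
rewrite {1}(vec_basisE z) deriveE// linear_sum/= /dot; apply: eq_bigr => i _.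
by rewrite linearZ/= mxE -deriveE// mulrC.
Qed.

(** The mean value theorem on the segment compares the gradient at an intermediate point with the
    one at x; hence the constant is the Lipschitz constant of the gradient rather than its half. *)
Lemma C11_Taylor : exists2 L, 0 <= L & forall x z,
  `|u0 (x + z) - u0 x - dot (gradient u0 x) z| <= L * n2 z.
Proof.
have [[du _] [L hL]] := u0C.
exists (Num.max L 0); first by rewrite le_max lexx orbT.
set L' := Num.max L 0; have L0 : 0 <= L' by rewrite le_max lexx orbT.
move=> x z.
have [|c /andP[c0 c1]] := @MVT_line R (fun s => u0 (x + s *: z))
    (fun s => dot (gradient u0 (x + s *: z)) z).
  move=> s; rewrite -derive_gradient; apply: is_derive_line.
  exact/diff_derivable/du.
rewrite scale1r scale0r addr0 => ->.
set g := gradient u0 (x + c *: z).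
have -> : dot g z - dot (gradient u0 x) z = dot (g - gradient u0 x) z.
  by rewrite dotDl -[- gradient _ _]scaleN1r dotZl mulN1r.
set e := g - _.
have ne : n2 e <= L' ^+ 2 * n2 z.
  rewrite -!frobenius_sqr -exprMn lerXn2r ?nnegrE ?mulr_ge0 ?sqrtr_ge0//.
  apply: le_trans (hL _ _) _; rewrite [_ + _ - x]addrAC subrr add0r !frobeniusE n2Z.
  apply: (@le_trans _ _ (L' * Num.sqrt (c ^+ 2 * n2 z))).
    by rewrite ler_wpM2r ?sqrtr_ge0// le_max lexx.
  rewrite ler_wpM2l// ler_wsqrtr// ler_piMl ?n2_ge0// exprn_ile1 ?ltW//.
have := CS e z => cs.
have : `|dot e z| ^+ 2 <= (L' * n2 z) ^+ 2.
  rewrite real_normK ?num_real//; apply: le_trans cs _.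
  by rewrite [(L' * _) ^+ 2]exprMn [n2 z ^+ 2]expr2 mulrA ler_wpM2r ?n2_ge0.
by move=> h; rewrite -(@ler_pXn2r _ 2) ?nnegrE ?mulr_ge0 ?n2_ge0.
Qed.

Lemma C11_semiconvex : exists2 L, 0 <= L & forall y z,
  2 * u0 y - 2 * L * n2 z <= u0 (y + z) + u0 (y - z).
Proof.
have [L L0 hL] := C11_Taylor; exists L => // y z.
have := hL y z; have := hL y (- z).
rewrite n2N -[- z]scaleN1r dotZr mulN1r !ler_norml => /andP[? _] /andP[? _]; lra.
Qed.

(** The gradient grows at most linearly, so Young's inequality with a small weight on its square
    splits the first order term into del (1 + |x|^2) and a multiple of |z|^2. D is such that
    |gradient|^2 <= 2 D (1 + |x|^2). *)
Lemma C11_modulus : modulus u0.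
Proof.
have [[du _] [L hL]] := u0C; have [K K0 hK] := C11_Taylor.
pose g0 := n2 (gradient u0 0).
have g00 : 0 <= g0 by exact: n2_ge0.
have gb x : n2 (gradient u0 x) <= 2 * g0 + 2 * L ^+ 2 * n2 x.
  rewrite -[gradient u0 x](subrK (gradient u0 0)); apply: le_trans (n2D_le _ _) _.
  rewrite addrC lerD2l -mulrA ler_pM2l// -!frobenius_sqr -exprMn.
  have := hL x 0; rewrite subr0 => h.
  rewrite lerXn2r ?nnegrE ?sqrtr_ge0//; exact: le_trans (sqrtr_ge0 _) h.
move=> del del0; pose D := g0 + L ^+ 2 + 1.
have D0 : 0 < D by rewrite ltr_wpDl// addr_ge0// sqr_ge0.
have c0 : 0 < del / D by rewrite divr_gt0.
exists (K + (del / D)^-1); first by rewrite addr_ge0// invr_ge0 ltW.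
move=> x z; have := hK x z; rewrite ler_norml => /andP[_ h].
have h2 := dot_le (gradient u0 x) z c0.
have x0 := n2_ge0 x; have z0 := n2_ge0 z.
have h3 : del / D * n2 (gradient u0 x) <= 2 * (del * (1 + n2 x)).
  apply: (@le_trans _ _ (del / D * (2 * (D * (1 + n2 x))))).
    rewrite (ler_wpM2l (ltW c0))//; apply: le_trans (gb x) _.
    have := sqr_ge0 L; rewrite /D; nra.
  by rewrite le_eqVlt; apply/orP; left; apply/eqP; field; rewrite gt_eqF.
have i0 : 0 <= (del / D)^-1 by rewrite invr_ge0 ltW.
have : 0 <= (del / D)^-1 * n2 z by rewrite mulr_ge0.
nra.
Qed.

End C11_datum.

Lemma superlinear_lower_bound : superlinear u0 -> modulus u0 -> exists m, forall y, m <= u0 y.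
Proof.
move=> su mu; have [r hr] := su 1; have [K K0 hK] := modulus_growth mu.
exists (- (K * (1 + r ^+ 2))) => y.
have [ry|yr] := ltP r (frobenius y).
  apply: (@le_trans _ _ 0).
    by rewrite oppr_le0 mulr_ge0// addr_ge0// sqr_ge0.
  (* The radius r may be negative, so y = 0 can occur here; the quotient is then 0 by the convention
     on division, against 1 <= 0. *)
  have := hr y ry; have [y0|y0 h] := leP (frobenius y) 0.
    have -> : frobenius y = 0 by apply/eqP; rewrite eq_le y0 sqrtr_ge0.
    by rewrite invr0 mulr0 ler10.
  apply: ltW; rewrite -(pmulr_lgt0 _ (x := (frobenius y)^-1)) ?invr_gt0//.
  by apply: lt_le_trans h.
have : n2 y <= r ^+ 2.
  rewrite -frobenius_sqr lerXn2r ?nnegrE ?sqrtr_ge0//.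
  by apply: le_trans yr; exact: sqrtr_ge0.
have := hK y; rewrite ler_norml => /andP[h _] h2; apply: le_trans h; rewrite lerN2.
by rewrite ler_wpM2l// lerD2l.
Qed.

Section envelope.
Context (m : R).
Hypothesis u0m : forall y, m <= u0 y.

Definition convex_minorant (w : V -> R) :=
  @convex_function R V setT w /\ forall y, w y <= u0 y.

Lemma minorant_conv w (s : R) x y : convex_minorant w -> 0 <= s -> s <= 1 ->
  w ((1 - s) *: x + s *: y) <= (1 - s) * w x + s * w y.
Proof.
move=> [cw _] s0 s1.
have := cw (Itv01 s0 s1) y x (mem_set I) (mem_set I).
rewrite [X in w X](_ : _ = (1 - s) *: x + s *: y); last by rewrite [RHS]addrC.
by rewrite convRE/= [leRHS]addrC; exact.
Qed.

Lemma minorant_midpoint w y z : convex_minorant w -> w y <= (w (y + z) + w (y - z)) / 2.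
Proof.
move=> cw; have h2 : (0 : R) <= 2^-1 by rewrite invr_ge0.
have h1 : 2^-1 <= 1 :> R by rewrite invf_le1// ler1n.
have := minorant_conv (y + z) (y - z) cw h2 h1.
have -> : (1 - 2^-1) *: (y + z) + 2^-1 *: (y - z) = y.
  have -> : 1 - 2^-1 = 2^-1 :> R by field.
  by rewrite -scalerDr addrACA subrr addr0 -mulr2n -[y *+ 2]scaler_nat scalerA mulVf ?scale1r.
lra.
Qed.

Lemma convex_minorant_cst : convex_minorant (fun=> m).
Proof.
by split=> // t x y _ _; rewrite convmm.
Qed.

Lemma minorant_le_envelope w x : convex_minorant w -> w x <= convex_envelope u0 x.
Proof.
move=> cw; apply: ub_le_sup; last by exists w.
by exists (u0 x) => _ [v [_ vu] <-].
Qed.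

Lemma envelope_le (c : R) x : (forall w, convex_minorant w -> w x <= c) -> convex_envelope u0 x <= c.
Proof.
move=> h; apply: ge_sup; last by move=> _ [w cw <-]; exact: h.
(* The constant minorant m makes the set nonempty; on an empty set [sup] would return its default
   value. *)
by exists m, (fun=> m) => //; exact: convex_minorant_cst.
Qed.

Lemma envelope_le_datum x : convex_envelope u0 x <= u0 x.
Proof. by apply: envelope_le => w [_]. Qed.

Lemma envelope_conv (s : R) x y : 0 <= s -> s <= 1 ->
  convex_envelope u0 ((1 - s) *: x + s *: y) <=
  (1 - s) * convex_envelope u0 x + s * convex_envelope u0 y.
Proof.
move=> s0 s1; apply: envelope_le => w cw; apply: le_trans (minorant_conv _ _ cw s0 s1) _.
by apply: lerD; apply: ler_wpM2l; rewrite ?subr_ge0//; exact: minorant_le_envelope.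
Qed.

Lemma envelope_midpoint y z :
  convex_envelope u0 y <= (convex_envelope u0 (y + z) + convex_envelope u0 (y - z)) / 2.
Proof.
apply: envelope_le => w cw; apply: le_trans (minorant_midpoint y z cw) _.
by rewrite ler_pM2r ?invr_gt0//; apply: lerD; exact: minorant_le_envelope.
Qed.

(* On the sphere itself, follow the ray through x: convexity of the envelope
   between x and 2 x, and continuity of u0. *)
Lemma datum_eq_envelope (R0 : R) x : continuous u0 -> 0 < R0 ->
  (forall x, R0 < frobenius x -> u0 x = convex_envelope u0 x) ->
  R0 <= frobenius x -> u0 x = convex_envelope u0 x.
Proof.
move=> cu R00 hR xR; apply/eqP; rewrite eq_le envelope_le_datum andbT.
set e := convex_envelope u0.
pose g (s : R) := u0 (x + s *: x) - ((1 - s) * e x + s * e (2 *: x)).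
have cg : continuous g.
  move=> s; apply: cvgB; first by apply: (@continuous_comp _ _ _ (fun s : R => x + s *: x) u0); [exact: continuous_line|exact: cu].
  by apply: cvgD; apply: cvgM; [apply: cvgB; [exact: cvg_cst|exact: cvg_id]|exact: cvg_cst|exact: cvg_id|exact: cvg_cst].
have g0 : g 0 = u0 x - e x by rewrite /g scale0r mul0r !addr0 subr0 mul1r.
rewrite -subr_le0 -g0.
have gpos (s : R) : 0 < s -> s <= 1 -> g s <= 0.
  move=> s0 s1; rewrite /g subr_le0 hR; last first.
    rewrite frobeniusE -[X in X + _]scale1r -scalerDl n2Z sqrtrM ?sqr_ge0// sqrtr_sqr.
    rewrite -frobeniusE ger0_norm; last by lra.
    have := lt_le_trans R00 xR; nra.
  have -> : x + s *: x = (1 - s) *: x + s *: (2 *: x).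
    by rewrite scalerA -scalerDl -[X in X + _]scale1r -scalerDl; congr (_ *: _); ring.
  exact: envelope_conv (ltW s0) s1.
have cr : g s @[s --> 0^'+] --> g 0 by exact: cvg_at_right_filter (cg 0).
rewrite -(cvg_lim (@Rhausdorff R) cr); apply: limr_le; first exact: cvgP cr.
near=> s; apply: gpos; near: s.
  exact: nbhs_right_gt.
by apply: nbhs_right_le; exact: ltr01.
Unshelve. all: by end_near.
Qed.

End envelope.
End datum.

(** * Steklov averages *)


Section unit_average.
Context {R : realType}.
Local Notation mu := (@lebesgue_measure R).
Implicit Types g : R -> R.

Definition average g : R := \int[mu]_(s in `[0, 1]) g s.

Lemma average_integrable g : continuous g -> mu.-integrable `[0, 1] (EFin \o g).
Proof.
move=> cg; apply: continuous_compact_integrable; first exact: segment_compact.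
exact: continuous_subspaceT.
Qed.

Lemma average_cst (k : R) : average (fun=> k) = k.
Proof.
rewrite /average Rintegral_cst; last exact: measurable_itv.
by rewrite [X in fine X](lebesgue_measure_itv `[0, 1])/= lte_fin ltr01 oppr0 adde0 mulr1.
Qed.

Lemma averageB g (h : R -> R) : continuous g -> continuous h ->
  average (fun s => g s - h s) = average g - average h.
Proof. by move=> cg ch; apply: RintegralB => //; exact: average_integrable. Qed.

Lemma le_average g (h : R -> R) : continuous g -> continuous h ->
  (forall s, 0 <= s <= 1 -> g s <= h s) -> average g <= average h.
Proof.
move=> cg ch gh; apply: le_Rintegral; [exact: measurable_itv|exact: average_integrable|
  exact: average_integrable|by move=> s /=; rewrite in_itv/=; exact: gh].
Qed.

Lemma average_le (k : R) g : continuous g ->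
  (forall s, 0 <= s <= 1 -> g s <= k) -> average g <= k.
Proof.
by move=> cg gk; rewrite -(average_cst k); apply: le_average => // s; exact: cvg_cst.
Qed.

Lemma average_ge (k : R) g : continuous g ->
  (forall s, 0 <= s <= 1 -> k <= g s) -> k <= average g.
Proof.
by move=> cg gk; rewrite -(average_cst k); apply: le_average => // s; exact: cvg_cst.
Qed.

(** For |h| < 1 the average is F (1 + h) - F h with F a primitive of g. The interval [-2, 3] leaves
    room around all the points s + h. *)
Lemma average_derive g : continuous g ->
  is_derive (0 : R) (1 : R) (fun h => average (fun s => g (s + h))) (g 1 - g 0).
Proof.
move=> cg; pose F x : R := \int[mu]_(t in `[-2%:R, x]) g t.
have dF (x : R) : -2%:R < x -> x < 3 -> is_derive x (1 : R) F (g x).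
  move=> x2 x3; have [|dF F'] := @continuous_FTC1_closed R g (- 2%:R) x 3 x3 _ x2 (cg x).
    apply: continuous_compact_integrable; first exact: segment_compact.
    exact: continuous_subspaceT.
  by split; [exact: dF|rewrite -derive1E; exact: F'].
have shiftF (h x : R) : -2%:R < x + h -> x + h < 3 ->
    is_derive x (1 : R) (fun s => F (s + h)) (g (x + h)).
  move=> h2 h3; have dFh := dF _ h2 h3.
  have ds : is_derive x (1 : R) (fun s : R => s + h) (1 + 0).
    by apply: is_deriveD.
  have := @is_derive1_comp R F (fun s : R => s + h) x _ _ dFh ds.
  by rewrite addr0 mulr1.
have avgE (h : R) : `|h| < 1 -> average (fun s => g (s + h)) = F (1 + h) - F (0 + h).
  rewrite ltr_norml => /andP[h1 h2].
  have cgh : continuous (fun s => g (s + h)).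
    by move=> s; apply: (@continuous_comp _ _ _ (fun s => s + h) g); [exact: continuous_addr|exact: cg].
  have dh (x : R) : 0 <= x <= 1 -> is_derive x (1 : R) (fun s => F (s + h)) (g (x + h)).
    by move=> /andP[x0 x1]; apply: shiftF; lra.
  have cF (x : R) : 0 <= x <= 1 -> {for x, continuous (fun s => F (s + h))}.
    move=> /dh [dx _]; apply/differentiable_continuous.
    exact/derivable1_diffP.
  rewrite /average /Rintegral (@continuous_FTC2 R _ (fun s => F (s + h)) 0 1)//.
  - exact: continuous_subspaceT.
  - split.
    + by move=> x; rewrite in_itv/= => /andP[x0 x1]; have [] := dh x (introT andP (conj (ltW x0) (ltW x1))).
    + by apply: cvg_at_right_filter; apply: cF; rewrite lexx ler01.
    + by apply: cvg_at_left_filter; apply: cF; rewrite lexx ler01.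
  - move=> x; rewrite in_itv/= => /andP[x0 x1].
    have [_] := dh x (introT andP (conj (ltW x0) (ltW x1))).
    by rewrite derive1E.
have d1 : is_derive (0 : R) (1 : R) (fun h => F (1 + h)) (g 1).
  have := @shiftF 1 0; rewrite add0r => s1.
  have -> : (fun h => F (1 + h)) = (fun h => F (h + 1)) by apply/funext => h; rewrite addrC.
  by apply: s1; lra.
have d0 : is_derive (0 : R) (1 : R) (fun h => F (0 + h)) (g 0).
  have -> : (fun h => F (0 + h)) = F by apply/funext => h; rewrite add0r.
  by apply: dF; lra.
apply: (near_eq_is_derive _ (is_deriveB d1 d0)).
apply/nbhs_ballP; exists 1 => //= h; rewrite /ball/= sub0r normrN => h1.
by rewrite avgE.
Qed.

End unit_average.


Section exchange.
Context {R : realType}.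
Local Notation mu := (@lebesgue_measure R).

(** Fubini's theorem, justified by a majorant uniform in s. With nu the Lebesgue measure it makes
    two averages commute; with nu Gaussian it makes averages commute with [heat]. *)
Lemma average_exchange (nu : {sigma_finite_measure set (measurableTypeR R) -> \bar R})
    (D : set (measurableTypeR R)) (F : R -> R -> R) (H : R -> R) :
  measurable D ->
  measurable_fun setT (fun q : measurableTypeR R * measurableTypeR R => F q.1 q.2) ->
  nu.-integrable D (EFin \o H) ->
  (forall z s, D z -> 0 <= s <= 1 -> `|F z s| <= H z) ->
  mu.-integrable `[0, 1] (EFin \o (fun s => \int[nu]_(z in D) F z s)) /\
  \int[nu]_(z in D) average (F z) = average (fun s => \int[nu]_(z in D) F z s).
Proof.
move=> mD mF iH FH; set I := `[0, 1]%classic : set (measurableTypeR R).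
have mI : measurable I by exact: measurable_itv.
have inI s : s \in I -> 0 <= s <= 1 by move=> /set_mem; rewrite /I /= in_itv.
(* The factors are taken in the order (s, z), for which the library states the
   integrability of the partial integral in s. *)
pose G (q : measurableTypeR R * measurableTypeR R) : R := F q.2 q.1 * (\1_D q.2 * \1_I q.1).
have mG : measurable_fun setT G.
  apply: measurable_funM.
    exact: (measurableT_comp mF (measurable_fun_pair measurable_snd measurable_fst)).
  apply: measurable_funM.
    have m1 : measurable_fun setT (\1_D : measurableTypeR R -> R) by exact: measurable_indic.
    exact: (measurableT_comp m1 measurable_snd).
  have m1 : measurable_fun setT (\1_I : measurableTypeR R -> R) by exact: measurable_indic.
  exact: (measurableT_comp m1 measurable_fst).
have iG : (mu \x nu)%E.-integrable setT (EFin \o G).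
  apply/integrable21ltyP; first exact/measurable_EFinP.
  apply: (@le_lt_trans _ _ (\int[nu]_(z in D) `|(EFin \o H) z|)%E); last by have /integrableP[] := iH.
  rewrite [leRHS]integral_mkcond; apply: ge0_le_integral => //.
  - by move=> z _; apply: integral_ge0.
  - have mGa : measurable_fun setT (fun q : measurableTypeR R * measurableTypeR R => `|(G q)%:E|%E).
      by apply: measurableT_comp => //; exact/measurable_EFinP.
    have mF3 := @measurable_fun_fubini_tonelli_G _ _ _ _ R mu _ mGa (fun q => abse_ge0 _).
    exact: mF3.
  - apply/(measurable_restrictT _ mD); apply: measurableT_comp => //.
    by have /integrableP[] := iH.
  - move=> z _; rewrite patchE; case: ifPn => zD; last first.
      rewrite integral0_eq// => s _; rewrite /G/= [\1_D _]indicE (negbTE zD) mul0r mulr0.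
      by rewrite normr0.
    apply: (@le_trans _ _ (\int[mu]_(s in I) (`|H z|)%:E)%E); last first.
      rewrite integral_cst// [X in (_ * X)%E](lebesgue_measure_itv `[0, 1])/=.
      by rewrite lte_fin ltr01 oppr0 adde0 mule1.
    rewrite [leRHS]integral_mkcond; apply: le_integral_nonneg => s _ //.
    rewrite patchE; case: ifPn => sI; last first.
      by rewrite /G/= [\1_I _]indicE (negbTE sI) !mulr0 normr0.
    rewrite lee_fin /G/= !indicE zD sI !mulr1.
    by apply: le_trans (FH z s (set_mem zD) (inI s sI)) _; exact: ler_norm.
have mF1 z : measurable_fun setT (fun s : measurableTypeR R => F z s).
  apply: (measurableT_comp mF (g := fun s : measurableTypeR R => (z : measurableTypeR R, s))).
  exact: measurable_fun_pair.
have mF2 s : measurable_fun setT (fun z : measurableTypeR R => F z s).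
  apply: (measurableT_comp mF (g := fun z : measurableTypeR R => (z, s : measurableTypeR R))).
  exact: measurable_fun_pair.
have innerE s : s \in I ->
    (\int[nu]_x (EFin \o G) (s, x) = (\int[nu]_(z in D) F z s)%:E)%E.
  move=> sI; rewrite /Rintegral fineK.
    rewrite [RHS]integral_mkcond; apply: eq_integral => z _; rewrite patchE /G/= !indicE sI mulr1.
    by case: ifP => _; rewrite ?mulr1// mulr0.
  apply: integrable_fin_num => //.
  apply: (le_integrable mD (g := EFin \o H) (f := fun z => (F z s)%:E)).
  - by apply/measurable_EFinP/measurable_funTS; exact: mF2.
  - move=> z zD; rewrite lee_fin.
    by apply: le_trans (FH z s zD (inI s sI)) _; exact: ler_norm.
  - exact: iH.
split.
  have := integrable_fubini_F iG => /(integrableS measurableT mI (@subsetT _ _)).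
  by apply: (eq_integrable mI) => s sI; exact: innerE.
have := Fubini iG; rewrite /average /Rintegral => fub.
transitivity (fine (\int[nu]_x \int[mu]_y (EFin \o G) (y, x))%E).
  congr fine; rewrite integral_mkcond; apply: eq_integral => z _.
  rewrite patchE; case: ifPn => zD; last first.
    by rewrite integral0_eq// => s _; rewrite /G/= [\1_D _]indicE (negbTE zD) mul0r mulr0.
  rewrite fineK.
    rewrite integral_mkcond; apply: eq_integral => s _; rewrite patchE /G/= !indicE zD mul1r.
    by case: ifP => _; rewrite ?mulr1// mulr0.
  apply: integrable_fin_num => //.
  have ic : mu.-integrable I (EFin \o cst (H z)) by apply: average_integrable => s; exact: cvg_cst.
  have b1 (s : R) : I s -> (`|(F z s)%:E| <= `|(EFin \o cst (H z)) s|)%E.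
    rewrite /I /= in_itv/= lee_fin => sI.
    apply: le_trans (FH z s (set_mem zD) sI) _; exact: ler_norm.
  have b2 : measurable_fun I (fun s : measurableTypeR R => (F z s)%:E).
    by apply/measurable_EFinP/measurable_funTS; exact: mF1.
  refine (le_integrable mI b2 b1 ic).
rewrite -fub; congr fine; rewrite [RHS]integral_mkcond; apply: eq_integral => s _.
rewrite patchE; case: ifPn => sI; last first.
  by rewrite integral0_eq// => z _; rewrite /G/= [\1_I _]indicE (negbTE sI) !mulr0.
exact: innerE.
Qed.

End exchange.


(** Tube lemma in near-covering form: L is covered uniformly near each point of K, and then K is
    covered. *)
Lemma compact_setX {S T : topologicalType} (K : set S) (L : set T) :
  compact K -> compact L -> compact (K `*` L).
Proof.
move=> /compact_near_coveringP cK /compact_near_coveringP cL.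
apply/compact_near_coveringP => J F P FF cov.
have := cK J F (fun i x => forall y, L y -> P i (x, y)) FF.
have h x : K x -> \forall x' \near x & i \near F, forall y, L y -> P i (x', y).
  move=> Kx; have := cL (S * J)%type (filter_prod (nbhs x) F)
    (fun xi y => P xi.2 (xi.1, y)) _.
  apply=> y Ly; have [[A B] [/= [[A1 A2] /= [A1x A2y] AA] FB] AB] := cov (x, y) (conj Kx Ly).
  exists (A2, A1 `*` B) => /=; first by split => //; exists (A1, B).
  by move=> [y' [x' i]] /= [A2y' [A1x' Bi]]; apply: (AB ((x', y'), i)); split => //; apply: AA.
by move/(_ h); apply: filterS => i KP [x y] [/= Kx Ly]; exact: KP.
Qed.

Lemma is_derive_of_line {R : realType} {V : normedModType R} (f : V -> R) (p v : V) (l : R) :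
  is_derive (0 : R) (1 : R) (fun s : R => f (p + s *: v)) l -> is_derive p v f l.
Proof.
have p0 : p + (0 : R) *: v = p by rewrite scale0r addr0.
rewrite -[X in is_derive X v]p0; case=> dl El; have E := line_derive_ext f p v 0.
by split; [rewrite /derivable -E|rewrite /derive -E].
Qed.

Section steklov.
Context {R : realType} {d : nat}.
Local Notation V := 'cV[R]_d.
Local Notation E := (R * V)%type.
Implicit Types (f : E -> R) (p c : E) (l : seq E).

(** Averaging over the segment from p to p + c makes a continuous f differentiable along c, with
    derivative f (p + c) - f p. Two averages along each vector of a basis therefore give class
    C2. *)
Definition steklov c f p : R := average (fun s : R => f (p + s *: c)).

Lemma continuous_on_line f p c : continuous f -> continuous (fun s : R => f (p + s *: c)).
Proof.
move=> cf s; apply: (@continuous_comp _ _ _ (fun s : R => p + s *: c) f); last exact: cf.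
exact: continuous_line.
Qed.

Lemma continuous_plane f (p a b : E) : continuous f ->
  continuous (fun q : R * R => f (p + q.1 *: a + q.2 *: b)).
Proof.
move=> cf q; apply: (@continuous_comp _ _ _ (fun q : R * R => p + q.1 *: a + q.2 *: b) f); last exact: cf.
apply: cvgD; last by apply: cvgZ; [exact: cvg_snd|exact: cvg_cst].
by apply: cvgD; [exact: cvg_cst|apply: cvgZ; [exact: cvg_fst|exact: cvg_cst]].
Qed.

Lemma measurable_plane f (p a b : E) : continuous f ->
  measurable_fun setT (fun q : measurableTypeR R * measurableTypeR R =>
    f (p + (q.1 : R) *: a + (q.2 : R) *: b)).
Proof.
move=> cf.
have -> : (fun q : measurableTypeR R * measurableTypeR R =>
     f (p + (q.1 : R) *: a + (q.2 : R) *: b)) =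
  (fun q => f (p.1 + q.1 * a.1 + q.2 * b.1, p.2 + (q.1 : R) *: a.2 + (q.2 : R) *: b.2)).
  by apply/funext => q; congr f; apply/pair_equal_spec.
apply: (measurable_continuous_coord cf).
  by apply: measurable_funD; [apply: measurable_funD => //|]; apply: measurable_funM.
move=> i.
have -> : (fun w : measurableTypeR R * measurableTypeR R =>
     (p.2 + (w.1 : R) *: a.2 + (w.2 : R) *: b.2) i ord0) =
   (fun w => p.2 i ord0 + w.1 * a.2 i ord0 + w.2 * b.2 i ord0).
  by apply/funext => w; rewrite !mxE.
by apply: measurable_funD; [apply: measurable_funD => //|]; apply: measurable_funM.
Qed.

Lemma steklov_continuous c f : continuous f -> continuous (steklov c f).
Proof.
move=> cf p; apply/cvgrPdist_le => /= e e0.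
have /compact_near_coveringP cov := @segment_compact R 0 1.
have h (s : R) : (`[0, 1]%classic : set R) s ->
    \forall s' \near s & q \near p, `|f (p + s' *: c) - f (q + s' *: c)| <= e.
  move=> _.
  have ch : continuous (fun z : R * E => f (p + z.1 *: c) - f (z.2 + z.1 *: c)).
    move=> z; apply: cvgB.
      apply: (@continuous_comp _ _ _ (fun z : R * E => p + z.1 *: c) f); last exact: cf.
      by apply: cvgD; [exact: cvg_cst|apply: cvgZ; [exact: cvg_fst|exact: cvg_cst]].
    apply: (@continuous_comp _ _ _ (fun z : R * E => z.2 + z.1 *: c) f); last exact: cf.
    by apply: cvgD; [exact: cvg_snd|apply: cvgZ; [exact: cvg_fst|exact: cvg_cst]].
  have /cvgrPdist_le/(_ e e0) := ch (s, p).
  by rewrite subrr; apply: filterS => z; rewrite sub0r normrN.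
have := cov E (nbhs p) (fun q s => `|f (p + s *: c) - f (q + s *: c)| <= e) (nbhs_filter p) h.
apply: (@filterS _ _ (nbhs_filter p)) => q hq.
rewrite /steklov -averageB; try exact: continuous_on_line.
have hI s : 0 <= s <= 1 -> `|f (p + s *: c) - f (q + s *: c)| <= e.
  by move=> sI; apply: hq; rewrite /= in_itv.
have cd : continuous (fun s : R => f (p + s *: c) - f (q + s *: c)).
  by move=> s; apply: cvgB; apply: continuous_on_line.
rewrite ler_norml; apply/andP; split.
  by apply: average_ge => // s /hI; rewrite ler_norml => /andP[].
by apply: average_le => // s /hI; rewrite ler_norml => /andP[].
Qed.

Lemma steklov_derive c f p : continuous f ->
  is_derive p c (steklov c f) (f (p + c) - f p).
Proof.
move=> cf; apply: is_derive_of_line.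
have := average_derive (continuous_on_line (p := p) (c := c) cf).
rewrite scale1r scale0r addr0.
have -> // : (fun h : R => average (fun s : R => f (p + (s + h) *: c))) =
  (fun s : R => steklov c f (p + s *: c)).
by apply/funext => r; congr average; apply/funext => s; rewrite scalerDl [s *: c + _]addrC addrA.
Qed.

Lemma steklovC c c' f p : continuous f ->
  steklov c (steklov c' f) p = steklov c' (steklov c f) p.
Proof.
move=> cf.
pose A := (`[0, 1]%classic : set R) `*` (`[0, 1]%classic : set R).
have [q _ hq] : exists2 q, q \in A & forall r, r \in A ->
    `|f (p + r.1 *: c + r.2 *: c')| <= `|f (p + q.1 *: c + q.2 *: c')|.
  apply: (@compact_EVT_max _ R (fun r : R * R => `|f (p + r.1 *: c + r.2 *: c')|)).
  - by exists (0, 0); split => /=; rewrite in_itv/= lexx ler01.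
  - by apply: compact_setX; exact: segment_compact.
  - apply: continuous_subspaceT => r.
    apply: (@continuous_comp _ _ _ _ (fun y : R => `|y|)); first exact: continuous_plane.
    exact: norm_continuous.
set M := `|_| in hq.
have iM : lebesgue_measure.-integrable `[0, 1]%classic (EFin \o (fun=> M)).
  by apply: average_integrable => s; exact: cvg_cst.
have bM (z s : R) : `[0, 1]%classic z -> 0 <= s <= 1 -> `|f (p + z *: c + s *: c')| <= M.
  move=> zI sI; apply: (hq (z, s)); apply/mem_set; split; first exact: zI.
  by rewrite /= in_itv.
rewrite /steklov.
have [_ ex] := (@average_exchange R (@lebesgue_measure R) `[0, 1]%classic
  (fun z s => f (p + z *: c + s *: c')) (fun=> M) (measurable_itv _)
  (@measurable_plane f p c c' cf) iM bM).
rewrite [LHS]ex.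
by congr average; apply/funext => s; congr average; apply/funext => r; rewrite addrAC.
Qed.

Definition steklovs l f : E -> R := foldr steklov f l.

Lemma steklovs_continuous l f : continuous f -> continuous (steklovs l f).
Proof. by move=> cf; elim: l => //= c l IH; exact: steklov_continuous. Qed.

(** Averages commute, so any direction of the list can be brought to the front and
    differentiated. *)
Lemma steklovs_rem c l f : continuous f -> c \in l ->
  steklovs l f = steklov c (steklovs (rem c l) f).
Proof.
move=> cf; elim: l => //= a l IH; rewrite inE; have [->//|ca cl] := eqVneq c a.
transitivity (steklov a (steklov c (steklovs (rem c l) f))); first by congr steklov; exact: IH.
transitivity (steklov c (steklov a (steklovs (rem c l) f))); last by [].
by apply/funext => p; rewrite (steklovC a c p (@steklovs_continuous (rem c l) _ cf)).
Qed.

Lemma steklovs_derive c l f p : continuous f -> c \in l ->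
  is_derive p c (steklovs l f) (steklovs (rem c l) f (p + c) - steklovs (rem c l) f p).
Proof.
move=> cf cl; rewrite (steklovs_rem cf cl); apply: steklov_derive.
exact: steklovs_continuous.
Qed.

End steklov.


(** * Class C1 and C2 from continuous derivatives along a basis *)

Section partials.
Context {R : realType} {E : normedModType R} {n : nat}.
Context (b : 'I_n -> E) (l : 'I_n -> E -> R) (K : R).
Hypothesis basisE : forall w, w = \sum_j l j w *: b j.
Hypothesis l_linear : forall j a w w', l j (a *: w + w') = a * l j w + l j w'.
Hypothesis l_continuous : forall j, continuous (l j).
Hypothesis K0 : 0 <= K.
Hypothesis l_bound : forall j w, `|l j w| <= K * `|w|.
Implicit Types (f : E -> R) (p q w : E).

Lemma is_derive_scaled_line f (D : E -> R) q v (a s : R) :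
  (forall q, is_derive q v f (D q)) ->
  is_derive s (1 : R) (fun s : R => f (q + (s * a) *: v)) (D (q + (s * a) *: v) * a).
Proof.
move=> dD.
have h1 : is_derive (s * a) (1 : R) (fun r : R => f (q + r *: v)) (D (q + (s * a) *: v)).
  by have [df <-] := dD (q + (s * a) *: v); exact: is_derive_line.
have h2 : is_derive s (1 : R) (fun s : R => s * a) a.
  have := is_deriveM (is_derive_id s (1 : R)) (is_derive_cst a s (1 : R)).
  by rewrite scaler0 add0r /GRing.scale/= mulr1.
exact: (@is_derive1_comp R (fun r : R => f (q + r *: v)) (fun s : R => s * a)).
Qed.

(** The path from p to p + w follows one basis vector after the other: [Q k] is reached after k
    legs, and the mean value theorem on each leg compares the derivative with its value at p. *)
Lemma partials_near f (Df : 'I_n -> E -> R) p :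
  (forall j q, is_derive q (b j) f (Df j q)) ->
  (forall j, {for p, continuous (Df j)}) ->
  forall e : R, 0 < e -> \forall w \near (0 : E),
    `|f (p + w) - f p - \sum_j l j w * Df j p| <= e * `|w|.
Proof.
move=> dD cD e e0.
have nK : 0 < n%:R * K + 1 by rewrite ltr_wpDl// mulr_ge0.
pose e' := e / (n%:R * K + 1); have e'0 : 0 < e' by rewrite divr_gt0.
have /nbhs_ballP[r /= r0 hr] : \forall q \near p, forall j, `|Df j p - Df j q| <= e'.
  apply: filter_forall => j; have /cvgrPdist_le := cD j; exact.
pose M := \sum_j K * `|b j|.
have M0 : 0 <= M by apply: sumr_ge0 => j _; rewrite mulr_ge0.
have M1 : 0 < M + 1 by rewrite ltr_wpDl.
apply/nbhs_ballP; exists (r / (M + 1)) => /=; first by rewrite divr_gt0.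
move=> w; rewrite -ball_normE/= sub0r normrN => wr.
pose Q (k : nat) : E := p + \sum_(j < n | (j < k)%N) l j w *: b j.
pose S (k : nat) : R := \sum_(j < n | (j < k)%N) l j w * Df j p.
have claim k : (k <= n)%N -> `|f (Q k) - f p - S k| <= k%:R * (e' * (K * `|w|)).
  elim: k => [|k IH] kn.
    by rewrite /Q /S !big_pred0// addr0 subrr subr0 normr0 mul0r.
  pose i := Ordinal kn.
  have QS : Q k.+1 = Q k + l i w *: b i.
    rewrite /Q (bigD1 i)//= addrA addrAC; congr (_ + _ + _).
    by apply: eq_bigl => j; rewrite ltnS ltn_neqAle andbC.
  have SS : S k.+1 = S k + l i w * Df i p.
    rewrite /S (bigD1 i)//= addrC; congr (_ + _).
    by apply: eq_bigl => j; rewrite ltnS ltn_neqAle andbC.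
  have [c /andP[c0 c1]] := MVT_line (fun s => is_derive_scaled_line (Q k) (l i w) s (dD i)).
  rewrite mul1r mul0r scale0r addr0 -QS => mvt.
  set xi := Q k + (c * l i w) *: b i in mvt.
  have pxi : `|p - xi| < r.
    apply: (@le_lt_trans _ _ (M * `|w|)); last first.
      apply: (@le_lt_trans _ _ ((M + 1) * `|w|)); first by rewrite ler_wpM2r// lerDl.
      by rewrite mulrC -ltr_pdivlMr.
    rewrite distrC /xi /Q addrAC [p + _ - p]addrAC subrr add0r.
    apply: (@le_trans _ _ (\sum_(j < n | (j < k.+1)%N) K * `|b j| * `|w|)); last first.
      rewrite mulr_suml [leRHS](bigID (fun j : 'I_n => (j < k.+1)%N))/= lerDl.
      by apply: sumr_ge0 => j _; rewrite !mulr_ge0.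
    rewrite [leRHS](bigD1 i)//=; apply: le_trans (ler_normD _ _) _; rewrite [leLHS]addrC; apply: lerD.
      rewrite normrZ mulrAC ler_wpM2r// normrM; apply: le_trans (l_bound i w).
      by rewrite ler_piMl// ger0_norm ltW.
    apply: le_trans (ler_norm_sum _ _ _) _.
    have -> : \sum_(j < n | (j < k.+1)%N && (j != i)) K * `|b j| * `|w| =
        \sum_(j < n | (j < k)%N) K * `|b j| * `|w|.
      by apply: eq_bigl => j; rewrite ltnS ltn_neqAle andbC.
    by apply: ler_sum => j _; rewrite normrZ mulrAC ler_wpM2r.
  have -> : f (Q k.+1) - f p - S k.+1 =
      (f (Q k) - f p - S k) + l i w * (Df i xi - Df i p).
    rewrite SS mulrBr [l i w * Df i xi]mulrC -mvt; ring.
  apply: le_trans (ler_normD _ _) _; rewrite -[k.+1%:R]natr1 mulrDl mul1r.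
  apply: lerD; first exact: IH (ltnW kn).
  rewrite normrM mulrC; apply: ler_pM => //.
  by rewrite distrC; apply: hr; rewrite -ball_normE.
have := claim n (leqnn n).
have -> : Q n = p + w.
  rewrite /Q {2}(basisE w); congr (_ + _); apply: eq_bigl => j; exact: ltn_ord.
have -> : S n = \sum_j l j w * Df j p by apply: eq_bigl => j; exact: ltn_ord.
move=> h; apply: le_trans h _.
have -> : n%:R * (e' * (K * `|w|)) = e' * (n%:R * K) * `|w| by ring.
rewrite ler_wpM2r// /e' mulrAC -mulrA ger_pMr// ler_pdivrMr// mul1r lerDl//.
Qed.

Lemma partials_diff f (Df : 'I_n -> E -> R) p :
  (forall j q, is_derive q (b j) f (Df j q)) ->
  (forall j, {for p, continuous (Df j)}) ->
  differentiable f p /\ forall w, 'D_w f p = \sum_j l j w * Df j p.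
Proof.
move=> dD cD; pose df w : R := \sum_j l j w * Df j p.
have dfL : linear df.
  move=> a w w'; rewrite /df /GRing.scale/= mulr_sumr -big_split/=; apply: eq_bigr => j _.
  by rewrite l_linear mulrDl mulrA.
pose L : {linear E -> R} := HB.pack df (GRing.isLinear.Build R E R *:%R df dfL).
have cL : continuous L.
  rewrite /L/= /df; apply: (continuous_big (op := +%R)); first exact: add_continuous.
  by move=> j _ w; apply: cvgM; [exact: l_continuous|exact: cvg_cst].
have E1 : f \o shift p = cst (f p) + L +o_ (0 : E) id.
  apply/eqaddoP => e e0.
  have := partials_near dD cD e0; apply: filterS => w /=.
  by rewrite /= !fctE/= opprD addrA [w + p]addrC.
have dE := diff_unique cL E1.
have df_p : differentiable f p by apply/diff_locallyP; rewrite dE.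
by split => // w; rewrite deriveE// dE.
Qed.

Lemma C1_of_partials f (Df : 'I_n -> E -> R) (A : set E) :
  (forall j q, is_derive q (b j) f (Df j q)) ->
  (forall j, continuous (Df j)) -> C1_on A f.
Proof.
move=> dD cD; split=> [p _|w]; first by have [] := partials_diff dD (fun j => @cD j p).
apply: continuous_subspaceT.
have -> : (fun p => 'D_w f p) = (fun p => \sum_j l j w * Df j p).
  by apply/funext => p; have [_] := partials_diff dD (fun j => @cD j p).
apply: (continuous_big (op := +%R)); first exact: add_continuous.
by move=> j _ p; apply: cvgM; [exact: cvg_cst|exact: cD].
Qed.

Lemma C2_of_partials f (Df : 'I_n -> E -> R) (D2f : 'I_n -> 'I_n -> E -> R) (A : set E) :
  (forall j q, is_derive q (b j) f (Df j q)) ->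
  (forall j k q, is_derive q (b k) (Df j) (D2f j k q)) ->
  (forall j k, continuous (D2f j k)) -> C2_on A f.
Proof.
move=> dD dD2 cD2.
have cD j : continuous (Df j).
  move=> p; apply: differentiable_continuous.
  by have [] := partials_diff (dD2 j) (fun k => @cD2 j k p).
split=> [|w]; first exact: C1_of_partials dD cD.
have -> : (fun p => 'D_w f p) = (\sum_j (fun p => l j w * Df j p)).
  apply/funext => p; rewrite fct_sumE.
  by have [_] := partials_diff dD (fun j => @cD j p).
have h1 k p : is_derive p (b k) (\sum_j (fun p => l j w * Df j p)) (\sum_j l j w * D2f j k p).
  by apply: is_derive_sum => j; exact: (is_deriveZ (l j w) (dD2 j k p)).
have h2 k : continuous (fun p => \sum_j l j w * D2f j k p).
  apply: (continuous_big (op := +%R)); first exact: add_continuous.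
  by move=> j _ p; apply: cvgM; [exact: cvg_cst|exact: cD2].
exact: C1_of_partials h1 h2.
Qed.

End partials.


(** * Smooth approximation that preserves averaged inequalities *)

Section cylinder_smoothing.
Context {R : realType} {d : nat}.
Local Notation V := 'cV[R]_d.
Local Notation E := (R * V)%type.
Implicit Types (f : E -> R) (p q c w : E).

Lemma is_derive_shift (W : normedModType R) (F : W -> R) (q a v : W) (l : R) :
  is_derive (q + a) v F l -> is_derive q v (fun r : W => F (r + a)) l.
Proof.
have e : (fun h : R => h^-1 *: (((fun r : W => F (r + a)) \o shift q) (h *: v) - F (q + a))) =
    (fun h : R => h^-1 *: ((F \o shift (q + a)) (h *: v) - F (q + a))).
  by apply/funext => h /=; rewrite addrA.
by case=> d1 e1; split; [rewrite /derivable e|rewrite /derive e].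
Qed.

Lemma normr_coord_le (x : V) (i : 'I_d) : `|x i ord0| <= d.+1%:R * `|x|.
Proof.
rewrite -(@ler_pXn2r _ 2) ?nnegrE ?mulr_ge0//.
apply: le_trans (coord_le_n2 x i) _; apply: le_trans (n2_le_normr x) _.
rewrite exprMn ler_wpM2r ?sqr_ge0// -natrX ler_nat.
by apply: leq_trans (leqnSn d) _; rewrite -[X in (X <= _)%N]expn1 leq_pexp2l.
Qed.

Definition quadratic_growth f := forall T : R, exists2 K, 0 <= K &
  forall t x, 0 <= t <= T -> `|f (t, x)| <= K * (1 + n2 x).

Lemma slice_continuous f (t : R) : continuous f -> continuous (fun x : V => f (t, x)).
Proof. by move=> cf x; apply: space_slice_continuous; exact: cf. Qed.

Lemma steklov_growth c f : continuous f -> quadratic_growth f -> 0 <= c.1 ->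
  quadratic_growth (steklov c f).
Proof.
move=> cf gf c1 T; have [K K0 hK] := gf (T + c.1).
exists (K * (2 + 2 * n2 c.2)); first by rewrite mulr_ge0// addr_ge0// mulr_ge0// n2_ge0.
move=> t x /andP[t0 tT].
have bnd (s : R) : 0 <= s <= 1 ->
    `|f ((t, x) + s *: c)| <= K * (2 + 2 * n2 c.2) * (1 + n2 x).
  move=> /andP[s0 s1]; have sc : s * c.1 <= c.1 by rewrite ler_piMl.
  apply: le_trans (hK (t + s * c.1) (x + s *: c.2) _) _.
    by rewrite addr_ge0 ?mulr_ge0//= lerD.
  rewrite -mulrA ler_wpM2l//; have := n2D_le x (s *: c.2); rewrite n2Z => h.
  have x0 := n2_ge0 x; have c0 := n2_ge0 c.2.
  have : s ^+ 2 * n2 c.2 <= n2 c.2 by rewrite ler_piMl// exprn_ile1.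
  nra.
have cs := continuous_on_line (p := (t, x)) (c := c) cf.
rewrite ler_norml; apply/andP; split.
  by apply: average_ge => // s /bnd; rewrite ler_norml => /andP[].
by apply: average_le => // s /bnd; rewrite ler_norml => /andP[].
Qed.

(** The linear inequality that smoothing has to preserve, with a strictness k. It is asked only from
    time t0 on, and averages over directions with nonnegative time component never look back before
    t0. *)
Definition heat_dominated f (t0 : R) (v : V) (h k : R) :=
  forall t x, t0 <= t -> f (t + h, x) <= heat v (fun y => f (t, y)) x - k.

Lemma steklov_heat_dominated c f t0 v h k : continuous f -> quadratic_growth f ->
  0 <= c.1 -> 0 <= t0 -> heat_dominated f t0 v h k -> heat_dominated (steklov c f) t0 v h k.
Proof.
move=> cf gf c1 t00 hd t x t0t; have t_ge0 := le_trans t00 t0t.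
have [K K0 hK] := gf (t + c.1).
pose F (z s : R) : R := f ((t, x) + z *: ((0, v) : E) + s *: c).
have FE z s : F z s = f (t + s * c.1, x + s *: c.2 + z *: v).
  rewrite /F; congr f; apply/pair_equal_spec; split=> /=; last by rewrite addrAC.
  by rewrite [z *: 0]mulr0 addr0.
pose H (z : R) := K * (1 + 4 * n2 x + 2 * n2 c.2) + (K * (4 * n2 v)) * z ^+ 2.
have qH : quartic H.
  by apply: quarticD; [exact: quartic_cst|apply: quarticZ; exact: quartic_pow].
have FH (z s : R) : [set: R] z -> 0 <= s <= 1 -> `|F z s| <= H z.
  move=> _ /andP[s0 s1]; have sc : s * c.1 <= c.1 by rewrite ler_piMl.
  rewrite FE; apply: le_trans (hK _ _ _) _.
    by rewrite addr_ge0 ?mulr_ge0//= lerD.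
  have -> : H z = K * (1 + 4 * n2 x + 2 * n2 c.2 + 4 * n2 v * z ^+ 2) by rewrite /H; ring.
  rewrite ler_wpM2l// addrAC; have := n2D_le (x + z *: v) (s *: c.2).
  have := n2D_le x (z *: v); rewrite !n2Z.
  have : s ^+ 2 * n2 c.2 <= n2 c.2 by rewrite ler_piMl ?n2_ge0// exprn_ile1.
  nra.
have [iF eF] := @average_exchange R std_normal setT F H measurableT
  (@measurable_plane R d f (t, x) (0, v) c cf) (quartic_integrable qH) FH.
have -> : heat v (fun y => steklov c f (t, y)) x = average (fun s => gaussE (F^~ s)).
  rewrite -[RHS]eF /heat /gaussE; congr (Rintegral _ _); apply/funext => z.
  congr average; apply/funext => s; rewrite FE; congr f; apply/pair_equal_spec; split=> //=.
  by rewrite addrAC.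
rewrite -[X in _ - X](average_cst k) /average -RintegralB//; last first.
  by apply: average_integrable => s; exact: cvg_cst.
apply: le_Rintegral => //.
- exact/average_integrable/continuous_on_line.
- have mI : measurable (`[0, 1]%classic : set (measurableTypeR R)) by exact: measurable_itv.
  have ik : lebesgue_measure.-integrable (`[0, 1]%classic : set (measurableTypeR R)) (EFin \o cst k).
    by apply: average_integrable => s; exact: cvg_cst.
  have iFk := integrableB mI iF ik.
  exact: iFk.
- move=> s /=; rewrite in_itv/= => /andP[s0 s1].
  have -> : f ((t + h, x) + s *: c) = f (t + s * c.1 + h, x + s *: c.2).
    by congr f; apply/pair_equal_spec; split=> //=; rewrite addrAC.
  apply: le_trans (hd (t + s * c.1) (x + s *: c.2) _) _.
    by apply: le_trans t0t _; rewrite lerDl mulr_ge0.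
  by rewrite lerD2r /heat le_eqVlt; apply/orP; left; apply/eqP; congr gaussE; apply/funext => z; rewrite FE.
Qed.

Lemma steklovs_growth (l : seq E) f : continuous f -> quadratic_growth f ->
  (forall c, c \in l -> 0 <= c.1) -> quadratic_growth (steklovs l f).
Proof.
move=> cf gf; elim: l => //= c l IH hl; apply: steklov_growth.
- exact: steklovs_continuous.
- by apply: IH => a al; apply: hl; rewrite inE al orbT.
- by apply: hl; rewrite inE eqxx.
Qed.

Lemma steklovs_heat_dominated (l : seq E) f t0 v h k : continuous f -> quadratic_growth f ->
  (forall c, c \in l -> 0 <= c.1) -> 0 <= t0 ->
  heat_dominated f t0 v h k -> heat_dominated (steklovs l f) t0 v h k.
Proof.
move=> cf gf hl t00 hd; elim: l hl => //= c l IH hl.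
have hl' a : a \in l -> 0 <= a.1 by move=> al; apply: hl; rewrite inE al orbT.
apply: steklov_heat_dominated => //.
- exact: steklovs_continuous.
- exact: steklovs_growth.
- by apply: hl; rewrite inE eqxx.
- exact: IH.
Qed.

Lemma steklovs_le (l : seq E) f p (M : R) : continuous f ->
  (forall c, c \in l -> 0 <= c.1) ->
  (forall q : E, 0 <= q.1 -> `|q| <= \sum_(c <- l) `|c| -> f (p + q) <= M) -> steklovs l f p <= M.
Proof.
move=> cf; elim: l p => [|c l IH] p hl hf.
  by have := hf 0; rewrite big_nil normr0 addr0; apply.
have hl' a : a \in l -> 0 <= a.1 by move=> al; apply: hl; rewrite inE al orbT.
have hs (s : R) : 0 <= s <= 1 -> steklovs l f (p + s *: c) <= M.
  move=> /andP[s0 s1]; apply: IH => // q q1 ql; rewrite -addrA; apply: hf.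
    by rewrite /= addr_ge0// mulr_ge0//; apply: hl; rewrite inE eqxx.
  rewrite big_cons; apply: le_trans (ler_normD _ _) _; apply: lerD => //.
  by rewrite normrZ ger0_norm// ler_piMl.
apply: average_le => //; apply: continuous_on_line; exact: steklovs_continuous.
Qed.

Lemma steklovs_ge (l : seq E) f p (m : R) : continuous f ->
  (forall c, c \in l -> 0 <= c.1) ->
  (forall q : E, 0 <= q.1 -> `|q| <= \sum_(c <- l) `|c| -> m <= f (p + q)) -> m <= steklovs l f p.
Proof.
move=> cf; elim: l p => [|c l IH] p hl hf.
  by have := hf 0; rewrite big_nil normr0 addr0; apply.
have hl' a : a \in l -> 0 <= a.1 by move=> al; apply: hl; rewrite inE al orbT.
have hs (s : R) : 0 <= s <= 1 -> m <= steklovs l f (p + s *: c).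
  move=> /andP[s0 s1]; apply: IH => // q q1 ql; rewrite -addrA; apply: hf.
    by rewrite /= addr_ge0// mulr_ge0//; apply: hl; rewrite inE eqxx.
  rewrite big_cons; apply: le_trans (ler_normD _ _) _; apply: lerD => //.
  by rewrite normrZ ger0_norm// ler_piMl.
apply: average_ge => //; apply: continuous_on_line; exact: steklovs_continuous.
Qed.

Section cylinder_basis.
Context (ep : R).
Hypothesis ep0 : 0 < ep.

(** Index 0 is the time direction and the others are the space directions. The time components are
    nonnegative, so averaging looks only forward in time. *)
Definition cyl_basis (j : 'I_d.+1) : E :=
  if unlift ord0 j is Some i then (0, ep *: basis_vec i) else (ep, 0).

Definition cyl_coord (j : 'I_d.+1) (w : E) : R :=
  ep^-1 * (if unlift ord0 j is Some i then w.2 i ord0 else w.1).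

Lemma cyl_basisE w : w = \sum_j cyl_coord j w *: cyl_basis j.
Proof.
have e1 : ep != 0 by rewrite gt_eqF.
rewrite big_ord_recl /cyl_coord /cyl_basis unlift_none/=.
under eq_bigr do rewrite liftK.
have -> : \sum_(i < d) (ep^-1 * w.2 i ord0) *: ((0, ep *: basis_vec i) : E) = (0, w.2).
  rewrite {2}(vec_basisE w.2); elim/big_rec2 : _ => [//|i a q _ ->].
  apply/pair_equal_spec; split=> /=; first by rewrite scaler0 addr0.
  by rewrite scalerA mulrAC mulVf// mul1r.
rewrite [LHS]surjective_pairing; apply/pair_equal_spec; split=> /=.
  by rewrite addr0 [_ *: _]mulrAC mulVf// mul1r.
by rewrite scaler0 add0r.
Qed.

Lemma cyl_coord_linear j a w w' :
  cyl_coord j (a *: w + w') = a * cyl_coord j w + cyl_coord j w'.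
Proof.
rewrite /cyl_coord; case: (unlift ord0 j) => [i|] /=; first by rewrite !mxE mulrDr mulrCA.
by rewrite mulrDr mulrCA.
Qed.

Lemma cyl_coord_continuous j : continuous (cyl_coord j).
Proof.
move=> w; rewrite /cyl_coord; case: (unlift ord0 j) => [i|].
  apply: cvgM; first exact: cvg_cst.
  apply: (@continuous_comp _ _ _ snd (fun y : V => y i ord0)); first exact: cvg_snd.
  exact: coord_continuous.
by apply: cvgM; [exact: cvg_cst|exact: cvg_fst].
Qed.

Lemma cyl_coord_bound j w : `|cyl_coord j w| <= ep^-1 * d.+1%:R * `|w|.
Proof.
have e1 : 0 <= ep^-1 by rewrite invr_ge0 ltW.
rewrite /cyl_coord normrM (ger0_norm e1) -mulrA ler_wpM2l// prod_normE.
case: (unlift ord0 j) => [i|].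
  apply: le_trans (normr_coord_le _ _) _.
  by rewrite ler_wpM2l// le_max lexx orbT.
apply: (@le_trans _ _ (Num.max `|w.1| `|w.2|)); first by rewrite le_max lexx.
by rewrite ler_peMl ?le_max ?normr_ge0// ler1n.
Qed.

Lemma cyl_basis_time j : 0 <= (cyl_basis j).1.
Proof. by rewrite /cyl_basis; case: (unlift ord0 j) => [i|] //=; exact: ltW. Qed.

Lemma cyl_basis_norm j : `|cyl_basis j| <= ep.
Proof.
rewrite /cyl_basis; case: (unlift ord0 j) => [i|]; rewrite prod_normE/= ge_max normr0 (ltW ep0)//=.
  apply: normr_cV_le => [|k]; first exact: ltW.
  by rewrite !mxE; case: (_ && _); rewrite ?mulr1 ?mulr0 ?normr0 ?gtr0_norm// ltW.
by rewrite gtr0_norm// lexx.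
Qed.

(** Each vector is listed twice: after a first derivative along one direction, every direction is
    still present for a second one, the same direction included. *)
Definition cyl_dirs : seq E := codom cyl_basis ++ codom cyl_basis.

Lemma steklovs_C2 f (A : set E) : continuous f -> C2_on A (steklovs cyl_dirs f).
Proof.
move=> cf; pose l := cyl_dirs.
have bl j : cyl_basis j \in l by rewrite mem_cat codom_f.
have bl2 j k : cyl_basis k \in rem (cyl_basis j) l.
  have h : (0 < count_mem (cyl_basis k) (codom cyl_basis))%N by rewrite -has_count has_pred1 codom_f.
  rewrite -has_pred1 has_count count_rem count_cat subn_gt0.
  by apply: leq_ltn_trans (leq_b1 _) _; exact: (leq_add h h).
pose D (j : 'I_d.+1) (p : E) : R := steklovs (rem (cyl_basis j) l) f (p + cyl_basis j) -
   steklovs (rem (cyl_basis j) l) f p.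
pose l2 j k := rem (cyl_basis k) (rem (cyl_basis j) l).
pose g j k (p : E) : R := steklovs (l2 j k) f (p + cyl_basis k) - steklovs (l2 j k) f p.
have cg j k : continuous (g j k).
  move=> p; apply: cvgB; last exact: steklovs_continuous.
  apply: (@continuous_comp _ _ _ (fun p : E => p + cyl_basis k) (steklovs (l2 j k) f)).
    exact: continuous_addr.
  exact: steklovs_continuous.
pose D2 j k (p : E) : R := g j k (p + cyl_basis j) - g j k p.
apply: (C2_of_partials cyl_basisE cyl_coord_linear cyl_coord_continuous
  (K := ep^-1 * d.+1%:R) _ cyl_coord_bound (Df := D) (D2f := D2)).
- by rewrite mulr_ge0// invr_ge0 ltW.
- by move=> j q; exact: steklovs_derive.
- move=> j k q; apply: is_deriveB; last exact: steklovs_derive.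
  by apply: is_derive_shift; exact: steklovs_derive.
- move=> j k p; apply: cvgB; last exact: cg.
  apply: (@continuous_comp _ _ _ (fun p : E => p + cyl_basis j) (g j k)); last exact: cg.
  exact: continuous_addr.
Qed.

End cylinder_basis.

Lemma cyl_dirs_norm (r : R) : 0 < r ->
  \sum_(c <- cyl_dirs (r / (2 * d.+1%:R))) `|c| <= r.
Proof.
move=> r0; set ep := r / _; have ep0 : 0 < ep by rewrite divr_gt0// mulr_gt0.
rewrite /cyl_dirs big_cat/= /codom big_image/=.
have : \sum_(j : 'I_d.+1) `|cyl_basis ep j| <= d.+1%:R * ep.
  apply: (@le_trans _ _ (\sum_(j : 'I_d.+1) ep)).
    by apply: ler_sum => j _; exact: cyl_basis_norm.
  by rewrite sumr_const card_ord mulr_natl.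
have : d.+1%:R * ep = r / 2 by rewrite /ep; field; rewrite addrC natr1 pnatr_eq0.
lra.
Qed.

Lemma smoothing f (r : R) : continuous f -> quadratic_growth f -> 0 < r ->
  exists phi : E -> R, [/\ forall A, C2_on A phi, continuous phi, quadratic_growth phi,
    (forall p M, (forall q, 0 <= q.1 -> `|q| <= r -> f (p + q) <= M) -> phi p <= M) /\
    (forall p m, (forall q, 0 <= q.1 -> `|q| <= r -> m <= f (p + q)) -> m <= phi p) &
    forall t0 v h k, 0 <= t0 -> heat_dominated f t0 v h k -> heat_dominated phi t0 v h k].
Proof.
(* There are 2 (d + 1) averages, each along a vector of norm at most ep, so the total displacement
   is at most r. *)
move=> cf gf r0; pose ep := r / (2 * d.+1%:R).
have ep0 : 0 < ep by rewrite divr_gt0// mulr_gt0.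
have tl c : c \in cyl_dirs ep -> 0 <= c.1.
  by rewrite mem_cat orbb => /codomP[j ->]; exact: cyl_basis_time.
exists (steklovs (cyl_dirs ep) f); split.
- by move=> A; exact: steklovs_C2.
- exact: steklovs_continuous.
- exact: steklovs_growth.
- have lr := cyl_dirs_norm r0; split=> [p M hf|p m hf].
    by apply: steklovs_le => // q q1 qr; apply: hf => //; exact: le_trans qr lr.
  by apply: steklovs_ge => // q q1 qr; apply: hf => //; exact: le_trans qr lr.
- by move=> t0 v h k t00 hd; exact: steklovs_heat_dominated.
Qed.

End cylinder_smoothing.

(** * Comparison *)


Section compact_box.
Context {R : realType} {d : nat}.
Local Notation V := 'cV[R]_d.
Local Notation E := (R * V)%type.

Definition box (r : R) : set V := [set x | forall i, -r <= x i ord0 <= r].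

Lemma trmx_row_continuous : continuous (fun v : 'rV[R]_d => v^T).
Proof.
move=> v; apply/(@cvgrPdist_le _ _ _ (nbhs v) (nbhs_filter v)) => e e0.
have : nbhs v (fun y : 'rV[R]_d => forall i, `|v ord0 i - y ord0 i| <= e).
  apply: (@filter_forall _ _ (fun i (y : 'rV[R]_d) => `|v ord0 i - y ord0 i| <= e) _ (nbhs_filter v)) => i.
  have := @coord_continuous R 1 d ord0 i v.
  by move=> /(@cvgrPdist_le _ _ _ (nbhs v) (nbhs_filter v))/(_ e e0).
apply: (@filterS _ _ (nbhs_filter v)) => y hy.
by apply: normr_cV_le => [|i]; [exact: ltW|rewrite !mxE; exact: hy].
Qed.

Lemma box_compact r : compact (box r).
Proof.
have -> : box r = [set v^T | v in [set v : 'rV[R]_d | forall i, `[-r, r]%classic (v ord0 i)]].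
  apply/seteqP; split => [x hx|_ [v hv <-] i].
    exists x^T; last by rewrite trmxK.
    by move=> i /=; rewrite mxE in_itv/=; exact: hx.
  by rewrite mxE; have := hv i; rewrite /= in_itv.
apply: continuous_compact; first exact/continuous_subspaceT/trmx_row_continuous.
apply: (@rV_compact R d (fun=> `[-r, r]%classic)) => i.
exact: segment_compact.
Qed.

Lemma box_n2 r x : 0 <= r -> n2 x < r ^+ 2 -> box r x.
Proof.
move=> r0 xr i; rewrite -ler_norml -(@ler_pXn2r _ 2) ?nnegrE//.
by apply: le_trans (coord_le_n2 x i) (ltW xr).
Qed.

Lemma slab_bound (g : E -> R) (T r : R) : continuous g -> exists2 c, 0 <= c &
  forall t x, 0 <= t <= T -> box r x -> `|g (t, x)| <= c.
Proof.
move=> cg; pose A := (`[0, T]%classic : set R) `*` box r.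
have [A0|/set0P A0] := eqVneq A set0.
  exists 0 => // t x tT xr; have : A (t, x) by split => //=; rewrite in_itv.
  by rewrite A0.
have cA : compact A by apply: compact_setX; [exact: segment_compact|exact: box_compact].
have cng : continuous (fun p => `|g p|).
  by move=> p; apply: (@continuous_comp _ _ _ g (fun y : R => `|y|)); [exact: cg|exact: norm_continuous].
have [q _ hq] := @compact_EVT_max _ R (fun p => `|g p|) A A0 cA (continuous_subspaceT cng).
by exists `|g q| => // t x tT xr; apply: (hq (t, x)); apply/mem_set; split.
Qed.

End compact_box.

(** * Barriers in time *)

Section ramps.
Context {R : realType}.
Context (a : R) (c : nat -> R).
Hypothesis a0 : 0 <= a.
Hypothesis c0 : forall i, 0 <= c i.

(** Meant to outgrow any prescribed sequence: the resulting function vanishes up to time a and is at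
    least c i from time a + i + 1 on. It handles a difference that is bounded only on bounded time
    intervals. *)
Definition ramp_sum (N : nat) (t : R) : R := \sum_(i < N) c i * Num.max 0 (t - a - i%:R).

(* A locally finite sum: the ramps starting after time t vanish at t. *)
Definition ramp (t : R) : R := ramp_sum (Num.truncn t).+1 t.

Lemma ramp_sum_stable N k t : t <= N%:R -> ramp_sum (N + k) t = ramp_sum N t.
Proof.
move=> tN; elim: k => [|k IH]; first by rewrite addn0.
rewrite addnS /ramp_sum big_ord_recr/= -/(ramp_sum (N + k) t) IH max_l ?mulr0 ?addr0//.
by rewrite natrD; have := ler0n R k; move: a0 tN; lra.
Qed.

Lemma rampE N t : t <= N%:R -> ramp t = ramp_sum N t.
Proof.
move=> tN; have tT := ltW (truncnS_gt t).
by rewrite /ramp -(ramp_sum_stable N tT) addnC ramp_sum_stable.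
Qed.

Lemma ramp_sum_ge0 N t : 0 <= ramp_sum N t.
Proof. by apply: sumr_ge0 => i _; rewrite mulr_ge0// le_max lexx. Qed.

Lemma ramp_ge0 t : 0 <= ramp t.
Proof. exact: ramp_sum_ge0. Qed.

Lemma ramp_eq0 t : t <= a -> ramp t = 0.
Proof.
move=> ta; rewrite /ramp /ramp_sum big1// => i _; rewrite max_l ?mulr0//.
by have := ler0n R i; lra.
Qed.

Lemma ramp_nondecreasing s t : s <= t -> ramp s <= ramp t.
Proof.
move=> st; have tT := ltW (truncnS_gt t).
rewrite (rampE tT) (rampE (le_trans st tT)); apply: ler_sum => i _.
by rewrite ler_wpM2l// ge_max le_max lexx/= le_max; apply/orP; right; lra.
Qed.

Lemma ramp_continuous : continuous ramp.
Proof.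
move=> t; pose N := (Num.truncn t).+1; have tN : t < N%:R := truncnS_gt t.
have near_t : \forall s \near t, ramp s = ramp_sum N s.
  have : \forall s \near t, s < N%:R by apply: lt_nbhsl.
  by apply: filterS => s sN; apply: rampE; exact: ltW.
have cN : continuous (ramp_sum N).
  apply: (continuous_big (op := +%R)); first exact: add_continuous.
  move=> i _ s; apply: cvgM; first exact: cvg_cst.
  apply: (@continuous_max _ _ (fun=> 0) (fun s => s - a - i%:R)); first exact: cvg_cst.
  by apply: cvgB; [exact: continuous_subr|exact: cvg_cst].
apply/cvgrPdist_le => e e0; move: near_t; have /cvgrPdist_le/(_ e e0) := cN t.
by apply: filterS2 => s h1 h2; rewrite h2 (rampE (ltW tN)).
Qed.

Lemma ramp_ge i t : a + i%:R + 1 <= t -> c i <= ramp t.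
Proof.
move=> ait; pose N := maxn i.+1 (Num.truncn t).+1.
have iN : (i < N)%N by rewrite leq_max leqnn.
have tN : t <= N%:R.
  by apply: le_trans (ltW (truncnS_gt t)) _; rewrite ler_nat leq_max leqnn orbT.
rewrite (rampE tN) /ramp_sum (bigD1 (Ordinal iN))//= -[leLHS]addr0 lerD//.
  by rewrite ler_peMr// le_max; apply/orP; right; lra.
by apply: sumr_ge0 => j _; rewrite mulr_ge0// le_max lexx.
Qed.

End ramps.

Section time_barrier.
Context {R : realType} {d : nat}.
Local Notation V := 'cV[R]_d.
Local Notation E := (R * V)%type.

(* g stands for the difference v - w: the barrier compensates its negative
   values before t0 and after a + 1, and vanishes in between. *)
Lemma time_barrier (g : E -> R) (t0 a r m : R) : continuous g -> 0 <= t0 -> t0 <= a ->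
  0 < m -> (forall x, 0 <= g (t0, x)) ->
  exists (k : R -> R) (L : R), [/\ continuous k, forall t, 0 <= k t & 0 <= L] /\
   [/\ forall t, t0 <= t <= a -> k t = 0,
       forall s t, t0 <= s -> s <= t -> k s <= k t,
       forall t s, 0 <= s -> k t - L * s <= k (t + s) &
       forall t x, 0 <= t -> t <= t0 \/ a + 1 <= t -> box r x -> - m <= g (t, x) + k t].
Proof.
move=> cg t00 t0a m0 g0; have a0 := le_trans t00 t0a.
have /choice[b hb] : forall n : nat, exists c, 0 <= c /\
    forall t x, 0 <= t <= a + n%:R -> box r x -> `|g (t, x)| <= c.
  by move=> n; have [c c0 hc] := slab_bound (a + n%:R) r cg; exists c.
(* The ramp reaches c i at time a + i + 1 and must serve until a + i + 2, so c i has to bound g up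
   to that time. *)
pose c i := b i.+2.
have c0 i : 0 <= c i by have [] := hb i.+2.
have [rho rho0 hrho] : exists2 rho, 0 < rho &
    forall t x, `|t0 - t| < rho -> box r x -> - m <= g (t, x).
  have /compact_near_coveringP cov := @box_compact R d r.
  have := cov R (nbhs t0) (fun t x => - m <= g (t, x)) (nbhs_filter t0).
  have h (x : V) : box r x -> \forall x' \near x & t \near t0, - m <= g (t, x').
    move=> _; have cg' : continuous (fun p : V * R => g (p.2, p.1)).
      move=> p; apply: (@continuous_comp _ _ _ (fun p : V * R => (p.2, p.1)) g); last exact: cg.
      by apply: continuous_pair => q; [exact: cvg_snd|exact: cvg_fst].
    have /cvgrPdist_le/(_ m m0) := cg' (x, t0).
    apply: filterS => p /=; rewrite ler_norml => /andP[_ h]; have := g0 x; lra.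
  move=> /(_ h) /nbhs_ballP[rho /= rho0 hr]; exists rho => // t x tr; apply: hr.
  by rewrite -ball_normE.
(* With this slope the part before t0 has risen to b 0, a bound of |g| up to time a, at distance rho
   from t0, where g >= - m is no longer guaranteed. *)
pose L := b 0%N / rho; have b00 : 0 <= b 0%N by have [] := hb 0%N.
have L0 : 0 <= L by rewrite divr_ge0// ltW.
pose k2 t := L * Num.max 0 (t0 - t).
have k2_0 t : t0 <= t -> k2 t = 0 by move=> tt; rewrite /k2 max_l ?mulr0// subr_le0.
have k2_ge0 t : 0 <= k2 t by rewrite mulr_ge0// le_max lexx.
exists (fun t => k2 t + ramp a c t), L; split; split => //.
- move=> t; apply: cvgD; last exact: ramp_continuous.
  apply: cvgM; first exact: cvg_cst.
  apply: (@continuous_max _ _ (fun=> 0) (fun s => t0 - s)); first exact: cvg_cst.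
  by apply: cvgB; [exact: cvg_cst|exact: cvg_id].
- by move=> t; rewrite addr_ge0// ramp_ge0.
- by move=> t /andP[t1 t2]; rewrite k2_0// ramp_eq0// addr0.
- move=> s t ts st; rewrite !k2_0 ?(le_trans ts)// lerD2l.
  exact: ramp_nondecreasing.
- move=> t s s0; rewrite addrAC; apply: lerD; last by apply: ramp_nondecreasing; rewrite // lerDl.
  rewrite /k2 -mulrBr ler_wpM2l// lerBlDr ge_max; apply/andP; split.
    by rewrite addr_ge0// le_max lexx.
  have : t0 - (t + s) <= Num.max 0 (t0 - (t + s)) by rewrite le_max lexx orbT.
  lra.
- move=> t x t_ge0 [tt0|ta] xr.
    have r0 := ramp_ge0 a c0 t; have k0 := k2_ge0 t.
    have [tr|tr] := ltP (t0 - t) rho.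
      have := hrho t x _ xr; rewrite ger0_norm ?subr_ge0// => /(_ tr); lra.
    have [_ /(_ t x _ xr)] := hb 0%N; rewrite addr0 t_ge0 (le_trans tt0 t0a) => /(_ isT).
    rewrite ler_norml => /andP[h _].
    have : b 0%N <= k2 t.
      rewrite /k2 /L max_r ?subr_ge0// mulrAC ler_pdivlMr//.
      by rewrite ler_wpM2l.
    lra.
  have ta0 : 0 <= t - (a + 1) by rewrite subr_ge0.
  have /andP[i1 i2] := truncn_itv ta0; set i := Num.truncn _ in i1 i2.
  have ri : c i <= ramp a c t by apply: ramp_ge => //; lra.
  have [_ /(_ t x _ xr)] := hb i.+2; rewrite t_ge0/= => h.
  have {h} : - c i <= g (t, x).
    suff : `|g (t, x)| <= c i by rewrite ler_norml => /andP[].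
    by apply: h; rewrite -[i.+2%:R]natr1; lra.
  by have := k2_ge0 t; lra.
Qed.

End time_barrier.


(** * Contact between a violating pair of functions *)

Section touching.
Context {R : realType} {d : nat}.
Local Notation V := 'cV[R]_d.
Local Notation E := (R * V)%type.
Local Notation O := (cylinder (setT : set V)).

Lemma stmodulus_modulus (w : R -> V -> R) (t : R) : stmodulus w -> 0 <= t -> modulus (w t).
Proof.
move=> mw t0; apply: (@modulus_atP _ _ (1 + t)); first by rewrite addr_ge0.
move=> del del0; have [C C0 hC] := mw del del0; exists C => // x z.
have := hC t 0 x z t0 (lexx 0); rewrite addr0 add0r; exact: le_trans (ler_norm _).
Qed.

Lemma stmodulus_growth (w : E -> R) : stmodulus (fun t x => w (t, x)) -> quadratic_growth w.
Proof.
move=> mw T; have [C C0 hC] := mw 1 ltr01.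
exists (`|w (0, 0)| + 1 + C * (1 + `|T|)); first by rewrite !addr_ge0// mulr_ge0// addr_ge0.
move=> t x /andP[t0 tT]; have := hC 0 t 0 x (lexx 0) t0; rewrite !add0r n2_0 addr0 mul1r => h.
have x0 := n2_ge0 x.
have : `|w (t, x)| <= `|w (t, x) - w (0, 0)| + `|w (0, 0)|.
  by rewrite -[X in `|X| <= _](subrK (w (0, 0))) ler_normD.
have : C * (t + n2 x) <= C * (1 + `|T|) * (1 + n2 x).
  rewrite -mulrA ler_wpM2l//; have := ler_norm T; have := normr_ge0 T; nra.
have := normr_ge0 (w (0, 0)); nra.
Qed.

Lemma heat_sub_quadratic (z x : V) (g : V -> R) (a del b : R) : modulus g ->
  heat z (fun y => g y - a - del * n2 y - b) x = heat z g x - a - del * (n2 x + n2 z) - b.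
Proof.
move=> mg.
have q1 : quartic (fun r : R => g (x + r *: z)) by exact: quartic_modulus.
have q2 : quartic (fun r : R => del * n2 (x + r *: z)).
  by apply: quarticZ; apply: quartic_modulus; exact: modulus_n2.
have q3 := quarticB q1 (quartic_cst a); have q4 := quarticB q3 q2.
rewrite -heat_n2 /heat (gaussEB q4 (quartic_cst b)) (gaussEB q3 q2) (gaussEB q1 (quartic_cst a)).
rewrite !gaussE_cst gaussEZ//; apply: quartic_modulus; exact: modulus_n2.
Qed.

Context (v w : E -> R) (t0 r t1 : R) (x1 : V) (D : V -> Prop).
Hypothesis cv : continuous v.
Hypothesis cw : continuous w.
Hypothesis mw : stmodulus (fun t x => w (t, x)).
Hypothesis t00 : 0 <= t0.
Hypothesis r0 : 0 <= r.
Hypothesis initial : forall x, w (t0, x) <= v (t0, x).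
Hypothesis lateral : forall t x, 0 <= t -> r ^+ 2 <= n2 x -> w (t, x) <= v (t, x).
Hypothesis t01 : t0 <= t1.
Hypothesis bad : v (t1, x1) < w (t1, x1).
Hypothesis D1 : forall e, D e -> n2 e <= 1.
Hypothesis dominated : forall e h, D e -> 0 <= h ->
  heat_dominated w t0 (Num.sqrt (2 * h) *: e) h 0.

(** The function w - k(t) - del |x|^2 - eta t is smoothed into phi. The term eta t makes its
    averaged inequality strict, and del is small enough that c = eta - 2 del stays positive. A test
    has to touch on the whole of (0, +oo) x R^d, while w is comparable with v only at time t0 and
    outside a ball: the barrier k keeps the minimum of v - phi away from times up to t0 and from
    large times. *)
Lemma touching_point : exists (phi : E -> R) (p : E) (c : R),
  [/\ forall A, C2_on A phi, O p, forall q, O q -> v p - phi p <= v q - phi q & 0 < c] /\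
  forall e, D e -> dt phi p <= quad (D2x phi p) e e - c.
Proof.
have t10 := le_trans t00 t01.
pose M := w (t1, x1) - v (t1, x1); have M0 : 0 < M by rewrite subr_gt0.
have M4 : 0 < M / 4 by rewrite divr_gt0.
have t0a : t0 <= t1 + 1 by rewrite (le_trans t01)// lerDl.
pose g p := v p - w p.
have cg : continuous g by move=> p; apply: cvgB; [exact: cv|exact: cw].
have g0 x : 0 <= g (t0, x) by rewrite subr_ge0.
have [k [L [[ck k0 L0] [kz km kL kg]]]] :=
  @time_barrier R d g t0 (t1 + 1) r (M / 4) cg t00 t0a M4 g0.
pose X1 := n2 x1; have X10 : 0 <= X1 by exact: n2_ge0.
(* All parameters are fractions of the violation M: penalties and smoothing cost at most 3 M / 8 at
   the bad point, where v - phi is then at most - 5 M / 8, whereas outside the box and the time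
   interval v - phi is at least - M / 4 - 5 M / 32. *)
pose eta := M / (16 * (1 + t1)).
have e1 : 0 < 1 + t1 by rewrite ltr_wpDr.
have eta0 : 0 < eta by rewrite divr_gt0// mulr_gt0.
have etaE : eta * (1 + t1) = M / 16 by rewrite /eta; field; rewrite gt_eqF.
pose del := Num.min (eta / 4) (M / (16 * (1 + X1))).
have X11 : 0 < 1 + X1 by rewrite ltr_wpDr.
have del0 : 0 < del by rewrite lt_min !divr_gt0// mulr_gt0.
have deleta : del <= eta / 4 by rewrite ge_min lexx.
have delE : del * (1 + X1) <= M / 16.
  apply: (@le_trans _ _ (M / (16 * (1 + X1)) * (1 + X1))).
    by rewrite ler_wpM2r ?(ltW X11)// ge_min lexx orbT.
  by rewrite le_eqVlt; apply/orP; left; apply/eqP; field; rewrite gt_eqF.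
have t1X : 0 < 1 + t1 + X1 by rewrite ltr_wpDr.
(* Smoothing moves points at which w may vary more and more as |x| and t grow; with th <= del / 2
   the penalties del |x|^2 and eta t absorb this variation. *)
pose th := Num.min (del / 2) (M / (32 * (1 + t1 + X1))).
have th0 : 0 < th by rewrite lt_min !divr_gt0// mulr_gt0.
have thdel : th <= del / 2 by rewrite ge_min lexx.
have thE : th * (1 + t1 + X1) <= M / 32.
  apply: (@le_trans _ _ (M / (32 * (1 + t1 + X1)) * (1 + t1 + X1))).
    by rewrite ler_wpM2r ?(ltW t1X)// ge_min lexx orbT.
  by rewrite le_eqVlt; apply/orP; left; apply/eqP; field; rewrite gt_eqF.
have th32 : th <= M / 32.
  apply: le_trans thE; rewrite ler_peMr ?(ltW th0)//; lra.
have [C C0 hC] := mw th0.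
pose B := 2 * C + L + 1 + d%:R; have B1 : 1 <= B.
  by rewrite /B; have := ler0n R d; lra.
have B0 : 0 < B by lra.
pose rr := Num.min 1 (M / 32) / B.
have rr0 : 0 < rr by rewrite divr_gt0// lt_min ltr01 divr_gt0.
have rrB : rr * B = Num.min 1 (M / 32) by rewrite /rr mulfVK// gt_eqF.
have rrB1 : rr * B <= 1 by rewrite rrB ge_min lexx.
have rrBM : rr * B <= M / 32 by rewrite rrB ge_min lexx orbT.
have d0 := ler0n R d.
have rr1 : rr <= 1 by apply: le_trans rrB1; rewrite ler_peMr ?(ltW rr0).
have drr : d%:R * rr <= 1.
  by apply: le_trans rrB1; rewrite mulrC ler_wpM2l ?(ltW rr0)// /B; lra.
have Crr : 2 * C * rr <= M / 32.
  by apply: le_trans rrBM; rewrite mulrC ler_wpM2l ?(ltW rr0)// /B; lra.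
have Lrr : L * rr <= M / 32.
  by apply: le_trans rrBM; rewrite mulrC ler_wpM2l ?(ltW rr0)// /B; lra.
pose f (p : E) : R := w p - k p.1 - del * n2 p.2 - eta * p.1.
have cf : continuous f.
  have c1 : continuous (fun p : E => k p.1).
    by move=> p; apply: (@continuous_comp _ _ _ fst k); [exact: cvg_fst|exact: ck].
  have c2 : continuous (fun p : E => n2 p.2).
    by move=> p; apply: (@continuous_comp _ _ _ snd (@n2 R d)); [exact: cvg_snd|exact: n2_continuous].
  move=> p; apply: cvgB; last by apply: cvgM; [exact: cvg_cst|exact: cvg_fst].
  apply: cvgB; last by apply: cvgM; [exact: cvg_cst|exact: c2].
  by apply: cvgB; [exact: cw|exact: c1].
have gf : quadratic_growth f.
  move=> T; have [K K0 hK] := stmodulus_growth mw T.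
  have ck' : continuous (fun p : E => k p.1).
    by move=> p; apply: (@continuous_comp _ _ _ fst k); [exact: cvg_fst|exact: ck].
  have [K' K'0 hK'] := @slab_bound R d _ T 0 ck'.
  exists (K + K' + del + eta * `|T|); first by exact: addr_ge0 (addr_ge0 (addr_ge0 K0 K'0) (ltW del0)) (mulr_ge0 (ltW eta0) (normr_ge0 T)).
  move=> t x /[dup] tT /andP[t_0 t_T]; have x0 := n2_ge0 x.
  have h1 := hK t x tT.
  have b0 : @box R d 0 0 by move=> i; rewrite mxE oppr0 lexx.
  have h2 : `|k t| <= K' := hK' t 0 tT b0.
  have h3 : eta * t <= eta * `|T|.
    by rewrite ler_wpM2l ?(ltW eta0)// (le_trans t_T)// ler_norm.
  have h4 : 0 <= eta * t by rewrite mulr_ge0// ltW.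
  move: h1 h2; rewrite /f /= !ler_norml => /andP[h1a h1b] /andP[h2a h2b].
  have h5 : 0 <= del * n2 x by rewrite mulr_ge0// ltW.
  have h6 : 0 <= K' * n2 x by rewrite mulr_ge0.
  have h7 : 0 <= eta * `|T| by rewrite mulr_ge0// ltW.
  have h8 : 0 <= eta * `|T| * n2 x by rewrite mulr_ge0.
  by clear -del0 x0 K0 K'0 h1a h1b h2a h2b h3 h4 h5 h6 h7 h8; apply/andP; split; lra.
have [phi [C2phi cphi gphi [bphi1 bphi2] hphi]] := smoothing cf gf rr0.
have small (q : E) : 0 <= q.1 -> `|q| <= rr ->
    [/\ q.1 <= rr, n2 q.2 <= rr & C * (q.1 + n2 q.2) <= M / 32].
  move=> q1; rewrite prod_normE ge_max ger0_norm// => /andP[qr qn].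
  have nq : n2 q.2 <= rr.
    apply: le_trans (n2_le_normr _) _.
    apply: (@le_trans _ _ (d%:R * rr * rr)).
      by rewrite -mulrA -expr2 ler_wpM2l// lerXn2r ?nnegrE// ltW.
    by rewrite ler_piMl// ltW.
  split=> //; apply: le_trans Crr; rewrite [2 * C]mulrC -mulrA ler_wpM2l//; lra.
have upper t x : 0 <= t -> phi (t, x) <= w (t, x) - k t + M * (5 / 32).
  move=> t_0; apply: bphi1 => -[s z] /= s0 qr; have [/= s1 z1 Cq] := small (s, z) s0 qr.
  rewrite -[(t, x) + (s, z)]/(t + s, x + z) /f/=.
  have := hC t s x z t_0 s0; rewrite ler_norml => /andP[_ h1].
  have h2 := kL t s s0.
  have h3 : L * s <= M / 32 by apply: le_trans Lrr; rewrite ler_wpM2l.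
  have h4 : n2 x <= 2 * n2 (x + z) + 2 * n2 z.
    by have := n2D_le (x + z) (- z); rewrite addrK n2N.
  have h5 : del * n2 x <= del * (2 * n2 (x + z) + 2 * n2 z) by rewrite ler_wpM2l// ltW.
  have h6 : del * n2 z <= M / 16.
    by apply: le_trans delE; rewrite ler_wpM2l ?(ltW del0)//; lra.
  have h7 : th * t <= eta * t by rewrite ler_wpM2r//; lra.
  have h8 : th * n2 x <= del / 2 * n2 x by rewrite ler_wpM2r// n2_ge0.
  have h9 : 0 <= eta * s by rewrite mulr_ge0// ltW.
  have h10 : th * (1 + t + n2 x) = th + th * t + th * n2 x by ring.
  rewrite h10 in h1; clear -h1 h2 h3 h5 h6 h7 h8 h9 Cq th32 M0; lra.
have lower : w (t1, x1) - M * (3 / 8) <= phi (t1, x1).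
  apply: bphi2 => -[s z] /= s0 qr; have [/= s1 z1 Cq] := small (s, z) s0 qr.
  rewrite -[(t1, x1) + (s, z)]/(t1 + s, x1 + z) /f/=.
  have := hC t1 s x1 z t10 s0; rewrite ler_norml -/X1 => /andP[h1 _].
  have -> : k (t1 + s) = 0 by apply: kz; have := t01; move=> ?; apply/andP; split; lra.
  have h2 : n2 (x1 + z) <= 2 * (1 + X1) by have := n2D_le x1 z; rewrite -/X1; lra.
  have h3 : del * n2 (x1 + z) <= del * (2 * (1 + X1)) by rewrite ler_wpM2l// ltW.
  have h4 : eta * (t1 + s) <= eta * (1 + t1) by rewrite ler_wpM2l ?(ltW eta0)//; lra.
  lra.
pose T := t1 + 2; pose K := (`[0, T]%classic : set R) `*` (@box R d r).
have cK : compact K by apply: compact_setX; [exact: segment_compact|exact: box_compact].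
have x1r : box r x1.
  by apply: box_n2 => //; rewrite ltNge; apply/negP => /(lateral t10); rewrite leNgt bad.
have K1 : K (t1, x1) by split => //=; rewrite in_itv/= t10/= /T; lra.
have ch : continuous (fun p => v p - phi p) by move=> p; apply: cvgB; [exact: cv|exact: cphi].
have [[tp xp] /set_mem[/= tpT xpr] hp] := compact_EVT_min (ex_intro _ _ K1) cK (continuous_subspaceT ch).
rewrite in_itv/= in tpT; case/andP: tpT => tp0 tpT.
have hp1 : v (tp, xp) - phi (tp, xp) <= - (M * (5 / 8)).
  apply: le_trans (hp _ (mem_set K1)) _; rewrite /M in lower *; lra.
have outside t x : 0 <= t -> ~ box r x \/ t <= t0 \/ T <= t ->
    - (M * (5 / 8)) < v (t, x) - phi (t, x).
  move=> t_0 H; have h1 := upper t x t_0; have h2 := k0 t.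
  have [xr|xr] := pselect (box r x).
    case: H => [//|H]; have : t <= t0 \/ t1 + 1 + 1 <= t.
      by case: H => H; [left|right; apply: le_trans H; rewrite /T; lra].
    move=> /(kg t x t_0) /(_ xr); rewrite /g => h3; lra.
  have h3 : r ^+ 2 <= n2 x by rewrite leNgt; apply/negP => /(box_n2 r0).
  have := lateral t_0 h3; lra.
have tpt0 : t0 < tp.
  by rewrite ltNge; apply/negP => tp_t0; have := outside tp xp tp0 (or_intror (or_introl tp_t0)); lra.
have Op : O (tp, xp) by split => //=; exact: le_lt_trans t00 tpt0.
have c0 : 0 < eta - 2 * del by lra.
exists phi, (tp, xp), (eta - 2 * del); split; first split => //.
  move=> [t x] [/= t_0 _]; have [xr|xr] := pselect (box r x); last first.
    by have := outside t x (ltW t_0) (or_introl xr); lra.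
  have [tT|tT] := leP t T; last first.
    by have := outside t x (ltW t_0) (or_intror (or_intror (ltW tT))); lra.
  by apply: hp; apply/mem_set; split => //=; rewrite in_itv/= (ltW t_0).
move=> e De; have [Kp Kp0 hKp] := gphi tp.
(* The function phi is its own test function: [touching_above] merely converts its averaged
   inequality into one on its derivatives at the contact point. *)
have hA q : O q -> phi q - phi q <= phi (tp, xp) - phi (tp, xp) by rewrite !subrr.
have hB : 0 < tp - t0 by rewrite subr_gt0.
have hC' h x : 0 < h < tp - t0 -> `|phi ((tp, xp).1 - h, x)| <= Kp * (1 + n2 x).
  move=> /andP[h0 h1]; apply: hKp.
  by apply/andP; split => /=; have := t00; move=> ?; lra.
have hD h : 0 < h < tp - t0 -> continuous (fun x : V => phi ((tp, xp).1 - h, x)).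
  by move=> _; exact: slice_continuous.
apply: (touching_above Op (C2phi O) hA hB Kp0 hC' hD) => h /andP[h0 h1] /=.
have hd : heat_dominated f t0 (Num.sqrt (2 * h) *: e) h ((eta - 2 * del) * h).
    move=> t x t0t; have t_0 := le_trans t00 t0t.
    have h2 := dominated De (ltW h0) x t0t; rewrite subr0 in h2.
    set ve := _ *: e in h2 *.
    have mwt : modulus (fun y => w (t, y)) := stmodulus_modulus mw t_0.
    have hE : heat ve (fun y => w (t, y) - k t - del * n2 y - eta * t) x =
        heat ve (fun y => w (t, y)) x - k t - del * (n2 x + n2 ve) - eta * t.
      by rewrite heat_sub_quadratic.
    have fE : (fun y => f (t, y)) = (fun y => w (t, y) - k t - del * n2 y - eta * t).
      by apply/funext.
    rewrite fE hE -[f (t + h, x)]/(w (t + h, x) - k (t + h) - del * n2 x - eta * (t + h)).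
    have h3 : k t <= k (t + h) by apply: km => //; rewrite lerDl ltW.
    have h4 : n2 ve <= 2 * h.
      rewrite /ve n2Z sqr_sqrtr ?mulr_ge0 ?(ltW h0)// ler_piMr ?mulr_ge0 ?(ltW h0)//.
      exact: D1.
    have h5 : del * n2 ve <= del * (2 * h) by rewrite ler_wpM2l// ltW.
    lra.
  have h2 : t0 <= tp - h by lra.
  by have := hphi _ _ _ _ t00 hd (tp - h) xp h2; rewrite subrK.
Qed.

End touching.


Section compact_support.
Context {R : realType} {d : nat}.
Local Notation V := 'cV[R]_d.

Lemma box_far (r : R) (x : V) : 0 <= r -> ~ box r x -> r ^+ 2 <= n2 x.
Proof. by move=> r0 xr; rewrite leNgt; apply/negP => /(box_n2 r0). Qed.

(** For small z uniform continuity bounds the increment by del; for larger z the bound 2 M is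
    absorbed by C |z|^2. *)
Lemma modulus_compact_support (f : V -> R) (r : R) : continuous f -> 0 <= r ->
  (forall x, r ^+ 2 <= n2 x -> f x = 0) -> modulus f.
Proof.
move=> cf r0 fr del del0.
have [M M0 hM] : exists2 M, 0 <= M & forall x, `|f x| <= M.
  have cf2 : continuous (fun p : R * V => f p.2).
    by move=> p; apply: (@continuous_comp _ _ _ snd f); [exact: cvg_snd|exact: cf].
  have [M M0 hM] := @slab_bound R d _ 0 r cf2.
  exists M => // x; have [xr|xr] := pselect (box r x); last by rewrite fr ?normr0//; exact: box_far.
  by apply: (hM 0 x _ xr); rewrite lexx.
have [rho rho0 hrho] : exists2 rho, 0 < rho & forall x z, `|z| < rho -> `|f (x + z) - f x| <= del.
  have /compact_near_coveringP cov := @box_compact R d (r + 1).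
  have := cov V (nbhs (0 : V)) (fun z x => `|f (x + z) - f x| <= del) (nbhs_filter _).
  have h (x : V) : box (r + 1) x ->
      \forall x' \near x & z \near (0 : V), `|f (x' + z) - f x'| <= del.
    move=> _; have cg : continuous (fun p : V * V => f (p.1 + p.2) - f p.1).
      move=> p; apply: cvgB.
        apply: (@continuous_comp _ _ _ (fun p : V * V => p.1 + p.2) f); last exact: cf.
        exact: add_continuous.
      by apply: (@continuous_comp _ _ _ fst f); [exact: cvg_fst|exact: cf].
    have /cvgrPdist_le/(_ _ del0) := cg (x, 0).
    by apply: filterS => p /=; rewrite addr0 subrr sub0r normrN.
  move=> /(_ h) /nbhs_ballP[rho /= rho0 hr].
  exists (Num.min rho d.+1%:R^-1); first by rewrite lt_min rho0 invr_gt0 ltr0n.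
  move=> x z; rewrite lt_min => /andP[zr z1].
  have [xr|xr] := pselect (box (r + 1) x).
    by apply: hr => //; rewrite -ball_normE/= sub0r normrN.
  have xfar : ~ box r x.
    by apply: contra_not xr => xr i; have /andP[? ?] := xr i; apply/andP; split; lra.
  have xzfar : ~ box r (x + z).
    apply: contra_not xr => xr i; have := xr i; rewrite mxE => /andP[? ?].
    have zi : `|z i ord0| <= 1.
      apply: le_trans (normr_coord_le z i) _; rewrite mulrC -ler_pdivlMr// mul1r.
      exact: ltW.
    by move: zi; rewrite ler_norml => /andP[? ?]; apply/andP; split; lra.
  by rewrite (fr _ (box_far r0 xfar)) (fr _ (box_far r0 xzfar)) subrr normr0 ltW.
have Mr0 : 0 <= 2 * M / rho ^+ 2 by exact: divr_ge0 (mulr_ge0 (ler0n R 2) M0) (sqr_ge0 rho).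
exists (2 * M / rho ^+ 2) => //.
move=> x z; have x0 := n2_ge0 x; have z0 := n2_ge0 z.
have [zr|zr] := ltP `|z| rho.
  have := hrho x z zr; rewrite ler_norml => /andP[_ h].
  have : 0 <= 2 * M / rho ^+ 2 * n2 z by rewrite mulr_ge0.
  nra.
have h1 : rho ^+ 2 <= n2 z.
  by apply: le_trans (normr_le_n2 z); rewrite lerXn2r ?nnegrE// ltW.
have h2 : 2 * M <= 2 * M / rho ^+ 2 * n2 z.
  by rewrite mulrAC ler_pdivlMr ?exprn_gt0// ler_wpM2l// mulr_ge0.
have := hM x; have := hM (x + z); rewrite !ler_norml => /andP[_ h3] /andP[h4 _].
have : 0 <= del * (1 + n2 x) by rewrite mulr_ge0 ?(ltW del0)// addr_ge0.
lra.
Qed.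

End compact_support.

(** * Heat flow along a fixed direction *)

Section heat_flow.
Context {R : realType} {d : nat}.
Local Notation V := 'cV[R]_d.

(** The solution from time t0 of the heat equation with second derivative along e; before t0 it is
    frozen at its initial value, so that it is defined and continuous at all times. *)
Definition heat_flow (t0 : R) (e : V) (f : V -> R) (t : R) : V -> R :=
  heat (Num.sqrt (2 * Num.max (t - t0) 0) *: e) f.

Lemma heat_flow_shift t0 e f t h x : modulus f -> t0 <= t -> 0 <= h ->
  heat_flow t0 e f (t + h) x = heat (Num.sqrt (2 * h) *: e) (heat_flow t0 e f t) x.
Proof.
move=> mf t0t h0; rewrite /heat_flow.
have a0 : 0 <= t - t0 by rewrite subr_ge0.
have b0 : 0 <= t + h - t0 by rewrite addrAC addr_ge0.
rewrite !max_l//; symmetry; apply: heat_heat; rewrite ?sqrtr_ge0//.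
by rewrite !sqr_sqrtr ?mulr_ge0//; ring.
Qed.

Lemma heat_flow_le0 t0 e f t x : t <= t0 -> heat_flow t0 e f t x = f x.
Proof.
by move=> tt0; rewrite /heat_flow max_r ?subr_le0// mulr0 sqrtr0 scale0r heat0.
Qed.

Lemma modulus_heat_flow t0 e f t : modulus f -> modulus (heat_flow t0 e f t).
Proof. exact: modulus_heat. Qed.

(** The flow up to t + s is the flow up to t averaged over an extra time b - a <= s, so the modulus
    of the latter is averaged once more. The lower bound is the same estimate for - f. *)
Lemma heat_flow_stmodulus_upper t0 e f : modulus f -> 0 <= t0 -> n2 e <= 1 ->
  forall del, 0 < del -> exists2 C, 0 <= C & forall t s x z, 0 <= t -> 0 <= s ->
  heat_flow t0 e f (t + s) (x + z) - heat_flow t0 e f t x <=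
  del * (1 + t + n2 x) + C * (s + n2 z).
Proof.
move=> mf t00 e1 del del0.
have del2 : 0 < del / 2 by rewrite divr_gt0.
have [C C0 fC] := mf _ del2; exists (2 * C); first by rewrite mulr_ge0.
move=> t s x z t_0 s_0; have x0 := n2_ge0 x; have z0 := n2_ge0 z; have e0 := n2_ge0 e.
pose a := Num.max (t - t0) 0; pose b := Num.max (t + s - t0) 0.
have a0 : 0 <= a by rewrite le_max lexx orbT.
have b0 : 0 <= b by rewrite le_max lexx orbT.
have at_ : a <= t by rewrite ge_max t_0 andbT; lra.
have ab : a <= b by rewrite ge_max b0 andbT le_max; apply/orP; left; lra.
have bas : b <= a + s.
  rewrite ge_max; apply/andP; split; last by rewrite addr_ge0.
  have : t - t0 <= a by rewrite le_max lexx.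
  lra.
have ba0 : 0 <= b - a by rewrite subr_ge0.
pose va := Num.sqrt (2 * a) *: e; pose vs := Num.sqrt (2 * (b - a)) *: e.
have nva : n2 va <= 2 * t.
  by rewrite /va n2Z sqr_sqrtr ?mulr_ge0//; nra.
have nvs : n2 vs <= 2 * s.
  by rewrite /vs n2Z sqr_sqrtr ?mulr_ge0//; nra.
have mg : modulus (heat va f) by exact: modulus_heat.
have gC := heat_modulus_at va mf fC.
have -> : heat_flow t0 e f (t + s) (x + z) = heat vs (heat va f) (x + z).
  symmetry; apply: heat_heat; rewrite ?sqrtr_ge0//.
  by rewrite !sqr_sqrtr ?mulr_ge0//; rewrite -/b; ring.
have -> : heat_flow t0 e f t x = heat va f x by [].
have mgx : quartic (fun r : R => C * n2 (z + r *: vs)).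
  by apply: quarticZ; apply: quartic_modulus; exact: modulus_n2.
apply: (@le_trans _ _ (del / 2 * (1 + n2 va + n2 x) + C * (n2 z + n2 vs))); last first.
  have : del * n2 va <= del * (2 * t) by rewrite ler_wpM2l// ltW.
  have : del / 2 * n2 x <= del * n2 x by rewrite ler_wpM2r//; lra.
  have : C * n2 vs <= C * (2 * s) by rewrite ler_wpM2l.
  have : 0 <= C * n2 z by rewrite mulr_ge0.
  have : 0 <= C * s by rewrite mulr_ge0.
  lra.
rewrite -heat_n2 /heat -gaussEZ; last by apply: quartic_modulus; exact: modulus_n2.
rewrite lerBlDr addrAC -[del / 2 * _ + _](gaussE_cst (del / 2 * (1 + n2 va + n2 x) + gaussE (fun z0 : R => f (x + z0 *: va)))).
rewrite -gaussED//; last exact: quartic_cst.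
apply: le_gaussE.
- exact: (@quartic_modulus _ _ (heat va f) (x + z) vs mg).
- by apply: quarticD => //; exact: quartic_cst.
- by move=> r; have := gC x (z + r *: vs); rewrite addrA /heat; lra.
Qed.

Lemma heat_flow_stmodulus t0 e f : modulus f -> 0 <= t0 -> n2 e <= 1 ->
  stmodulus (heat_flow t0 e f).
Proof.
move=> mf t00 e1 del del0.
have [C1 C10 h1] := heat_flow_stmodulus_upper mf t00 e1 del0.
have [C2 C20 h2] := heat_flow_stmodulus_upper (modulusN mf) t00 e1 del0.
exists (C1 + C2); first exact: addr_ge0.
move=> t s x z t_0 s_0.
have := h1 t s x z t_0 s_0; have := h2 t s x z t_0 s_0.
rewrite /heat_flow !heatN// => H2 H1.
have c1 : 0 <= C1 * (s + n2 z) by rewrite mulr_ge0// addr_ge0// n2_ge0.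
have c2 : 0 <= C2 * (s + n2 z) by rewrite mulr_ge0// addr_ge0// n2_ge0.
move: (heat _ f (x + z)) (heat _ f x) H1 H2 => A B H1 H2; rewrite mulrDl.
move: (C1 * _) (C2 * _) (del * _) c1 c2 H1 H2 => {h1 h2 mf} c1 c2 r c10 c20 H1 H2.
by rewrite ler_norml; apply/andP; split; lra.
Qed.

End heat_flow.

Section opposite.
Context {R : realType} {d : nat}.
Local Notation V := 'cV[R]_d.
Local Notation E := (R * V)%type.
Local Notation O := (cylinder (setT : set V)).

Lemma derive_oppE (phi : E -> R) (q w : E) : differentiable phi q ->
  'D_w (fun p => - phi p) q = - 'D_w phi q.
Proof. by move=> df; exact: (deriveN (diff_derivable df)). Qed.

Lemma C1_on_opp (phi : E -> R) (A : set E) : C1_on setT phi -> C1_on A (fun p => - phi p).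
Proof.
move=> [df cD]; split=> [p _|w]; first exact: (differentiableN (df p I)).
apply: continuous_subspaceT.
have -> : (fun p => 'D_w (fun p => - phi p) p) = (fun p => - 'D_w phi p).
  by apply/funext => p; exact/derive_oppE/df.
by move=> p; apply: cvgN; exact: (within_open_continuous openT I (cD w)).
Qed.

Lemma C2_on_opp (phi : E -> R) (A : set E) : C2_on setT phi -> C2_on A (fun p => - phi p).
Proof.
move=> [c1 c2]; split=> [|w]; first exact: C1_on_opp.
have -> : (fun p => 'D_w (fun p => - phi p) p) = (fun p => - 'D_w phi p).
  by apply/funext => p; apply: derive_oppE; exact: c1.1.
exact: C1_on_opp.
Qed.

Lemma dt_opp (phi : E -> R) p : C2_on setT phi -> dt (fun p => - phi p) p = - dt phi p.
Proof. by move=> [[df _] _]; rewrite !dtE derive_oppE//; exact: df. Qed.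

Lemma D2x_opp (phi : E -> R) p : C2_on setT phi -> D2x (fun p => - phi p) p = - D2x phi p.
Proof.
move=> [[df _] c2]; apply/matrixP => i j; rewrite [RHS]mxE.
rewrite [LHS]D2xE [D2x phi p i j]D2xE.
have -> : 'D_(0, basis_vec j) (fun p => - phi p) = (fun p => - 'D_(0, basis_vec j) phi p).
  by apply/funext => q; apply: derive_oppE; exact: df.
by rewrite derive_oppE//; exact: (c2 _).1.
Qed.

End opposite.


(** * Uniqueness *)

Section uniqueness.
Context {R : realType} {d : nat}.
Local Notation V := 'cV[R]_d.
Local Notation E := (R * V)%type.
Local Notation O := (cylinder (setT : set V)).
Context (u0 ce : V -> R) (m L R0 : R).
Hypothesis d0 : (0 < d)%N.
Hypothesis L0 : 0 <= L.
Hypothesis au0 : admissible_fun m u0.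
Hypothesis scu0 : forall y z, 2 * u0 y - 2 * L * n2 z <= u0 (y + z) + u0 (y - z).
Hypothesis R00 : 0 <= R0.
Hypothesis ce_midpoint : forall y z, ce y <= (ce (y + z) + ce (y - z)) / 2.
Hypothesis ce_le : forall y, ce y <= u0 y.
Hypothesis ce_far : forall x, R0 ^+ 2 <= n2 x -> u0 x = ce x.

Lemma value_far t x : R0 ^+ 2 <= n2 x -> value u0 t x = ce x.
Proof.
move=> xR; apply/eqP; rewrite eq_le -{1}(ce_far xR) (value_le_u0 au0)/=.
exact: (value_ge_convex au0).
Qed.

Lemma value_fun_stmodulus : stmodulus (fun t x => value_fun u0 (t, x)).
Proof.
move=> del del0; have [C C0 hC] := value_stmodulus L0 au0 scu0 del0.
by exists C => // t s x z t0 s0; rewrite !value_funE ?addr_ge0//; exact: hC.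
Qed.

Lemma value_fun_heat_dominated (e : V) (h : R) : n2 e <= 1 -> 0 <= h ->
  heat_dominated (value_fun u0) 0 (Num.sqrt (2 * h) *: e) h 0.
Proof.
move=> e1 h0 t x t0; rewrite subr0 value_funE ?addr_ge0//.
have -> : (fun y => value_fun u0 (t, y)) = value u0 t by apply/funext => y; rewrite value_funE.
apply: (value_le_heat L0 au0 scu0) => //.
by rewrite n2Z sqr_sqrtr ?mulr_ge0// ler_piMr ?mulr_ge0.
Qed.

Lemma clamp_continuous (v : E -> R) : {within [set p : E | 0 <= p.1], continuous v} ->
  continuous (fun p : E => v (Num.max p.1 0, p.2)).
Proof.
move=> /subspace_continuousP cv p.
pose g (q : E) : E := (Num.max q.1 0, q.2).
have g0 q : 0 <= (g q).1 by rewrite /= le_max lexx orbT.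
have cg : continuous g.
  apply: continuous_pair => q; last exact: cvg_snd.
  by apply: (@continuous_max _ _ (fun q : E => q.1) (fun=> 0)); [exact: cvg_fst|exact: cvg_cst].
apply: (@cvg_comp _ _ _ g v); last exact: (cv (g p) (g0 p)).
move=> B hB; have h1 : nbhs p (fun q => 0 <= (g q).1 -> B (g q)) := cg p _ hB.
by move: h1; apply: (@filterS _ _ (nbhs_filter p)) => q h; exact: h (g0 q).
Qed.

Context (v : E -> R).
Hypothesis cv : {within [set p : E | 0 <= p.1], continuous v}.
Hypothesis v0 : forall x, v (0, x) = u0 x.
Hypothesis v_far : forall t x, 0 <= t -> R0 ^+ 2 <= n2 x -> v (t, x) = ce x.

Let v' (p : E) := v (Num.max p.1 0, p.2).
Let cv' : continuous v'. Proof. exact: clamp_continuous. Qed.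
Let v'E t x : 0 <= t -> v' (t, x) = v (t, x).
Proof. by move=> t0; rewrite /v'/= max_l. Qed.

(** [touching_point] with w the value function, t0 = 0 and all directions with |e| <= 1 gives dt phi
    + c <= quad e e for each of them. Then dt phi + c is at most min (0, lambda1), against the
    supersolution inequality. *)
Lemma supersolution_ge : viscosity_supersolution setT v ->
  forall t x, 0 <= t -> value u0 t x <= v (t, x).
Proof.
move=> sup t1 x1 t10; rewrite leNgt; apply/negP => bad.
have init x : value_fun u0 (0, x) <= v' (0, x).
  by rewrite v'E// v0 value_funE// (value_le_u0 au0).
have lat t x : 0 <= t -> R0 ^+ 2 <= n2 x -> value_fun u0 (t, x) <= v' (t, x).
  by move=> t0 xR; rewrite v'E// value_funE// value_far// v_far.
have bad' : v' (t1, x1) < value_fun u0 (t1, x1) by rewrite v'E// value_funE.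
have [phi [p [c [[C2 Op hmin c0] hD]]]] := touching_point
  (D := fun e => n2 e <= 1) cv' (value_fun_continuous L0 au0 scu0)
  value_fun_stmodulus (lexx 0) R00 init lat t10 bad' (fun e h => h) value_fun_heat_dominated.
have h1 : Num.min 0 (lambda1 (D2x phi p)) <= dt phi p.
  apply: (sup phi (C2 O) p Op) => q Oq.
  have := hmin q Oq; case: p Op {hmin hD} => tp xp Op; case: q Oq => tq xq Oq.
  by rewrite !v'E//; [exact: ltW Oq.1|exact: ltW Op.1].
set a := dt phi p + c.
have a0 : a <= 0.
  have := hD 0; rewrite n2_0 => /(_ ler01).
  have -> : quad (D2x phi p) 0 0 = 0 by rewrite -[X in quad _ X _](scale0r (0 : V)) quadZl mul0r.
  by rewrite /a; lra.
have h2 : a <= lambda1 (D2x phi p).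
  apply: le_lambda1 => // x; have x0 := n2_ge0 x.
  have [nx|nx] := eqVneq (n2 x) 0.
    have x_0 : x = 0.
      by apply/eqP; rewrite -normr_eq0 -sqrf_eq0 eq_le sqr_ge0 andbT -nx normr_le_n2.
    by rewrite x_0 n2_0 mulr0 -[X in quad _ X _](scale0r (0 : V)) quadZl mul0r.
  have nx0 : 0 < n2 x by rewrite lt_neqAle eq_sym nx.
  pose k := Num.sqrt (n2 x)^-1.
  have k2 : k ^+ 2 = (n2 x)^-1 by rewrite sqr_sqrtr// invr_ge0.
  have := hD (k *: x); rewrite n2Z k2 mulVf// quadZl quadZr mulrA -expr2 k2 => /(_ (lexx 1)) h.
  by rewrite -ler_pdivlMr// [_ / _]mulrC /a; lra.
have : a <= Num.min 0 (lambda1 (D2x phi p)) by rewrite le_min a0.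
by rewrite /a; lra.
Qed.

Lemma ce_le_solution t x : viscosity_supersolution setT v -> 0 <= t -> ce x <= v (t, x).
Proof.
move=> sup t0; apply: le_trans (supersolution_ge sup x t0).
exact: (value_ge_convex au0).
Qed.

(** The slice differs from u0 by a continuous function that vanishes where |x| >= R0. *)
Lemma slice_modulus t : 0 <= t -> modulus (fun y => v (t, y)).
Proof.
move=> t0; pose f (y : V) := v (t, y) - u0 y.
have cf : continuous f.
  have cvt : continuous (fun y : V => v (t, y)).
    have -> : (fun y => v (t, y)) = (fun y => v' (t, y)) by apply/funext => z; rewrite v'E.
    exact: slice_continuous.
  by move=> y; exact: (continuousB (cvt y) (modulus_continuous au0.1 (x := y))).
have mf : modulus f.
  by apply: (modulus_compact_support cf R00) => x xR; rewrite /f v_far// ce_far// subrr.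
have e : (fun y => f y + u0 y) = (fun y => v (t, y)) by apply/funext => y; rewrite /f subrK.
exact: (eq_ind _ (@modulus R d) (modulusD mf au0.1) _ e).
Qed.

(* The heat flow of v(t0, .) along e solves a linear equation and lies above v
   on the boundary, so that the subsolution v stays below it. *)
Lemma subsolution_le_heat (t0 h : R) (e x : V) : viscosity_solution setT v ->
  0 <= t0 -> 0 <= h -> n2 e <= 1 ->
  v (t0 + h, x) <= heat (Num.sqrt (2 * h) *: e) (fun y => v (t0, y)) x.
Proof.
move=> [sub sup] t00 h0 e1; rewrite leNgt; apply/negP => bad.
pose V0 (y : V) := v (t0, y).
have mV0 : modulus V0 by exact: slice_modulus.
pose F := heat_flow t0 e V0.
have mF : stmodulus F by exact: heat_flow_stmodulus.
(* Signs are reversed: [touching_point] is applied to - v and - F, so that - phi touches v from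
   above. *)
pose w (p : E) : R := - F (Num.max p.1 0) p.2.
have cw : continuous w.
  by move=> p; apply: cvgN; exact: (stmodulus_slice_continuous mF).
have wE t y : 0 <= t -> w (t, y) = - F t y by move=> t_0; rewrite /w/= max_l.
have mw : stmodulus (fun t y => w (t, y)).
  move=> del del0; have [C C0 hC] := mF del del0; exists C => // t s y z t_0 s_0.
  by rewrite !wE ?addr_ge0// opprK addrC distrC; exact: hC.
have cnv : continuous (fun p : E => - v' p) by move=> p; apply: cvgN; exact: cv'.
have init y : w (t0, y) <= - v' (t0, y) by rewrite wE// v'E// /F heat_flow_le0.
(* There v = [ce], and [ce] lies below the heat flow because it is midpoint convex and below v (t0,
   .); the latter holds since v is a supersolution. *)
have lat t y : 0 <= t -> R0 ^+ 2 <= n2 y -> w (t, y) <= - v' (t, y).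
  move=> t_0 yR; rewrite wE// v'E// v_far// lerN2 /F /heat_flow.
  apply: heat_convex_minorant => // z; exact: ce_le_solution.
have t01 : t0 <= t0 + h by rewrite lerDl.
have bad' : - v' (t0 + h, x) < w (t0 + h, x).
  rewrite wE ?addr_ge0// v'E ?addr_ge0// ltrN2 /F heat_flow_shift//.
  have -> // : heat_flow t0 e V0 t0 = V0 by apply/funext => y; exact: heat_flow_le0.
have dom e' (s : R) : e' = e -> 0 <= s -> heat_dominated w t0 (Num.sqrt (2 * s) *: e') s 0.
  move=> -> s0 t y t0t; have t_0 := le_trans t00 t0t.
  rewrite subr0 wE ?addr_ge0//.
  have -> : (fun y => w (t, y)) = (fun y => - F t y) by apply/funext => z; rewrite wE.
  rewrite (@heatN _ _ _ (F t)); last exact: modulus_heat_flow.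
  by rewrite lerN2 /F heat_flow_shift.
have [phi [p [c [[C2 Op hmin c0] hD]]]] := touching_point (D := fun e' => e' = e)
  cnv cw mw t00 R00 init lat t01 bad' (fun e' h => eq_ind_r (fun e => n2 e <= 1) e1 h) dom.
have h1 : dt (fun q => - phi q) p <= Num.min 0 (lambda1 (D2x (fun q => - phi q) p)).
  apply: (sub _ (C2_on_opp O (C2 setT)) p Op) => q Oq.
  have := hmin q Oq; case: p Op {hmin hD} => tp xp Op; case: q Oq => tq xq Oq.
  by rewrite !v'E ?(ltW Oq.1) ?(ltW Op.1)// !opprK; lra.
have sym := D2x_sym (C2_on_opp O (C2 setT)) Op.
have h2 := lambda1_le_quad e d0 sym.
have h3 := hD e erefl.
have h4 : Num.min 0 (lambda1 (D2x (fun q => - phi q) p)) <= quad (D2x (fun q => - phi q) p) e e.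
  apply: le_trans h2; have e0 := n2_ge0 e.
  rewrite ge_min; have [l0|l0] := leP 0 (lambda1 (D2x (fun q => - phi q) p)).
    by rewrite mulr_ge0.
  by apply/orP; right; rewrite ler_nMr.
have h5 : quad (D2x (fun q => - phi q) p) e e = - quad (D2x phi p) e e.
  by rewrite D2x_opp; [rewrite -scaleN1r /quad -scalemxAl dotZr mulN1r|exact: C2].
rewrite dt_opp in h1; last exact: C2.
have := le_trans h1 h4; rewrite h5 lerN2 => h6; rewrite lerBrDr in h3.
by have := le_trans h3 h6; rewrite gerDl leNgt c0.
Qed.

(** The case e = 0, in which the average is the identity. *)
Lemma solution_noninc (t s : R) x : viscosity_solution setT v -> 0 <= t -> t <= s ->
  v (s, x) <= v (t, x).
Proof.
move=> sol t0 ts; have st0 : 0 <= s - t by rewrite subr_ge0.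
have := subsolution_le_heat x sol t0 st0 (e := 0).
by rewrite n2_0 scaler0 heat0 subrKC => /(_ ler01).
Qed.

Lemma solution_le_grid (n j : nat) x : viscosity_solution setT v ->
  v (2 ^- n * j%:R, x) <= bellman_grid u0 n j x.
Proof.
move=> sol; have h0 : 0 <= 2 ^- n :> R by rewrite invr_ge0 exprn_ge0.
elim: j x => [|j IH] x; first by rewrite mulr0 v0.
rewrite /bellman_grid iterS; apply: le_bellman_glb => // z hz.
have hn : 0 < 2 ^- n :> R by rewrite invr_gt0 exprn_gt0.
have t0 : 0 <= 2 ^- n * j%:R :> R by rewrite mulr_ge0.
have s0 : 0 < Num.sqrt (2 * 2 ^- n) :> R by rewrite sqrtr_gt0 mulr_gt0.
pose e := (Num.sqrt (2 * 2 ^- n))^-1 *: z.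
have e1 : n2 e <= 1.
  by rewrite /e n2Z exprVn sqr_sqrtr ?mulr_ge0// mulrC ler_pdivrMr ?mul1r// mulr_gt0.
have := subsolution_le_heat x sol t0 h0 e1.
have -> : Num.sqrt (2 * 2 ^- n) *: e = z by rewrite /e scalerA mulfV ?scale1r// gt_eqF.
rewrite -[j.+1%:R]natr1 mulrDr mulr1 => h; apply: le_trans h _.
apply: le_heat => [||y]; [exact: slice_modulus|exact: (admissible_grid au0 n j).1|exact: IH].
Qed.

Lemma solution_unique t x : viscosity_solution setT v -> 0 <= t -> v (t, x) = value u0 t x.
Proof.
move=> /[dup] sol [_ sup] t0; apply/eqP; rewrite eq_le supersolution_ge// andbT.
apply: (le_value au0) => n; rewrite /bellman_dyadic.
have pn : 0 < 2 ^+ n :> R by rewrite exprn_gt0.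
have n0 : 0 <= 2 ^+ n * t by rewrite mulr_ge0// ltW.
have /andP[j1 _] := truncn_itv n0; set j := Num.truncn _ in j1 *.
apply: le_trans (solution_le_grid n j x sol); apply: solution_noninc => //.
by rewrite ler_pdivrMl.
Qed.

End uniqueness.

(** * Feedback controls *)


Section near_optimal.
Context {R : realType} {d : nat}.
Local Notation V := 'cV[R]_d.
Context (m : R).

(* The selection is constant on the cells of a fine grid, hence measurable. *)
Lemma near_optimal_selection (g : V -> R) (h th : R) : admissible_fun m g -> 0 <= h -> 0 < th ->
  exists sel : V -> V, [/\ forall y, n2 (sel y) <= 2 * h,
    forall y, heat (sel y) g y <= bellman h g y + th * (1 + n2 y) &
    forall d1 (X : measurableType d1) (Y : X -> V),
      (forall i, measurable_fun setT (fun w => Y w i ord0)) ->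
      forall i, measurable_fun setT (fun w => sel (Y w) i ord0)].
Proof.
move=> ag h0 th0; have [mg _] := ag.
have h1 : 0 < 4 + 4 * h by rewrite ltr_wpDr// mulr_ge0.
pose del := Num.min (th / 8) (th / (2 * (4 + 4 * h))).
have del0 : 0 < del by rewrite lt_min !divr_gt0// mulr_gt0.
have [C C0 gC] := mg del del0.
have del8 : del <= th / 8 by rewrite ge_min lexx.
have delh : del * (4 + 4 * h) <= th / 2.
  apply: (@le_trans _ _ (th / (2 * (4 + 4 * h)) * (4 + 4 * h))).
    by rewrite ler_wpM2r ?(ltW h1)// ge_min lexx orbT.
  by rewrite le_eqVlt; apply/orP; left; apply/eqP; field; rewrite gt_eqF.
have C1 : 0 < d%:R + 1 :> R by rewrite ltr_wpDl.
have C2 : 0 < 8 * (C + 1) by rewrite mulr_gt0// ltr_wpDl.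
pose rho := Num.min 1 (th / (8 * (C + 1))).
have rho0 : 0 < rho by rewrite lt_min ltr01 divr_gt0.
have [q hq] : exists q, 2 ^- q < rho / (d%:R + 1) :> R.
  by have [N /(_ N (leqnn _))] := exists_dyadic_lt (divr_gt0 rho0 C1); exists N.
(* The lower corner of the grid cell of y; the time coordinate of the grid is set to 0 and
   discarded. *)
pose P (y : V) := (@grid_point R d q (grid_index q (fun=> 0) id y)).2.
have /choice[v hv] : forall z : V, exists v, n2 v <= 2 * h /\ heat v g z < bellman h g z + th / 8.
  move=> z; have th8 : 0 < th / 8 by rewrite divr_gt0.
  by have [v ? ?] := bellman_approx z ag h0 th8; exists v.
exists (v \o P); split => [y|y|d1 X Y mY i]; first by have [] := hv (P y).
- have [nv hvP] := hv (P y); rewrite /= in hvP *.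
  have nP : n2 (y - P y) <= rho.
    apply: (@le_trans _ _ (\sum_(i < d) 2 ^- q)).
      apply: ler_sum => i _; rewrite !mxE -real_normK ?num_real//.
      have [_ /(_ i)] := grid_point_dist q (fun=> 0) id y; rewrite mxE => hi.
      have q0 : 0 <= 2 ^- q :> R by rewrite invr_ge0 exprn_ge0.
      apply: (@le_trans _ _ ((2 ^- q) ^+ 2)); first by rewrite lerXn2r ?nnegrE.
      rewrite expr2 ler_piMr// invf_le1 ?exprn_gt0//; apply: exprn_ege1; exact: ler1n.
    rewrite sumr_const card_ord -[_ *+ d]mulr_natl.
    move: hq; rewrite ltr_pdivlMr// => /ltW; apply: le_trans.
    by rewrite mulrC ler_wpM2l ?invr_ge0 ?exprn_ge0// lerDl.
  have rho1 : rho <= 1 by rewrite ge_min lexx.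
  have Crho : C * rho <= th / 8.
    apply: (@le_trans _ _ ((C + 1) * (th / (8 * (C + 1))))).
      apply: ler_pM => //; [exact: ltW|by rewrite lerDl|by rewrite ge_min lexx orbT].
    by rewrite le_eqVlt; apply/orP; left; apply/eqP; field; rewrite gt_eqF// ltr_wpDl.
  have y0 := n2_ge0 y; have z0 := n2_ge0 (P y - y).
  have nPN : n2 (P y - y) <= rho by rewrite -n2N opprB.
  have nPy : n2 (P y) <= 2 * n2 y + 2.
    by have := n2D_le y (P y - y); rewrite subrKC; lra.
  have b1 := heat_modulus_at (v (P y)) mg gC (P y) (y - P y).
  have b2 := bellman_modulus_at h0 (ltW del0) ag gC y (P y - y).
  rewrite subrKC in b1; rewrite subrKC in b2.
  have c1 : C * n2 (y - P y) <= C * rho by rewrite ler_wpM2l.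
  have c2 : C * n2 (P y - y) <= C * rho by rewrite ler_wpM2l.
  have c3 : del * (1 + n2 (v (P y)) + n2 (P y)) <= del * (1 + 2 * h + (2 * n2 y + 2)).
    by rewrite ler_wpM2l ?(ltW del0)//; lra.
  have c4 : del * n2 y <= th / 8 * n2 y by rewrite ler_wpM2r.
  have c5 : 0 <= th * n2 y by rewrite mulr_ge0// ltW.
  have c6 : 0 <= del * h by rewrite mulr_ge0// ltW.
  lra.
- apply: (@measurable_countable_valued _ _ _ X _ (fun w => grid_index q (fun=> 0) id (Y w))
    (fun c => v (@grid_point R d q c).2 i ord0)) => c.
  exact: (@measurable_grid_index R d _ X q (fun=> 0) Y c (measurable_cst _) mY).
Qed.

End near_optimal.

Section sp_eval_facts.
Context {R : realType} {d : nat} {disp : measure_display} {T : measurableType disp}.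
Context (W : R -> T -> 'cV[R]_d) (t : R) (H : simple_process W t).

Lemma sp_eval_cases (s : R) (w : T) : sp_eval H s w = 0 \/
  exists k : 'I_(sp_size H), sp_eval H s w = sp_val H k w.
Proof.
have [[k ks]|nk] := pselect (exists k : 'I_(sp_size H), sp_time H k < s <= sp_time H k.+1).
  right; exists k; rewrite /sp_eval (bigD1 k)//= indicE mem_set ?scale1r; last by rewrite /= in_itv.
  rewrite big1 ?addr0// => j jk; rewrite indicE; case: (boolP (s \in _)); rewrite ?scale0r//.
  move=> /set_mem /=; rewrite in_itv/= => /andP[js sj]; case/andP: ks => ks sk.
  have [lt_jk|lt_kj|/val_inj e] := ltngtP j k; last by rewrite e eqxx in jk.
    exfalso; have := sp_time_mono lt_jk (ltnW (ltn_ord k)); lra.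
  exfalso; have := sp_time_mono lt_kj (ltnW (ltn_ord j)); lra.
left; rewrite /sp_eval big1// => k _; rewrite indicE; case: (boolP (s \in _)); rewrite ?scale0r//.
by move=> /set_mem /=; rewrite in_itv/= => ks; case: nk; exists k.
Qed.

Lemma sp_eval_progressive (c : R) : progressive W (fun s w => c *: sp_eval H s w).
Proof.
move=> r r0 i j.
have mD : measurable (`[0, r]%classic `*` setT : set (measurableTypeR R * past_space W r)).
  by apply: measurableX => //; exact: measurable_itv.
pose F (k : 'I_(sp_size H)) (p : measurableTypeR R * past_space W r) : R :=
  \1_(`]sp_time H k, sp_time H k.+1]%classic) p.1 * sp_val H k p.2 i j.
have -> : (fun p : R * past_space W r => (c *: sp_eval H p.1 p.2) i j) =
    (fun p => c * \sum_k F k p).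
  apply/funext => p; rewrite mxE summxE; congr (_ * _); apply: eq_bigr => k _.
  by rewrite mxE.
apply: measurable_funM => //; apply: measurable_sum => k.
have [kr|rk] := ltP (sp_time H k) r.
  apply: measurable_funM.
    apply: measurable_funTS.
    have m1 : measurable_fun setT (\1_(`]sp_time H k, sp_time H k.+1]%classic) : measurableTypeR R -> R).
      by apply: measurable_indic; exact: measurable_itv.
    exact: (measurableT_comp m1 measurable_fst).
  apply: measurable_funTS.
  have m2 : @measurable_fun _ _ (past_space W r) R setT (fun w => sp_val H k w i j).
    by apply: measurable_past_mono (ltW kr) _; exact: sp_measurable.
  exact: (measurableT_comp m2 measurable_snd).
(* The interval is open at its left end, which is at least r, so the summand vanishes on [0, r].
   This is essential, since its value need not be determined by the past at time r. *)
have e0 : {in `[0, r]%classic `*` setT, cst 0 =1 F k}.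
  move=> p /set_mem[/= + _]; rewrite in_itv/= => /andP[_ pr].
  rewrite /F indicE; case: (boolP (p.1 \in _)); rewrite ?mul0r// => /set_mem /=.
  by rewrite in_itv/= => /andP[h _]; have := lt_le_trans h pr; rewrite ltNge rk.
by apply: (eq_measurable_fun _ e0); exact: measurable_cst.
Qed.

End sp_eval_facts.


Section feedback.
Context {R : realType} {d : nat} {disp : measure_display} {T : measurableType disp}.
Context (P : probability T R) (W : R -> T -> 'cV[R]_d).
Hypothesis bm : brownian_motion P W.
Local Notation V := 'cV[R]_d.
Context (m : R) (u0 : V -> R).
Hypothesis au0 : admissible_fun m u0.
Context (i0 : 'I_d) (t : R) (x : V) (n : nat) (th : R) (sel : nat -> V -> V).
Hypothesis t0 : 0 <= t.
Hypothesis th0 : 0 <= th.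
Local Notation h := (2 ^- n : R).
Local Notation N := (Num.truncn (2 ^+ n * t)).
Local Notation U := (bellman_grid u0 n).
Hypothesis sel_bound : forall j y, n2 (sel j y) <= 2 * h.
Hypothesis sel_opt : forall j y, heat (sel j y) (U j) y <= U j.+1 y + th * (1 + n2 y).
Hypothesis sel_measurable : forall j d1 (X : measurableType d1) (Y : X -> V),
  (forall i, measurable_fun setT (fun w => Y w i ord0)) ->
  forall i, measurable_fun setT (fun w => sel j (Y w) i ord0).

Let h0 : 0 < h. Proof. by rewrite invr_gt0 exprn_gt0. Qed.
Let sh0 : 0 < Num.sqrt h. Proof. by rewrite sqrtr_gt0. Qed.

Definition fb_time (k : nat) : R := k%:R * h.

Let time_ge0 k : 0 <= fb_time k. Proof. by rewrite mulr_ge0// ltW. Qed.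
Let time_lt k : fb_time k < fb_time k.+1. Proof. by rewrite ltr_pM2r// ltr_nat. Qed.

(* Only the coordinate i0 of the increments is used: a rank one volatility along
   the selected direction. *)
Fixpoint fb_path (k : nat) (w : T) : V :=
  if k is k'.+1 then fb_path k' w + increment W (fb_time k') (fb_time k) w i0 ord0 *:
    ((Num.sqrt h)^-1 *: sel (N - k) (fb_path k' w)) else x.

(** An increment over one step has standard deviation sqrt h, hence the division: the displacement
    is a standard Gaussian times the selected direction. With N - k steps left the direction is the
    one chosen for the values after the step, those of [U (N - k - 1)]. *)
Definition fb_val (k : nat) (w : T) : 'M[R]_d :=
  \matrix_(i, j) (if j == i0 then (Num.sqrt h)^-1 * sel (N - k.+1) (fb_path k w) i ord0 else 0).

Lemma measurable_fb_path k i :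
  @measurable_fun _ _ (past_space W (fb_time k)) R setT (fun w => fb_path k w i ord0).
Proof.
elim: k i => [|k IH] i; first exact: measurable_cst.
have -> : (fun w => fb_path k.+1 w i ord0) = (fun w => fb_path k w i ord0 +
    increment W (fb_time k) (fb_time k.+1) w i0 ord0 *
    ((Num.sqrt h)^-1 * sel (N - k.+1) (fb_path k w) i ord0)).
  by apply/funext => w; rewrite /= !mxE.
have tk := ltW (time_lt k).
apply: measurable_funD; first exact: measurable_past_mono tk (IH i).
apply: measurable_funM.
  by apply: measurable_past_increment; rewrite ?time_ge0 ?tk ?lexx.
apply: measurable_funM => //; apply: measurable_past_mono tk _.
exact: (@sel_measurable _ _ (past_space W (fb_time k)) (fb_path k) IH).
Qed.

Lemma measurable_fb_path' k i : measurable_fun setT (fun w => fb_path k w i ord0).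
Proof. by apply: (measurable_past bm (s := fb_time k)); exact: measurable_fb_path. Qed.

Lemma measurable_fb_val k i j :
  @measurable_fun _ _ (past_space W (fb_time k)) R setT (fun w => fb_val k w i j).
Proof.
have -> : (fun w => fb_val k w i j) = (fun w => if j == i0 then
    (Num.sqrt h)^-1 * sel (N - k.+1) (fb_path k w) i ord0 else 0).
  by apply/funext => w; rewrite mxE.
case: (j == i0); last exact: measurable_cst.
apply: measurable_funM; first exact: measurable_cst.
by apply: (@sel_measurable _ _ (past_space W (fb_time k)) (fb_path k)) => i'; exact: measurable_fb_path.
Qed.

Lemma f2_fb_val k w : f2 (fb_val k w) <= 2.
Proof.
have -> : f2 (fb_val k w) = (Num.sqrt h)^-1 ^+ 2 * n2 (sel (N - k.+1) (fb_path k w)).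
  rewrite /f2 /n2 mulr_sumr; apply: eq_bigr => i _; rewrite (bigD1 i0)//= big1 ?addr0.
    by rewrite mxE eqxx exprMn.
  by move=> j /negbTE ji; rewrite mxE ji expr0n.
rewrite exprVn sqr_sqrtr ?(ltW h0)// ler_pdivrMl// [leRHS]mulrC; exact: sel_bound.
Qed.

Lemma fb_val_increment k w (y : V) :
  fb_val k w *m y = y i0 ord0 *: ((Num.sqrt h)^-1 *: sel (N - k.+1) (fb_path k w)).
Proof.
apply/colP => i; rewrite !mxE (bigD1 i0)//= big1 ?addr0; first by rewrite mxE eqxx mulrC.
by move=> j /negbTE ji; rewrite mxE ji mul0r.
Qed.

Let time_end : fb_time N <= t.
Proof.
have pn : 0 < 2 ^+ n :> R by rewrite exprn_gt0.
by rewrite /fb_time mulrC ler_pdivrMl// truncn_le mulr_ge0// ltW.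
Qed.

Let val_bounded : exists M : R, forall k w, (k < N)%N -> frobenius (fb_val k w) <= M.
Proof.
exists 2 => k w _; rewrite -(@ler_pXn2r _ 2) ?nnegrE ?sqrtr_ge0//.
by rewrite frobenius_sqr_mx; apply: le_trans (f2_fb_val k w) _; lra.
Qed.

Definition fb_process : simple_process W t :=
  @SimpleProcess R d disp T W t N fb_time fb_val (time_ge0 0)
    (fun k _ => ltW (time_lt k)) time_end val_bounded
    (fun k i j _ => @measurable_fb_val k i j).

Lemma fb_pathE k w : simple_path x fb_process k w = fb_path k w.
Proof.
elim: k => [|k IH]; first by rewrite /simple_path big_ord0 addr0.
by rewrite simple_pathS IH /= fb_val_increment.
Qed.

Lemma fb_path_freezing k (g : V -> R) : modulus g -> (forall y, 0 <= g y) ->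
  (\int[P]_w (g (fb_path k.+1 w))%:E =
   \int[P]_w (heat (sel (N - k.+1) (fb_path k w)) g (fb_path k w))%:E)%E.
Proof.
move=> mg g0; have cg : continuous (fun p : R * V => g p.2).
  move=> p; apply: (@continuous_comp _ _ _ snd g); first exact: cvg_snd.
  exact: modulus_continuous.
have g0' (p : R * V) : 0 <= g p.2 by [].
pose e w := (Num.sqrt h)^-1 *: sel (N - k.+1) (fb_path k w).
have me i : @measurable_fun _ _ (past_space W (fb_time k)) R setT (fun w => e w i ord0).
  have -> : (fun w => e w i ord0) = (fun w => (Num.sqrt h)^-1 * sel (N - k.+1) (fb_path k w) i ord0).
    by apply/funext => w; rewrite mxE.
  apply: measurable_funM; first exact: measurable_cst.
  by apply: (@sel_measurable _ _ (past_space W (fb_time k)) (fb_path k)) => i'; exact: measurable_fb_path.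
have := increment_freezing (i := i0) bm (time_ge0 k) (time_lt k) (tau := fun=> 0)
  (Y := fb_path k) (e := e) cg g0' (measurable_cst _)
  (fun j => measurable_past_coord (@measurable_fb_path k j))
  (fun j => measurable_past_coord (me j)).
move=> ->; apply: eq_integral => w _ /=.
have -> : fb_time k.+1 - fb_time k = h by rewrite /fb_time -[k.+1%:R]natr1; ring.
have -> : Num.sqrt h *: e w = sel (N - k.+1) (fb_path k w).
  by rewrite /e scalerA mulfV ?scale1r// gt_eqF.
by rewrite gaussE_EFin//; exact: quartic_modulus.
Qed.

Lemma fb_moment k : exists2 a, 0 <= a <= n2 x + 2 * fb_time k &
  (\int[P]_w (n2 (fb_path k w))%:E = a%:E)%E.
Proof.
elim: k => [|k [a /andP[a0 ak] ea]].
  exists (n2 x); first by rewrite n2_ge0 /fb_time mul0r mulr0 addr0 lexx.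
  exact: (integral_prob_cst P (n2 x)).
have le1 : (\int[P]_w (n2 (fb_path k.+1 w))%:E <= (a + 2 * h)%:E)%E.
  rewrite fb_path_freezing; [|exact: modulus_n2|exact: n2_ge0].
  have h2 : 0 <= 2 * h by rewrite mulr_ge0// ltW.
  have m1 : measurable_fun setT (fun w => n2 (fb_path k w)).
    by apply: measurable_n2 => i; exact: measurable_fb_path'.
  rewrite EFinD -ea -(integral_prob_cst P (2 * h)).
  rewrite -(integral_EFinD P m1 (measurable_cst (2 * h)) (fun w => n2_ge0 _) (fun _ => h2)).
  apply: le_integral_nonneg => w _; rewrite lee_fin heat_n2 ?addr_ge0 ?n2_ge0//.
  by rewrite lerD2l.
have ge1 : (0 <= \int[P]_w (n2 (fb_path k.+1 w))%:E)%E.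
  by apply: integral_ge0 => w _; rewrite lee_fin n2_ge0.
case: (\int[P]_w _)%E le1 ge1 => // b; rewrite !lee_fin => b1 b0; exists b => //.
rewrite b0/=; apply: le_trans b1 _; rewrite /fb_time -[k.+1%:R]natr1 in ak *; lra.
Qed.

(** Dynamic programming with errors: a step replaces [U j.+1] by the average of [U j] up to th (1 +
    |X_k|^2) in expectation, and the second moment of the path stays below |x|^2 + 2 t. *)
Lemma fb_cost k : (k <= N)%N ->
  (\int[P]_w (U (N - k) (fb_path k w) - m)%:E <=
   (U N x - m + k%:R * (th * (1 + (n2 x + 2 * t))))%:E)%E.
Proof.
elim: k => [|k IH] kN.
  rewrite mul0r addr0 subn0 /=.
  by rewrite (integral_prob_cst P (U N x - m)).
set j := (N - k.+1)%N; have jE : (N - k = j.+1)%N by rewrite /j subnSK.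
have aj := admissible_grid au0 n j; have aj1 := admissible_grid au0 n j.+1.
have mj : modulus (fun y => U j y - m) by exact: modulus_sub_cst aj.1.
have mjk w := measurable_fb_path' w.
have [a /andP[a0 ak] ea] := fb_moment k.
have at_ : a <= n2 x + 2 * t.
  apply: le_trans ak _; rewrite lerD2l ler_pM2l//; apply: le_trans time_end.
  by rewrite /fb_time ler_pM2r// ler_nat ltnW.
have fz : (\int[P]_w (U j (fb_path k.+1 w) - m)%:E =
    \int[P]_w (heat (sel j (fb_path k w)) (fun y => U j y - m) (fb_path k w))%:E)%E.
  by apply: (fb_path_freezing k mj) => y; rewrite subr_ge0 aj.2.
rewrite fz.
apply: (@le_trans _ _ (\int[P]_w ((U j.+1 (fb_path k w) - m) + th * (1 + n2 (fb_path k w)))%:E)%E).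
  apply: le_integral_nonneg => w _; rewrite lee_fin heat_sub_cst; [|exact: aj.1| |exact: aj.1].
    by rewrite subr_ge0; apply: le_heat_cst; [exact: aj.1|exact: aj.2].
  by rewrite addrAC lerD2r; exact: sel_opt.
have mn : measurable_fun setT (fun w => n2 (fb_path k w)).
  by apply: measurable_n2 => i; exact: measurable_fb_path'.
have mn1 : measurable_fun setT (fun w => 1 + n2 (fb_path k w)) by exact: measurable_funD.
have n10 w : 0 <= 1 + n2 (fb_path k w) by rewrite addr_ge0// n2_ge0.
have mUj : measurable_fun setT (fun w => U j.+1 (fb_path k w) - m).
  by apply: measurable_funB => //; apply: (measurable_datum aj1) => i; exact: measurable_fb_path'.
have Uj0 w : 0 <= U j.+1 (fb_path k w) - m by rewrite subr_ge0 aj1.2.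
have mth : measurable_fun setT (fun w => th * (1 + n2 (fb_path k w))) by exact: measurable_funM.
rewrite (integral_EFinD P mUj mth Uj0 (fun w => mulr_ge0 th0 (n10 w))).
have -> : (\int[P]_w (th * (1 + n2 (fb_path k w)))%:E = (th * (1 + a))%:E)%E.
  rewrite (integral_EFinZ P mn1 n10 th0).
  rewrite (integral_EFinD P (measurable_cst (1 : R)) mn (fun _ => ler01) (fun w => n2_ge0 _)).
  by rewrite integral_prob_cst ea -EFinD -EFinM.
have := IH (ltnW kN); rewrite jE => IHk; apply: le_trans (leeD IHk (lexx _)) _.
rewrite -EFinD lee_fin -[k.+1%:R]natr1 [(k%:R + 1) * _]mulrDl mul1r [leRHS]addrA lerD2l.
by rewrite ler_wpM2l// lerD2l.
Qed.

(** Up to the factor sqrt 2 the control is a simple process, so a constant sequence approximates it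
    and its Ito integral is the finite sum. It vanishes after the last grid time, which is at most
    t. *)
Lemma fb_control : (control_value P W u0 t x <=
  (U N x + N%:R * (th * (1 + (n2 x + 2 * t))))%:E)%E.
Proof.
have s2 : 0 < Num.sqrt 2 :> R by rewrite sqrtr_gt0.
pose sigma s w := (Num.sqrt 2)^-1 *: sp_eval fb_process s w.
have sigmaE : (fun s w => Num.sqrt 2 *: sigma s w) = sp_eval fb_process.
  apply/funext => s; apply/funext => w.
  by rewrite /sigma scalerA mulfV ?scale1r// gt_eqF.
pose I := sp_integral fb_process.
have mI i : measurable_fun setT (fun w => I w i ord0) by exact: (measurable_sp_integral bm).
have z0 k : frobenius (0 : 'M[R]_(d, k)) ^+ 2 = 0.
  by rewrite /frobenius mul0mx mxtrace0 sqrtr0 expr0n.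
have ac : admissible_control W sigma.
  split; first exact: sp_eval_progressive.
  move=> s w _; rewrite -(@ler_pXn2r _ 2) ?nnegrE ?sqrtr_ge0// expr1n.
  rewrite frobenius_sqr_mx /sigma f2Z exprVn sqr_sqrtr// ler_pdivrMl// mulr1.
  have [->|[k ->]] := sp_eval_cases fb_process s w; last exact: f2_fb_val.
  by rewrite -frobenius_sqr_mx z0.
have ito : ito_integral P W (fun s w => Num.sqrt 2 *: sigma s w) t I.
  rewrite sigmaE; split=> //; exists (fun=> fb_process); split.
    have -> : (fun _ : nat => \int[P]_w \int[lebesgue_measure]_(s in `[0%R, t]%classic)
       ((frobenius (sp_eval fb_process s w - sp_eval fb_process s w)%R) ^+ 2)%:E)%E = (fun=> 0%E).
      apply/funext => _; rewrite integral0_eq// => w _; rewrite integral0_eq// => s _.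
      by rewrite subrr z0.
    exact: cvg_cst.
  have -> : (fun _ : nat => 'E_P[fun w => ((frobenius (sp_integral fb_process w - I w)) ^+ 2)%R])%E
    = (fun=> 0%E).
    apply/funext => _; rewrite unlock integral0_eq// => w _; by rewrite subrr z0.
  exact: cvg_cst.
have pathE w : x + I w = fb_path N w by rewrite -fb_pathE.
have mY i : measurable_fun setT (fun w => (x + I w) i ord0).
  have -> : (fun w => (x + I w) i ord0) = (fun w => fb_path N w i ord0).
    by apply/funext => w; rewrite pathE.
  exact: measurable_fb_path'.
have Y2 : (\int[P]_w (n2 (x + I w)%R)%:E < +oo)%E.
  have [a _ ea] := fb_moment N; under eq_integral do rewrite pathE.
  by rewrite ea ltry.
apply: (@le_trans _ _ 'E_P[fun w => u0 (x + I w)%R]%E).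
  by apply: ereal_inf_lbound; exists sigma, I.
have [-> _] := expectation_datum au0 mY Y2.
have -> : (\int[P]_w (u0 (x + I w)%R - m)%:E = \int[P]_w (U (N - N) (fb_path N w) - m)%:E)%E.
  by apply: eq_integral => w _; rewrite pathE subnn.
apply: le_trans (leeD (fb_cost (leqnn N)) (lexx _)) _.
by rewrite -EFinD lee_fin addrAC subrK.
Qed.

End feedback.

Lemma control_value_le {R : realType} {d : nat} {disp : measure_display} {T : measurableType disp}
    (P : probability T R) (W : R -> T -> 'cV[R]_d) (m : R) (u0 : 'cV[R]_d -> R)
    (t : R) (x : 'cV[R]_d) : (0 < d)%N -> brownian_motion P W -> admissible_fun m u0 ->
  0 <= t -> (control_value P W u0 t x <= (value u0 t x)%:E)%E.
Proof.
move=> d0 bm au0 t0; apply/lee_addgt0Pr => e e0; rewrite -EFinD.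
have e2 : 0 < e / 2 by rewrite divr_gt0.
have [n /(_ n (leqnn _)) hn] := value_approx au0 t x e2.
pose N := Num.truncn (2 ^+ n * t); pose A := N%:R * (1 + (n2 x + 2 * t)).
have A0 : 0 <= A by rewrite mulr_ge0// !addr_ge0 ?n2_ge0// mulr_ge0.
have A1 : 0 < A + 1 by rewrite ltr_wpDl.
pose th := e / (2 * (A + 1)); have th0 : 0 < th by rewrite divr_gt0// mulr_gt0.
have hh : 0 <= 2 ^- n :> R by rewrite invr_ge0 exprn_ge0.
have /choice[sel hsel] := fun j => near_optimal_selection (admissible_grid au0 n j) hh th0.
have := fb_control bm au0 (Ordinal d0) x t0 (ltW th0)
  (fun j => (let: And3 a _ _ := hsel j in a)) (fun j => (let: And3 _ b _ := hsel j in b))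
  (fun j => (let: And3 _ _ c := hsel j in c)).
move=> /le_trans; apply; rewrite lee_fin -/N.
have : N%:R * (th * (1 + (n2 x + 2 * t))) <= e / 2.
  have -> : N%:R * (th * (1 + (n2 x + 2 * t))) = e / 2 * (A / (A + 1)).
    by rewrite /th /A; field; rewrite gt_eqF.
  by rewrite ler_piMr ?(ltW e2)// ler_pdivrMr// mul1r lerDl.
move: hn; rewrite /bellman_dyadic -/N; lra.
Qed.

(** * The theorem *)


Theorem theorem3p2 (R : realType) (d : nat) (u0 : 'cV[R]_d -> R) (R0 : R) :
  (0 < d)%N ->
  C11 u0 ->
  superlinear u0 ->
  0 < R0 ->
  (forall x, R0 < frobenius x -> u0 x = convex_envelope u0 x) ->
  let solves (u : R * 'cV[R]_d -> R) :=
    [/\ {within [set p : R * 'cV[R]_d | 0 <= p.1], continuous u},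
        forall x, u (0, x) = u0 x,
        viscosity_solution setT u &
        forall t x, 0 <= t -> R0 <= frobenius x ->
          u (t, x) = convex_envelope u0 x] in
  exists u : R * 'cV[R]_d -> R,
    [/\ solves u,
        forall v, solves v -> forall t x, 0 <= t -> v (t, x) = u (t, x) &
        forall (disp : measure_display) (T : measurableType disp)
          (P : probability T R) (W : R -> T -> 'cV[R]_d),
          brownian_motion P W ->
          forall t x, 0 <= t -> (u (t, x))%:E = control_value P W u0 t x].
Proof.
move=> d0 u0C su R00 hR solves.
have mu0 := C11_modulus u0C; have [L L0 scu0] := C11_semiconvex u0C.
have [m hm] := superlinear_lower_bound su mu0.
have au0 : admissible_fun m u0 by split.
have frob x : (R0 <= frobenius x) = (R0 ^+ 2 <= n2 x).
  by rewrite -frobenius_sqr ler_pXn2r ?nnegrE ?sqrtr_ge0 ?(ltW R00).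
have far x : R0 ^+ 2 <= n2 x -> u0 x = convex_envelope u0 x.
  by rewrite -frob; exact: (datum_eq_envelope hm (modulus_continuous mu0) R00 hR).
have mid := envelope_midpoint hm; have le_env := envelope_le_datum hm.
have sol_u : solves (value_fun u0).
  split.
  - exact: continuous_subspaceT (value_fun_continuous L0 au0 scu0).
  - by move=> x; rewrite value_funE// (value_0 au0).
  - exact: (value_viscosity d0 L0 au0 scu0).
  - move=> t x t0; rewrite frob => xR; rewrite value_funE//.
    exact: (value_far au0 mid le_env far).
exists (value_fun u0); split=> // [v [cv v0 vis vfar] t x t0|disp T P W bm t x t0].
  rewrite value_funE//.
  apply: (solution_unique d0 L0 au0 scu0 (ltW R00) mid le_env far cv v0 _ _ vis t0).
  by move=> s y s0 yR; apply: vfar => //; rewrite frob.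
rewrite value_funE//; apply/eqP.
by rewrite eq_le (control_value_ge bm L0 au0 scu0)// (control_value_le x d0 bm au0 t0).
Qed.
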